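(* Let $V_9$ be a $9$-dimensional vector space over a field $\mathbf{k}$ and let $\gamma\in\bigwedge^3V_9$. If $\gamma$ is stable with respect to the natural action of $\mathrm{SL}(V_9)$, then $D_\gamma\subset\mathbf{P}(V_9)$ and $Y_\gamma\subset\mathbf{P}(V_9^* )$ are projectively dual hypersurfaces.
   Context: $\mathbf{P}(V)$ denotes the space of lines in $V$. Stable means GIT-stable (closed orbit and finite stabilizer over an algebraic closure). Definition of $Y_\gamma$: via comultiplication $\bigwedge^3V_9\to\bigwedge^2V_9\otimes V_9$ and the surjection $V_9\otimes\mathcal{O}_{\mathbf{P}(V_9^* )}\to\mathcal{O}_{\mathbf{P}(V_9^* )}(1)$, $\gamma$ gives a family of skew-symmetric matrices $\Phi_\gamma\colon V_9^*\to V_9\otimes\mathcal{O}_{\mathbf{P}(V_9^* )}(1)$ over $\mathbf{P}(V_9^* )$ (at the line spanned by $x\in V_9^*$ it is the contraction $\gamma(x,-,-)$). Then $Y_\gamma=\{x\in\mathbf{P}(V_9^* )\mid\operatorname{rank}(\Phi_\gamma|_x)\le6\}$; for stable $\gamma$ it is known to be a cubic hypersurface. Definition of $D_\gamma$: in characteristic $0$ there is, up to scalar, a unique $\mathrm{SL}_8$-invariant polynomial of degree $16$ on $\bigwedge^3$ of an $8$-dimensional space; scaled to be a primitive polynomial with integer coefficients it makes sense over any field, and is called the hyperdiscriminant $f_{16}$. Let $\mathcal{Q}$ be the tautological rank $8$ quotient bundle on $\mathbf{P}(V_9)$ (with fiber $V_9/\ell$ at the line $\ell$). Then $\gamma$ gives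 a section of $\bigwedge^3\mathcal{Q}\cong(\bigwedge^3\mathcal{T}_{\mathbf{P}(V_9)})(-3)$, and $D_\gamma$ is the subscheme of points $\ell\in\mathbf{P}(V_9)$ where the image of $\gamma$ in $\bigwedge^3(V_9/\ell)$ has vanishing hyperdiscriminant; its equation is a section of $\mathcal{O}_{\mathbf{P}(V_9)}(6)$. The projective dual of a hypersurface is the closure of the set of its tangent hyperplanes at smooth points, as a subvariety of the dual projective space; a point of $\mathbf{P}(V_9)$ is identified with a hyperplane in $\mathbf{P}(V_9^* )$.
   Formalization: That D_γ is the projective dual of Y_γ is stated over every field; that Y_γ is the projective dual of D_γ only in characteristic different from 2, since in characteristic 2 the sextic of D_γ is a proper power, so D_γ has no smooth points and this direction fails. *)

(* Defs.v *)
From mathcomp Require Import all_boot all_order all_algebra.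
From mathcomp Require Import mpoly.

Set Implicit Arguments.
Unset Strict Implicit.
Unset Printing Implicit Defensive.

Import GRing.Theory.
Local Open Scope ring_scope.

(* For finite-dimensional V, the third exterior power of V is the space of
   alternating trilinear forms on the dual of V, in every characteristic. *)
Record trivector (k : fieldType) (V : vectType k) := Trivector {
  tri_form :> 'Hom(V, k^o) -> 'Hom(V, k^o) -> 'Hom(V, k^o) -> k;
  tri_linear1 : forall a x x' y z,
    tri_form (a *: x + x') y z = a * tri_form x y z + tri_form x' y z;
  tri_linear2 : forall a x y y' z,
    tri_form x (a *: y + y') z = a * tri_form x y z + tri_form x y' z;
  tri_linear3 : forall a x y z z',
    tri_form x y (a *: z + z') = a * tri_form x y z + tri_form x y z';
  tri_alt12 : forall x z, tri_form x x z = 0;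
  tri_alt23 : forall x y, tri_form x y y = 0
}.

(* Index set of the basis e_a /\ e_b /\ e_c (a < b < c) of the third exterior
   power of R^n. *)
Definition triple (n : nat) :=
  {t : 3.-tuple 'I_n | sorted ltn [seq nat_of_ord i | i <- t]}.

Definition ext3 (R : Type) (n : nat) := {ffun triple n -> R}.

Definition tri_coords (k : fieldType) (V : vectType k) (n : nat)
    (e : n.-tuple V) (gamma : trivector V) : ext3 k n :=
  let dual_basis i : 'Hom(V, k^o) := linfun (coord e i : V -> k^o) in
  [ffun t : triple n => gamma (dual_basis (tnth (val t) ord0))
                              (dual_basis (tnth (val t) (inord 1)))
                              (dual_basis (tnth (val t) (inord 2)))].

Definition ext3_base_change (k K : fieldType) (iota : {rmorphism k -> K})
    (n : nat) (w : ext3 k n) : ext3 K n :=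
  [ffun t => iota (w t)].

(* The coordinates as a valuation for polynomials in as many variables as
   there are triples. *)
Definition ext3_val (R : Type) (n : nat) (w : ext3 R n)
    (i : 'I_#|{: triple n}|) : R := w (enum_val i).

(* Vectors of R^n and linear functionals on R^n are both row vectors, in dual
   coordinates. The rows of X are three functionals, on which w is evaluated
   as an alternating form. *)
Definition ext3_form (R : comNzRingType) (n : nat) (w : ext3 R n)
    (X : 'M[R]_(3, n)) : R :=
  \sum_(t : triple n) w t * \det (colsub (tnth (val t)) X).

(* Third exterior power of the linear map u |-> u *m M from R^m to R^n: the
   pull-back to R^m of the i-th coordinate functional of R^n is the i-th column
   of M. *)
Definition ext3_map (R : comNzRingType) (m n : nat) (M : 'M[R]_(m, n))
    (w : ext3 R m) : ext3 R n :=
  [ffun t => ext3_form w (rowsub (tnth (val t)) M^T)].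

Definition SL_orbit (R : comNzRingType) (n : nat) (w w' : ext3 R n) : Prop :=
  exists2 g : 'M[R]_n, \det g = 1 & w' = ext3_map g w.

Definition ext3_zariski_closed (K : fieldType) (n : nat)
    (S : ext3 K n -> Prop) : Prop :=
  forall w,
    (forall p : {mpoly K[#|{: triple n}|]},
       (forall w', S w' -> p.@[ext3_val w'] = 0) -> p.@[ext3_val w] = 0) ->
    S w.

Definition finite_SL_stabilizer (K : fieldType) (n : nat) (w : ext3 K n) :
    Prop :=
  exists s : seq 'M[K]_n,
    forall g : 'M[K]_n, \det g = 1 -> ext3_map g w = w -> g \in s.

Definition stable (K : closedFieldType) (n : nat) (w : ext3 K n) : Prop :=
  ext3_zariski_closed (SL_orbit w) /\ finite_SL_stabilizer w.

(* These conditions determine the polynomial up to sign. *)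
Definition is_hyperdiscriminant (f : {mpoly int[#|{: triple 8}|]}) : Prop :=
  [/\ f \is 16.-homog,
      forall d : nat, (forall m, (d%:Z %| f@_m)%Z) -> d = 1%N &
      forall (g : 'M[rat]_8) (w : ext3 rat 8), \det g = 1 ->
        (map_mpoly intr f).@[ext3_val (ext3_map g w)]
          = (map_mpoly intr f).@[ext3_val w]].

(* A subset of the projective space of K^n is given as a predicate on the
   nonzero vectors of K^n. *)

Definition contraction (K : fieldType) (n : nat) (w : ext3 K n)
    (x : 'rV[K]_n) : 'M[K]_n :=
  \matrix_(i, j) ext3_form w
    (\matrix_(r < 3) tnth [tuple x; delta_mx 0 i; delta_mx 0 j] r).

Definition Y_locus (K : fieldType) (w : ext3 K 9) (x : 'rV[K]_9) : Prop :=
  x != 0 /\ (\rank (contraction w x) <= 6)%N.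

(* M is a coordinate form of the projection of K^9 onto its quotient by the
   line of v; the vanishing of f does not depend on the choice of M. *)
Definition D_locus (f : {mpoly int[#|{: triple 8}|]}) (K : fieldType)
    (w : ext3 K 9) (v : 'rV[K]_9) : Prop :=
  v != 0 /\ exists M : 'M[K]_(9, 8),
    [/\ \rank M = 8%N, v *m M = 0 &
        (map_mpoly intr f).@[ext3_val (ext3_map M w)] = 0].

Definition is_hypersurface (k K : fieldType) (iota : {rmorphism k -> K})
    (n : nat) (X : 'rV[K]_n -> Prop) : Prop :=
  exists (d : nat) (F : {mpoly k[n]}),
    [/\ (0 < d)%N, F != 0, F \is d.-homog &
        forall x, X x <-> x != 0 /\ (map_mpoly iota F).@[x 0] = 0].

Definition vanishes_on (K : fieldType) (n : nat) (X : 'rV[K]_n -> Prop)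
    (p : {mpoly K[n]}) : Prop :=
  forall x, X x -> p.@[x 0] = 0.

Definition proj_closure (K : fieldType) (n : nat) (X : 'rV[K]_n -> Prop)
    (x : 'rV[K]_n) : Prop :=
  x != 0 /\ forall (d : nat) (p : {mpoly K[n]}),
    p \is d.-homog -> vanishes_on X p -> p.@[x 0] = 0.

Definition gradient (K : fieldType) (n : nat) (p : {mpoly K[n]})
    (x : 'rV[K]_n) : 'rV[K]_n :=
  \row_i (mderiv i p).@[x 0].

(* The differentials at x of the homogeneous equations of X form the line
   spanned by h: for a hypersurface X, this says that x is a smooth point of X
   with its reduced structure, and that h is the tangent hyperplane at x. *)
Definition tangent_hyperplane_at (K : fieldType) (n : nat)
    (X : 'rV[K]_n -> Prop) (x h : 'rV[K]_n) : Prop :=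
  [/\ X x, h != 0 &
      forall u : 'rV[K]_n,
        (exists (d : nat) (p : {mpoly K[n]}),
           [/\ p \is d.-homog, vanishes_on X p & gradient p x = u])
        <-> exists c : K, u = c *: h].

Definition proj_dual (K : fieldType) (n : nat) (X : 'rV[K]_n -> Prop) :
    'rV[K]_n -> Prop :=
  proj_closure (fun h => exists x, tangent_hyperplane_at X x h).

(* Main.v *)
(** Contracting gamma with a point x gives a 9 x 9 alternating matrix om x. A limit under a one-parameter subgroup stays
    in the closed orbit of gamma, so by finiteness of the stabilizer gamma satisfies three non-degeneracy conditions: no
    three independent vectors kill each other pairwise, om x has rank at least 4, and gamma vanishes on no R x R x H with
    R in H of dimensions 4 and 8. Nothing else about stability is needed.

    The sub-Pfaffians of om x of size 8 are x_i F(x), up to sign, for a cubic F, which is the equation of Y. At a point x of rank 6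
    with kernel <x, a, b> the gradient of F is a nonzero multiple of gamma(a, b, -); points of rank 4 are singular. Y
    contains no hyperplane, hence F is irreducible and generates the ideal of Y.

    The hyperdiscriminant vanishes at theta in the third exterior power of K^8 iff theta vanishes on U x U x K^8 for some
    U of dimension 3: such theta are unstable, and all the others form one GL_8-orbit, on which the primitive polynomial
    cannot vanish. So D consists of the forms gamma(a, b, -) with x, a, b independent and a, b killed by x, that is,
    of the tangent hyperplanes of Y and of their limits at the points of rank 4; a dimension count shows that they
    satisfy an equation.

    For the converse duality let p be an equation of D of minimal degree. Differentiating p(grad F) = 0 along Y shows that
    Hess F(x) kills 2 grad p(grad F(x)) - q x, so that grad p(grad F(x)) is proportional to x as soon as Hess F is
    invertible at some point of Y. If Y has no point of rank 4, Hess F is invertible at every point of Y, because a kernel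
    vector would be an infinitesimal deformation of the isotropic space <x, a, b>. If x0 has rank 4 with kernel N, suppose
    that det Hess F vanishes on Y. At a general x in N the Hessian has a one-dimensional kernel, spanned by some k(x) in N,
    and F''(k, k, -) = l F''(x, x, -); differentiating this along N produces two singular points k + e x and k - e x,
    e^2 = - l, whose Hessians have kernels that together span N, which is impossible as these have dimension at most 2
    in N. *)
Require Import Defs.
From HB Require Import structures.
From mathcomp Require Import all_boot all_order all_algebra generic_quotient.
From mathcomp Require Import mpoly zify ring.
From Stdlib Require Import Classical.

Set Implicit Arguments.
Unset Strict Implicit.
Unset Printing Implicit Defensive.

Import Order.TTheory GRing.Theory Num.Theory.
Local Open Scope ring_scope.

(** * Alternating matrices and pencils *)

(** The Pfaffian enters through its square: one determinantal identity, quadratic in [F], ties [F]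
    to gamma. Its expansion along lines x + t y gives squares of the wanted statements about Taylor
    coefficients of [F], and square roots are taken among polynomial functions, which form a domain.
    Points in special position come from pencils of matrices, which become singular at some
    parameter because the field is closed. The characteristic shapes the rest. Cubics are kept as
    unsymmetrized trilinear forms; an equation of D may have vanishing partial derivatives, whence
    the Frobenius root; and biduality is not automatic, because the Gauss map of Y may be
    inseparable. Hence the search for a point of Y with invertible Hessian. In characteristic 2 the
    Hessian of a cubic is an alternating matrix of odd size 9 and never invertible, so that this
    method stops there. The hyperdiscriminant is known only by its defining properties over the
    rationals; invariance is carried to all rings by a generic matrix and a generic trivector with
    integral polynomial entries. *)

Lemma basis_completion (F : fieldType) (d e n : nat) (A : 'M[F]_(d, n)) :
  (d + e = n)%N -> row_free A ->
  exists C : 'M_(e, n), row_free (col_mx A C) && row_full (col_mx A C).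
Proof.
move=> den freeA; have rkA : \rank A = d by apply/eqP.
have rkC : \rank (A^C)%MS = e by rewrite mxrank_compl rkA -den addKn.
subst e; exists (row_base (A^C)%MS).
have rk : \rank (col_mx A (row_base (A^C)%MS)) = n.
  rewrite -addsmxE (adds_eqmx (eqmx_refl A) (eq_row_base _)).
  by apply/eqP; have /= := addsmx_compl_full A; rewrite /row_full.
by rewrite /row_free /row_full rk den !eqxx.
Qed.

(** In characteristic 2 this is stronger than skew-symmetry: it also forces a zero diagonal. *)
Definition altm (F : fieldType) (n : nat) (A : 'M[F]_n) :=
  forall u : 'rV_n, u *m A *m u^T = 0.

Lemma altmC (F : fieldType) (n : nat) (A : 'M[F]_n) (u v : 'rV_n) :
  altm A -> u *m A *m v^T = - (v *m A *m u^T).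
Proof.
move=> altA; have := altA (u + v).
rewrite linearD /= !mulmxDl !mulmxDr !altA add0r addr0 => /eqP.
by rewrite addrC addr_eq0 => /eqP ->; rewrite opprK.
Qed.

Lemma altm_cong (F : fieldType) (m n : nat) (A : 'M[F]_n) (P : 'M_(m, n)) :
  altm A -> altm (P *m A *m P^T).
Proof.
by move=> altA u; rewrite !mulmxA -mulmxA -trmx_mul altA.
Qed.

Lemma mx11_eq (R : pzRingType) (A B : 'M[R]_1) : A 0 0 = B 0 0 -> A = B.
Proof. by move=> eqAB; apply/matrixP=> i j; rewrite !ord1. Qed.

Lemma altm_diag (F : fieldType) (n : nat) (A : 'M[F]_n) i : altm A -> A i i = 0.
Proof.
move=> /(_ (delta_mx 0 i)) /matrixP /(_ 0 0).
by rewrite -rowE trmx_delta -colE !mxE.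
Qed.

Lemma altm_tr (F : fieldType) (n : nat) (A : 'M[F]_n) : altm A -> A^T = - A.
Proof.
move=> altA; apply/matrixP=> i j.
have /matrixP/(_ 0 0) := altmC (delta_mx 0 j) (delta_mx 0 i) altA.
by rewrite -!rowE !trmx_delta -!colE !mxE.
Qed.

Lemma altmP (F : fieldType) (n : nat) (A : 'M[F]_n) :
  (forall i, A i i = 0) -> A^T = - A -> altm A.
Proof.
move=> dA trA u; apply: mx11_eq; rewrite !mxE.
under eq_bigr do rewrite !mxE big_distrl /=.
have splitE: \sum_(i < n) \sum_(j < n) u 0 j * A j i * u 0 i =
  \sum_(i < n) \sum_(j < n | (j < i)%N) (u 0 j * A j i * u 0 i)
  + \sum_(i < n) \sum_(j < n | (i < j)%N) (u 0 j * A j i * u 0 i).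
  rewrite -big_split; apply: eq_bigr => i _ /=.
  rewrite (bigID (fun j : 'I_n => j < i)%N) /=; congr (_ + _).
  rewrite (bigD1 i) ?ltnn //= dA mulr0 mul0r add0r.
  apply: eq_bigl => j; rewrite -leqNgt leq_eqVlt.
  by case: (ltngtP i j) => // ij; rewrite -?(inj_eq val_inj) /= ?ij ?eqxx ?gtn_eqF ?andbF ?ltn_eqF ?andbT.
rewrite splitE [X in _ + X](exchange_big_dep xpredT) //= -big_split big1 // => i _ /=.
rewrite -big_split big1 // => j _ /=.
have -> : A j i = - A i j by move/matrixP: trA => /(_ i j); rewrite !mxE.
by ring.
Qed.

Lemma col_row_free (F : fieldType) (d e n : nat) (A : 'M[F]_(d, n)) (C : 'M_(e, n)) :
  (forall (u : 'rV_d) (v : 'rV_e), u *m A + v *m C = 0 -> u = 0 /\ v = 0) -> row_free (col_mx A C).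
Proof.
move=> H; apply: inj_row_free => v.
rewrite -[v]hsubmxK mul_row_col => /H[-> ->].
by rewrite row_mx0.
Qed.

(** Induction on the size: two rows with x A y^T = 1 span a hyperbolic plane, and on the orthogonal
    complement [W] the form is again alternating, of rank smaller by 2. *)
Lemma altm_rank_even (F : fieldType) (n : nat) (A : 'M[F]_n) :
  altm A -> ~~ odd (\rank A).
Proof.
have [k] := ubnP n; elim: k => // k IHk in n A *; rewrite ltnS => lenk altA.
have [-> | nzA] := eqVneq A 0; first by rewrite mxrank0.
have [i [j Aij]] : exists i, exists j, A i j != 0.
  have /rV0Pn[j] : mxvec A != 0 by rewrite mxvec_eq0.
  by case/mxvec_indexP: j => i j; rewrite mxvecE => Aij; exists i, j.
pose x : 'rV[F]_n := delta_mx 0 i; pose y : 'rV[F]_n := (A i j)^-1 *: delta_mx 0 j.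
have xAy : x *m A *m y^T = 1.
  apply: mx11_eq; rewrite -rowE linearZ /= -scalemxAr trmx_delta -colE !mxE.
  by rewrite mulVf.
pose xy := col_mx x y.
have Jdef : xy *m A *m xy^T = block_mx 0 1 (-1) 0.
  rewrite tr_col_mx mul_col_mx mul_col_row !altA xAy.
  by rewrite (altmC _ _ altA) xAy.
have Junit : xy *m A *m xy^T \in unitmx.
  have /mulmx1_unit[] // : xy *m A *m xy^T *m - (xy *m A *m xy^T) = 1.
  rewrite Jdef mulmxN mulmx_block !mul0mx !mulmx0 !mul1mx !mulNmx !mulmx1 ?mul1mx.
  by rewrite !(add0r, addr0) opp_block_mx oppr0 opprK -scalar_mx_block.
pose W := kermx (A *m xy^T); pose C := row_base W.
have CA0 : C *m (A *m xy^T) = 0.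
  by apply/sub_kermxP; rewrite eq_row_base.
have xyAC : xy *m A *m C^T = 0.
  apply: trmx_inj; rewrite trmx0 trmx_mul (trmx_mul xy) [C^T^T]trmxK (altm_tr altA).
  by rewrite mulNmx mulmxN CA0 oppr0.
have freeP : row_free (col_mx xy C).
  apply: col_row_free => u v uv0.
  have u0 : u = 0.
    have uJ : u *m (xy *m A *m xy^T) = 0.
      have := congr1 (fun z => z *m (A *m xy^T)) uv0.
      by rewrite mulmxDl -(mulmxA v) CA0 mulmx0 addr0 mul0mx !mulmxA.
    by rewrite -(mulmxK Junit u) uJ mul0mx.
  split=> //; move: uv0; rewrite u0 mul0mx add0r => vC.
  by apply: (row_free_inj (row_base_free W)); rewrite mul0mx.
have rkW : \rank W = (n - 2)%N.
  rewrite mxrank_ker; congr (_ - _)%N; apply/eqP; rewrite eqn_leq rank_leq_col /=.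
  by apply: leq_trans (mxrankM_maxr xy _); rewrite mulmxA (mxrank_unit Junit).
have n2 : (2 <= n)%N.
  by have := mxrankM_maxr xy (A *m xy^T); rewrite mulmxA (mxrank_unit Junit) => /leq_trans; apply; rewrite rank_leq_row.
have fullP : row_full (col_mx xy C).
  by rewrite /row_full (eqP freeP) rkW subnKC.
have -> : \rank A = \rank (col_mx xy C *m A *m (col_mx xy C)^T).
  by rewrite mxrankMfree ?(eqmxMfull _ fullP) // /row_free mxrank_tr.
rewrite tr_col_mx mul_col_mx mul_col_row xyAC.
have -> : C *m A *m xy^T = 0 by rewrite -mulmxA.
rewrite rank_diag_block_mx oddD (mxrank_unit Junit) /=.
apply: IHk; last exact: altm_cong.
by rewrite rkW; lia.
Qed.

Section ClosedField.
Variable K : closedFieldType.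

Lemma poly_zero_on_closed (p : {poly K}) : (forall t, p.[t] = 0) -> p = 0.
Proof.
move=> p0; apply/eqP/negP=> /negP/closed_nonrootP[t].
by rewrite rootE p0 eqxx.
Qed.

Lemma poly_mul_zero (p q : {poly K}) : p != 0 -> (forall t, p.[t] * q.[t] = 0) -> q = 0.
Proof.
move=> p0 pq0; have /eqP : p * q = 0.
  by apply: poly_zero_on_closed => t; rewrite hornerM.
by rewrite mulf_eq0 (negPf p0) => /eqP.
Qed.

(** The factor t ^ d comes out of the first d rows. What remains contains t only in the lower rows
    and is block triangular at t = 0. *)
Lemma det_pencil (d r : nat) (A : 'M[K]_d) (B : 'M_(d, r)) (C : 'M_(r, d)) (D E : 'M_r) :
  exists2 q : {poly K}, q.[0] = \det A * \det D &
    forall t, \det (block_mx (t *: A) (t *: B) (t *: C) (D + t *: E)) = t ^+ d * q.[t].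
Proof.
pose P m n (M : 'M[K]_(m, n)) := map_mx polyC M.
pose M' := block_mx (P _ _ A) (P _ _ B) ('X *: P _ _ C) (P _ _ D + 'X *: P _ _ E).
exists (\det M') => [|t].
  rewrite -horner_evalE -det_map_mx map_block_mx.
  have -> : map_mx (horner_eval 0) (P _ _ A) = A by apply/matrixP=> i j; rewrite !mxE horner_evalE hornerC.
  have -> : map_mx (horner_eval 0) ('X *: P _ _ C) = 0 by apply/matrixP=> i j; rewrite !mxE horner_evalE !hornerE.
  have -> : map_mx (horner_eval 0) (P _ _ D + 'X *: P _ _ E) = D.
    by apply/matrixP=> i j; rewrite !mxE horner_evalE !hornerE.
  by rewrite det_ublock.
rewrite -horner_evalE -det_map_mx map_block_mx.
have -> : map_mx (horner_eval t) (P _ _ A) = A by apply/matrixP=> i j; rewrite !mxE horner_evalE hornerC.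
have -> : map_mx (horner_eval t) (P _ _ B) = B by apply/matrixP=> i j; rewrite !mxE horner_evalE hornerC.
have -> : map_mx (horner_eval t) ('X *: P _ _ C) = t *: C by apply/matrixP=> i j; rewrite !mxE horner_evalE !hornerE.
have -> : map_mx (horner_eval t) (P _ _ D + 'X *: P _ _ E) = D + t *: E.
  by apply/matrixP=> i j; rewrite !mxE horner_evalE !hornerE.
rewrite -[t ^+ d](det_scalar d) -[X in X * _]mulr1 -(det1 _ r) -(det_lblock _ 0) -det_mulmx.
by rewrite mulmx_block !mul0mx !mul1mx !addr0 !mul_scalar_mx !add0r.
Qed.

(** The tangent space of a determinantal variety: bordering an invertible minor of [A] of size r by
    [u] and [z] gives a minor of [A + t B] whose linear coefficient in t is u B z^T, so that a
    non-zero value would raise the rank. *)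
Lemma pencil_orth (m n : nat) (A B : 'M[K]_(m, n)) (u : 'rV_m) (z : 'rV_n) :
  (forall t, \rank (A + t *: B)%R <= \rank A)%N ->
  u *m A = 0 -> A *m z^T = 0 -> u *m B *m z^T = 0.
Proof.
move=> rkle uA Az; pose r := \rank A.
have [R [C RAC]] : exists R : 'M_(r, m), exists C : 'M_(n, r), R *m A *m C = 1%:M.
  exists (pid_mx r *m invmx (col_ebase A)), (invmx (row_ebase A) *m pid_mx r).
  rewrite -[X in _ *m X *m _]mulmx_ebase !mulmxA mulmxKV ?col_ebase_unit //.
  rewrite mulmxK ?row_ebase_unit // !pid_mx_id ?rank_leq_row ?rank_leq_col //.
  by rewrite pid_mx_1.
apply/eqP/negPn/negP=> nz.
have [q q0 qE] := det_pencil (u *m B *m z^T) (u *m B *m C) (R *m B *m z^T) 1%:M (R *m B *m C).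
have qnz : q != 0.
  apply: contraNneq nz => q_eq0; move: q0; rewrite q_eq0 horner0 det1 mulr1 det_mx11 => /esym d0.
  by apply/eqP/mx11_eq; rewrite d0 mxE.
have /closed_nonrootP[t] : 'X * q != 0 by rewrite mulf_neq0 ?polyX_eq0.
rewrite rootE hornerM hornerX -[X in X * _]expr1 -qE => detnz.
have := rkle t; apply/negP; rewrite -ltnNge.
apply: (@leq_trans (\rank (block_mx (t *: (u *m B *m z^T)) (t *: (u *m B *m C))
   (t *: (R *m B *m z^T)) (1%:M + t *: (R *m B *m C))))).
  by rewrite mxrank_unit // unitmxE unitfE.
have -> : block_mx (t *: (u *m B *m z^T)) (t *: (u *m B *m C))
   (t *: (R *m B *m z^T)) (1%:M + t *: (R *m B *m C)) = col_mx u R *m (A + t *: B) *m row_mx z^T C.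
  rewrite mul_col_mx mul_col_row !mulmxDr !mulmxDl -!scalemxAr -!scalemxAl uA !mul0mx RAC.
  by rewrite -(mulmxA R A) Az mulmx0 !add0r.
exact: leq_trans (mxrankM_maxl _ _) (mxrankM_maxr _ _).
Qed.

End ClosedField.

(** * Alternating trilinear forms *)

(** Trivectors are handled as forms on row vectors rather than through their coordinates, so that a
    change of basis is a substitution. *)
Record alt3 (K : fieldType) (n : nat) := Alt3 {
  aform :> 'rV[K]_n -> 'rV[K]_n -> 'rV[K]_n -> K;
  alin1 : forall a x x' y z, aform (a *: x + x') y z = a * aform x y z + aform x' y z;
  alin2 : forall a x y y' z, aform x (a *: y + y') z = a * aform x y z + aform x y' z;
  alin3 : forall a x y z z', aform x y (a *: z + z') = a * aform x y z + aform x y z';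
  aalt12 : forall x z, aform x x z = 0;
  aalt23 : forall x y, aform x y y = 0 }.

Section Alt3.
Variables (K : fieldType) (n : nat) (g : alt3 K n).
Implicit Types x y z : 'rV[K]_n.

Lemma aD1 x x' y z : g (x + x') y z = g x y z + g x' y z.
Proof. by rewrite -{1}[x]scale1r alin1 mul1r. Qed.
Lemma aD2 x y y' z : g x (y + y') z = g x y z + g x y' z.
Proof. by rewrite -{1}[y]scale1r alin2 mul1r. Qed.
Lemma aD3 x y z z' : g x y (z + z') = g x y z + g x y z'.
Proof. by rewrite -{1}[z]scale1r alin3 mul1r. Qed.
Lemma a01 y z : g 0 y z = 0.
Proof. by have := alin1 g (-1) 0 0 y z; rewrite scaler0 addr0 mulN1r addNr. Qed.
Lemma a02 x z : g x 0 z = 0.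
Proof. by have := alin2 g (-1) x 0 0 z; rewrite scaler0 addr0 mulN1r addNr. Qed.
Lemma a03 x y : g x y 0 = 0.
Proof. by have := alin3 g (-1) x y 0 0; rewrite scaler0 addr0 mulN1r addNr. Qed.
Lemma aZ1 a x y z : g (a *: x) y z = a * g x y z.
Proof. by rewrite -[a *: x]addr0 alin1 a01 addr0. Qed.
Lemma aZ2 a x y z : g x (a *: y) z = a * g x y z.
Proof. by rewrite -[a *: y]addr0 alin2 a02 addr0. Qed.
Lemma aZ3 a x y z : g x y (a *: z) = a * g x y z.
Proof. by rewrite -[a *: z]addr0 alin3 a03 addr0. Qed.
Lemma aN1 x y z : g (- x) y z = - g x y z.
Proof. by rewrite -scaleN1r aZ1 mulN1r. Qed.
Lemma aN2 x y z : g x (- y) z = - g x y z.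
Proof. by rewrite -scaleN1r aZ2 mulN1r. Qed.
Lemma aN3 x y z : g x y (- z) = - g x y z.
Proof. by rewrite -scaleN1r aZ3 mulN1r. Qed.
Definition aE := (aD1, aD2, aD3, aZ1, aZ2, aZ3, aN1, aN2, aN3, a01, a02, a03, aalt12, aalt23).

Lemma a_sum1 I (r : seq I) P (F : I -> 'rV_n) y z :
  g (\sum_(i <- r | P i) F i) y z = \sum_(i <- r | P i) g (F i) y z.
Proof. by elim/big_rec2: _ => [|i a b _ <-]; rewrite ?a01 ?aD1. Qed.
Lemma a_sum2 I (r : seq I) P (F : I -> 'rV_n) x z :
  g x (\sum_(i <- r | P i) F i) z = \sum_(i <- r | P i) g x (F i) z.
Proof. by elim/big_rec2: _ => [|i a b _ <-]; rewrite ?a02 ?aD2. Qed.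
Lemma a_sum3 I (r : seq I) P (F : I -> 'rV_n) x y :
  g x y (\sum_(i <- r | P i) F i) = \sum_(i <- r | P i) g x y (F i).
Proof. by elim/big_rec2: _ => [|i a b _ <-]; rewrite ?a03 ?aD3. Qed.

Lemma aC12 x y z : g x y z = - g y x z.
Proof. by have /eqP := aalt12 g (x + y) z; rewrite !aE add0r addr0 addrC addr_eq0 => /eqP ->; rewrite opprK. Qed.
Lemma aC23 x y z : g x y z = - g x z y.
Proof. by have /eqP := aalt23 g x (y + z); rewrite !aE add0r addr0 addr_eq0 => /eqP. Qed.
Lemma aC13 x y z : g x y z = - g z y x.
Proof. by rewrite aC12 aC23 opprK aC12. Qed.
Lemma aalt13 x y : g x y x = 0.
Proof. by rewrite aC23 aalt12 oppr0. Qed.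
Lemma a_rot x y z : g x y z = g y z x.
Proof. by rewrite aC12 aC23 opprK. Qed.

Definition om x : 'M[K]_n := \matrix_(i, j) g x (delta_mx 0 i) (delta_mx 0 j).

Lemma omE x y z : y *m om x *m z^T = (g x y z)%:M.
Proof.
apply: mx11_eq; rewrite [RHS]mxE mulr1n {2}(row_sum_delta y) {2}(row_sum_delta z).
rewrite a_sum2 !mxE; under eq_bigr do rewrite !mxE big_distrl /=.
rewrite exchange_big; apply: eq_bigr => i _ /=.
rewrite a_sum3; apply: eq_bigr => j _; rewrite !mxE aZ2 aZ3.
by ring.
Qed.

Lemma omE00 x y z : (y *m om x *m z^T) 0 0 = g x y z.
Proof. by rewrite omE mxE mulr1n. Qed.

Lemma omD x y : om (x + y) = om x + om y.
Proof. by apply/matrixP=> i j; rewrite !mxE aD1. Qed.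
Lemma omZ a x : om (a *: x) = a *: om x.
Proof. by apply/matrixP=> i j; rewrite !mxE aZ1. Qed.
Lemma om0 : om 0 = 0.
Proof. by apply/matrixP=> i j; rewrite !mxE a01. Qed.

Lemma om_altm x : altm (om x).
Proof. by move=> u; rewrite omE aalt23 raddf0. Qed.

Lemma omP_mx p q x (A : 'M_(p, n)) (B : 'M_(q, n)) i j :
  (A *m om x *m B^T) i j = g x (row i A) (row j B).
Proof.
by rewrite -omE00 tr_row !mxE; apply: eq_bigr => k _; rewrite -row_mul !mxE.
Qed.

Definition kill x y := y *m om x = 0.

Lemma killP x y : kill x y <-> forall z, g x y z = 0.
Proof.
split=> [k z|k]; first by rewrite -omE00 k mul0mx mxE.
apply/rowP=> j; rewrite [RHS]mxE -(k (delta_mx 0 j)) -omE00.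
by rewrite trmx_delta -colE [RHS]mxE.
Qed.

Lemma kill_sym x y : kill x y -> kill y x.
Proof. by move/killP=> k; apply/killP=> z; rewrite aC12 k oppr0. Qed.

Lemma killxx x : kill x x.
Proof. by apply/killP=> z; rewrite aalt12. Qed.

Lemma rank_om_even x : ~~ odd (\rank (om x)).
Proof. exact/altm_rank_even/om_altm. Qed.

End Alt3.

Section Pull.
Variables (K : fieldType) (m n : nat) (g : alt3 K n) (B : 'M[K]_(m, n)).
Lemma pull_subproof :
  let h x y z := g (x *m B) (y *m B) (z *m B) in
  [/\ forall a x x' y z, h (a *: x + x') y z = a * h x y z + h x' y z,
      forall a x y y' z, h x (a *: y + y') z = a * h x y z + h x y' z,
      forall a x y z z', h x y (a *: z + z') = a * h x y z + h x y z',
      forall x z, h x x z = 0 & forall x y, h x y y = 0].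
Proof. by split=> *; rewrite /= ?mulmxDl -?scalemxAl !aE. Qed.
Definition pull : alt3 K m :=
  let: And5 a b c d e := pull_subproof in Alt3 a b c d e.
Lemma pullE x y z : pull x y z = g (x *m B) (y *m B) (z *m B).
Proof. by rewrite /pull; case: pull_subproof. Qed.
End Pull.

Lemma alt3_ext (K : fieldType) (n : nat) (g h : alt3 K n) :
  (forall i j k : 'I_n, (i < j < k)%N ->
     g (delta_mx 0 i) (delta_mx 0 j) (delta_mx 0 k)
     = h (delta_mx 0 i) (delta_mx 0 j) (delta_mx 0 k)) ->
  forall x y z, g x y z = h x y z.
Proof.
move=> gh.
have gh' i j k : g (delta_mx 0 i) (delta_mx 0 j) (delta_mx 0 k)
     = h (delta_mx 0 i) (delta_mx 0 j) (delta_mx 0 k).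
  have [ij|ji|/val_inj<-] := ltngtP i j; last by rewrite !aE.
    have [jk|kj|/val_inj<-] := ltngtP j k; last by rewrite !aE.
      by rewrite gh ?ij.
    rewrite [LHS]aC23 [RHS]aC23.
    have [ik|ki|/val_inj<-] := ltngtP i k; last by rewrite !aE.
      by rewrite gh ?ik.
    by rewrite [in LHS]aC12 [in RHS]aC12 gh ?ki.
  have [ik|ki|/val_inj<-] := ltngtP i k; last by rewrite !aalt13.
    by rewrite [LHS]aC12 [RHS]aC12 gh ?ji.
  rewrite [LHS]a_rot [RHS]a_rot.
  have [jk|kj|/val_inj<-] := ltngtP j k; last by rewrite !aE.
    by rewrite gh ?jk.
  by rewrite [LHS]aC12 [RHS]aC12 gh ?kj.
move=> x y z; rewrite (row_sum_delta x) (row_sum_delta y) (row_sum_delta z).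
rewrite !a_sum1; apply: eq_bigr => i _; rewrite !a_sum2; apply: eq_bigr => j _.
by rewrite !a_sum3; apply: eq_bigr => k _; rewrite !aE gh'.
Qed.

Definition rows3 (R : pzRingType) (n : nat) (x y z : 'rV[R]_n) : 'M[R]_(3, n) :=
  \matrix_(r < 3) tnth [tuple x; y; z] r.

Definition d3 (R : pzRingType) (x0 x1 x2 y0 y1 y2 z0 z1 z2 : R) :=
  x0 * y1 * z2 - x0 * y2 * z1 - x1 * y0 * z2 + x1 * y2 * z0 + x2 * y0 * z1 - x2 * y1 * z0.

Definition i30 : 'I_3 := ord0.
Definition i31 : 'I_3 := Ordinal (isT : 1 < 3)%N.
Definition i32 : 'I_3 := Ordinal (isT : 2 < 3)%N.

Lemma det3 (R : comPzRingType) (A : 'M[R]_3) :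
  \det A = d3 (A i30 i30) (A i30 i31) (A i30 i32) (A i31 i30) (A i31 i31) (A i31 i32)
              (A i32 i30) (A i32 i31) (A i32 i32).
Proof.
pose a p q := A (inord p) (inord q).
have aE' i j : A i j = a i j by rewrite /a !inord_val.
rewrite (expand_det_row _ i30) !big_ord_recl big_ord0 /cofactor.
rewrite !(expand_det_row _ (ord0 : 'I_2)) !big_ord_recl !big_ord0 /cofactor !det_mx11 !mxE.
rewrite !aE' /d3 /= /bump /= !addr0 ?addn0 ?addn1 ?add0n.
by ring.
Qed.

Section Tri.
Variables (K : fieldType) (n : nat).

Lemma tri_expand (w : ext3 K n) (x y z : 'rV[K]_n) :
  ext3_form w (rows3 x y z) = \sum_(t : triple n) w t *
    d3 (x 0 (tnth (val t) i30)) (x 0 (tnth (val t) i31)) (x 0 (tnth (val t) i32))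
       (y 0 (tnth (val t) i30)) (y 0 (tnth (val t) i31)) (y 0 (tnth (val t) i32))
       (z 0 (tnth (val t) i30)) (z 0 (tnth (val t) i31)) (z 0 (tnth (val t) i32)).
Proof. by apply: eq_bigr => t _; rewrite det3 !mxE !(tnth_nth 0). Qed.

Lemma tri_subproof (w : ext3 K n) :
  let h x y z := ext3_form w (rows3 x y z) in
  [/\ forall a x x' y z, h (a *: x + x') y z = a * h x y z + h x' y z,
      forall a x y y' z, h x (a *: y + y') z = a * h x y z + h x y' z,
      forall a x y z z', h x y (a *: z + z') = a * h x y z + h x y z',
      forall x z, h x x z = 0 & forall x y, h x y y = 0].
Proof.
split=> *; rewrite /= !tri_expand.
- by rewrite big_distrr -big_split; apply: eq_bigr => t _; rewrite !mxE /d3 /=; ring.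
- by rewrite big_distrr -big_split; apply: eq_bigr => t _; rewrite !mxE /d3 /=; ring.
- by rewrite big_distrr -big_split; apply: eq_bigr => t _; rewrite !mxE /d3 /=; ring.
- by rewrite big1 // => t _; rewrite /d3; ring.
- by rewrite big1 // => t _; rewrite /d3; ring.
Qed.
Definition tri (w : ext3 K n) : alt3 K n :=
  let: And5 a b c d e := tri_subproof w in Alt3 a b c d e.
Lemma triE w x y z : tri w x y z = ext3_form w (rows3 x y z).
Proof. by rewrite /tri; case: tri_subproof. Qed.

Lemma ext3_formE w (X : 'M[K]_(3, n)) :
  ext3_form w X = tri w (row i30 X) (row i31 X) (row i32 X).
Proof.
rewrite triE; congr ext3_form; apply/matrixP=> i j.
rewrite !mxE (tnth_nth 0); case: i => [[|[|[|//]]]] p /=; rewrite mxE; congr (X _ _); exact: val_inj.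
Qed.

Lemma contractionE w x : contraction w x = om (tri w) x.
Proof. by apply/matrixP=> i j; rewrite !mxE triE. Qed.

Lemma triple_lt (t : triple n) :
  (tnth (val t) i30 < tnth (val t) i31)%N && (tnth (val t) i31 < tnth (val t) i32)%N.
Proof.
case: t => [[[|a [|b [|c [|//]]]] //= sz]] /=; rewrite /tnth /=.
by rewrite andbT.
Qed.

Lemma triple_eq (s t : triple n) :
  tnth (val s) i30 = tnth (val t) i30 -> tnth (val s) i31 = tnth (val t) i31 ->
  tnth (val s) i32 = tnth (val t) i32 -> s = t.
Proof.
move=> e0 e1 e2; apply: val_inj; apply: eq_from_tnth => i.
case: i => [[|[|[|//]]]] p.
- by rewrite (_ : Ordinal p = i30) //; apply: val_inj.
- by rewrite (_ : Ordinal p = i31) //; apply: val_inj.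
- by rewrite (_ : Ordinal p = i32) //; apply: val_inj.
Qed.

Lemma d3_delta (R : pzRingType) (a b c p q r : 'I_n) :
  (a < b < c)%N -> (p < q < r)%N ->
  d3 (a == p)%:R (b == p)%:R (c == p)%:R (a == q)%:R (b == q)%:R (c == q)%:R
     (a == r)%:R (b == r)%:R (c == r)%:R = [&& a == p, b == q & c == r]%:R :> R.
Proof.
move=> abc pqr; rewrite /d3 -!(inj_eq val_inj) /=.
have prodb (b1 b2 b3 : bool) : (b1%:R * b2%:R * b3%:R : R) = [&& b1, b2 & b3]%:R.
  by case: b1; case: b2; case: b3; rewrite /= ?mulr0 ?mul0r ?mulr1.
rewrite !prodb.
have -> : [&& nat_of_ord a == p, nat_of_ord c == q & nat_of_ord b == r] = false by lia.
have -> : [&& nat_of_ord b == p, nat_of_ord a == q & nat_of_ord c == r] = false by lia.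
have -> : [&& nat_of_ord b == p, nat_of_ord c == q & nat_of_ord a == r] = false by lia.
have -> : [&& nat_of_ord c == p, nat_of_ord a == q & nat_of_ord b == r] = false by lia.
have -> : [&& nat_of_ord c == p, nat_of_ord b == q & nat_of_ord a == r] = false by lia.
by rewrite /= !subr0 !addr0.
Qed.

Lemma tri_delta w (t : triple n) :
  tri w (delta_mx 0 (tnth (val t) i30)) (delta_mx 0 (tnth (val t) i31))
        (delta_mx 0 (tnth (val t) i32)) = w t.
Proof.
have lt1 := triple_lt t.
rewrite triE tri_expand (bigD1 t) //= big1 ?addr0 => [|s st].
  by rewrite !mxE /= d3_delta // !eqxx mulr1.
rewrite !mxE /= d3_delta ?triple_lt //; case: and3P => [[/eqP e0 /eqP e1 /eqP e2]|]; rewrite ?mulr0 //.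
by rewrite (triple_eq e0 e1 e2) eqxx in st.
Qed.

Definition ext3_of (g : alt3 K n) : ext3 K n :=
  [ffun t : triple n => g (delta_mx 0 (tnth (val t) i30)) (delta_mx 0 (tnth (val t) i31))
        (delta_mx 0 (tnth (val t) i32))].

Lemma ext3_of_tri w : ext3_of (tri w) = w.
Proof. by apply/ffunP=> t; rewrite ffunE tri_delta. Qed.

Lemma mk_triple_proof (i j k : 'I_n) : (i < j < k)%N ->
  sorted ltn [seq nat_of_ord i | i <- [tuple i; j; k]].
Proof. by rewrite /= andbT. Qed.
Definition mk_triple (i j k : 'I_n) (ijk : (i < j < k)%N) : triple n :=
  exist (fun t : 3.-tuple 'I_n => sorted ltn [seq nat_of_ord i | i <- t]) _ (mk_triple_proof ijk).

Lemma tri_ext3_of g x y z : tri (ext3_of g) x y z = g x y z.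
Proof.
apply: alt3_ext => i j k ijk.
by have := tri_delta (ext3_of g) (mk_triple ijk); rewrite ffunE.
Qed.

End Tri.

(** Trivectors are forms on the dual space, where a linear map acts by its transpose. *)
Lemma ext3_mapE (K : fieldType) (m n : nat) (M : 'M[K]_(m, n)) (w : ext3 K m) :
  ext3_map M w = ext3_of (pull (tri w) M^T).
Proof.
apply/ffunP=> t; rewrite !ffunE ext3_formE pullE.
by congr (tri w _ _ _); rewrite -rowE; apply/rowP=> j; rewrite !mxE.
Qed.

Lemma tri_ext3_map (K : fieldType) (m n : nat) (M : 'M[K]_(m, n)) (w : ext3 K m) x y z :
  tri (ext3_map M w) x y z = tri w (x *m M^T) (y *m M^T) (z *m M^T).
Proof. by rewrite ext3_mapE tri_ext3_of pullE. Qed.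

Lemma ext3_of_eq (K : fieldType) (n : nat) (g h : alt3 K n) :
  (forall x y z, g x y z = h x y z) -> ext3_of g = ext3_of h.
Proof. by move=> gh; apply/ffunP=> t; rewrite !ffunE gh. Qed.

Lemma ext3_map_comp (K : fieldType) (m n p : nat) (M : 'M[K]_(m, n)) (N : 'M_(n, p))
  (w : ext3 K m) : ext3_map N (ext3_map M w) = ext3_map (M *m N) w.
Proof.
rewrite (ext3_mapE N) (ext3_mapE (M *m N)); apply: ext3_of_eq => x y z.
by rewrite !pullE tri_ext3_map trmx_mul !mulmxA.
Qed.

Lemma ext3_map1 (K : fieldType) (n : nat) (w : ext3 K n) : ext3_map 1%:M w = w.
Proof.
rewrite ext3_mapE -[RHS]ext3_of_tri; apply: ext3_of_eq => x y z.
by rewrite pullE trmx1 !mulmx1.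
Qed.

(** * Consequences of stability *)

Lemma meval_curve (K : comNzRingType) (n : nat) (p : {mpoly K[n]}) (q : 'I_n -> {poly K}) :
  exists r : {poly K}, forall t (v : 'I_n -> K), (forall i, v i = (q i).[t]) -> p.@[v] = r.[t].
Proof.
exists (mmap polyC q p) => t v vE.
rewrite -horner_evalE /meval /mmap raddf_sum; apply: eq_bigr => m _ /=.
rewrite rmorphM /= horner_evalE hornerC; congr (_ * _).
rewrite /mmap1 rmorph_prod; apply: eq_bigr => i _.
by rewrite rmorphXn /= horner_evalE vE.
Qed.

Lemma row_free_extend (F : fieldType) (p d r n : nat) (A : 'M[F]_(p, n)) (N : 'M_(r, n)) :
  row_free A -> (A <= N)%MS -> (p + d <= \rank N)%N ->
  exists C : 'M_(d, n), row_free (col_mx A C) && (C <= N)%MS.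
Proof.
move=> freeA; rewrite -(eq_row_base N) => /submxP[U AE] le.
have freeU : row_free U.
  apply: inj_row_free => v vU; apply: (row_free_inj freeA).
  by rewrite AE mulmxA vU !mul0mx.
have [C /andP[freeC _]] := @basis_completion _ p (d + (\rank N - (p + d))) _ U (ltac:(lia)) freeU.
exists (usubmx C *m row_base N); apply/andP; split; last first.
  by rewrite (submx_trans (submxMl _ _)) // eq_row_base.
rewrite AE -mul_col_mx /row_free mxrankMfree ?row_base_free //.
rewrite -[C]vsubmxK in freeC.
apply/inj_row_free => v; rewrite -[v]hsubmxK mul_row_col => v0.
have := row_free_inj freeC; move=> /(_ _ (row_mx (lsubmx v) (row_mx (rsubmx v) 0)) 0).
rewrite !mul_row_col mul0mx addr0 mul0mx v0 => /(_ erefl).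
rewrite -[0 : 'rV_(p + _)]hsubmxK => /eq_row_mx[-> ]; rewrite -[rsubmx 0]hsubmxK => /eq_row_mx[-> _].
by rewrite !linear0 row_mx0.
Qed.

Lemma kernel_extend (F : fieldType) n (g : alt3 F n) d x : x != 0 -> (d.+1 + \rank (om g x) <= n)%N ->
  exists m : 'M_(d, n), row_free (col_mx x m) /\ m *m om g x = 0.
Proof.
move=> x0 le; have freex : row_free x by rewrite /row_free rank_rV x0.
have xN : (x <= kermx (om g x))%MS by apply/sub_kermxP/killxx.
have [|m /andP[fr mN]] := @row_free_extend _ 1 d _ _ _ _ freex xN.
  by rewrite mxrank_ker; lia.
by exists m; split=> //; apply/sub_kermxP.
Qed.

Section Stable.
Variables (K : closedFieldType) (w : ext3 K 9).
Let g := tri w.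
Hypothesis stab_w : stable w.

(* The weights [a], in the basis of the rows of [B], define a one-parameter subgroup under which [w] has a limit. This
   limit lies in the closed orbit of [w] and has an infinite stabilizer. *)
Section Destab.
Variables (B : 'M[K]_9) (a : 'I_9 -> int) (i0 : 'I_9).
Hypotheses (B_unit : B \in unitmx) (a_sum : \sum_i a i = 0) (ai0 : a i0 != 0).
Hypothesis gB0 : forall i j k, 0 < a i + a j + a k -> g (row i B) (row j B) (row k B) = 0.

Let wt (T : triple 9) := a (tnth (val T) i30) + a (tnth (val T) i31) + a (tnth (val T) i32).
Let c := ext3_of (pull g B).
Let D t : 'M[K]_9 := diag_mx (\row_i t ^ (- a i)).
Let M t := (invmx B *m D t *m B)^T.
(** Where [c T] is non-zero its weight is at most 0, so the absolute value equals [- wt T]. The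
    formula therefore agrees with the action of [D t] for t != 0 and makes sense at t = 0, where it
    gives the limit. *)
Let ct t : ext3 K 9 := [ffun T => t ^+ `|wt T| * c T].
Let W t := ext3_map (invmx B)^T (ct t).

Let c_wt T : c T != 0 -> wt T <= 0.
Proof.
rewrite leNgt; apply: contraNN => pos.
by rewrite ffunE pullE -!rowE gB0.
Qed.

Let ctE t : t != 0 -> forall x y z, tri (ct t) x y z = pull g B (x *m D t) (y *m D t) (z *m D t).
Proof.
move=> t0 x y z; rewrite -pullE; apply: alt3_ext => {x y z} i j k ijk.
have := tri_delta (ct t) (mk_triple ijk); rewrite /= => ->.
have dD l : (delta_mx 0 l : 'rV[K]_9) *m D t = t ^ (- a l) *: delta_mx 0 l.
  apply/rowP=> m; rewrite mul_mx_diag !mxE eqxx /=.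
  by case: eqP => [->|_]; rewrite ?mulr1 ?mul1r ?mulr0 ?mul0r.
rewrite [RHS]pullE !dD !aE ffunE -[pull g B _ _ _](_ : c (mk_triple ijk) = _); last by rewrite ffunE.
have [-> | /c_wt le0] := eqVneq (c (mk_triple ijk)) 0; first by rewrite !mulr0.
rewrite !mulrA -!expfzDr // -!opprD exprnP; congr (_ ^ _ * _).
by rewrite (_ : a i + a j + a k = wt (mk_triple ijk)) //; lia.
Qed.

Let detM t : t != 0 -> \det (M t) = 1.
Proof.
move=> t0; rewrite det_tr !det_mulmx mulrAC -det_mulmx mulVmx // det1 mul1r det_diag.
under eq_bigr do rewrite mxE.
have -> : \prod_i t ^ (- a i) = t ^ (\sum_i - a i).
  by elim/big_rec2: _ => [|i y1 y2 _ ->]; rewrite ?expr0z // expfzDr.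
by rewrite sumrN a_sum oppr0 expr0z.
Qed.

Let WE t : t != 0 -> W t = ext3_map (M t) w.
Proof.
move=> t0; rewrite /W (ext3_mapE (invmx B)^T) (ext3_mapE (M t)); apply: ext3_of_eq => x y z.
by rewrite !pullE !trmxK ctE // pullE !mulmxA.
Qed.

(** A polynomial vanishing on the orbit is a polynomial in t along the curve [W], zero for t != 0
    and hence at 0; the orbit is closed. *)
Let W0_orbit : SL_orbit w (W 0).
Proof.
apply: stab_w.1 => p p0.
pose q (i : 'I_#|{: triple 9}|) : {poly K} :=
   \sum_(T : triple 9) (c T * (let s := enum_val i in let r m := row m (rowsub (tnth (val s)) (invmx B)^T^T) in
    d3 (r i30 0 (tnth (val T) i30)) (r i30 0 (tnth (val T) i31)) (r i30 0 (tnth (val T) i32))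
       (r i31 0 (tnth (val T) i30)) (r i31 0 (tnth (val T) i31)) (r i31 0 (tnth (val T) i32))
       (r i32 0 (tnth (val T) i30)) (r i32 0 (tnth (val T) i31)) (r i32 0 (tnth (val T) i32))))
      *: 'X^(`|wt T|%N).
have qE t i : ext3_val (W t) i = (q i).[t].
  rewrite /ext3_val ffunE ext3_formE triE tri_expand /q horner_sum; apply: eq_bigr => T _.
  by rewrite hornerZ hornerXn ffunE /=; ring.
have [r rE] := meval_curve p q.
have r0 : r = 0.
  apply: (@poly_mul_zero _ 'X); first by rewrite polyX_eq0.
  move=> t; rewrite hornerX; have [-> | t0] := eqVneq t 0; first by rewrite mul0r.
  rewrite -(rE t (ext3_val (W t))) // p0 ?mulr0 //.
  by exists (M t); rewrite ?detM ?WE.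
by rewrite (rE 0 (ext3_val (W 0))) // r0 horner0.
Qed.

(** Only the coordinates of weight 0 survive in the limit. *)
Let MW0 t : t != 0 -> ext3_map (M t) (W 0) = W 0.
Proof.
move=> t0; rewrite /W ext3_map_comp ext3_mapE [RHS]ext3_mapE; apply: ext3_of_eq => x y z.
rewrite !pullE !trmx_mul !trmxK !mulmxA !mulmxK //.
move: (x *m invmx B) (y *m invmx B) (z *m invmx B) => {}x {}y {}z; rewrite -pullE.
apply: alt3_ext => {x y z} i j k ijk.
have := tri_delta (ct 0) (mk_triple ijk); rewrite /= => e; rewrite e.
have dD l : (delta_mx 0 l : 'rV[K]_9) *m D t = t ^ (- a l) *: delta_mx 0 l.
  apply/rowP=> m; rewrite mul_mx_diag !mxE eqxx /=.
  by case: eqP => [->|_]; rewrite ?mulr1 ?mul1r ?mulr0 ?mul0r.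
rewrite [LHS]pullE !dD !aE e ffunE expr0n.
case: (eqVneq `|wt (mk_triple ijk)|%N 0%N) => [wt0|_]; last by rewrite mul0r !mulr0.
rewrite mul1r !mulrA -!expfzDr // -!opprD.
rewrite (_ : a i + a j + a k = wt (mk_triple ijk)) //.
by move/eqP: wt0; rewrite absz_eq0 => /eqP ->; rewrite oppr0 expr0z mul1r.
Qed.

(** Conjugating [M t] by the element [h] that carries [w] to its limit gives stabilizers of [w].
    Their diagonal entry at [i0], read by [phi], is t ^ (- a i0) and takes infinitely many
    values. *)
Lemma destabilized : False.
Proof.
have [h hdet W0E] := W0_orbit; have [s sP] := stab_w.2.
have hU : h \in unitmx by rewrite unitmxE hdet unitr1.
have inS t : t != 0 -> h *m M t *m invmx h \in s.
  move=> t0; apply: sP.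
    by rewrite !det_mulmx mulrAC -det_mulmx mulmxV // det1 mul1r detM.
  rewrite -ext3_map_comp -ext3_map_comp -W0E MW0 // W0E ext3_map_comp mulmxV //.
  exact: ext3_map1.
pose phi (X : 'M[K]_9) := (B *m (invmx h *m X *m h)^T *m invmx B) i0 i0.
have phiE t : phi (h *m M t *m invmx h) = t ^ (- a i0).
  rewrite /phi !mulmxA mulVmx // mul1mx mulmxKV // /M trmxK !mulmxA mulmxV // mul1mx mulmxK //.
  by rewrite !mxE eqxx mulr1n.
(* A finite stabilizer would make every non-zero t a root of this non-zero polynomial. *)
pose P := \prod_(X <- s) ('X^(`|a i0|%N) - (phi X)%:P).
have P0 : P != 0.
  apply: monic_neq0; apply: monic_prod => X _; apply: monicXnsubC.
  by rewrite absz_gt0.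
have rootP t : t != 0 -> P.[t] = 0.
  move=> t0; have [u u0 tE] : exists2 u, u != 0 & t ^+ `|a i0|%N = u ^ (- a i0).
    have [neg|pos] := lerP (a i0) 0.
      by exists t => //; rewrite exprnP; congr (_ ^ _); lia.
    exists t^-1; rewrite ?invr_eq0 // exprnP exprz_inv opprK; congr (_ ^ _); lia.
  apply/eqP; rewrite horner_prod prodf_seq_eq0; apply/hasP; exists (h *m M u *m invmx h); first exact: inS.
  by rewrite /= !hornerE phiE tE subrr.
by move/eqP: P0; apply; apply: (@poly_mul_zero _ 'X); rewrite ?polyX_eq0 // => t;
  rewrite hornerX; have [-> | t0] := eqVneq t 0; rewrite ?mul0r // rootP ?mulr0.
Qed.
End Destab.

Lemma row_col_sub (F : fieldType) d e n (A : 'M[F]_(d, n)) (C : 'M_(e, n)) (i : 'I_(d + e)) :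
  (i < d)%N -> (row i (col_mx A C) <= A)%MS.
Proof.
case: (split_ordP i) => i' -> /=; first by rewrite rowKu row_sub.
by [].
Qed.

Lemma kill_rows3 (x a b : 'rV_9) y z : kill g x a -> kill g x b -> kill g a b ->
  (y <= rows3 x a b)%MS -> (z <= rows3 x a b)%MS -> kill g y z.
Proof.
move=> kxa kxb kab; pose A := rows3 x a b.
have kr (i j : 'I_3) : kill g (row i A) (row j A).
  have rE (i' : 'I_3) : row i' A = tnth [tuple x; a; b] i'.
    by apply/rowP=> l; rewrite !mxE.
  rewrite !rE; case: i => [[|[|[|//]]]] p; case: j => [[|[|[|//]]]] q;
   rewrite !(tnth_nth x) /=; try exact: killxx; by [|exact: kill_sym].
move=> /submxP[u ->] /submxP[v ->]; rewrite !mulmx_sum_row; apply/killP=> t.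
rewrite a_sum1 big1 // => i _; rewrite a_sum2 big1 // => j _.
by rewrite !aE; have /killP -> := kr i j; rewrite !mulr0.
Qed.

Lemma stable_no_triple (x a b : 'rV_9) :
  row_free (rows3 x a b) -> kill g x a -> kill g x b -> kill g a b -> False.
Proof.
move=> freeA kxa kxb kab; pose A := rows3 x a b.
have [C /andP[freeB _]] := @basis_completion _ 3 6 9 _ erefl freeA.
have rA : forall i : 'I_9, (i < 3)%N -> (row i (col_mx A C : 'M_9) <= A)%MS := @row_col_sub _ 3 6 9 A C.
have kA y z : (y <= A)%MS -> (z <= A)%MS -> kill g y z by apply: kill_rows3.
(* Total weight 3 * 2 - 6 = 0; a triple has positive weight exactly when at least two of its indices
   are below 3. *)
pose wt (i : 'I_9) : int := if (i < 3)%N then 2 else -1.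
apply: (@destabilized (col_mx A C) wt ord0).
- by rewrite -row_free_unit.
- by rewrite !big_ord_recl big_ord0.
- by [].
move=> i j k; rewrite /wt; have := rA i; have := rA j; have := rA k.
case: ifP => _; case: ifP => _; case: ifP => _ // kk jj ii _.
all: try (by have /killP -> := kA _ _ (ii isT) (jj isT)).
all: try (by rewrite a_rot; have /killP -> := kA _ _ (jj isT) (kk isT)).
all: by rewrite aC23; have /killP -> := kA _ _ (ii isT) (kk isT); rewrite oppr0.
Qed.

Lemma stable_rank_gt2 x : x != 0 -> (2 < \rank (om g x))%N.
Proof.
move=> x0; rewrite ltnNge; apply/negP=> rk.
have freex : row_free x by rewrite /row_free rank_rV x0.
have xN : (x <= kermx (om g x))%MS by apply/sub_kermxP/killxx.
have [|C /andP[freeC CN]] := @row_free_extend _ 1 6 _ _ _ _ freex xN.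
  by rewrite mxrank_ker; lia.
have [E /andP[freeB _]] := @basis_completion _ 7 2 9 _ erefl freeC.
pose B : 'M_9 := col_mx (col_mx x C) E.
have rB7 : forall i : 'I_9, (i < 7)%N -> (row i B <= col_mx x C)%MS := @row_col_sub _ 7 2 9 (col_mx x C) E.
have rB1 (i : 'I_9) : (i < 1)%N -> (row i B <= x)%MS.
  move=> i1; have -> : row i B = row (lshift 2 (lshift 6 (0 : 'I_1))) (col_mx (col_mx x C) E : 'M_(1 + 6 + 2, 9)).
    by congr (row _ B); apply: val_inj => /=; lia.
  by rewrite !rowKu row_sub.
have kB y z : (y <= x)%MS -> (z <= col_mx x C)%MS -> kill g y z.
  move=> /sub_rVP[l ->] zC; apply/killP=> t; rewrite aZ1.
  suff /killP -> : kill g x z by rewrite mulr0.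
  by apply/sub_kermxP; apply: (submx_trans zC); rewrite col_mx_sub xN.
(* Rank at most 2 leaves seven independent vectors in the kernel, [x] among them. A positive weight
   requires the index 0 together with another index below 7, where [x] kills. *)
pose wt (i : 'I_9) : int := if (i < 1)%N then 2 else if (i < 7)%N then 0 else -1.
apply: (@destabilized B wt ord0).
- by rewrite -row_free_unit.
- by rewrite !big_ord_recl big_ord0.
- by [].
move=> i j k; rewrite /wt.
have xC : (x <= col_mx x C)%MS by rewrite -addsmxE addsmxSl.
have := rB1 i; have := rB1 j; have := rB1 k; have := rB7 i; have := rB7 j; have := rB7 k.
case: ifP => _; [|case: ifP => _]; (case: ifP => _; [|case: ifP => _]); (case: ifP => _; [|case: ifP => _]) => //.
all: move=> k7 j7 i7 k1 j1 i1 _.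
all: try (by have /killP -> := kB _ _ (i1 isT) (j7 isT)).
all: try (by have /killP -> := kB _ _ (i1 isT) (submx_trans (j1 isT) xC)).
all: try (by rewrite aC23; have /killP -> := kB _ _ (i1 isT) (k7 isT); rewrite oppr0).
all: try (by rewrite aC23; have /killP -> := kB _ _ (i1 isT) (submx_trans (k1 isT) xC); rewrite oppr0).
all: try (by rewrite a_rot; have /killP -> := kB _ _ (j1 isT) (k7 isT)).
all: try (by rewrite a_rot; have /killP -> := kB _ _ (j1 isT) (submx_trans (k1 isT) xC)).
all: try (by rewrite aC12; have /killP -> := kB _ _ (j1 isT) (i7 isT); rewrite oppr0).
all: try (by rewrite aC13; have /killP -> := kB _ _ (k1 isT) (j7 isT); rewrite oppr0).
all: by rewrite a_rot a_rot; have /killP -> := kB _ _ (k1 isT) (i7 isT).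
Qed.

Lemma stable_no_flag (R : 'M_(4, 9)) (H : 'M_(8, 9)) :
  row_free R -> row_free H -> (R <= H)%MS ->
  (forall r s y : 'rV_9, (r <= R)%MS -> (s <= R)%MS -> (y <= H)%MS -> g r s y = 0) -> False.
Proof.
move=> freeR freeH RH g0.
have [|Q /andP[freeQ QH]] := @row_free_extend _ 4 4 _ _ _ _ freeR RH; first by rewrite (eqP freeH).
have [E /andP[freeB _]] := @basis_completion _ 8 1 9 _ erefl freeQ.
pose B : 'M_9 := col_mx (col_mx R Q) E.
have rB8 (i : 'I_9) : (i < 8)%N -> (row i B <= H)%MS.
  move=> i8; apply: (submx_trans (@row_col_sub _ 8 1 9 (col_mx R Q) E i i8)).
  by have -> // : (@col_mx _ 4 4 9 R Q <= H)%MS by rewrite col_mx_sub RH.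
have rB4 (i : 'I_9) : (i < 4)%N -> (row i B <= R)%MS.
  move=> i4; have i4' : (i < 4 + 4)%N by lia.
  have -> : row i B = row (lshift 1 (Ordinal i4')) (col_mx (col_mx R Q) E : 'M_(4 + 4 + 1, 9)).
    by congr (row _ B); apply: val_inj.
  by rewrite rowKu; apply: row_col_sub.
(* Total weight 8 - 4 - 4 = 0; positive weight means two indices in [R] and the third in [H]. *)
pose wt (i : 'I_9) : int := if (i < 4)%N then 2 else if (i < 8)%N then -1 else -4.
apply: (@destabilized B wt ord0).
- by rewrite -row_free_unit.
- by rewrite !big_ord_recl big_ord0.
- by [].
move=> i j k; rewrite /wt.
have := rB4 i; have := rB4 j; have := rB4 k; have := rB8 i; have := rB8 j; have := rB8 k.
case: ifP => _; [|case: ifP => _]; (case: ifP => _; [|case: ifP => _]); (case: ifP => _; [|case: ifP => _]) => //.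
all: move=> k8 j8 i8 k4 j4 i4 _.
all: try (exact: g0 (i4 isT) (j4 isT) (k8 isT)).
all: try (exact: g0 (i4 isT) (j4 isT) (submx_trans (k4 isT) RH)).
all: try (by rewrite aC23 (g0 _ _ _ (i4 isT) (k4 isT) (j8 isT)) oppr0).
all: by rewrite a_rot (g0 _ _ _ (j4 isT) (k4 isT) (i8 isT)).
Qed.
End Stable.

(** * Polynomial functions *)

(** Infinitude of the domain in the form in which it is used, for closed fields and for the
    rationals. *)
Definition inf_dom (F : idomainType) :=
  forall p : {poly F}, p != 0 -> exists t, p.[t] != 0.

Definition hE (R : comNzRingType) :=
  (@horner_exp R, @hornerD R, @hornerN R, @hornerM R, @hornerC R, @hornerZ R, @hornerX R).

Lemma inf_dom0 (F : idomainType) (p : {poly F}) : inf_dom F -> (forall t, p.[t] = 0) -> p = 0.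
Proof. by move=> infF p0; apply/eqP/negPn/negP => /infF[t]; rewrite p0 eqxx. Qed.

Lemma inf_dom_closed (K : closedFieldType) : inf_dom K.
Proof. by move=> p /closed_nonrootP. Qed.

Lemma inf_dom_rat : inf_dom rat.
Proof.
move=> p nz; pose s := [seq (i%:R : rat) | i <- iota 0 (size p)].
have [al|/allPn[t _ ?]] := boolP (all (root p) s); last by exists t.
have : (size s < size p)%N.
  apply: max_poly_roots => //.
  by rewrite map_inj_uniq ?iota_uniq // => i j /eqP; rewrite eqr_nat => /eqP.
by rewrite size_map size_iota ltnn.
Qed.

Lemma digits_inj (D n : nat) (f g : 'I_n -> nat) :
  (forall i, f i < D)%N -> (forall i, g i < D)%N ->
  (\sum_(i < n) f i * D ^ i = \sum_(i < n) g i * D ^ i)%N -> f =1 g.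
Proof.
elim: n f g => [|n IH] f g fD gD; first by move=> _ [].
rewrite !big_ord_recl !muln1.
have E (h : 'I_n.+1 -> nat) : (\sum_(i < n) h (lift ord0 i) * D ^ (lift ord0 i) = (\sum_(i < n) h (lift ord0 i) * D ^ i) * D)%N.
  by rewrite big_distrl; apply: eq_bigr => i _ /=; rewrite /bump add1n expnSr mulnA.
rewrite !E => eqfg.
have e0 : f ord0 = g ord0.
  by have := congr1 (modn^~ D) eqfg; rewrite /= ![(_ + _ * D)%N]addnC !modnMDl !modn_small.
move: eqfg; rewrite e0 => /addnI/eqP; rewrite eqn_pmul2r ?(leq_ltn_trans _ (fD ord0)) // => /eqP/IH E2.
move=> i; case: (unliftP ord0 i) => [j ->|-> //].
by apply: E2.
Qed.

(** Kronecker substitution: X_i becomes t ^ (D ^ i) with D larger than all exponents. Uniqueness of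
    digits in base D keeps distinct monomials distinct, which reduces the claim to one variable. *)
Lemma mpoly_nz (F : idomainType) (n : nat) (p : {mpoly F[n]}) :
  inf_dom F -> p != 0 -> exists v, p.@[v] != 0.
Proof.
move=> infF nz; have m0p := mlead_supp nz; move: (mlead p) m0p => m0 m0p.
pose D := msize p; pose e (m : 'X_{1..n}) := (\sum_(i < n) m i * D ^ i)%N.
have lt_m m : m \in msupp p -> forall i, (m i < D)%N.
  move=> mp i; apply: leq_ltn_trans (msize_mdeg_lt mp).
  by rewrite mdegE (bigD1 i) //= leq_addr.
pose P : {poly F} := \sum_(m <- msupp p) p@_m *: 'X^(e m).
have P0 : P`_(e m0) = p@_m0.
  rewrite coef_sum (bigD1_seq m0) //= ?msupp_uniq // coefZ coefXn eqxx mulr1.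
  rewrite big_seq_cond big1 ?addr0 // => m /andP[mp mm0].
  rewrite coefZ coefXn; case: eqP => [E|_]; rewrite ?mulr0 //.
  by case/eqP: mm0; apply/mnmP=> i; apply/esym/(digits_inj (lt_m _ m0p) (lt_m _ mp) E).
have /infF[t Pt] : P != 0.
  by apply/eqP => PE; move: m0p; rewrite mcoeff_msupp -P0 PE coef0 eqxx.
exists (fun i => t ^+ (D ^ i)); apply: contraNneq Pt => <-; apply/eqP.
rewrite mevalE horner_sum; apply: eq_bigr => m _; rewrite hornerZ hornerXn; congr (_ * _).
by rewrite /e -prodrXr; apply: eq_bigr => i _; rewrite -exprM mulnC.
Qed.

Lemma mpoly_fun0 (F : idomainType) (n : nat) (p : {mpoly F[n]}) :
  inf_dom F -> (forall v, p.@[v] = 0) -> p = 0.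
Proof. by move=> infF p0; apply/eqP/negPn/negP => /(mpoly_nz infF)[v]; rewrite p0 eqxx. Qed.

Lemma mpoly_fun_eq (F : idomainType) (n : nat) (p q : {mpoly F[n]}) :
  inf_dom F -> (forall v, p.@[v] = q.@[v]) -> p = q.
Proof.
move=> infF pq; apply/eqP; rewrite -subr_eq0; apply/eqP/mpoly_fun0 => // v.
by rewrite mevalB pq subrr.
Qed.

Lemma meval_homog (F : comNzRingType) (n d : nat) (p : {mpoly F[n]}) t v :
  p \is d.-homog -> p.@[fun i => t * v i] = t ^+ d * p.@[v].
Proof.
move=> /dhomogP hp; rewrite !mevalE big_distrr big_seq [RHS]big_seq /=; apply: eq_bigr => m mp.
rewrite -(hp _ mp) mulrCA; congr (_ * _).
rewrite /= mdegE -prodrXr -big_split; apply: eq_bigr => i _.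
by rewrite exprMn.
Qed.

Lemma homog_meval (F : idomainType) (n d : nat) (p : {mpoly F[n]}) :
  inf_dom F -> (forall t v, p.@[fun i => t * v i] = t ^+ d * p.@[v]) -> p \is d.-homog.
Proof.
move=> infF hp; apply/dhomogP=> m mp.
pose q t : {mpoly F[n]} := \sum_(m <- msupp p) (t ^+ mdeg m * p@_m) *: 'X_[m].
have qE t : q t = t ^+ d *: p.
  apply: mpoly_fun_eq => // v; rewrite mevalZ -hp [RHS]mevalE /q (raddf_sum (meval v)) /=; apply: eq_bigr => k _.
  rewrite mevalZ mevalX [t ^+ _ * _]mulrC -mulrA; congr (_ * _).
  rewrite mdegE -prodrXr -big_split; apply: eq_bigr => i _.
  by rewrite exprMn.
have E t : t ^+ mdeg m * p@_m = t ^+ d * p@_m.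
  have := congr1 (mcoeff m) (qE t); rewrite mcoeffZ => <-.
  rewrite /q (raddf_sum (mcoeff m)) (bigD1_seq m) //= ?msupp_uniq // mcoeffZ mcoeffX eqxx mulr1.
  by rewrite big1 ?addr0 // => k km; rewrite mcoeffZ mcoeffX (negPf km) mulr0.
have : ('X^(mdeg m) - 'X^d : {poly F}) = 0.
  apply: (inf_dom0 infF) => t; apply/eqP; rewrite !hornerE subr_eq0; apply/eqP.
  by apply: (mulIf (_ : p@_m != 0)); rewrite ?E // -mcoeff_msupp.
move=> /(congr1 (fun r : {poly F} => r`_d)) /eqP; rewrite coefB !coefXn eqxx coef0.
by case: (d =P mdeg m) => [-> //|_]; rewrite sub0r oppr_eq0 oner_eq0.
Qed.

(** The two monomials are coprime, so the second divides each monomial of [p]. *)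
Lemma mpoly_div_monomial (R : idomainType) (n : nat) (p q : {mpoly R[n]}) (m1 m2 : 'X_{1..n}) :
  (forall i, m1 i = 0%N \/ m2 i = 0%N) -> p * 'X_[m1] = q * 'X_[m2] ->
  exists r, p = r * 'X_[m2].
Proof.
move=> dis pq.
have le m : m \in msupp p -> (m2 <= m)%MM.
  move=> mp; have : (m + m1)%MM \in msupp (q * 'X_[m2]).
    by rewrite -pq addmC mcoeff_msupp mcoeffMX -mcoeff_msupp.
  rewrite (perm_mem (msuppMX _ _)) => /mapP[k _ E].
  apply/mnm_lepP=> i; have := congr1 (fun z : 'X_{1..n} => z i) E; rewrite !mnmDE.
  by case: (dis i) => ->; lia.
exists (\sum_(m <- msupp p) p@_m *: 'X_[(m - m2)%MM]).
rewrite [LHS]mpolyE big_distrl big_seq [RHS]big_seq /=; apply: eq_bigr => m mp.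
by rewrite -scalerAl -mpolyXD submK // le.
Qed.

Section PolyFun.
Variable K : closedFieldType.
Implicit Types n m : nat.

(** Polynomials are treated as functions, faithfully because the field is infinite; identities can
    then be checked pointwise and outside the zeros of a non-zero factor. *)
Definition polyf n (f : 'rV[K]_n -> K) := exists p : {mpoly K[n]}, forall x, f x = p.@[x 0].

Lemma polyf_ext n (f h : 'rV[K]_n -> K) : f =1 h -> polyf f -> polyf h.
Proof. by move=> fh [p pE]; exists p => x; rewrite -fh. Qed.
Lemma polyf_mp n (p : {mpoly K[n]}) : polyf (fun x => p.@[x 0]).
Proof. by exists p. Qed.
Lemma polyf_const n c : polyf (fun _ : 'rV[K]_n => c).
Proof. by exists c%:MP => x; rewrite mevalC. Qed.
Lemma polyf_coord n i : polyf (fun x : 'rV[K]_n => x 0 i).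
Proof. by exists 'X_i => x; rewrite mevalXU. Qed.
Lemma polyfD n (f h : 'rV[K]_n -> K) : polyf f -> polyf h -> polyf (fun x => f x + h x).
Proof. by move=> [p pE] [q qE]; exists (p + q) => x; rewrite mevalD pE qE. Qed.
Lemma polyfM n (f h : 'rV[K]_n -> K) : polyf f -> polyf h -> polyf (fun x => f x * h x).
Proof. by move=> [p pE] [q qE]; exists (p * q) => x; rewrite mevalM pE qE. Qed.
Lemma polyfN n (f : 'rV[K]_n -> K) : polyf f -> polyf (fun x => - f x).
Proof. by move=> [p pE]; exists (- p) => x; rewrite mevalN pE. Qed.
Lemma polyfB n (f h : 'rV[K]_n -> K) : polyf f -> polyf h -> polyf (fun x => f x - h x).
Proof. by move=> pf ph; apply: polyfD => //; apply: polyfN. Qed.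
Lemma polyfX n (f : 'rV[K]_n -> K) k : polyf f -> polyf (fun x => f x ^+ k).
Proof. by move=> [p pE]; exists (p ^+ k) => x; rewrite rmorphXn pE. Qed.
Lemma polyf_sum n I (r : seq I) (P : pred I) (f : I -> 'rV[K]_n -> K) :
  (forall i, P i -> polyf (f i)) -> polyf (fun x => \sum_(i <- r | P i) f i x).
Proof.
move=> pf; elim: r => [|i r IH].
  by apply: (polyf_ext _ (polyf_const n 0)) => x; rewrite big_nil.
case: (boolP (P i)) => Pi.
  by apply: (polyf_ext _ (polyfD (pf _ Pi) IH)) => x; rewrite big_cons Pi.
by apply: (polyf_ext _ IH) => x; rewrite big_cons (negPf Pi).
Qed.
Lemma polyf_prod n I (r : seq I) (P : pred I) (f : I -> 'rV[K]_n -> K) :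
  (forall i, P i -> polyf (f i)) -> polyf (fun x => \prod_(i <- r | P i) f i x).
Proof.
move=> pf; elim: r => [|i r IH].
  by apply: (polyf_ext _ (polyf_const n 1)) => x; rewrite big_nil.
case: (boolP (P i)) => Pi.
  by apply: (polyf_ext _ (polyfM (pf _ Pi) IH)) => x; rewrite big_cons Pi.
by apply: (polyf_ext _ IH) => x; rewrite big_cons (negPf Pi).
Qed.
Lemma polyf_det n m (A : 'rV[K]_n -> 'M[K]_m) :
  (forall i j, polyf (fun x => A x i j)) -> polyf (fun x => \det (A x)).
Proof.
move=> pA; apply: polyf_sum => s _; apply: polyfM; first exact: polyf_const.
by apply: polyf_prod.
Qed.
Lemma polyf_comp n m (f : 'rV[K]_m -> K) (G : 'rV[K]_n -> 'rV[K]_m) :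
  polyf f -> (forall i, polyf (fun x => G x 0 i)) -> polyf (fun x => f (G x)).
Proof.
move=> [p pE] pG; have /fin_all_exists[q qE] := pG.
exists (p \mPo [tuple q i | i < m]) => x.
rewrite pE comp_mpoly_meval; apply: meval_eq => i.
by rewrite tnth_mktuple qE.
Qed.
Lemma polyf_mx n m (M : 'M[K]_(n, m)) i : polyf (fun x => (x *m M) 0 i).
Proof.
apply: (polyf_ext (f := fun x => \sum_j x 0 j * M j i)) => [x|]; first by rewrite mxE.
by apply: polyf_sum => j _; apply: polyfM; [exact: polyf_coord|exact: polyf_const].
Qed.
Lemma polyf_lin n m (f : 'rV[K]_m -> K) (M : 'M[K]_(n, m)) : polyf f -> polyf (fun x => f (x *m M)).
Proof. by move=> pf; apply: polyf_comp => // i; apply: polyf_mx. Qed.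
Lemma polyf_curve n (f : 'rV[K]_n -> K) (c : K -> 'rV[K]_n) :
  polyf f -> (forall i, exists q : {poly K}, forall t, c t 0 i = q.[t]) ->
  exists r : {poly K}, forall t, f (c t) = r.[t].
Proof.
move=> [p pE] /fin_all_exists[q qE]; have [r rE] := meval_curve p q.
by exists r => t; rewrite pE; apply: rE => i; rewrite qE.
Qed.
Lemma polyf_line n (f : 'rV[K]_n -> K) x y :
  polyf f -> exists r : {poly K}, forall t, f (x + t *: y) = r.[t].
Proof.
move=> pf; apply: polyf_curve => // i; exists ((x 0 i)%:P + (y 0 i) *: 'X) => t.
by rewrite !mxE !hornerE mulrC.
Qed.
Lemma polyf_mul0 n (f h : 'rV[K]_n -> K) : polyf f -> polyf h ->
  (forall x, f x * h x = 0) -> (forall x, f x = 0) \/ (forall x, h x = 0).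
Proof.
move=> [p pE] [q qE] fh0; have /eqP : p * q = 0.
  apply: mpoly_fun0; first exact: inf_dom_closed.
  move=> v; have := fh0 (\row_i v i); rewrite pE qE -mevalM.
  by rewrite (meval_eq (v2 := v)) // => i; rewrite mxE.
by rewrite mulf_eq0 => /orP[]/eqP E; [left|right] => x; rewrite ?pE ?qE E meval0.
Qed.

Lemma poly_nz2 (p q : {poly K}) : p != 0 -> q != 0 -> exists t, p.[t] != 0 /\ q.[t] != 0.
Proof.
move=> p0 q0; have /inf_dom_closed[t] : p * q != 0 by rewrite mulf_neq0.
by rewrite hornerM mulf_eq0 negb_or => /andP; exists t.
Qed.

End PolyFun.

(** * Gradients and first-order expansions *)

Section Gradient.
Variables (K : fieldType) (n : nat).
Implicit Types (p q : {mpoly K[n]}) (x y : 'rV[K]_n).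

Lemma gradientD p q x : gradient (p + q) x = gradient p x + gradient q x.
Proof. by apply/rowP=> i; rewrite !mxE mderivD mevalD. Qed.
Lemma gradientM p q x : gradient (p * q) x = q.@[x 0] *: gradient p x + p.@[x 0] *: gradient q x.
Proof. by apply/rowP=> i; rewrite !mxE mderivM mevalD !mevalM mulrC. Qed.
Lemma gradientZ c p x : gradient (c *: p) x = c *: gradient p x.
Proof. by apply/rowP=> i; rewrite !mxE mderivZ mevalZ. Qed.
Lemma gradientXi i x : gradient 'X_i x = delta_mx 0 i.
Proof.
apply/rowP=> j; rewrite !mxE mderivX mevalZ mevalX eqxx /= mnm1E eq_sym.
case: eqP => [->|_]; rewrite ?mul0r // mul1r big1 // => l _.
by rewrite mnmBE subnn expr0.
Qed.

Lemma mpoly_ind (P : {mpoly K[n]} -> Prop) :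
  (forall c, P c%:MP) -> (forall i, P 'X_i) -> (forall p q, P p -> P q -> P (p + q)) ->
  (forall p q, P p -> P q -> P (p * q)) -> forall p, P p.
Proof.
move=> PC PX PD PM p; rewrite [p]mpolyE.
elim/big_ind: _ => [||m _]; [by rewrite -mpolyC0 | exact: PD |].
rewrite -mul_mpolyC; apply: (PM) => //; rewrite mpolyXE_id.
elim/big_ind: _ => [||i _]; [by rewrite -mpolyC1 | exact: PM |].
by elim: (m i) => [|k IH]; rewrite ?expr0 ?exprS -?mpolyC1 //; apply: PM.
Qed.

(** A Taylor expansion with a polynomial remainder, valid in every characteristic; induction over
    sums and products. *)
Lemma meval_line p x y : exists r : {poly K}, forall t,
  p.@[(x + t *: y) 0] = p.@[x 0] + t * ((gradient p x *m y^T) 0 0) + t ^+ 2 * r.[t].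
Proof.
elim/mpoly_ind: p => [c|i|p q [r rE] [s sE]|p q [r rE] [s sE]].
- exists 0 => t; rewrite !mevalC horner0 mulr0 addr0 (_ : gradient _ _ = 0).
    by rewrite mul0mx mxE mulr0 addr0.
  by apply/rowP=> i; rewrite !mxE mderivC meval0.
- exists 0 => t; rewrite !mevalXU horner0 mulr0 addr0 gradientXi -rowE.
  by rewrite !mxE.
- exists (r + s) => t; rewrite !mevalD rE sE gradientD mulmxDl hornerD [in RHS]mxE.
  by ring.
pose a := (gradient p x *m y^T) 0 0; pose b := (gradient q x *m y^T) 0 0.
exists ((a * b)%:P + p.@[x 0] *: s + q.@[x 0] *: r + 'X * (a *: s + b *: r) + 'X ^+ 2 * r * s) => t.
have gE : (gradient (p * q) x *m y^T) 0 0 = q.@[x 0] * a + p.@[x 0] * b.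
  by rewrite gradientM mulmxDl -!scalemxAl mxE [X in X + _]mxE [X in _ + X]mxE.
rewrite !mevalM gE rE sE -/a -/b !hornerE.
by ring.
Qed.
End Gradient.

Lemma gradient_comp (K : fieldType) (n m : nat) (p : {mpoly K[m]}) (lq : m.-tuple {mpoly K[n]}) x :
  gradient (p \mPo lq) x =
  gradient p (\row_i (tnth lq i).@[x 0]) *m (\matrix_(i, j) (tnth lq i)^`M(j).@[x 0]).
Proof.
set y := \row_i _; set J := \matrix_(i, j) _.
have yE i : y 0 i = (tnth lq i).@[x 0] by rewrite mxE.
elim/mpoly_ind: p => [c|i|p q IHp IHq|p q IHp IHq].
- rewrite comp_mpolyC.
  have g0 k c' (z : 'rV_k) : gradient c'%:MP z = 0 :> 'rV[K]_k.
    by apply/rowP=> i; rewrite !mxE mderivC meval0.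
  by rewrite !g0 mul0mx.
- by rewrite comp_mpolyXU gradientXi -rowE; apply/rowP=> j; rewrite !mxE -tnth_nth.
- by rewrite comp_mpolyD !gradientD mulmxDl IHp IHq.
have cE (r : {mpoly K[m]}) : (r \mPo lq).@[x 0] = r.@[y 0].
  by rewrite comp_mpoly_meval; apply: meval_eq => i; rewrite yE.
by rewrite (rmorphM (comp_mpoly lq)) !gradientM mulmxDl -!scalemxAl IHp IHq !cE.
Qed.

(** * Cubic forms and Pfaffians *)

(* The form is not assumed to be symmetric, so that in every characteristic each cubic is a [cF]; [cD] is the
   differential of [cF], and [cT] its full polarization. *)
Record tri3 (K : fieldType) (n : nat) := Tri3 {
  tform :> 'rV[K]_n -> 'rV[K]_n -> 'rV[K]_n -> K;
  tlin1 : forall a x x' y z, tform (a *: x + x') y z = a * tform x y z + tform x' y z;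
  tlin2 : forall a x y y' z, tform x (a *: y + y') z = a * tform x y z + tform x y' z;
  tlin3 : forall a x y z z', tform x y (a *: z + z') = a * tform x y z + tform x y z' }.

Section Tri3.
Variables (K : fieldType) (n : nat) (g : tri3 K n).
Implicit Types x y z : 'rV[K]_n.

Lemma tD1 x x' y z : g (x + x') y z = g x y z + g x' y z.
Proof. by rewrite -{1}[x]scale1r tlin1 mul1r. Qed.
Lemma tD2 x y y' z : g x (y + y') z = g x y z + g x y' z.
Proof. by rewrite -{1}[y]scale1r tlin2 mul1r. Qed.
Lemma tD3 x y z z' : g x y (z + z') = g x y z + g x y z'.
Proof. by rewrite -{1}[z]scale1r tlin3 mul1r. Qed.
Lemma t01 y z : g 0 y z = 0.
Proof. by have := tlin1 g (-1) 0 0 y z; rewrite scaler0 addr0 mulN1r addNr. Qed.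
Lemma t02 x z : g x 0 z = 0.
Proof. by have := tlin2 g (-1) x 0 0 z; rewrite scaler0 addr0 mulN1r addNr. Qed.
Lemma t03 x y : g x y 0 = 0.
Proof. by have := tlin3 g (-1) x y 0 0; rewrite scaler0 addr0 mulN1r addNr. Qed.
Lemma tZ1 a x y z : g (a *: x) y z = a * g x y z.
Proof. by rewrite -[a *: x]addr0 tlin1 t01 addr0. Qed.
Lemma tZ2 a x y z : g x (a *: y) z = a * g x y z.
Proof. by rewrite -[a *: y]addr0 tlin2 t02 addr0. Qed.
Lemma tZ3 a x y z : g x y (a *: z) = a * g x y z.
Proof. by rewrite -[a *: z]addr0 tlin3 t03 addr0. Qed.
Lemma tN1 x y z : g (- x) y z = - g x y z.
Proof. by rewrite -scaleN1r tZ1 mulN1r. Qed.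
Lemma tN2 x y z : g x (- y) z = - g x y z.
Proof. by rewrite -scaleN1r tZ2 mulN1r. Qed.
Lemma tN3 x y z : g x y (- z) = - g x y z.
Proof. by rewrite -scaleN1r tZ3 mulN1r. Qed.
Definition tE := (tD1, tD2, tD3, tZ1, tZ2, tZ3, tN1, tN2, tN3, t01, t02, t03).

Definition cF x := g x x x.
Definition cD x y := g y x x + g x y x + g x x y.
Definition cT x y z := g x y z + g x z y + g y x z + g y z x + g z x y + g z y x.

Lemma cFD x y : cF (x + y) = cF x + cD x y + cD y x + cF y.
Proof. by rewrite /cF /cD !tE; ring. Qed.
Lemma cFZ a x : cF (a *: x) = a ^+ 3 * cF x.
Proof. by rewrite /cF !tE; ring. Qed.
Lemma cDDl x y z : cD (x + y) z = cD x z + cT x y z + cD y z.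
Proof. by rewrite /cD /cT !tE; ring. Qed.
Lemma cDZl a x z : cD (a *: x) z = a ^+ 2 * cD x z.
Proof. by rewrite /cD !tE; ring. Qed.
Lemma cDDr x y z : cD x (y + z) = cD x y + cD x z.
Proof. by rewrite /cD !tE; ring. Qed.
Lemma cDZr a x z : cD x (a *: z) = a * cD x z.
Proof. by rewrite /cD !tE; ring. Qed.
Lemma cD0r x : cD x 0 = 0.
Proof. by rewrite /cD !tE !addr0. Qed.
Lemma cD0l x : cD 0 x = 0.
Proof. by rewrite /cD !tE !addr0. Qed.
Lemma cTxx x y : cT x x y = 2 * cD x y.
Proof. by rewrite /cD /cT; ring. Qed.
Lemma cT12 x y z : cT x y z = cT y x z.
Proof. by rewrite /cT; ring. Qed.
Lemma cT23 x y z : cT x y z = cT x z y.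
Proof. by rewrite /cT; ring. Qed.
Lemma cTD1 x x' y z : cT (x + x') y z = cT x y z + cT x' y z.
Proof. by rewrite /cT !tE; ring. Qed.
Lemma cTD2 x y y' z : cT x (y + y') z = cT x y z + cT x y' z.
Proof. by rewrite /cT !tE; ring. Qed.
Lemma cTD3 x y z z' : cT x y (z + z') = cT x y z + cT x y z'.
Proof. by rewrite /cT !tE; ring. Qed.
Lemma cTZ1 a x y z : cT (a *: x) y z = a * cT x y z.
Proof. by rewrite /cT !tE; ring. Qed.
Lemma cTZ2 a x y z : cT x (a *: y) z = a * cT x y z.
Proof. by rewrite /cT !tE; ring. Qed.
Lemma cTZ3 a x y z : cT x y (a *: z) = a * cT x y z.
Proof. by rewrite /cT !tE; ring. Qed.
Lemma cT01 y z : cT 0 y z = 0.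
Proof. by rewrite -(scale0r 0) cTZ1 mul0r. Qed.
Lemma cT02 x z : cT x 0 z = 0.
Proof. by rewrite -(scale0r 0) cTZ2 mul0r. Qed.
Lemma cT03 x y : cT x y 0 = 0.
Proof. by rewrite -(scale0r 0) cTZ3 mul0r. Qed.

Lemma cF_line x y t : cF (x + t *: y) = cF x + t * cD x y + t ^+ 2 * cD y x + t ^+ 3 * cF y.
Proof. by rewrite cFD cFZ cDZr cDZl. Qed.

Definition cgrad x : 'rV[K]_n := \row_i cD x (delta_mx 0 i).
Lemma cD_sum x I (r : seq I) P (f : I -> 'rV_n) :
  cD x (\sum_(i <- r | P i) f i) = \sum_(i <- r | P i) cD x (f i).
Proof. by elim/big_rec2: _ => [|i a b _ <-]; rewrite ?cD0r ?cDDr. Qed.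
Lemma cT_sum3 x y I (r : seq I) P (f : I -> 'rV_n) :
  cT x y (\sum_(i <- r | P i) f i) = \sum_(i <- r | P i) cT x y (f i).
Proof. by elim/big_rec2: _ => [|i a b _ <-]; rewrite ?cT03 ?cTD3. Qed.

Lemma cgradE x y : (cgrad x *m y^T) 0 0 = cD x y.
Proof.
rewrite mxE [in RHS](row_sum_delta y) cD_sum; apply: eq_bigr => i _.
by rewrite !mxE cDZr mulrC.
Qed.

Definition hessian x : 'M[K]_n := \matrix_(i, j) cT x (delta_mx 0 i) (delta_mx 0 j).

Lemma hessianE x y z : (y *m hessian x *m z^T) 0 0 = cT x y z.
Proof.
rewrite mxE [in RHS](row_sum_delta z) cT_sum3; apply: eq_bigr => j _.
rewrite cTZ3 [z^T _ _]mxE mulrC; congr (_ * _).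
rewrite mxE [in RHS](row_sum_delta y) cT23 cT_sum3; apply: eq_bigr => i _.
by rewrite mxE cTZ3 cT23.
Qed.

Lemma hessian_kerP x y : y *m hessian x = 0 <-> forall z, cT x y z = 0.
Proof.
split=> [k z|k]; first by rewrite -hessianE k mul0mx mxE.
apply/rowP=> j; rewrite [RHS]mxE -(k (delta_mx 0 j)) -hessianE.
by rewrite trmx_delta -colE [RHS]mxE.
Qed.

End Tri3.

Definition coef3 (K : fieldType) (n : nat) (c : 'I_n -> 'I_n -> 'I_n -> K) (x y z : 'rV[K]_n) :=
  \sum_i \sum_j \sum_l c i j l * x 0 i * y 0 j * z 0 l.

Lemma coef3_lin (K : fieldType) (n : nat) (c : 'I_n -> 'I_n -> 'I_n -> K) :
  [/\ forall a x x' y z, coef3 c (a *: x + x') y z = a * coef3 c x y z + coef3 c x' y z,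
      forall a x y y' z, coef3 c x (a *: y + y') z = a * coef3 c x y z + coef3 c x y' z &
      forall a x y z z', coef3 c x y (a *: z + z') = a * coef3 c x y z + coef3 c x y z'].
Proof.
split=> *; rewrite /coef3 big_distrr -big_split; apply: eq_bigr => i _ /=;
  rewrite big_distrr -big_split; apply: eq_bigr => j _ /=;
  rewrite big_distrr -big_split; apply: eq_bigr => l _ /=; rewrite !mxE; ring.
Qed.
Definition tri3_coef (K : fieldType) (n : nat) (c : 'I_n -> 'I_n -> 'I_n -> K) : tri3 K n :=
  let: And3 a b d := coef3_lin c in Tri3 a b d.
Lemma tri3_coefE (K : fieldType) n c x y z : @tri3_coef K n c x y z = coef3 c x y z.
Proof. by rewrite /tri3_coef; case: coef3_lin. Qed.

Lemma mdegS n (m : 'X_{1..n}) d : mdeg m = d.+1 -> exists i m', m = (U_(i) + m')%MM /\ mdeg m' = d.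
Proof.
move=> mE; have [i mi|m0] := pickP (fun i => m i != 0%N).
  have im : (U_(i) <= m)%MM.
    by apply/mnm_lepP=> j; rewrite mnm1E; case: eqP => [<-|//]; rewrite lt0n.
  exists i, (m - U_(i))%MM; rewrite addmC submK //; split=> //.
  by move: mE; rewrite -{1}(submK im) mdegD mdeg1 addn1 => -[].
move: mE; rewrite mdegE big1 // => i _.
by apply/eqP; have := m0 i; case: eqP.
Qed.

(** Each cubic monomial is written as an ordered product of three variables, without symmetrizing,
    so that 2 and 3 need not be inverted. *)
Lemma homog_tri3 (K : fieldType) n (p : {mpoly K[n]}) : p \is 3.-homog ->
  exists C : tri3 K n, forall x : 'rV_n, p.@[x 0] = cF C x.
Proof.
move=> /dhomogP hp.
suff [c cP] : exists c : 'I_n -> 'I_n -> 'I_n -> K, forall x : 'rV_n, p.@[x 0] = coef3 c x x x.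
  by exists (tri3_coef c) => x; rewrite /cF tri3_coefE.
have : forall m, m \in msupp p -> exists c : 'I_n -> 'I_n -> 'I_n -> K,
    forall x : 'rV_n, p@_m * \prod_i x 0 i ^+ m i = coef3 c x x x.
  move=> m /hp /mdegS[i [m1 [-> /mdegS[j [m2 [-> /mdegS[l [m3 [-> /eqP]]]]]]]]].
  rewrite mdeg_eq0 => /eqP ->; rewrite addm0; set a := p@_ _.
  exists (fun i' j' l' => a * [&& i' == i, j' == j & l' == l]%:R) => x.
  rewrite /coef3 [RHS](bigD1 i) //= [X in _ + X]big1 ?addr0 => [|i' /negPf ->]; last first.
    by rewrite big1 // => j' _; rewrite big1 // => l' _; rewrite mulr0 !mul0r.
  rewrite [RHS](bigD1 j) //= [X in _ + X]big1 ?addr0 => [|j' /negPf ->]; last first.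
    by rewrite big1 // => l' _; rewrite andbF mulr0 !mul0r.
  rewrite [RHS](bigD1 l) //= [X in _ + X]big1 ?addr0 => [|l' /negPf ->]; last first.
    by rewrite !andbF mulr0 !mul0r.
  rewrite !eqxx mulr1 -!mulrA; congr (_ * _).
  have pU (i' : 'I_n) : \prod_i0 x 0 i0 ^+ (U_(i')%MM i0) = x 0 i'.
    rewrite (bigD1 i') //= mnm1E eqxx expr1 big1 ?mulr1 // => k ki.
    by rewrite mnm1E eq_sym (negPf ki) expr0.
  rewrite -(pU i) -(pU j) -(pU l) -!big_split; apply: eq_bigr => k _ /=.
  by rewrite !mnmDE !exprD.
move: (msupp p) (fun x : 'rV_n => mevalE (x 0) p) => s mE.
suff H : forall s' : seq 'X_{1..n}, (forall m, m \in s' -> exists c : 'I_n -> 'I_n -> 'I_n -> K,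
    forall x : 'rV_n, p@_m * \prod_i x 0 i ^+ m i = coef3 c x x x) ->
    exists c : 'I_n -> 'I_n -> 'I_n -> K, forall x : 'rV_n,
    \sum_(m <- s') p@_m * \prod_i x 0 i ^+ m i = coef3 c x x x.
  by move=> /H[c cP]; exists c => x; rewrite mE cP.
elim=> [|m s' IH] H.
  exists (fun _ _ _ => 0) => x; rewrite big_nil /coef3.
  by rewrite big1 // => i _; rewrite big1 // => j _; rewrite big1 // => l _; rewrite !mul0r.
have [c1 c1P] := H m (mem_head _ _).
have [|c2 c2P] := IH; first by move=> k ks; apply: H; rewrite inE ks orbT.
exists (fun i j l => c1 i j l + c2 i j l) => x; rewrite big_cons c1P c2P /coef3 -big_split.
apply: eq_bigr => i _ /=; rewrite -big_split; apply: eq_bigr => j _ /=.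
by rewrite -big_split; apply: eq_bigr => l _ /=; ring.
Qed.

Lemma poly_lin_eq (K : closedFieldType) (a b : K) (p q : {poly K}) :
  (forall t, t * a + t ^+ 2 * p.[t] = t * b + t ^+ 2 * q.[t]) -> a = b.
Proof.
move=> E; have : 'X * (a%:P - b%:P + 'X * (p - q)) = 0 :> {poly K}.
  apply: inf_dom0 => [|t]; first exact: inf_dom_closed.
  have := E t; rewrite !hornerE => /eqP; rewrite -subr_eq0 => /eqP <-; ring.
move=> /eqP; rewrite mulf_eq0 polyX_eq0 /= => /eqP /(congr1 (horner^~ 0)).
by rewrite !hornerE => /eqP; rewrite subr_eq0 => /eqP.
Qed.

Lemma gradient_cgrad (K : closedFieldType) n (p : {mpoly K[n]}) (C : tri3 K n) :
  (forall x : 'rV_n, p.@[x 0] = cF C x) -> forall x, gradient p x = cgrad C x.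
Proof.
move=> pC x; apply/rowP=> i; have [r rE] := meval_line p x (delta_mx 0 i).
have -> : gradient p x 0 i = (gradient p x *m (delta_mx 0 i : 'rV_n)^T) 0 0.
  by rewrite trmx_delta -colE !mxE.
rewrite [RHS]mxE; set y : 'rV_n := delta_mx 0 i in rE *.
apply: (poly_lin_eq (p := r) (q := (cD C y x)%:P + (cF C y) *: 'X)) => t.
apply: (addrI (cF C x)); rewrite !addrA -{1}pC -rE pC cF_line !hornerE.
by ring.
Qed.

(** * Pfaffians of sizes 4 and 8 *)

Section Pfaffian.
Variable R : comNzRingType.

Definition ent n (A : 'M[R]_n.+1) (i j : nat) := A (inord i) (inord j).
Lemma entE n (A : 'M[R]_n.+1) i j : A i j = ent A i j.
Proof. by rewrite /ent !inord_val. Qed.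

Lemma ord4P (P : 'I_4 -> Prop) : P (inord 0) -> P (inord 1) -> P (inord 2) -> P (inord 3) -> forall i, P i.
Proof.
move=> p0 p1 p2 p3 i; rewrite -(inord_val i); case: i => [[|[|[|[|//]]]] lt]; [exact: p0|exact: p1|exact: p2|exact: p3].
Qed.

Definition pf4 (A : 'M[R]_4) := ent A 0 1 * ent A 2 3 - ent A 0 2 * ent A 1 3 + ent A 0 3 * ent A 1 2.
(** The polar form of the quadratic form [pf4]. *)
Definition polar4 (A B : 'M[R]_4) :=
  ent A 0 1 * ent B 2 3 - ent A 0 2 * ent B 1 3 + ent A 0 3 * ent B 1 2
  + ent B 0 1 * ent A 2 3 - ent B 0 2 * ent A 1 3 + ent B 0 3 * ent A 1 2.
(** The Hodge dual of a bivector, which is its Pfaffian adjugate: A times [dual4 A] is [- pf4 A]. *)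
Definition dual4 (A : 'M[R]_4) : 'M[R]_4 :=
  \matrix_(i, j) nth 0 (nth [::] [:: [:: 0; ent A 2 3; - ent A 1 3; ent A 1 2];
   [:: - ent A 2 3; 0; ent A 0 3; - ent A 0 2]; [:: ent A 1 3; - ent A 0 3; 0; ent A 0 1];
   [:: - ent A 1 2; ent A 0 2; - ent A 0 1; 0]] i) j.

Definition alt_ent n (A : 'M[R]_n.+1) := (forall i, A i i = 0) /\ A^T = - A.

Lemma alt4E (A : 'M[R]_4) : alt_ent A ->
  (forall i, (i < 4)%N -> ent A i i = 0) /\ (forall i j, ent A i j = - ent A j i).
Proof.
move=> [dA tA]; split=> [i _|i j]; first exact: dA.
by have := congr1 (fun M : 'M_4 => M (inord j) (inord i)) tA; rewrite !mxE.
Qed.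

Lemma det4 (A : 'M[R]_4) : \det A =
  ent A 0 0 * d3 (ent A 1 1) (ent A 1 2) (ent A 1 3) (ent A 2 1) (ent A 2 2) (ent A 2 3) (ent A 3 1) (ent A 3 2) (ent A 3 3)
  - ent A 0 1 * d3 (ent A 1 0) (ent A 1 2) (ent A 1 3) (ent A 2 0) (ent A 2 2) (ent A 2 3) (ent A 3 0) (ent A 3 2) (ent A 3 3)
  + ent A 0 2 * d3 (ent A 1 0) (ent A 1 1) (ent A 1 3) (ent A 2 0) (ent A 2 1) (ent A 2 3) (ent A 3 0) (ent A 3 1) (ent A 3 3)
  - ent A 0 3 * d3 (ent A 1 0) (ent A 1 1) (ent A 1 2) (ent A 2 0) (ent A 2 1) (ent A 2 2) (ent A 3 0) (ent A 3 1) (ent A 3 2).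
Proof.
rewrite (expand_det_row _ (ord0 : 'I_4)) !big_ord_recl big_ord0 /cofactor !det3 !mxE !entE.
rewrite /= /bump /= ?addr0 ?addn0 ?addn1 ?add0n ?add1n.
by ring.
Qed.

Lemma det_pf4 (A : 'M[R]_4) : alt_ent A -> \det A = pf4 A ^+ 2.
Proof.
move=> /alt4E[dA tA]; rewrite det4 /pf4 !dA // (tA 1 0)%N (tA 2 0)%N (tA 3 0)%N (tA 2 1)%N (tA 3 1)%N (tA 3 2)%N /d3.
by ring.
Qed.

Lemma sum4 (F : 'I_4 -> R) : \sum_i F i = F (inord 0) + F (inord 1) + F (inord 2) + F (inord 3).
Proof.
rewrite !big_ord_recl big_ord0 addr0 !addrA; congr (F _ + F _ + F _ + F _); apply: val_inj; by rewrite /= inordK.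
Qed.

Lemma ent_dual4 (A : 'M[R]_4) i j : (i < 4)%N -> (j < 4)%N -> ent (dual4 A) i j =
   nth 0 (nth [::] [:: [:: 0; ent A 2 3; - ent A 1 3; ent A 1 2];
   [:: - ent A 2 3; 0; ent A 0 3; - ent A 0 2]; [:: ent A 1 3; - ent A 0 3; 0; ent A 0 1];
   [:: - ent A 1 2; ent A 0 2; - ent A 0 1; 0]] i) j.
Proof. by move=> i4 j4; rewrite /ent mxE !inordK. Qed.

Lemma ent_mul (A B : 'M[R]_4) i j : ent (A *m B) i j =
  ent A i 0 * ent B 0 j + ent A i 1 * ent B 1 j + ent A i 2 * ent B 2 j + ent A i 3 * ent B 3 j.
Proof. by rewrite {1}/ent mxE sum4. Qed.

Lemma mul_dual4 (A : 'M[R]_4) : alt_ent A -> A *m dual4 A = (- pf4 A)%:M.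
Proof.
move=> /alt4E[dA tA]; apply/matrixP=> i j.
move: i j; apply: ord4P; apply: ord4P; rewrite -/(ent _ _ _) ent_mul !ent_dual4 //= mxE -val_eqE /= !inordK //= /pf4 ?mulr1n ?mulr0n ?dA //
 ?(tA 1 0)%N ?(tA 2 0)%N ?(tA 3 0)%N ?(tA 2 1)%N ?(tA 3 1)%N ?(tA 3 2)%N; by ring.
Qed.

Lemma ent_tr n (A : 'M[R]_n.+1) i j : ent A^T i j = ent A j i.
Proof. by rewrite /ent mxE. Qed.

Lemma pf4_cong (Q X : 'M[R]_4) : alt_ent X -> pf4 (Q^T *m X *m Q) = \det Q * pf4 X.
Proof.
move=> /alt4E[dX tX]; rewrite det4 /pf4 !ent_mul !ent_tr !dX // (tX 1 0)%N (tX 2 0)%N (tX 3 0)%N (tX 2 1)%N (tX 3 1)%N (tX 3 2)%N /d3.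
by ring.
Qed.

Lemma dual4_alt (A : 'M[R]_4) : alt_ent (dual4 A).
Proof.
split; first by apply: ord4P; rewrite -/(ent _ _ _) ent_dual4.
by apply/matrixP; apply: ord4P; apply: ord4P; rewrite [LHS]mxE [RHS]mxE -!/(ent _ _ _) !ent_dual4 //= ?opprK ?oppr0.
Qed.

Lemma pf4_dual (A : 'M[R]_4) : pf4 (dual4 A) = pf4 A.
Proof. by rewrite /pf4 !ent_dual4 //=; ring. Qed.

(* Pfaffian expansion in 4 x 4 blocks. *)
Definition pf8 (A : 'M[R]_(4 + 4)) :=
  let Q := ursubmx A in let P := ulsubmx A in let S := drsubmx A in
  pf4 P * pf4 S - polar4 S (Q^T *m dual4 P *m Q) + \det Q.

End Pfaffian.

Section PfMap.
Variables (R S : comNzRingType) (f : {rmorphism R -> S}).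
Lemma ent_map n (A : 'M[R]_n.+1) i j : ent (map_mx f A) i j = f (ent A i j).
Proof. by rewrite /ent mxE. Qed.
Lemma pf4_map A : pf4 (map_mx f A) = f (pf4 A).
Proof. by rewrite /pf4 !ent_map !(rmorphD, rmorphN, rmorphM). Qed.
Lemma polar4_map A B : polar4 (map_mx f A) (map_mx f B) = f (polar4 A B).
Proof. by rewrite /polar4 !ent_map !(rmorphD, rmorphN, rmorphM). Qed.
Lemma dual4_map A : dual4 (map_mx f A) = map_mx f (dual4 A).
Proof.
apply/matrixP; apply: ord4P; apply: ord4P;
  by rewrite [RHS]mxE -!/(ent _ _ _) !ent_dual4 //= ?ent_map ?rmorphN ?rmorph0.
Qed.
Lemma pf8_map A : pf8 (map_mx f A) = f (pf8 A).
Proof.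
rewrite /pf8 -map_ulsubmx -map_ursubmx -map_drsubmx dual4_map map_trmx -!map_mxM.
by rewrite !pf4_map polar4_map det_map_mx !(rmorphD, rmorphN, rmorphM).
Qed.
End PfMap.

Lemma alt_entP (F : fieldType) n (A : 'M[F]_n.+1) : alt_ent A <-> altm A.
Proof.
split=> [[dA tA]|aA]; first exact: altmP.
by split; [move=> i; apply: altm_diag | apply: altm_tr].
Qed.

Lemma altmD (F : fieldType) n (A B : 'M[F]_n) : altm A -> altm B -> altm (A + B).
Proof. by move=> aA aB u; rewrite mulmxDr mulmxDl aA aB addr0. Qed.
Lemma altmZ (F : fieldType) n a (A : 'M[F]_n) : altm A -> altm (a *: A).
Proof. by move=> aA u; rewrite -scalemxAr -scalemxAl aA scaler0. Qed.

Lemma altm_sub (F : fieldType) d e (A : 'M[F]_(d + e)) : altm A -> altm (ulsubmx A) /\ altm (drsubmx A).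
Proof.
move=> aA; split=> u.
  have := aA (row_mx u 0); rewrite -{1}[A]submxK mul_row_block !mul0mx !addr0.
  by rewrite tr_row_mx mul_row_col trmx0 mulmx0 addr0.
have := aA (row_mx 0 u); rewrite -{1}[A]submxK mul_row_block !mul0mx !add0r.
by rewrite tr_row_mx mul_row_col trmx0 mulmx0 add0r.
Qed.

Lemma ent_D (R : comNzRingType) n (A B : 'M[R]_n.+1) i j : ent (A + B) i j = ent A i j + ent B i j.
Proof. by rewrite /ent mxE. Qed.
Lemma ent_Z (R : comNzRingType) n a (A : 'M[R]_n.+1) i j : ent (a *: A) i j = a * ent A i j.
Proof. by rewrite /ent mxE. Qed.

Lemma pf4_DZ (R : comNzRingType) (A B : 'M[R]_4) c :
  pf4 (A + c *: B) = pf4 A + c * polar4 A B + c ^+ 2 * pf4 B.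
Proof. by rewrite /pf4 /polar4 !ent_D !ent_Z; ring. Qed.

Lemma pf8Z (R : comNzRingType) t (A : 'M[R]_(4 + 4)) : pf8 (t *: A) = t ^+ 4 * pf8 A.
Proof.
rewrite /pf8.
have -> : ulsubmx (t *: A) = t *: ulsubmx A by apply/matrixP=> i j; rewrite !mxE.
have -> : ursubmx (t *: A) = t *: ursubmx A by apply/matrixP=> i j; rewrite !mxE.
have -> : drsubmx (t *: A) = t *: drsubmx A by apply/matrixP=> i j; rewrite !mxE.
have pfZ (B : 'M_4) : pf4 (t *: B) = t ^+ 2 * pf4 B by rewrite /pf4 !ent_Z; ring.
have polZ (B B' : 'M_4) c : polar4 (t *: B) (c *: B') = t * c * polar4 B B'.
  by rewrite /polar4 !ent_Z; ring.
have dZ (B : 'M_4) : dual4 (t *: B) = t *: dual4 B.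
  apply/matrixP; apply: ord4P; apply: ord4P; rewrite [RHS]mxE -!/(ent _ _ _) !ent_dual4 //= ?ent_Z;
    by rewrite ?mulrN ?mulr0.
rewrite !pfZ detZ dZ [(t *: _)^T]linearZ /= -!scalemxAl -!scalemxAr -!scalemxAl !scalerA polZ.
by ring.
Qed.

Lemma det_pf8_reg (F : fieldType) (A : 'M[F]_(4 + 4)) :
  altm A -> pf4 (ulsubmx A) != 0 -> \det A = pf8 A ^+ 2.
Proof.
move=> aA; have [aP aS] := altm_sub aA.
set P := ulsubmx A in aP *; set S := drsubmx A in aS *; pose Q := ursubmx A => p0.
have dl : dlsubmx A = - Q^T.
  by rewrite /Q trmx_ursub (altm_tr aA); apply/matrixP=> i j; rewrite !mxE opprK.
pose Pi := (- (pf4 P)^-1) *: dual4 P.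
have PiP : Pi *m P = 1%:M.
  apply: mulmx1C; rewrite /Pi -scalemxAr mul_dual4; last exact/alt_entP.
  by rewrite scale_scalar_mx mulrNN mulVf.
pose L := block_mx 1%:M 0 (Q^T *m Pi) 1%:M : 'M_(4 + 4).
have dL : \det L = 1 by rewrite det_lblock !det1 mulr1.
have LA : L *m A = block_mx P Q 0 (S + Q^T *m Pi *m Q).
  rewrite -[A]submxK -/P -/S -/Q dl mulmx_block !mul1mx !mul0mx !addr0.
  by rewrite -mulmxA PiP mulmx1 addrN [_ + S]addrC.
rewrite -[\det A]mul1r -dL -det_mulmx LA det_ublock.
have SE : S + Q^T *m Pi *m Q = S + (- (pf4 P)^-1) *: (Q^T *m dual4 P *m Q).
  by rewrite /Pi -scalemxAr -scalemxAl.
have aS' : altm (S + Q^T *m Pi *m Q).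
  rewrite SE; apply: altmD => //; apply: altmZ; rewrite -{2}[Q]trmxK; apply: altm_cong.
  by apply/alt_entP/dual4_alt.
rewrite !det_pf4; try exact/alt_entP.
rewrite SE pf4_DZ pf4_cong ?pf4_dual; last exact: dual4_alt.
rewrite /pf8 -/P -/Q -/S; move: (pf4 P) (pf4 S) (polar4 _ _) (\det Q) p0 => a b c d a0.
by field.
Qed.

(* The Schur complement settles the case [pf4 P != 0]; the general case follows by adding a multiple of the standard
   symplectic form to [P]. *)
Lemma det_pf8 (K : closedFieldType) (A : 'M[K]_(4 + 4)) : altm A -> \det A = pf8 A ^+ 2.
Proof.
move=> aA.
pose J4 : 'M[K]_4 := \matrix_(i, j) nth 0 (nth [::] [:: [:: 0; 1; 0; 0]; [:: -1; 0; 0; 0];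
   [:: 0; 0; 0; 1]; [:: 0; 0; -1; 0]] i) j.
have entJ i j : (i < 4)%N -> (j < 4)%N -> ent J4 i j = nth 0 (nth [::] [:: [:: 0; 1; 0; 0]; [:: -1; 0; 0; 0];
   [:: 0; 0; 0; 1]; [:: 0; 0; -1; 0]] i) j by move=> i4 j4; rewrite /ent mxE !inordK.
have aJ4 : altm J4.
  apply/alt_entP; split; first by apply: ord4P; rewrite -/(ent _ _ _) entJ.
  by apply/matrixP; apply: ord4P; apply: ord4P; rewrite [LHS]mxE [RHS]mxE -!/(ent _ _ _) !entJ //= ?opprK ?oppr0.
have pJ4 : pf4 J4 = 1 by rewrite /pf4 !entJ //=; ring.
pose J := block_mx J4 0 0 0 : 'M_(4 + 4).
have aJ : altm J.
  move=> u; rewrite -[u]hsubmxK mul_row_block !mulmx0 !addr0 tr_row_mx mul_row_col mul0mx addr0.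
  exact: aJ4.
pose A' := map_mx polyC A + 'X *: map_mx polyC J.
have evA t : map_mx (horner_eval t) A' = A + t *: J.
  by apply/matrixP=> i j; rewrite !mxE /= horner_evalE !hornerE.
pose r := \det A' - pf8 A' ^+ 2; pose q := pf4 (ulsubmx A').
have rE t : r.[t] = \det (A + t *: J) - pf8 (A + t *: J) ^+ 2.
  by rewrite -evA pf8_map det_map_mx -rmorphXn -rmorphB.
have uJ t : ulsubmx (A + t *: J) = ulsubmx A + t *: J4.
  have -> : ulsubmx (A + t *: J) = ulsubmx A + t *: ulsubmx J.
    by apply/matrixP=> i j; rewrite !mxE.
  by rewrite block_mxKul.
have qE t : q.[t] = pf4 (ulsubmx (A + t *: J)).
  by rewrite -evA -map_ulsubmx pf4_map.
(* The coefficient of t ^ 2 is [pf4 J4 = 1], so the regular case applies for almost all t. *)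
have q0 : q != 0.
  apply/eqP => q0; pose b := polar4 (ulsubmx A) J4.
  have : 'X^2 + b *: 'X + (pf4 (ulsubmx A))%:P = 0 :> {poly K}.
    apply: inf_dom0 => [|t]; first exact: inf_dom_closed.
    have := qE t; rewrite q0 horner0 uJ pf4_DZ pJ4 => E.
    rewrite 2!hornerD hornerXn hornerZ hornerX hornerC [RHS]E mulr1 [RHS]addrC -[LHS]addrA; congr (_ + _).
    by rewrite addrC mulrC.
  move=> /(congr1 (fun z : {poly K} => z`_2)) /eqP.
  by rewrite !coefD coefXn coefZ coefX coefC coef0 /= mulr0 !addr0 oner_eq0.
have r0 : r = 0.
  apply: (poly_mul_zero q0) => t; rewrite rE qE.
  have [->|p0] := eqVneq (pf4 (ulsubmx (A + t *: J))) 0; first by rewrite mul0r.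
  by rewrite det_pf8_reg ?subrr ?mulr0 //; apply: altmD => //; apply: altmZ.
have := rE 0; rewrite r0 horner0 scale0r addr0 => /esym/eqP.
by rewrite subr_eq0 => /eqP.
Qed.

(** * The cubic equation of Y *)

(** The form descends to the quotient by [x]. Modulo [x] the rows of [C] are those of [C']
    multiplied by [rsubmx U], whose determinant enters squared on both sides. *)
Lemma det_radical_reg (F : fieldType) (A : 'M[F]_9) (x : 'rV_9) (C C' : 'M_(8, 9)) :
  altm A -> x *m A = 0 -> \det (col_mx x C' : 'M_9) != 0 ->
  \det (C *m A *m C^T) * \det (col_mx x C' : 'M_9) ^+ 2
  = \det (C' *m A *m C'^T) * \det (col_mx x C : 'M_9) ^+ 2.
Proof.
move=> aA xA dC'.
have uC' : (col_mx x C' : 'M_9) \in unitmx by rewrite unitmxE unitfE.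
pose U := (C *m invmx (col_mx x C' : 'M_9) : 'M_(8, 1 + 8)).
have CE : C = lsubmx U *m x + rsubmx U *m C'.
  by rewrite -mul_row_col hsubmxK -mulmxA mulVmx // mulmx1.
have Ax : A *m x^T = 0 by rewrite -[A]trmxK -trmx_mul (altm_tr aA) mulmxN xA oppr0 trmx0.
have -> : C *m A *m C^T = rsubmx U *m (C' *m A *m C'^T) *m (rsubmx U)^T.
  rewrite CE [(_ + _)^T]linearD /= !trmx_mul mulmxDl -!(mulmxA _ _ A) xA mulmx0 add0r.
  rewrite mulmxDr -!mulmxA [A *m (x^T *m _)]mulmxA Ax mul0mx !mulmx0 add0r.
  by rewrite !mulmxA.
have -> : (col_mx x C : 'M_9) = (block_mx 1%:M 0 (lsubmx U) (rsubmx U) : 'M_9) *m (col_mx x C' : 'M_9).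
  by rewrite (@mul_block_col _ 1 8 1 8 9) mul1mx mul0mx addr0 -CE.
rewrite !det_mulmx det_tr (@det_lblock _ 1 8) det1 mul1r.
by ring.
Qed.

Lemma det_radical (F : fieldType) (A : 'M[F]_9) (x : 'rV_9) (C C' : 'M_(8, 9)) :
  altm A -> x *m A = 0 ->
  \det (C *m A *m C^T) * \det (col_mx x C' : 'M_9) ^+ 2
  = \det (C' *m A *m C'^T) * \det (col_mx x C : 'M_9) ^+ 2.
Proof.
move=> aA xA; have [d0|] := eqVneq (\det (col_mx x C' : 'M_9)) 0; last exact: det_radical_reg.
have [d1|d1] := eqVneq (\det (col_mx x C : 'M_9)) 0; first by rewrite d0 d1 !expr0n !mulr0.
by apply/esym/det_radical_reg.
Qed.

Section PfaffianHypersurface.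
Variables (k : fieldType) (K : closedFieldType) (iota : {rmorphism k -> K}) (w0 : ext3 k 9).
Let w := ext3_base_change iota w0.
Let g := tri w.
Let R := {mpoly k[9]}.

Lemma tri_base_change i j l : g (delta_mx 0 i) (delta_mx 0 j) (delta_mx 0 l)
  = iota (tri w0 (delta_mx 0 i) (delta_mx 0 j) (delta_mx 0 l)).
Proof.
rewrite /g !triE !tri_expand rmorph_sum; apply: eq_bigr => t _.
by rewrite ffunE rmorphM /d3 !mxE !(rmorphD, rmorphN, rmorphM, rmorph_nat).
Qed.

(** The contraction with a generic point. Its entries are linear forms over [k], so that the cubic
    is obtained over [k] and not only over [K]. *)
Definition omX : 'M[R]_9 :=
  \matrix_(i, j) \sum_l tri w0 (delta_mx 0 l) (delta_mx 0 i) (delta_mx 0 j) *: 'X_l.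
Definition ev (x : 'rV[K]_9) : {rmorphism R -> K} := (meval (x 0) \o map_mpoly iota)%FUN.

Lemma map_mpolyXm m : map_mpoly iota 'X_[m] = 'X_[m] :> {mpoly K[9]}.
Proof. by apply/mpolyP=> m'; rewrite mcoeff_map_mpoly /= !mcoeffX rmorph_nat. Qed.
Lemma map_mpolyZc c (p : R) : map_mpoly iota (c *: p) = iota c *: map_mpoly iota p.
Proof. by apply/mpolyP=> m'; rewrite mcoeffZ !mcoeff_map_mpoly /= mcoeffZ rmorphM. Qed.

Lemma ev_omX x : map_mx (ev x) omX = om g x.
Proof.
apply/matrixP=> i j; rewrite !mxE rmorph_sum [in RHS](row_sum_delta x) a_sum1; apply: eq_bigr => l _.
by rewrite aZ1 /= map_mpolyZc mevalZ map_mpolyXm mevalXU tri_base_change mulrC.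
Qed.

(** [C0] completes [x] to a basis where the coordinate 0 of [x] is non-zero; [C1] does so where the
    coordinate 1 is non-zero. *)
Definition C0 (S : nzRingType) : 'M[S]_(8, 9) := row_mx (0 : 'M_(8, 1)) 1%:M.
Definition C1 (S : nzRingType) : 'M[S]_(8, 9) := C0 S *m perm_mx (perm.tperm ord0 (lift ord0 ord0)).

Lemma map_C0 (S T : nzRingType) (f : {rmorphism S -> T}) : map_mx f (C0 S) = C0 T.
Proof. by rewrite /C0 (@map_row_mx _ _ f 8 1 8) map_mx0 map_mx1. Qed.
Lemma map_C1 (S T : nzRingType) (f : {rmorphism S -> T}) : map_mx f (C1 S) = C1 T.
Proof. by rewrite /C1 map_mxM map_C0 map_perm_mx. Qed.

Lemma det_C0 (x : 'rV[K]_9) : \det (col_mx x (C0 K) : 'M_9) = x 0 0.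
Proof.
have -> : (col_mx x (C0 K) : 'M_9) = @block_mx K 1 8 1 8 (lsubmx (x : 'rV_(1 + 8))) (rsubmx (x : 'rV_(1 + 8))) 0 1%:M.
  by rewrite block_mxEv hsubmxK.
rewrite (@det_ublock _ 1 8) det1 mulr1 det_mx11 mxE; congr (x _ _).
exact: val_inj.
Qed.

Lemma det_C1 (x : 'rV[K]_9) : \det (col_mx x (C1 K) : 'M_9) ^+ 2 = x 0 1 ^+ 2.
Proof.
rewrite /C1; set T := perm_mx (perm.tperm _ _).
have TT : T *m T = 1%:M :> 'M[K]_9 by rewrite -perm_mxM perm.tperm2 perm_mx1.
have -> : (col_mx x (C0 K *m T) : 'M_9) = (col_mx (x *m T) (C0 K) : 'M_9) *m T.
  by rewrite (@mul_col_mx _ 1 8) -mulmxA TT mulmx1.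
rewrite det_mulmx exprMn det_C0 [\det T ^+ 2]expr2 -det_mulmx TT det1 mulr1.
congr (_ ^+ 2); rewrite /T -perm.tpermV -col_permE mxE; congr (x _ _); apply: val_inj.
by rewrite perm.tpermL.
Qed.

Definition pfC (C : 'M[R]_(8, 9)) : R := pf8 (C *m omX *m C^T : 'M_(4 + 4)).

Lemma ev_pfC (x : 'rV[K]_9) (C : forall S : nzRingType, 'M[S]_(8, 9)) :
  (forall (S T : nzRingType) (f : {rmorphism S -> T}), map_mx f (C S) = C T) ->
  ev x (pfC (C R)) = pf8 (C K *m om g x *m (C K)^T : 'M_(4 + 4)).
Proof.
by move=> mC; rewrite -pf8_map !map_mxM -map_trmx mC ev_omX.
Qed.

Lemma ev_pfC2 (x : 'rV[K]_9) (C : forall S : nzRingType, 'M[S]_(8, 9)) :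
  (forall (S T : nzRingType) (f : {rmorphism S -> T}), map_mx f (C S) = C T) ->
  ev x (pfC (C R)) ^+ 2 = \det (C K *m om g x *m (C K)^T).
Proof.
by move=> mC; rewrite ev_pfC // -det_pf8 //; apply/altm_cong/om_altm.
Qed.

Lemma ev_inj (p q : R) : (forall x, ev x p = ev x q) -> p = q.
Proof.
move=> pq; have : map_mpoly iota p = map_mpoly iota q.
  apply: mpoly_fun_eq => [|v]; first exact: inf_dom_closed.
  have := pq (\row_i v i); rewrite /= (meval_eq (v2 := v)) => [->|i]; last by rewrite mxE.
  by apply: meval_eq => i; rewrite mxE.
by move=> /mpolyP E; apply/mpolyP=> m; have := E m; rewrite !mcoeff_map_mpoly => /fmorph_inj.
Qed.

(* The sub-Pfaffians p_i satisfy (p_0 x_1)^2 = (p_1 x_0)^2, so x_0 divides p_0. *)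
Lemma pfC_div : exists F : R, pfC (C0 R) = F * 'X_0.
Proof.
move: (pfC (C0 R)) (pfC (C1 R)) (fun x => ev_pfC2 x map_C0) (fun x => ev_pfC2 x map_C1) => p0 p1 E0 E1.
have : (p0 * 'X_1) ^+ 2 = (p1 * 'X_0) ^+ 2.
  apply: ev_inj => x; rewrite 2!(rmorphXn (ev x)) 2!(rmorphM (ev x)) !exprMn E0 E1.
  rewrite /= !map_mpolyXm !mevalXU -det_C1 -det_C0.
  by apply: det_radical; [exact: om_altm | exact: killxx].
move/eqP; rewrite eqf_sqr => H.
have [q qE] : exists q, p0 * 'X_1 = q * 'X_0.
  case/orP: H => /eqP ->; first by exists p1.
  by exists (- p1); rewrite mulNr.
apply: (mpoly_div_monomial _ qE) => i; rewrite !mnm1E.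
by case: (1 =P i) => [<-|]; [right|left].
Qed.

(** [F] is the Pfaffian for the complement [C0] divided by X_0, of degree 4 - 1. [det_radical]
    passes from [C0] to any [C] where x_0 != 0, and the domain property of polynomial functions
    removes this restriction. *)
Lemma cubic_exists : exists F : R, F \is 3.-homog /\
  forall (x : 'rV[K]_9) (C : 'M[K]_(8, 9)),
    (map_mpoly iota F).@[x 0] ^+ 2 * \det (col_mx x C : 'M_9) ^+ 2 = \det (C *m om g x *m C^T).
Proof.
have [F FE] := pfC_div; exists F.
have FX (x : 'rV_9) : (map_mpoly iota F).@[x 0] * x 0 0 = pf8 (C0 K *m om g x *m (C0 K)^T : 'M_(4 + 4)).
  by rewrite -(ev_pfC x map_C0) FE (rmorphM (ev x)) /= map_mpolyXm mevalXU.
split.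
  have h4 : map_mpoly iota (F * 'X_0) \is 4.-homog.
    apply: homog_meval => [|t v]; first exact: inf_dom_closed.
    pose x := \row_i v i.
    have e1 : (fun i => t * v i) =1 (t *: x) 0 by move=> i; rewrite !mxE.
    have e2 : v =1 x 0 by move=> i; rewrite mxE.
    rewrite (meval_eq _ e1) (meval_eq _ e2) rmorphM /= map_mpolyXm !mevalM !mevalXU !FX omZ.
    rewrite -scalemxAr -scalemxAl (@pf8Z K t (C0 K *m om g x *m (C0 K)^T)).
    by ring.
  apply/dhomogP=> m mF.
  have : (m + U_(0%R : 'I_9))%MM \in msupp (map_mpoly iota (F * 'X_0)).
    rewrite mcoeff_msupp mcoeff_map_mpoly fmorph_eq0 addmC mcoeffMX.
    by rewrite -mcoeff_msupp.
  by move=> /(dhomog_mf h4) /=; rewrite mdegD mdeg1 addn1 => -[].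
move=> x C.
have polyfC (C' : 'M[K]_(8, 9)) : polyf (fun x : 'rV[K]_9 => \det (C' *m om g x *m C'^T)).
  apply: polyf_det => i j; apply: (polyf_ext (f := fun y => (y *m (\matrix_(l, l') g (delta_mx 0 l) (row i C') (row j C'))) 0 (0 : 'I_9))).
    move=> y; rewrite omP_mx mxE {2}(row_sum_delta y) a_sum1; apply: eq_bigr => l _.
    by rewrite mxE aZ1.
  exact: polyf_mx.
have := @polyf_mul0 K 9 (fun x => x 0 0) (fun x => (map_mpoly iota F).@[x 0] ^+ 2 * \det (col_mx x C : 'M_9) ^+ 2 - \det (C *m om g x *m C^T)).
case.
- exact: polyf_coord.
- apply: polyfB; last exact: polyfC.
  apply: polyfM; apply: polyfX; first exact: polyf_mp.
  apply: polyf_det => i j; case: (@split_ordP 1 8 i) => i' ->.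
    apply: (polyf_ext (f := fun y => y 0 j)) => [y|]; last exact: polyf_coord.
    by rewrite (@col_mxEu _ 1 8) ord1.
  apply: (polyf_ext (f := fun y => C i' j)) => [y|]; last exact: polyf_const.
  by rewrite (@col_mxEd _ 1 8).
- move=> y; have [-> //|y0] := eqVneq (y 0 0) 0; first by rewrite mul0r.
  suff -> : (map_mpoly iota F).@[y 0] ^+ 2 * \det (col_mx y C : 'M_9) ^+ 2 = \det (C *m om g y *m C^T).
    by rewrite subrr mulr0.
  have := det_radical C (C0 K) (om_altm g y) (killxx g y).
  rewrite det_C0 (@det_pf8 K (C0 K *m om g y *m (C0 K)^T)); last exact/altm_cong/om_altm.
  rewrite -FX exprMn => E; apply: (mulIf (_ : y 0 0 ^+ 2 != 0)); first by rewrite expf_neq0.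
  by rewrite E; ring.
- by move/(_ (delta_mx 0 0))/eqP; rewrite mxE !eqxx oner_eq0.
by move/(_ x)/eqP; rewrite subr_eq0 => /eqP.
Qed.

End PfaffianHypersurface.

(** * The gradient of the cubic *)

Lemma polyf_aform (K : closedFieldType) n m (g : alt3 K m) (G1 G2 G3 : 'rV[K]_n -> 'rV[K]_m) :
  (forall i, polyf (fun x => G1 x 0 i)) -> (forall i, polyf (fun x => G2 x 0 i)) ->
  (forall i, polyf (fun x => G3 x 0 i)) -> polyf (fun x => g (G1 x) (G2 x) (G3 x)).
Proof.
move=> p1 p2 p3.
apply: (polyf_ext (f := fun x => \sum_i \sum_j \sum_l G1 x 0 i * G2 x 0 j * G3 x 0 l *
    g (delta_mx 0 i) (delta_mx 0 j) (delta_mx 0 l))) => [x|].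
  rewrite [in RHS](row_sum_delta (G1 x)) a_sum1; apply: eq_bigr => i _.
  rewrite [in RHS](row_sum_delta (G2 x)) a_sum2; apply: eq_bigr => j _.
  rewrite [in RHS](row_sum_delta (G3 x)) a_sum3; apply: eq_bigr => l _.
  by rewrite aZ1 aZ2 aZ3; ring.
do 3!(apply: polyf_sum => ? _); apply: polyfM; last exact: polyf_const.
by apply: polyfM => //; apply: polyfM.
Qed.

Lemma polyf_tform (K : closedFieldType) n m (g : tri3 K m) (G1 G2 G3 : 'rV[K]_n -> 'rV[K]_m) :
  (forall i, polyf (fun x => G1 x 0 i)) -> (forall i, polyf (fun x => G2 x 0 i)) ->
  (forall i, polyf (fun x => G3 x 0 i)) -> polyf (fun x => g (G1 x) (G2 x) (G3 x)).
Proof.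
move=> p1 p2 p3.
have sum1 I (r : seq I) (f : I -> 'rV_m) y z : g (\sum_(i <- r) f i) y z = \sum_(i <- r) g (f i) y z.
  by elim/big_rec2: _ => [|i a b _ <-]; rewrite ?t01 ?tD1.
have sum2 I (r : seq I) (f : I -> 'rV_m) y z : g y (\sum_(i <- r) f i) z = \sum_(i <- r) g y (f i) z.
  by elim/big_rec2: _ => [|i a b _ <-]; rewrite ?t02 ?tD2.
have sum3 I (r : seq I) (f : I -> 'rV_m) y z : g y z (\sum_(i <- r) f i) = \sum_(i <- r) g y z (f i).
  by elim/big_rec2: _ => [|i a b _ <-]; rewrite ?t03 ?tD3.
apply: (polyf_ext (f := fun x => \sum_i \sum_j \sum_l G1 x 0 i * G2 x 0 j * G3 x 0 l *
    g (delta_mx 0 i) (delta_mx 0 j) (delta_mx 0 l))) => [x|].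
  rewrite [in RHS](row_sum_delta (G1 x)) sum1; apply: eq_bigr => i _.
  rewrite [in RHS](row_sum_delta (G2 x)) sum2; apply: eq_bigr => j _.
  rewrite [in RHS](row_sum_delta (G3 x)) sum3; apply: eq_bigr => l _.
  by rewrite tZ1 tZ2 tZ3; ring.
do 3!(apply: polyf_sum => ? _); apply: polyfM; last exact: polyf_const.
by apply: polyfM => //; apply: polyfM.
Qed.

Lemma sqr_exists (K : closedFieldType) (a : K) : exists c, c ^+ 2 = a.
Proof.
have sz : size ('X^2 - a%:P : {poly K}) != 1%N by rewrite size_XnsubC.
have /closed_rootP[c] := sz; rewrite /root !hornerE subr_eq0 => /eqP cE; by exists c.
Qed.

(** The difference of squares factors in a domain. This turns determinantal identities, which see
    Pfaffians only squared, into identities between the Pfaffians. *)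
Lemma sqr_polyf (K : closedFieldType) n (f h : 'rV[K]_n -> K) (a : K) : polyf f -> polyf h ->
  (forall x, f x ^+ 2 = a * h x ^+ 2) -> exists c, c ^+ 2 = a /\ forall x, f x = c * h x.
Proof.
move=> pf ph E; have [c cE] := sqr_exists a.
have := @polyf_mul0 K n (fun x => f x - c * h x) (fun x => f x + c * h x); case.
- by apply: polyfB => //; apply: polyfM => //; apply: polyf_const.
- by apply: polyfD => //; apply: polyfM => //; apply: polyf_const.
- by move=> x; have := E x; rewrite -cE => E'; rewrite -subr_sqr exprMn E' subrr.
- by move=> H; exists c; split=> // x; apply/eqP; rewrite -subr_eq0 H.
by move=> H; exists (- c); split=> [|x]; [rewrite sqrrN | apply/eqP; rewrite mulNr -addr_eq0 H].
Qed.

Lemma max_exists (T : Type) (P : T -> Prop) (f : T -> nat) (b : nat) :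
  (forall x, f x <= b)%N -> (exists x, P x) -> exists x, P x /\ forall y, P y -> (f y <= f x)%N.
Proof.
move=> fb [x0 Px0].
have [m] := ubnP (b - f x0); elim: m x0 Px0 => // m IH x0 Px0 lt.
have [H|H] := classic (forall y, P y -> (f y <= f x0)%N); first by exists x0.
have [y yP] := not_all_ex_not _ _ H; have [Py /negP] := imply_to_and _ _ yP; rewrite -ltnNge => fy.
by apply: (IH y) => //; have := fb y; lia.
Qed.

Lemma poly_cancelX (K : closedFieldType) k (p q : {poly K}) :
  (forall t, t ^+ k * p.[t] = t ^+ k * q.[t]) -> p = q.
Proof.
move=> E; apply/eqP; rewrite -subr_eq0; apply/eqP; apply: (@poly_mul_zero _ 'X^k) => [|t].
  by rewrite expf_neq0 ?polyX_eq0.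
by rewrite hornerXn hornerD hornerN mulrBr E subrr.
Qed.

Lemma col_mxA_free (F : fieldType) (d e f n : nat) (A : 'M[F]_(d, n)) (B : 'M_(e, n)) (C : 'M_(f, n)) :
  row_free (col_mx (col_mx A B) C) -> row_free (col_mx A (col_mx B C)).
Proof.
move=> fr; apply: col_row_free => u v uv.
have : row_mx (row_mx u (lsubmx v)) (rsubmx v) *m col_mx (col_mx A B) C = 0.
  by rewrite !mul_row_col -addrA -mul_row_col hsubmxK.
rewrite -[RHS](mul0mx 1%N (col_mx (col_mx A B) C)) => /(row_free_inj fr).
rewrite -(@row_mx0 _ 1 (d + e) f) => /eq_row_mx[+ vr].
rewrite -(@row_mx0 _ 1 d e) => /eq_row_mx[-> vl]; split=> //.
by rewrite -[v]hsubmxK vl vr row_mx0.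
Qed.

Lemma rank_reduced (F : fieldType) (d r n : nat) (A : 'M[F]_n) (N : 'M_(d, n)) (h : 'M_(r, n)) :
  altm A -> row_free (col_mx N h) -> row_full (col_mx N h) -> N *m A = 0 ->
  \rank (h *m A *m h^T) = \rank A.
Proof.
move=> aA fr fu NA.
have AN : A *m N^T = 0 by rewrite -[A]trmxK -trmx_mul (altm_tr aA) mulmxN NA oppr0 trmx0.
have -> : \rank A = \rank (col_mx N h *m A *m (col_mx N h)^T).
  have frT : row_free (col_mx N h)^T by rewrite /row_free mxrank_tr.
  by rewrite mxrankMfree // (eqmxMfull A fu).
rewrite mul_col_mx NA tr_col_mx mul_col_row !mul0mx -[h *m A *m N^T]mulmxA AN mulmx0.
by rewrite rank_diag_block_mx mxrank0.
Qed.

Lemma det2 (R : comNzRingType) (A : 'M[R]_2) : \det A = A 0 0 * A 1 1 - A 0 1 * A 1 0.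
Proof.
rewrite (expand_det_row _ (ord0 : 'I_2)) !big_ord_recl big_ord0 /cofactor !det_mx11 !mxE !entE.
by rewrite /= /bump /= ?addr0 ?addn0 ?addn1; ring.
Qed.

Section Cubic.
Variables (K : closedFieldType) (g : alt3 K 9) (C : tri3 K 9).
Let F := cF C.
Hypothesis FE : forall (x : 'rV[K]_9) (M : 'M_(8, 9)),
  F x ^+ 2 * \det (col_mx x M : 'M_9) ^+ 2 = \det (M *m om g x *m M^T).
Hypothesis S1 : forall x a b : 'rV_9,
  row_free (rows3 x a b) -> kill g x a -> kill g x b -> kill g a b -> False.
Hypothesis S3 : forall (R : 'M_(4, 9)) (H : 'M_(8, 9)),
  row_free R -> row_free H -> (R <= H)%MS ->
  (forall r s y : 'rV_9, (r <= R)%MS -> (s <= R)%MS -> (y <= H)%MS -> g r s y = 0) -> False.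

Lemma det_unit9 (M : 'M[K]_9) : row_free M -> \det M != 0.
Proof. by rewrite row_free_unit unitmxE unitfE. Qed.

(** The block complementary to [x] has the rank of [om g x] and size 8; since this rank is even, a
    singular block has rank at most 6. *)
Lemma F_rank x : x != 0 -> (F x == 0) = (\rank (om g x) <= 6)%N.
Proof.
move=> x0; have freex : row_free x by rewrite /row_free rank_rV x0.
have [M /andP[fr fu]] := @basis_completion _ 1 8 9 _ erefl freex.
have d0 : \det (col_mx x M : 'M_9) != 0 by apply: det_unit9.
have rk := rank_reduced (om_altm g x) fr fu (killxx g x).
have := FE x M; have ev := rank_om_even g x; have := rank_leq_row (M *m om g x *m M^T).
rewrite rk => le8 E.
have -> : (F x == 0) = (\det (M *m om g x *m M^T) == 0).
  by rewrite -E mulf_eq0 !expf_eq0 (negPf d0) orbF.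
have -> : (\det (M *m om g x *m M^T) == 0) = ~~ row_free (M *m om g x *m M^T).
  by rewrite row_free_unit unitmxE unitfE negbK.
by rewrite /row_free rk; lia.
Qed.

Lemma rows3_free x (n : 'M[K]_(2, 9)) : row_free (col_mx x n) -> row_free (rows3 x (row 0 n) (row 1 n)).
Proof.
move=> fr; suff <- : (col_mx x n : 'M_(3, 9)) = rows3 x (row 0 n) (row 1 n) by [].
apply/row_matrixP=> i; case: (@split_ordP 1 2 i) => j ->.
  by rewrite (@rowKu _ 1 2 9) [j]ord1; apply/rowP=> l; rewrite !mxE.
rewrite (@rowKd _ 1 2 9); apply/rowP=> l; rewrite !mxE (tnth_nth 0) /=.
by case: j => [[|[|//]]] lt /=; rewrite mxE; congr (n _ _); apply: val_inj.
Qed.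

(** [pencil_orth] at a point of maximal rank within [P]. *)
Lemma max_rank_kernel (P : 'rV[K]_9 -> Prop) x :
  P x -> x != 0 -> (forall y t, P y -> P (x + t *: y)) ->
  (forall y, P y -> (\rank (om g y) <= \rank (om g x))%N) ->
  forall u z y, kill g x u -> kill g x z -> P y -> g y u z = 0.
Proof.
move=> Px x0 Padd Pmax u z y ku kz Py.
rewrite -omE00 (@pencil_orth _ _ _ (om g x) (om g y) u z) ?mxE // => [t|].
  by rewrite -omZ -omD; apply/Pmax/Padd.
by rewrite -[om g x]trmxK -trmx_mul (altm_tr (om_altm g x)) mulmxN kz oppr0 trmx0.
Qed.

(** If [F] were zero, a point of maximal rank would have rank at most 6, and by [max_rank_kernel]
    any two vectors of its kernel would kill each other, against [S1]. *)
Lemma F_neq0 : exists x, F x != 0.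
Proof.
have [//|H] := classic (exists x, F x != 0).
have F0 x : F x = 0 by apply/eqP/negPn/negP => Fx; apply: H; exists x.
have [||x [x0 xmax]] := @max_exists _ (fun x : 'rV[K]_9 => x != 0) (fun x => \rank (om g x)) 9.
- by move=> x; apply: rank_leq_row.
- exists (delta_mx 0 0); apply/eqP=> /rowP/(_ 0)/eqP.
  by rewrite !mxE eqxx oner_eq0.
have rk : (\rank (om g x) <= 6)%N by rewrite -F_rank // F0.
have [|n [fr nx]] := @kernel_extend _ _ g 2 x x0; first by lia.
have kx i : kill g x (row i n) by rewrite /kill -row_mul nx row0.
case: (@S1 x (row 0 n) (row 1 n)); rewrite ?rows3_free //.
apply/killP=> y; rewrite -a_rot.
apply: (@max_rank_kernel (fun _ => True) x) => // z _.
by have [->|z0] := eqVneq z 0; [rewrite om0 mxrank0 | apply: xmax].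
Qed.

Lemma pencil_expand d r (n : 'M_(d, 9)) (h : 'M_(r, 9)) x y : n *m om g x = 0 ->
  exists2 q : {poly K}, q.[0] = \det (n *m om g y *m n^T) * \det (h *m om g x *m h^T) &
    forall t, \det (col_mx n h *m om g (x + t *: y) *m (col_mx n h)^T) = t ^+ d * q.[t].
Proof.
move=> nx.
have xn : om g x *m n^T = 0.
  by rewrite -[om g x]trmxK -trmx_mul (altm_tr (om_altm g x)) mulmxN nx oppr0 trmx0.
have [q q0 qE] := det_pencil (n *m om g y *m n^T) (n *m om g y *m h^T) (h *m om g y *m n^T)
   (h *m om g x *m h^T) (h *m om g y *m h^T).
exists q => // t; rewrite -qE omD omZ tr_col_mx mul_col_mx mul_col_row; congr (\det _).
rewrite !mulmxDr !mulmxDl nx !mul0mx !add0r -[h *m om g x *m n^T]mulmxA xn mulmx0 add0r.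
by rewrite -!scalemxAr -!scalemxAl.
Qed.

Lemma polyf_det_col (M : 'M[K]_(8, 9)) : polyf (fun x : 'rV[K]_9 => \det (col_mx x M : 'M_9)).
Proof.
apply: polyf_det => i j; case: (@split_ordP 1 8 i) => i' ->.
  apply: (polyf_ext (f := fun y => y 0 j)) => [y|]; last exact: polyf_coord.
  by rewrite (@col_mxEu _ 1 8) ord1.
apply: (polyf_ext (f := fun y => M i' j)) => [y|]; last exact: polyf_const.
by rewrite (@col_mxEd _ 1 8).
Qed.

Lemma polyf_cDr x : polyf (cD C x).
Proof.
by do 2?apply: polyfD; apply: polyf_tform => i; try exact: polyf_const; exact: polyf_coord.
Qed.
Lemma polyf_cDl x : polyf (fun y => cD C y x).
Proof.
by do 2?apply: polyfD; apply: polyf_tform => i; try exact: polyf_const; exact: polyf_coord.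
Qed.
Lemma polyf_cF : polyf F.
Proof. by apply: polyf_tform => i; exact: polyf_coord. Qed.

(** Along x + t y both sides of [FE] have order at least 2 in t. The coefficients of t ^ 2 are the
    squares of the two linear forms, up to constants, and [sqr_polyf] extracts the roots. *)
Lemma grad_rank6 x (n : 'M_(2, 9)) : \rank (om g x) = 6%N ->
  row_free (col_mx x n) -> n *m om g x = 0 ->
  exists c, c != 0 /\ forall y, cD C x y = c * g (row 0 n) (row 1 n) y.
Proof.
move=> rk fr nx.
have x0 : x != 0.
  by apply: contra_eq_neq rk => ->; rewrite om0 mxrank0.
have Fx : F x = 0 by apply/eqP; rewrite F_rank ?rk.
have [h /andP[frB fuB]] := @basis_completion _ 3 6 9 (col_mx x n) erefl fr.
have rkh : \rank (h *m om g x *m h^T) = 6%N.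
  rewrite (rank_reduced (om_altm g x) frB fuB) //.
  by rewrite (@mul_col_mx _ 1 2) nx (killxx g x) col_mx0.
have dh : \det (h *m om g x *m h^T) != 0.
  by rewrite -unitfE -unitmxE -row_free_unit /row_free rkh.
pose M : 'M_(8, 9) := col_mx n h.
have d0 : \det (col_mx x M : 'M_9) != 0 by apply: det_unit9; apply: (@col_mxA_free _ 1 2 6 9).
pose a := \det (h *m om g x *m h^T) / \det (col_mx x M : 'M_9) ^+ 2.
have E y : cD C x y ^+ 2 = a * g (row 0 n) (row 1 n) y ^+ 2.
  have [q q0 qE] := @pencil_expand 2 6 n h x y nx.
  have [dl dlE] := polyf_line x y (polyf_det_col M).
  pose P := (cD C x y)%:P + cD C y x *: 'X + F y *: 'X^2.
  have PE : P ^+ 2 * dl ^+ 2 = q.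
    apply: (@poly_cancelX _ 2) => t; rewrite -qE -FE dlE /F cF_line -/F Fx /P !hE -/F.
    by ring.
  have := congr1 (horner^~ 0) PE; rewrite q0 /P !hE -dlE scale0r !(expr0n, mulr0, addr0) /=.
  have -> : \det (n *m om g y *m n^T) = g (row 0 n) (row 1 n) y ^+ 2.
    rewrite det2 !omP_mx !aE; move: (row 0 n) (row 1 n) => u v.
    by rewrite (aC23 g y v) -(a_rot g y u v) mul0r sub0r mulrN opprK expr2.
  move=> E; apply: (mulIf (_ : \det (col_mx x M : 'M_9) ^+ 2 != 0)); first by rewrite expf_neq0.
  have aE : a * \det (col_mx x M : 'M_9) ^+ 2 = \det (h *m om g x *m h^T).
    by rewrite divfK ?expf_neq0.
  by rewrite [RHS]mulrAC aE E mulrC.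
have [||c [cE cP]] := sqr_polyf _ _ E; first exact: polyf_cDr.
  by apply: polyf_aform => i; try exact: polyf_const; exact: polyf_coord.
exists c; split=> //; apply: contraNneq dh => c0; move: cE; rewrite c0 expr0n /= => /esym/eqP.
by rewrite mulf_eq0 invr_eq0 expf_eq0 (negPf d0) orbF.
Qed.

(** As for rank 6, but the kernel now has four rows besides [x], so the determinant has order at
    least 4: the linear term of [F] vanishes and the square of the quadratic term [cD C y x] is a
    multiple of a squared Pfaffian. *)
Lemma grad_rank4 x (n : 'M_(4, 9)) : \rank (om g x) = 4%N ->
  row_free (col_mx x n) -> n *m om g x = 0 ->
  (forall y, cD C x y = 0) /\
  exists c, c != 0 /\ forall y, cD C y x = c * pf4 (n *m om g y *m n^T).
Proof.
move=> rk fr nx.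
have x0 : x != 0.
  by apply: contra_eq_neq rk => ->; rewrite om0 mxrank0.
have Fx : F x = 0 by apply/eqP; rewrite F_rank ?rk.
have [h /andP[frB fuB]] := @basis_completion _ 5 4 9 (col_mx x n) erefl fr.
have rkh : \rank (h *m om g x *m h^T) = 4%N.
  rewrite (rank_reduced (om_altm g x) frB fuB) //.
  by rewrite (@mul_col_mx _ 1 4) nx (killxx g x) col_mx0.
have dh : \det (h *m om g x *m h^T) != 0.
  by rewrite -unitfE -unitmxE -row_free_unit /row_free rkh.
pose M : 'M_(8, 9) := col_mx n h.
have d0 : \det (col_mx x M : 'M_9) != 0 by apply: det_unit9; apply: (@col_mxA_free _ 1 4 4 9).
pose a := \det (h *m om g x *m h^T) / \det (col_mx x M : 'M_9) ^+ 2.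
have E y : cD C x y = 0 /\ cD C y x ^+ 2 = a * pf4 (n *m om g y *m n^T) ^+ 2.
  have [q q0 qE] := @pencil_expand 4 4 n h x y nx.
  have [dl dlE] := polyf_line x y (polyf_det_col M).
  pose P := (cD C x y)%:P + cD C y x *: 'X + F y *: 'X^2.
  have PE : P ^+ 2 * dl ^+ 2 = 'X^2 * q.
    apply: (@poly_cancelX _ 2) => t.
    rewrite [_ * ('X^2 * q).[t]](_ : _ = t ^+ 4 * q.[t]) => [|]; last by rewrite !hE; ring.
    rewrite -qE -FE dlE /F cF_line -/F Fx /P !hE -/F.
    by ring.
  have Dx : cD C x y = 0.
    have /eqP := congr1 (horner^~ 0) PE; rewrite /P !hE -dlE scale0r !(expr0n, mulr0, addr0, mul0r) /= ?(mulr0, addr0, mul0r).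
    by rewrite mulf_eq0 !expf_eq0 /= (negPf d0) orbF => /eqP.
  split=> //; have PE2 : (cD C y x *: 1 + F y *: 'X) ^+ 2 * dl ^+ 2 = q.
    apply: (@poly_cancelX _ 2) => t; have := congr1 (horner^~ t) PE.
    by rewrite /P Dx !hE => <-; ring.
  have := congr1 (horner^~ 0) PE2; rewrite q0 !hE -dlE scale0r !(expr0n, mulr0, addr0) /= mulr1.
  rewrite det_pf4; last exact/alt_entP/altm_cong/om_altm.
  move=> E; apply: (mulIf (_ : \det (col_mx x M : 'M_9) ^+ 2 != 0)); first by rewrite expf_neq0.
  have aE : a * \det (col_mx x M : 'M_9) ^+ 2 = \det (h *m om g x *m h^T).
    by rewrite divfK ?expf_neq0.
  by rewrite [RHS]mulrAC aE E mulrC.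
split=> [y|]; first by case: (E y).
have [||c [cE cP]] := @sqr_polyf _ _ _ (fun y => pf4 (n *m om g y *m n^T)) a (polyf_cDl x).
- have pe i j : polyf (fun y => ent (n *m om g y *m n^T : 'M_4) i j).
    apply: (polyf_ext (f := fun y => g y (row (inord i) n) (row (inord j) n))) => [y|].
      by rewrite -omP_mx.
    by apply: polyf_aform => i'; try exact: polyf_const; exact: polyf_coord.
  apply: polyfD; first apply: polyfB; exact: polyfM.
- by move=> y; case: (E y).
exists c; split=> //; apply: contraNneq dh => c0; move: cE; rewrite c0 expr0n /= => /esym/eqP.
by rewrite mulf_eq0 invr_eq0 expf_eq0 (negPf d0) orbF.
Qed.

Lemma cD_zero_on (x y : 'rV[K]_9) : (forall t, F (x + t *: y) = 0) -> cD C x y = 0.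
Proof.
move=> F0; have Fx : F x = 0 by have := F0 0; rewrite scale0r addr0.
apply: (poly_lin_eq (p := (cD C y x)%:P + F y *: 'X) (q := 0)) => t.
have := F0 t; rewrite /F cF_line -/F Fx !hE => E.
by rewrite !mulr0 addr0 -[RHS]E; ring.
Qed.

(** If [F] vanished on [H], all contractions restricted to [H] would have rank at most 4. At a point
    where this rank is maximal, [pencil_orth] makes the kernel in [H], of dimension at least 4,
    isotropic for the contractions with all of [H], against [S3]. *)
Lemma no_hyperplane (H : 'M_(8, 9)) : row_free H -> exists y, (y <= H)%MS /\ F y != 0.
Proof.
move=> frH; have [//|nH] := classic (exists y, (y <= H)%MS /\ F y != 0).
have F0 y : (y <= H)%MS -> F y = 0.
  by move=> yH; apply/eqP/negPn/negP => Fy; apply: nH; exists y.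
pose f x := \rank (H *m om g x *m H^T).
have f_even x : ~~ odd (f x) by apply/altm_rank_even/altm_cong/om_altm.
have Hadd (x y : 'rV_9) t : (x <= H)%MS -> (y <= H)%MS -> ((x + t *: y)%R <= H)%MS.
  by move=> xH yH; apply: addmx_sub => //; apply: scalemx_sub.
(* At a point of rank 6 the tangent hyperplane is [H] itself, so [H] contains the three kernel
   vectors. The restriction has rank at most 8 - 3, and at most 4 by parity. *)
have f4 x : (x <= H)%MS -> x != 0 -> (f x <= 4)%N.
  move=> xH x0; have rk6 : (\rank (om g x) <= 6)%N by rewrite -F_rank // F0.
  have le : (f x <= \rank (om g x))%N.
    by apply: leq_trans (mxrankM_maxl _ _) (mxrankM_maxr _ _).
  have [le4|gt4] := leqP (\rank (om g x)) 4; first exact: leq_trans le le4.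
  have rk : \rank (om g x) = 6%N by have := rank_om_even g x; lia.
  have [|n [fr nx]] := @kernel_extend _ _ g 2 x x0; first by lia.
  have [c [c0 cE]] := grad_rank6 rk fr nx.
  have kx i : kill g x (row i n) by rewrite /kill -row_mul nx row0.
  have v0 y : (y <= H)%MS -> g (row 0 n) (row 1 n) y = 0.
    move=> yH; apply: (mulfI c0); rewrite mulr0 -cE.
    by apply: cD_zero_on => t; apply/F0/Hadd.
  have inH z : g (row 0 n) (row 1 n) z = 0 -> (z <= H)%MS.
    move=> gz; apply/negPn/negP => zH.
    apply: (@S1 x (row 0 n) (row 1 n)) => //; first exact: rows3_free.
    apply/killP=> y; have : (y <= H + z)%MS.
      apply: submx_full; rewrite /row_full eqn_leq rank_leq_col /=.
      have := (rank_ltmx (_ : (H < H + z)%MS)); rewrite (eqP frH); apply.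
      by rewrite /ltmx addsmxSl addsmx_sub submx_refl.
    move=> /sub_addsmxP[[u v] /= ->]; rewrite aE v0 ?submxMl //.
    by rewrite [v]mx11_scalar mul_scalar_mx aE gz mulr0 addr0.
  have xnH : (col_mx x n <= H)%MS.
    rewrite col_mx_sub xH; apply/row_subP=> i; apply: inH.
    by case: i => [[|[|//]]] lt; [rewrite (_ : Ordinal lt = 0) ?aalt13 //|rewrite (_ : Ordinal lt = 1) ?aE //]; apply: val_inj.
  have [U UE] := submxP xnH.
  have U0 : U *m (H *m om g x *m H^T) = 0.
    by rewrite !mulmxA -UE mul_col_mx nx (killxx g x) !col_mx0 mul0mx.
  have := mulmx0_rank_max U0; have : (3 <= \rank U)%N.
    by have := mxrankM_maxl U H; rewrite -UE (eqP fr).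
  by have := f_even x; rewrite -/(f x); lia.
have frHT : row_free H^T = false.
  by rewrite /row_free mxrank_tr (eqP frH).
have HI (u : 'rV_8) : u *m H = 0 -> u = 0.
  by rewrite -[RHS](mul0mx 1%N H) => /(row_free_inj frH).
have [||x [[xH x0] xmax]] := @max_exists _ (fun x : 'rV[K]_9 => (x <= H)%MS /\ x != 0) f 8.
- by move=> x; apply: rank_leq_row.
- exists (row 0 H); split; first exact: row_sub.
  rewrite rowE; apply/eqP=> /HI /rowP/(_ 0)/eqP.
  by rewrite !mxE eqxx oner_eq0.
have [u xE] := submxP xH; have u0 : u != 0 by apply: contraNneq x0 => u0; rewrite xE u0 mul0mx.
pose A := H *m om g x *m H^T.
have uA : u *m A = 0 by rewrite /A !mulmxA -xE (killxx g x) mul0mx.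
have fru : row_free u by rewrite /row_free rank_rV u0.
have [||U /andP[frU UA]] := @row_free_extend _ 1 3 _ _ _ (kermx A) fru.
- exact/sub_kermxP.
- by rewrite mxrank_ker -/(f x); have := f4 x xH x0; lia.
have RA : (col_mx u U <= kermx A)%MS by rewrite col_mx_sub UA andbT; apply/sub_kermxP.
case: (@S3 ((col_mx u U : 'M_(4, 8)) *m H) H) => //.
- by rewrite /row_free mxrankMfree.
- exact: submxMl.
move=> r s y /submxP[r' ->] /submxP[s' ->] yH.
have kk (r0 : 'rV_4) : (r0 *m (col_mx u U : 'M_(4, 8))) *m A = 0.
  by apply/sub_kermxP; apply: submx_trans RA; apply: submxMl.
rewrite a_rot a_rot !mulmxA -(mulmxA r') -(mulmxA s') !mulmxA.
set r1 := r' *m _; set s1 := s' *m _; rewrite -omE00 trmx_mul !mulmxA.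
have := @pencil_orth _ _ _ A (H *m om g y *m H^T) r1 s1.
rewrite !mulmxA => -> //; first by rewrite mxE.
- move=> t; have -> : A + t *: (H *m om g y *m H^T) = H *m om g (x + t *: y) *m H^T.
    by rewrite omD omZ mulmxDr mulmxDl -scalemxAr -scalemxAl.
  have [->|z0] := eqVneq (x + t *: y) 0; first by rewrite om0 mulmx0 mul0mx mxrank0.
  by apply: xmax; split=> //; apply: Hadd.
- by have := kk r'; rewrite /A !mulmxA.
rewrite -/A; have aA : altm A by apply/altm_cong/om_altm.
by rewrite -[A]trmxK -trmx_mul (altm_tr aA) mulmxN kk oppr0 trmx0.
Qed.

End Cubic.

(** * Irreducibility of the cubic *)

Section FractionClear.
Variable R : idomainType.
Notation "x %:F" := (@FracField.tofrac R x).

Lemma fraction_ratio (x : {fraction R}) : exists n d, d != 0 /\ x * d%:F = n%:F.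
Proof.
elim/quotW: x => r; exists (\n_r), (\d_r); split; first exact: denom_ratioP.
rewrite !piE /FracField.mulf; apply/eqP; rewrite piE /FracField.equivf /=.
by rewrite !numden_Ratio ?oner_eq0 ?mulr1 ?denom_ratioP ?mulf_neq0 ?oner_eq0 // mulrC.
Qed.

Lemma fraction_clear (p : {poly {fraction R}}) :
  exists d q, d != 0 /\ map_poly (@FracField.tofrac R) q = (d%:F) *: p.
Proof.
elim/poly_ind: p => [|p c [d [q [d0 qE]]]].
  by exists 1, 0; rewrite oner_eq0 map_poly0 scaler0.
have [n [e [e0 ce]]] := fraction_ratio c.
exists (d * e), (e *: q * 'X + (d * n)%:P); split; first by rewrite mulf_neq0.
rewrite rmorphD rmorphM /= map_polyX map_polyZ map_polyC /= qE tofracM.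
rewrite scalerDr scalerA -scalerAl [e%:F * _]mulrC; congr (_ + _); first by rewrite tofracM.
by rewrite !tofracM -ce -mul_polyC -polyCM; congr (_%:P); rewrite -mulrA [_ * c]mulrC.
Qed.
End FractionClear.

Lemma cubic_clear (L : fieldType) (a b c n d : L) : d != 0 ->
  a + b * (n / d) + c * (n / d) ^+ 2 + 1 * (n / d) ^+ 3 = 0 ->
  a * d * d * d + b * n * d * d + c * n * n * d + n * n * n = 0.
Proof.
move=> d0 E; rewrite -[RHS](mulr0 (d ^+ 3)) -E.
by field.
Qed.

Section Irreducible.
Variables (K : closedFieldType) (C : tri3 K 9).
Local Notation F := (cF C).
Hypothesis no_hyper : forall H : 'M[K]_(8, 9), row_free H -> exists y, (y <= H)%MS /\ F y != 0.
Variables (e : 'rV[K]_9) (H : 'M[K]_(8, 9)).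
Hypotheses (Fe : F e != 0) (freeH : row_free (col_mx e H)) (fullH : row_full (col_mx e H)).
Let R := {mpoly K[8]}.

Lemma monic_poly3 (a b c : {poly K}) (s : {poly K}) :
  (size a <= 2)%N -> (size b <= 3)%N -> (size c <= 4)%N ->
  s ^+ 3 + a * s ^+ 2 + b * s + c = 0 -> (size s <= 2)%N.
Proof.
move=> sa sb sc E; rewrite leqNgt; apply/negP => gt.
have s0 : s != 0 by rewrite -size_poly_gt0; lia.
have sX k : size (s ^+ k) = ((size s).-1 * k).+1 by rewrite -(size_exp s k) prednK // size_poly_gt0 expf_neq0.
have : s ^+ 3 = - (a * s ^+ 2 + b * s + c) by apply/eqP; rewrite -addr_eq0 !addrA E.
move=> /(congr1 (fun p : {poly K} => size p)); rewrite sX size_polyN => Es.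
have l1 := size_polyMleq a (s ^+ 2); have l2 := size_polyMleq b s; rewrite sX in l1.
have l3 := size_polyD (a * s ^+ 2 + b * s) c; have l4 := size_polyD (a * s ^+ 2) (b * s).
move: sa sb sc gt Es l1 l2 l3 l4.
have key (n na nb nc n1 n2 n3 n4 : nat) : (na <= 2 -> nb <= 3 -> nc <= 4 -> 2 < n ->
  (n.-1 * 3).+1 = n1 -> n2 <= (na + (n.-1 * 2).+1).-1 -> n3 <= (nb + n).-1 ->
  n1 <= maxn n4 nc -> n4 <= maxn n2 n3 -> False)%N by lia.
exact: key.
Qed.

(* On a line through a suitable point the denominator of the root cancels and the root becomes affine, which produces a
   hyperplane inside the cubic. *)
Lemma no_rational_root (c d : R) : d != 0 ->
  (forall y : 'rV_8, F (d.@[y 0] *: (y *m H) + c.@[y 0] *: e) = 0) -> False.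
Proof.
move=> d0 rt.
have [y0 dy0] : exists y : 'rV_8, d.@[y 0] != 0.
  have [v dv] := mpoly_nz (@inf_dom_closed K) d0; exists (\row_i v i).
  by rewrite (meval_eq (v2 := v)) // => i; rewrite mxE.
(* [b0] is the value of the rational root c / d at [y0], and [b1] is its differential there. *)
set d0' := d.@[y0 0] in dy0; pose b0 := c.@[y0 0] / d0'.
pose b1 (y : 'rV_8) := ((gradient c y0 *m y^T) 0 0 - b0 * (gradient d y0 *m y^T) 0 0) / d0'.
have key y : F (y *m H + b1 y *: e) = 0.
  have [cs csE] := meval_line c y0 y; have [ds dsE] := meval_line d y0 y.
  pose mk (p : R) r : {poly K} := (p.@[y0 0])%:P + ((gradient p y0 *m y^T) 0 0) *: 'X + 'X^2 * r.
  have mkE p r : (forall t, p.@[(y0 + t *: y) 0] = p.@[y0 0] + t * ((gradient p y0 *m y^T) 0 0) + t ^+ 2 * r.[t]) ->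
      forall t, p.@[(y0 + t *: y) 0] = (mk p r).[t].
    by move=> E t; rewrite E /mk !hE; ring.
  have {}csE' := mkE _ _ csE; have {}dsE' := mkE _ _ dsE.
  set c1 := mk c cs in csE'; set d1 := mk d ds in dsE'.
  have d10 : d1 != 0.
    by apply: contraNneq dy0 => E; have := dsE' 0; rewrite E horner0 scale0r addr0 /d0' => ->.
  pose m := gcdp c1 d1; pose c' := c1 %/ m; pose d' := d1 %/ m.
  have m0 : m != 0 by rewrite gcdp_eq0 negb_and d10 orbT.
  have cE : c1 = c' * m by rewrite divpK // dvdp_gcdl.
  have dE : d1 = d' * m by rewrite divpK // dvdp_gcdr.
  have cop : coprimep c' d' by apply: coprimep_div_gcd; rewrite d10 orbT.
  have [Q QE] : exists Q : {poly K}, forall t, F (d'.[t] *: ((y0 + t *: y) *m H) + c'.[t] *: e) = Q.[t].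
    apply: (polyf_curve (f := F)); first exact: polyf_cF.
    move=> i; exists (d' * (((y0 *m H) 0 i)%:P + (y *m H) 0 i *: 'X) + e 0 i *: c') => t.
    by rewrite mulmxDl -scalemxAl !mxE !hE; ring.
  have Q0 : Q = 0.
    apply: (@poly_mul_zero _ (m ^+ 3)); first by rewrite expf_neq0.
    move=> t; rewrite horner_exp -QE -cFZ scalerDr !scalerA ![m.[t] * _]mulrC -!hornerM -cE -dE.
    by rewrite -csE' -dsE' rt.
  (* At a root of [d'] the equation reduces to c' ^ 3 F(e) = 0, so [c'] would vanish as well,
     against coprimality. *)
  have sd' : size d' == 1%N.
    apply/negPn/negP => /closed_rootP[s rs].
    have := QE s; rewrite Q0 horner0 (eqP rs) scale0r add0r cFZ => /eqP.
    rewrite mulf_eq0 (negPf Fe) orbF expf_eq0 /= => /eqP c's.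
    by have := coprimep_root cop (x := s); rewrite /root c's eqxx (eqP rs) eqxx => /(_ isT).
  have [k k0 d'E] := size_poly1P _ sd'.
  pose b := k^-1 *: c'.
  have cbd : c1 = b * d1.
    by rewrite cE dE /b d'E mul_polyC -scalerAl -scalerAr scalerA mulVf // scale1r.
  have Fb t : F ((y0 + t *: y) *m H + b.[t] *: e) = 0.
    apply/eqP; have := QE t; rewrite Q0 horner0 d'E hornerC => /eqP.
    have -> : c'.[t] = k * b.[t] by rewrite /b !hE mulrA mulfV ?mul1r.
    by rewrite -scalerA -scalerDr cFZ mulf_eq0 expf_eq0 /= (negPf k0).
  clearbody b; have sb : (size b <= 2)%N.
    have : forall t, F (y0 *m H + t *: (y *m H) + b.[t] *: e) = 0.
      by move=> t; rewrite -(Fb t) mulmxDl scalemxAl.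
    move: (y0 *m H) (y *m H) => u v Fb'.
    pose A := (F e)^-1 *: ((cD C e u)%:P + cD C e v *: 'X).
    pose B := (F e)^-1 *: ((cD C u e)%:P + cT C u v e *: 'X + cD C v e *: 'X^2).
    pose D := (F e)^-1 *: ((F u)%:P + cD C u v *: 'X + cD C v u *: 'X^2 + F v *: 'X^3).
    apply: (@monic_poly3 A B D).
    - apply: leq_trans (size_scale_leq _ _) _; apply: leq_trans (size_polyD _ _) _.
      by rewrite geq_max (leq_trans (size_polyC_leq1 _)) // (leq_trans (size_scale_leq _ _)) // size_polyX.
    - apply: leq_trans (size_scale_leq _ _) _; apply: leq_trans (size_polyD _ _) _.
      rewrite geq_max (leq_trans (size_scale_leq _ _)) ?size_polyXn // andbT.
      apply: leq_trans (size_polyD _ _) _.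
      by rewrite geq_max (leq_trans (size_polyC_leq1 _)) // (leq_trans (size_scale_leq _ _)) // size_polyX.
    - apply: leq_trans (size_scale_leq _ _) _; apply: leq_trans (size_polyD _ _) _.
      rewrite geq_max [X in _ && X](leq_trans (size_scale_leq _ _)) ?size_polyXn // andbT.
      apply: leq_trans (size_polyD _ _) _.
      rewrite geq_max [X in _ && X](leq_trans (size_scale_leq _ _)) ?size_polyXn // andbT.
      apply: leq_trans (size_polyD _ _) _.
      by rewrite geq_max (leq_trans (size_polyC_leq1 _)) // (leq_trans (size_scale_leq _ _)) // size_polyX.
    apply: inf_dom0 => [|t]; first exact: inf_dom_closed.
    have := Fb' t; rewrite !cFD !cFZ !(cDDl, cDDr, cDZl, cDZr, cTZ2, cTZ3) => E.
    apply: (mulfI Fe); rewrite mulr0 -[RHS]E /A /B /D !hE.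
    by field.
  have bE t : b.[t] = b`_0 + b`_1 * t by rewrite (horner_coef_wide _ sb) !big_ord_recl big_ord0 addr0 mulr1 expr1.
  have c0E : b`_0 = b0.
    have := congr1 (horner^~ 0) cbd; rewrite hornerM -csE' -dsE' scale0r addr0 bE mulr0 addr0 => E.
    by rewrite /b0 E mulfK.
  have c1E : b`_1 = b1 y.
    have E1 : (gradient c y0 *m y^T) 0 0 = b0 * (gradient d y0 *m y^T) 0 0 + b`_1 * d0'.
      apply: (poly_lin_eq (p := cs) (q := b0 *: ds + b`_1 *: (((gradient d y0 *m y^T) 0 0)%:P + 'X * ds))) => t.
      have := congr1 (horner^~ t) cbd; rewrite hornerM -csE' -dsE' csE dsE bE c0E => E.
      apply: (addrI c.@[y0 0]); rewrite addrA E !hE.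
      have -> : c.@[y0 0] = b0 * d0' by rewrite divfK.
      by rewrite -/d0'; ring.
    by rewrite /b1 E1 addrC addKr mulfK.
  have V t : F (y0 *m H + b0 *: e + t *: (y *m H + b1 y *: e)) = 0.
    rewrite -(Fb t) bE c0E c1E mulmxDl -scalemxAl; congr F.
    by rewrite scalerDr scalerDl scalerA [t * _]mulrC !addrA; congr (_ + _); rewrite addrAC.
  move: (y *m H + _) (y0 *m H + _) V => w u V.
  (* The line u + t w lies in the cubic, so the coefficient F(w) of t ^ 3 vanishes; these w fill the
     hyperplane [H'] below. *)
  have : (F u)%:P + cD C u w *: 'X + cD C w u *: 'X^2 + F w *: 'X^3 = 0 :> {poly K}.
    apply: inf_dom0 => [|t]; first exact: inf_dom_closed.
    by rewrite -(V t) cF_line !hE; ring.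
  move=> /(congr1 (fun p : {poly K} => p`_3)).
  by rewrite !coefD coefC !coefZ !coefXn coefX coef0 /= !mulr0 !add0r mulr1.
pose lam := d0'^-1 *: (gradient c y0 - b0 *: gradient d y0).
pose H' := H + lam^T *m e.
have H'E (y : 'rV_8) : y *m H' = y *m H + b1 y *: e.
  rewrite mulmxDr mulmxA [y *m lam^T]mx11_scalar mul_scalar_mx; congr (_ + _ *: _).
  rewrite -[y in LHS]trmxK -trmx_mul mxE /lam -scalemxAl mulmxBl -scalemxAl /b1 mulrC.
  by rewrite mxE [X in _ * X]mxE [X in _ + X]mxE [X in - X]mxE.
have [|z [zH Fz]] := no_hyper (H := H').
  apply: inj_row_free => v; rewrite H'E => vH.
  have : row_mx (b1 v)%:M v *m col_mx e H = 0 by rewrite mul_row_col mul_scalar_mx addrC.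
  rewrite -[RHS](mul0mx 1%N (col_mx e H)) => /(row_free_inj freeH).
  by rewrite -(@row_mx0 _ 1 1 8) => /eq_row_mx[].
by case/submxP: zH Fz => y ->; rewrite H'E key eqxx.
Qed.

Local Notation tofr := (@FracField.tofrac R).
Local Notation evp y := (map_poly (meval (y 0))).

Lemma slice (p : {mpoly K[9]}) : exists P : {poly R}, forall (y : 'rV_8) t,
  p.@[(y *m H + t *: e) 0] = (evp y P).[t].
Proof.
pose v i : {poly R} := (\sum_j H j i *: 'X_j)%:P + ((e 0 i)%:MP)%:P * 'X.
exists (mmap (polyC \o @mpolyC 8 K) v p) => y t.
rewrite -[RHS]/(horner_eval t _) [in LHS]/meval /mmap !raddf_sum; apply: eq_bigr => m _ /=.
rewrite !rmorphM /= map_polyC /= mevalC horner_evalE hornerC; congr (_ * _).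
rewrite /mmap1 !rmorph_prod; apply: eq_bigr => i _.
rewrite !rmorphXn /=; congr (_ ^+ _).
have -> : horner_eval t (evp y (v i)) = (\sum_j H j i * y 0 j) + e 0 i * t.
  rewrite /v rmorphD rmorphM /= !map_polyC map_polyX /= mevalC horner_evalE hornerD hornerM !hornerC hornerX.
  by rewrite raddf_sum; congr (_ + _); apply: eq_bigr => j _; rewrite /= mevalZ mevalXU.
rewrite mxE [(t *: e) _ _]mxE [(y *m H) _ _]mxE [t * _]mulrC; congr (_ + _).
by apply: eq_bigr => j _; rewrite mulrC.
Qed.

Lemma slice_cubic : exists P : {poly R}, [/\ P \is monic, size P = 4%N &
  forall (y : 'rV_8) t, F (y *m H + t *: e) = F e * (evp y P).[t]].
Proof.
have lin (f : 'rV_9 -> K) : polyf f -> exists a : R, forall y : 'rV_8, f (y *m H) = a.@[y 0].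
  by move=> pf; have [a aE] := polyf_lin H pf; exists a.
have [a aE] := lin _ (polyf_cDr C e); have [b bE] := lin _ (polyf_cDl C e).
have [c cE'] := lin _ (polyf_cF C).
pose P : {poly R} := 'X^3 + ((F e)^-1 *: a) *: 'X^2 + ((F e)^-1 *: b) *: 'X + ((F e)^-1 *: c)%:P.
have sz : (size (((F e)^-1 *: a) *: 'X^2 + ((F e)^-1 *: b) *: 'X + ((F e)^-1 *: c)%:P)%R < 4)%N.
  rewrite ltnS; apply: leq_trans (size_polyD _ _) _; rewrite geq_max (leq_trans (size_polyC_leq1 _)) // andbT.
  apply: leq_trans (size_polyD _ _) _; rewrite geq_max !(leq_trans (size_scale_leq _ _)) //.
    by rewrite size_polyX.
  by rewrite size_polyXn.
have PE : P = 'X^3 + (((F e)^-1 *: a) *: 'X^2 + ((F e)^-1 *: b) *: 'X + ((F e)^-1 *: c)%:P).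
  by rewrite /P !addrA.
exists P; split.
- by rewrite PE monicE lead_coefDl ?size_polyXn // lead_coefXn.
- by rewrite PE size_polyDl ?size_polyXn.
move=> y t; rewrite cF_line aE bE cE' /P !rmorphD /= !map_polyZ !map_polyXn map_polyX map_polyC /= !hE !mevalZ.
by field.
Qed.

Lemma horner4 (S : nzRingType) (p : {poly S}) x : (size p <= 4)%N ->
  p.[x] = p`_0 + p`_1 * x + p`_2 * x ^+ 2 + p`_3 * x ^+ 3.
Proof. by move=> sp; rewrite (horner_coef_wide _ sp) !big_ord_recl big_ord0 /= addr0 !addrA expr0 mulr1 expr1. Qed.

(* Since the monic cubic has no root in the fraction field it is irreducible there, and either divides [p] or satisfies
   a Bezout identity with it. *)
Lemma cubic_dichotomy (p : {mpoly K[9]}) :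
  (exists q : 'rV[K]_9 -> K, polyf q /\ forall x : 'rV_9, p.@[x 0] = q x * F x) \/
  (exists2 d : R, d != 0 & forall (y : 'rV_8) t, d.@[y 0] != 0 -> F (y *m H + t *: e) = 0 ->
     p.@[(y *m H + t *: e) 0] != 0).
Proof.
have [P PE] := slice p; have [Q [mQ sQ QE]] := slice_cubic.
have injF : injective tofr by move=> u v /eqP; rewrite tofrac_eq => /eqP.
pose PL := map_poly tofr P; pose QL := map_poly tofr Q.
have sQL : size QL = 4%N by rewrite size_map_inj_poly // rmorph0.
have irr : irreducible_poly QL.
  apply: cubic_irreducible; first by rewrite sQL.
  move=> x; apply/negP => rx; have [n [d [d0 xd]]] := fraction_ratio x.
  have dF0 : tofr d != 0 by rewrite tofrac_eq0.
  have xE : x = tofr n / tofr d by rewrite -xd mulfK.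
  apply: (@no_rational_root n d d0) => y.
  pose h := Q`_0 * d * d * d + Q`_1 * n * d * d + Q`_2 * n * n * d + n * n * n.
  have Q3 : Q`_3 = 1 by have := monicP mQ; rewrite lead_coefE sQ.
  have dE : F (d.@[y 0] *: (y *m H) + n.@[y 0] *: e) = F e * h.@[y 0].
    have [dy|dy] := eqVneq d.@[y 0] 0.
      by rewrite dy scale0r add0r cFZ /h !(mevalD, mevalM) dy; ring.
    have -> : d.@[y 0] *: (y *m H) + n.@[y 0] *: e = d.@[y 0] *: (y *m H + (n.@[y 0] / d.@[y 0]) *: e).
      by rewrite scalerDr scalerA [d.@[_] * _]mulrC divfK.
    rewrite cFZ QE horner4 ?(leq_trans (size_poly _ _)) ?sQ // !coef_map /= Q3 meval1 /h !(mevalD, mevalM).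
    by field.
  rewrite dE (_ : h = 0) ?meval0 ?mulr0 //; apply: injF; rewrite rmorph0.
  have /eqP := rx; rewrite horner4 ?sQL // !coef_map /= Q3 rmorph1 xE => E.
  by rewrite /h !(rmorphD, rmorphM) /=; apply: cubic_clear.
have [dv|ndv] := boolP (QL %| PL)%R; [left|right].
  (* [Q] is monic, so the division introduces no denominators; the remainder is divisible by [QL]
     over the fraction field and too small to be non-zero. *)
  pose q := Pdiv.Ring.rdivp P Q; pose r := Pdiv.Ring.rmodp P Q.
  have PQ : P = q * Q + r by apply: Pdiv.RingMonic.rdivp_eq.
  have r0 : r = 0.
    apply: (map_inj_poly injF); first by rewrite rmorph0.
    rewrite rmorph0; apply/eqP/negPn/negP => rL.
    have : QL %| map_poly tofr r.
      have -> : map_poly tofr r = PL - map_poly tofr q * QL.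
        by rewrite /PL PQ rmorphD rmorphM /= addrC addKr.
      by rewrite dvdp_subl // dvdp_mull.
    move=> /(dvdp_leq rL); rewrite sQL size_map_inj_poly ?rmorph0 // => le.
    have := Pdiv.Ring.ltn_rmodpN0 P (monic_neq0 mQ); by rewrite sQ -/r ltnS leqNgt le.
  pose B := invmx (col_mx e H : 'M_9).
  have uB : (col_mx e H : 'M_9) \in unitmx by rewrite -row_free_unit.
  pose yy (x : 'rV[K]_9) := rsubmx (x *m B : 'rV_(1 + 8)).
  pose tt (x : 'rV[K]_9) := (lsubmx (x *m B : 'rV_(1 + 8))) 0 0.
  have xE x : x = yy x *m H + tt x *: e.
    rewrite -mul_scalar_mx -mx11_scalar addrC -mul_row_col hsubmxK -mulmxA mulVmx ?mulmx1 //.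
  exists (fun x => (F e)^-1 * (evp (yy x) q).[tt x]); split.
    apply: polyfM; first exact: polyf_const.
    apply: (polyf_ext (f := fun x => \sum_(i < size q) (q`_i).@[(yy x) 0] * tt x ^+ i)) => [x|].
      rewrite (@horner_coef_wide _ (size q)); last exact: size_poly.
      by apply: eq_bigr => i _; rewrite coef_map.
    apply: polyf_sum => i _; apply: polyfM.
      apply: (polyf_ext (f := fun x => (q`_i).@[(x *m rsubmx (B : 'M_(9, 1 + 8))) 0])) => [x|].
        by rewrite /yy -mulmx_rsub.
      by apply: (polyf_lin (f := fun z => (q`_i).@[z 0])); apply: polyf_mp.
    apply: polyfX; apply: (polyf_ext (f := fun x => (x *m lsubmx (B : 'M_(9, 1 + 8))) 0 0)) => [x|].
      by rewrite /tt -mulmx_lsub.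
    exact: polyf_mx.
  move=> x; have Fx : F x = F e * (evp (yy x) Q).[tt x] by rewrite {1}(xE x) QE.
  rewrite {1}(xE x) PE Fx PQ r0 addr0 rmorphM /= hornerM.
  by rewrite mulrACA mulVf ?mul1r.
have /Bezout_eq1_coprimepP[[u v] /= uv] : coprimep PL QL.
  by rewrite coprimep_sym irreducible_poly_coprime.
have [d1 [U [d10 UE]]] := fraction_clear u; have [d2 [V [d20 VE]]] := fraction_clear v.
exists (d1 * d2); first by rewrite mulf_neq0.
have E : d2 *: (U * P) + d1 *: (V * Q) = (d1 * d2)%:P.
  apply: (map_inj_poly injF); first by rewrite rmorph0.
  rewrite [RHS]map_polyC /= tofracM rmorphD /= !map_polyZ !(rmorphM (map_poly tofr)) /= UE VE -!scalerAl !scalerA.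
  have uv' : u * map_poly tofr P + v * map_poly tofr Q = 1 by exact: uv.
  rewrite [tofr d2 * _]mulrC.
  rewrite -scalerDr.
  rewrite uv'.
  exact: alg_polyC.
move=> y t dy Fy; rewrite PE; apply: contraNneq dy => Py.
have := congr1 (fun p => (evp y p).[t]) E.
rewrite map_polyC /= hornerC mevalM rmorphD /= !map_polyZ !(rmorphM (map_poly (meval (y 0)))) /= !hE Py.
have -> : (evp y Q).[t] = 0 by apply: (mulfI Fe); rewrite -QE Fy mulr0.
by rewrite !mulr0 addr0 => <-.
Qed.

Lemma slice_root (y : 'rV_8) : exists t, F (y *m H + t *: e) = 0.
Proof.
have [Q [mQ sQ QE]] := slice_cubic.
have : size (evp y Q) != 1%N.
  by rewrite size_map_poly_id0 ?sQ // (monicP mQ) rmorph1 oner_eq0.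
by move=> /closed_rootP[t rt]; exists t; rewrite QE (eqP rt) mulr0.
Qed.

Lemma slice_neq0 (y : 'rV_8) t : y != 0 -> y *m H + t *: e != 0.
Proof.
apply: contraNneq => E; have : row_mx t%:M y *m col_mx e H = 0.
  by rewrite mul_row_col mul_scalar_mx addrC.
rewrite -[RHS](mul0mx 1%N (col_mx e H)) => /(row_free_inj freeH).
by rewrite -(@row_mx0 _ 1 1 8) => /eq_row_mx[_ ->].
Qed.

Lemma generic_point (d : R) : d != 0 -> exists y : 'rV_8, y != 0 /\ d.@[y 0] != 0.
Proof.
move=> d0; have : d * 'X_0 != 0 by rewrite mulf_neq0 // -msize_poly_eq0 msizeX.
move=> /(mpoly_nz (@inf_dom_closed K))[v]; rewrite mevalM mevalXU mulf_eq0 negb_or => /andP[dv v0].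
exists (\row_i v i); rewrite (meval_eq (v2 := v)) => [|i]; last by rewrite mxE.
by split=> //; apply: contraNneq v0 => /rowP/(_ 0); rewrite !mxE => ->.
Qed.

End Irreducible.

Section Prime.
Variables (K : closedFieldType) (C : tri3 K 9).
Local Notation F := (cF C).
Hypothesis no_hyper : forall H : 'M[K]_(8, 9), row_free H -> exists y, (y <= H)%MS /\ F y != 0.

Lemma good_frame : exists (e : 'rV[K]_9) (H : 'M[K]_(8, 9)),
  [/\ F e != 0, row_free (col_mx e H) & row_full (col_mx e H)].
Proof.
have [|e [_ Fe]] := no_hyper (H := row_mx (0 : 'M_(8, 1)) 1%:M).
  by apply: inj_row_free => v; rewrite (@mul_mx_row _ 1 8 1 8) mulmx1 -(@row_mx0 _ 1 1 8) => /(@eq_row_mx _ 1 1 8)[].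
have e0 : e != 0 by apply: contraNneq Fe => ->; rewrite -(scale0r 0) cFZ expr0n mul0r.
have [|H /andP[fr fu]] := @basis_completion _ 1 8 9 e erefl; first by rewrite /row_free rank_rV e0.
by exists e, H.
Qed.

(** In the second case of the dichotomy, a general line in the direction [e] meets the cubic in a
    point where p does not vanish. *)
Lemma cubic_divides (p : 'rV[K]_9 -> K) : polyf p ->
  (forall x, x != 0 -> F x = 0 -> p x = 0) ->
  exists q, polyf q /\ forall x, p x = q x * F x.
Proof.
move=> [p' pE] p0; have [e [H [Fe fr fu]]] := good_frame.
have [[q [pq qE]]|[d d0 dP]] := cubic_dichotomy no_hyper Fe fr fu p'.
  by exists q; split=> // x; rewrite pE.
have [y [y0 dy]] := generic_point d0; have [t Ft] := slice_root H Fe y.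
by have := dP y t dy Ft; rewrite -pE p0 ?eqxx //; apply: slice_neq0.
Qed.

Lemma cubic_prime (p q : 'rV[K]_9 -> K) : polyf p -> polyf q ->
  (forall x, x != 0 -> F x = 0 -> p x * q x = 0) ->
  (forall x, F x = 0 -> p x = 0) \/ (forall x, F x = 0 -> q x = 0).
Proof.
move=> [p' pE] [q' qE] pq0; have [e [H [Fe fr fu]]] := good_frame.
have [[r [pr rE]]|[d d0 dP]] := cubic_dichotomy no_hyper Fe fr fu p'.
  by left=> x Fx; rewrite pE rE Fx mulr0.
have [[r [pr rE]]|[d' d'0 d'P]] := cubic_dichotomy no_hyper Fe fr fu q'.
  by right=> x Fx; rewrite qE rE Fx mulr0.
have [|y [y0]] := @generic_point _ (d * d'); first by rewrite mulf_neq0.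
rewrite mevalM mulf_eq0 negb_or => /andP[dy d'y]; have [t Ft] := slice_root H Fe y.
have := pq0 _ (slice_neq0 fr t y0) Ft; rewrite pE qE => /eqP.
by rewrite mulf_eq0 (negPf (dP y t dy Ft)) (negPf (d'P y t d'y Ft)).
Qed.
End Prime.

(** * Limits of tangent hyperplanes at the singular points of Y *)

Section Alt4.
Variable F : fieldType.
Implicit Types (U B : 'M[F]_4) (u : 'rV[F]_6).

Definition vec6 B : 'rV[F]_6 := \row_i nth 0 [:: ent B 0 1; ent B 0 2; ent B 0 3; ent B 1 2; ent B 1 3; ent B 2 3] i.
Definition alt4 u : 'M[F]_4 :=
  let c k := u 0 (inord k) in
  \matrix_(i, j) nth 0 (nth [::] [:: [:: 0; c 0%N; c 1%N; c 2%N]; [:: - c 0%N; 0; c 3%N; c 4%N];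
     [:: - c 1%N; - c 3%N; 0; c 5%N]; [:: - c 2%N; - c 4%N; - c 5%N; 0]] i) j.
(** The pairing of a bivector with an alternating form; on the bivector of a and b it gives B(a,
    b). *)
Definition pair4 U B := ent U 0 1 * ent B 0 1 + ent U 0 2 * ent B 0 2 + ent U 0 3 * ent B 0 3
   + ent U 1 2 * ent B 1 2 + ent U 1 3 * ent B 1 3 + ent U 2 3 * ent B 2 3.

Lemma ent_alt4 u i j : (i < 4)%N -> (j < 4)%N -> ent (alt4 u) i j =
  let c k := u 0 (inord k) in
  nth 0 (nth [::] [:: [:: 0; c 0%N; c 1%N; c 2%N]; [:: - c 0%N; 0; c 3%N; c 4%N];
     [:: - c 1%N; - c 3%N; 0; c 5%N]; [:: - c 2%N; - c 4%N; - c 5%N; 0]] i) j.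
Proof. by move=> i4 j4; rewrite /ent mxE !inordK. Qed.

Lemma altm_alt4 u : altm (alt4 u).
Proof.
apply/alt_entP; split; first by apply: ord4P; rewrite -/(ent _ _ _) ent_alt4.
by apply/matrixP; apply: ord4P; apply: ord4P; rewrite [LHS]mxE [RHS]mxE -!/(ent _ _ _) !ent_alt4 //= ?opprK ?oppr0.
Qed.

Lemma alt4_vec6 B : altm B -> alt4 (vec6 B) = B.
Proof.
move=> /alt_entP/alt4E[dB tB]; apply/matrixP; apply: ord4P; apply: ord4P;
  rewrite -!/(ent _ _ _) ent_alt4 //= ?mxE ?inordK //= ?dB //; by rewrite [RHS]tB.
Qed.

Lemma sum6 (f : 'I_6 -> F) : \sum_i f i = f (inord 0) + f (inord 1) + f (inord 2) + f (inord 3) + f (inord 4) + f (inord 5).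
Proof.
rewrite !big_ord_recl big_ord0 addr0 !addrA.
by congr (f _ + f _ + f _ + f _ + f _ + f _); apply: val_inj; rewrite /= inordK.
Qed.

Lemma pair4_alt4 u B : pair4 (alt4 u) B = (u *m (vec6 B)^T) 0 0.
Proof. by rewrite mxE sum6 /pair4 !ent_alt4 //= !mxE !inordK. Qed.

Lemma polar4_dual U B : polar4 (dual4 U) B = pair4 U B.
Proof. by rewrite /polar4 /pair4 !ent_dual4 //=; ring. Qed.

Lemma mul_alt4 B (a b : 'rV_4) : altm B -> (a *m B *m b^T) 0 0 =
   pair4 (a^T *m b - b^T *m a) B.
Proof.
move=> /alt_entP/alt4E[dB tB].
have E i j : ent (a^T *m b - b^T *m a) i j = a 0 (inord i) * b 0 (inord j) - b 0 (inord i) * a 0 (inord j).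
  by rewrite /ent !mxE !big_ord1 !mxE.
rewrite /pair4 !E mxE sum4 ![(a *m B) _ _]mxE !sum4 ![b^T _ _]mxE -!/(ent B _ _) !dB //.
rewrite (tB 1 0)%N (tB 2 0)%N (tB 3 0)%N (tB 2 1)%N (tB 3 1)%N (tB 3 2)%N.
by ring.
Qed.

Lemma pf4_wedge (a b : 'rV[F]_4) : pf4 (a^T *m b - b^T *m a) = 0.
Proof.
have E i j : ent (a^T *m b - b^T *m a) i j = a 0 (inord i) * b 0 (inord j) - b 0 (inord i) * a 0 (inord j).
  by rewrite /ent !mxE !big_ord1 !mxE.
by rewrite /pf4 !E; ring.
Qed.

Lemma ltn4P (P : nat -> nat -> Prop) : P 0%N 1%N -> P 0%N 2%N -> P 0%N 3%N -> P 1%N 2%N -> P 1%N 3%N ->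
  P 2%N 3%N -> forall p q, (p < q < 4)%N -> P p q.
Proof.
by move=> ? ? ? ? ? ? [|[|[|[|p]]]] [|[|[|[|q]]]] // /andP[].
Qed.

(** In each of the 36 cases the difference of the two sides is identically zero or equals the
    Pfaffian up to sign. *)
Lemma plucker4 U p q k l : altm U -> pf4 U = 0 ->
  (p < q < 4)%N -> (k < l < 4)%N -> ent U p k * ent U q l - ent U p l * ent U q k = ent U p q * ent U k l.
Proof.
move=> /alt_entP/alt4E[dU tU] p0 pq kl.
have tU' := (tU 1 0, tU 2 0, tU 3 0, tU 2 1, tU 3 1, tU 3 2)%N.
apply/eqP; rewrite -subr_eq0; apply/eqP.
move: p q pq k l kl; apply: ltn4P; apply: ltn4P; rewrite ?dU // ?tU';
  first [by ring | by transitivity (pf4 U); [rewrite /pf4; ring | exact: p0]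
                 | by transitivity (- pf4 U); [rewrite /pf4; ring | rewrite p0 oppr0]].
Qed.

(** By the Pluecker relations [U] is the wedge of its rows p and q, the former divided by a non-zero
    entry [U p q]. *)
Lemma decomposable4 U : altm U -> U != 0 -> pf4 U = 0 ->
  exists a b : 'rV_4, row_free (col_mx a b) /\ forall B, altm B -> pair4 U B = (a *m B *m b^T) 0 0.
Proof.
move=> aU U0 p0; have [dU tU] := alt4E ((alt_entP U).2 aU).
have [p [q [pq Upq]]] : exists p q, (p < q < 4)%N /\ ent U p q != 0.
  apply: NNPP => H; case/eqP: U0.
  have z p q : (p < q < 4)%N -> ent U p q = 0.
    by move=> pq; apply/eqP/negPn/negP => Upq; apply: H; exists p, q.
  apply/matrixP=> i j; rewrite entE [RHS]mxE -[i]inord_val -[j]inord_val.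
  rewrite /ent !inord_val -[i]inord_val -[j]inord_val -/(ent U i j).
  have [ij|ji|->] := ltngtP i j; last by rewrite dU.
    by rewrite z // ij ltn_ord.
  by rewrite tU z ?oppr0 // ji ltn_ord.
pose a : 'rV_4 := (ent U p q)^-1 *: row (inord p) U; pose b : 'rV_4 := row (inord q) U.
have wE k l : (k < l < 4)%N -> a 0 (inord k) * b 0 (inord l) - b 0 (inord k) * a 0 (inord l) = ent U k l.
  move=> kl; rewrite !mxE -!/(ent U _ _).
  have := plucker4 aU p0 pq kl => E.
  by apply: (mulfI Upq); rewrite -E; field.
have E i j : ent (a^T *m b - b^T *m a) i j = a 0 (inord i) * b 0 (inord j) - b 0 (inord i) * a 0 (inord j).
  by rewrite /ent !mxE !big_ord1 !mxE.
exists a, b; split=> [|B aB]; last by rewrite mul_alt4 // /pair4 !E !wE.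
apply: col_row_free => u v; rewrite [u]mx11_scalar [v]mx11_scalar !mul_scalar_mx.
set s := u 0 0; set t := v 0 0 => st.
have st' k : s * a 0 k + t * b 0 k = 0 by have := congr1 (fun z : 'rV_4 => z 0 k) st; rewrite !mxE.
have W := wE p q pq.
have s0 : s = 0.
  apply: (mulIf Upq); rewrite mul0r -W.
  have := st' (inord p); have := st' (inord q); move: (a 0 _) (b 0 _) (a 0 _) (b 0 _) => ap bp aq bq e2 e1.
  have -> : s * (ap * bq - bp * aq) = (s * ap + t * bp) * bq - (s * aq + t * bq) * bp by ring.
  by rewrite e1 e2; ring.
have t0 : t = 0.
  apply: (mulIf Upq); rewrite mul0r -W.
  have := st' (inord p); have := st' (inord q); move: (a 0 _) (b 0 _) (a 0 _) (b 0 _) => ap bp aq bq e2 e1.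
  have -> : t * (ap * bq - bp * aq) = ap * (s * aq + t * bq) - aq * (s * ap + t * bp) by ring.
  by rewrite e1 e2; ring.
by rewrite s0 t0 !raddf0.
Qed.

End Alt4.

Lemma kernel_rows (F : fieldType) (m n d : nat) (M : 'M[F]_(m, n)) : (d + n <= m)%N ->
  exists Z : 'M_(d, m), row_free Z /\ Z *m M = 0.
Proof.
move=> le; have fr0 : row_free (0 : 'M[F]_(0, m)) by rewrite /row_free mxrank0.
have [||Z /andP[fr ZK]] := @row_free_extend F 0 d _ _ _ (kermx M) fr0.
- exact: sub0mx.
- by rewrite mxrank_ker; have := rank_leq_col M; lia.
exists Z; split; last exact/sub_kermxP.
by move: fr; rewrite /row_free rank_col_0mx.
Qed.

Lemma col_row_freeP (F : fieldType) (d e n : nat) (A : 'M[F]_(d, n)) (B : 'M_(e, n)) (u : 'rV_d) (v : 'rV_e) :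
  row_free (col_mx A B) -> u *m A + v *m B = 0 -> u = 0 /\ v = 0.
Proof.
move=> fr; rewrite -mul_row_col -[RHS](mul0mx 1%N (col_mx A B)) => /(row_free_inj fr).
by rewrite -(@row_mx0 _ 1 d e) => /eq_row_mx.
Qed.

Lemma mul_rows3 (R : pzRingType) n (v : 'rV[R]_3) (x a b : 'rV_n) :
  v *m rows3 x a b = v 0 i30 *: x + v 0 i31 *: a + v 0 i32 *: b.
Proof.
rewrite mulmx_sum_row !big_ord_recl big_ord0 addr0 addrA.
by congr (_ + _ + _); congr (v _ _ *: _); try exact: val_inj; apply/rowP=> j; rewrite !mxE.
Qed.

Lemma rows3_freeP (F : fieldType) n (x a b : 'rV[F]_n) :
  (forall r s t, r *: x + s *: a + t *: b = 0 -> [/\ r = 0, s = 0 & t = 0]) -> row_free (rows3 x a b).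
Proof.
move=> H; apply: inj_row_free => v; rewrite mul_rows3 => /H[v0 v1 v2].
apply/rowP=> i; rewrite mxE; case: i => [[|[|[|//]]]] lt.
- by rewrite -v0; congr (v _ _); apply: val_inj.
- by rewrite -v1; congr (v _ _); apply: val_inj.
- by rewrite -v2; congr (v _ _); apply: val_inj.
Qed.

Lemma rows3_free_pair (F : fieldType) n (x : 'rV[F]_n) (q : 'M_(4, n)) (a b : 'rV_4) :
  row_free (col_mx x q) -> row_free (col_mx a b) -> row_free (rows3 x (a *m q) (b *m q)).
Proof.
move=> frq frab; apply: rows3_freeP => r s t E.
have [|r0 st] := @col_row_freeP _ 1 4 n x q r%:M (s *: a + t *: b) frq.
  by rewrite mul_scalar_mx mulmxDl -!scalemxAl addrA.
have [|s0 t0] := @col_row_freeP _ 1 1 4 a b s%:M t%:M frab; first by rewrite !mul_scalar_mx.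
by split; [have := congr1 (fun M : 'M_1 => M 0 0) r0|have := congr1 (fun M : 'M_1 => M 0 0) s0|
  have := congr1 (fun M : 'M_1 => M 0 0) t0]; rewrite !mxE eqxx mulr1n.
Qed.

Lemma vec6_alt4 (F : fieldType) (u : 'rV[F]_6) : vec6 (alt4 u) = u.
Proof.
apply/rowP=> i; rewrite mxE !ent_alt4 //= -[in RHS](inord_val i).
by case: i => [[|[|[|[|[|[|//]]]]]]] lt.
Qed.

(** * The quadratic term at a point of rank 4 *)

Section Singular.
Variables (K : closedFieldType) (g : alt3 K 9) (C : tri3 K 9).
Local Notation F := (cF C).
Hypothesis S1 : forall x a b : 'rV_9,
  row_free (rows3 x a b) -> kill g x a -> kill g x b -> kill g a b -> False.
Variables (x0 : 'rV[K]_9) (n : 'M[K]_(4, 9)).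
Hypotheses (free_n : row_free (col_mx x0 n)) (kill_n : n *m om g x0 = 0).
Local Notation phi y := (n *m om g y *m n^T).

Lemma phi_altm y : altm (phi y).
Proof. exact/altm_cong/om_altm. Qed.

Lemma phi_formE y (a b : 'rV_4) : (a *m phi y *m b^T) 0 0 = g y (a *m n) (b *m n).
Proof. by rewrite -omE00 trmx_mul !mulmxA. Qed.

Lemma ent_phi y i j : ent (phi y) i j = g y (row (inord i) n) (row (inord j) n).
Proof. by rewrite -omP_mx. Qed.

(** If the bivector of a and b annihilates all [phi y], then [a *m n] and [b *m n] kill each other
    and form with [x0] a triple excluded by [S1]. *)
Lemma phi_no_decomposable U : altm U -> U != 0 -> pf4 U = 0 ->
  (forall y, pair4 U (phi y) = 0) -> False.
Proof.
move=> aU U0 pU ann; have [a [b [frab abE]]] := decomposable4 aU U0 pU.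
apply: (@S1 x0 (a *m n) (b *m n)).
- exact: rows3_free_pair.
- by rewrite /kill -mulmxA kill_n mulmx0.
- by rewrite /kill -mulmxA kill_n mulmx0.
by apply/killP => y; rewrite -a_rot -phi_formE -abE ?ann //; apply: phi_altm.
Qed.

Let Mphi : 'M[K]_(9, 6) := \matrix_i vec6 (phi (delta_mx 0 i)).
Lemma vec6_phi y : vec6 (phi y) = y *m Mphi.
Proof.
apply/rowP=> k; rewrite !mxE.
have e i j : ent (phi y) i j = \sum_l y 0 l * ent (phi (delta_mx 0 l)) i j.
  rewrite ent_phi [in LHS](row_sum_delta y) a_sum1; apply: eq_bigr => l _.
  by rewrite aZ1 ent_phi.
under eq_bigr do rewrite !mxE.
by case: k => [[|[|[|[|[|[|//]]]]]]] lt; rewrite /= e.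
Qed.

Lemma pair4_phi (u : 'rV_6) y : pair4 (alt4 u) (phi y) = (u *m Mphi^T *m y^T) 0 0.
Proof. by rewrite pair4_alt4 vec6_phi trmx_mul mulmxA. Qed.

Lemma alt4D (u v : 'rV[K]_6) t : alt4 (u + t *: v) = alt4 u + t *: alt4 v.
Proof.
apply/matrixP; apply: ord4P; apply: ord4P; rewrite -[LHS]/(ent (alt4 (u + t *: v)) _ _);
  rewrite -[RHS]/(ent (alt4 u + t *: alt4 v) _ _) ent_D ent_Z !ent_alt4 //= ?mxE; ring.
Qed.

(** Taking the rows of [n] for y, the hypothesis says that [dual4 U] kills the vector [z] of signed
    values of the 3-form on these rows, and [dual4 U] is invertible. *)
Lemma triple_zero U : altm U -> pf4 U != 0 -> (forall y, pair4 U (phi y) = 0) ->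
  forall a b c : 'rV_4, g (a *m n) (b *m n) (c *m n) = 0.
Proof.
move=> aU pU ann.
pose r i := row (inord i : 'I_4) n.
pose z : 'cV[K]_4 := \col_i nth 0 [:: - g (r 1) (r 2) (r 3); g (r 0) (r 2) (r 3); - g (r 0) (r 1) (r 3); g (r 0) (r 1) (r 2)]%N i.
have phiE l i j : ent (phi (r l)) i j = g (r l) (r i) (r j) by exact: ent_phi.
have dz : dual4 U *m z = 0.
  apply/colP; apply: ord4P; rewrite mxE sum4 [RHS]mxE -!/(ent (dual4 U) _ _) !ent_dual4 // !mxE !inordK //=;
    [rewrite -[RHS](ann (r 0%N)) | rewrite -[RHS](ann (r 1%N)) | rewrite -[RHS](ann (r 2%N)) | rewrite -[RHS](ann (r 3%N))];
    rewrite /pair4 !phiE !(aalt12, aalt23, aalt13);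
    rewrite ?(aC12 g (r 1) (r 0))%N ?(aC12 g (r 2) (r 0))%N ?(aC12 g (r 3) (r 0))%N
      ?(aC23 g (r 0) (r 2) (r 1))%N ?(aC23 g (r 0) (r 3) (r 1))%N ?(aC23 g (r 0) (r 3) (r 2))%N
      ?(aC12 g (r 2) (r 1))%N ?(aC12 g (r 3) (r 1))%N ?(aC23 g (r 1) (r 3) (r 2))%N; ring.
have z0 : z = 0.
  have := congr1 (fun M => U *m M) dz; rewrite mulmxA mul_dual4; last exact/alt_entP.
  rewrite mulmx0 mul_scalar_mx => /eqP; rewrite scaler_eq0 oppr_eq0 (negPf pU) => /eqP //.
have zE i : (i < 4)%N -> nth 0 [:: - g (r 1) (r 2) (r 3); g (r 0) (r 2) (r 3); - g (r 0) (r 1) (r 3); g (r 0) (r 1) (r 2)]%N i = 0.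
  by move=> i4; have := congr1 (fun M : 'cV_4 => M (inord i) 0) z0; rewrite !mxE inordK.
have e3 := zE 0%N isT; have e2 := zE 1%N isT; have e1 := zE 2 isT; have e0 := zE 3 isT.
move: e0 e1 e2 e3 => /= e0 /eqP; rewrite oppr_eq0 => /eqP e1 e2 /eqP; rewrite oppr_eq0 => /eqP e3.
move=> a b c; rewrite -pullE -[RHS](_ : pull g (0 : 'M_(4, 9)) a b c = 0); last by rewrite pullE mulmx0 aE.
apply: alt3_ext => i j k ijk; rewrite !pullE !mulmx0 a01 -!rowE.
rewrite -(inord_val i) -(inord_val j) -(inord_val k) -!/(r _).
by case: i j k ijk => [[|[|[|[|//]]]] ?] [[|[|[|[|//]]]] ?] [[|[|[|[|//]]]] ?].
Qed.

(* An alternating form annihilating the image is indecomposable by [S1], hence makes [g] vanish on the kernel of [x0];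
   but then the annihilator is so large that it contains a decomposable form. *)
Lemma phi_surj A : altm A -> exists y, phi y = A.
Proof.
move=> aA; have [full|nfull] := boolP (row_full Mphi).
  have /submxP[y yE] : (vec6 A <= Mphi)%MS by apply: submx_full.
  by exists y; rewrite -[LHS]alt4_vec6 ?vec6_phi -?yE ?alt4_vec6 //; apply: phi_altm.
exfalso.
have alt4_neq0 (u : 'rV[K]_6) : u != 0 -> alt4 u != 0.
  apply: contraNneq => E; rewrite -[u]vec6_alt4 E; apply/eqP/rowP=> i; rewrite !mxE.
  by case: i => [[|[|[|[|[|[|//]]]]]]] lt; rewrite /= /ent mxE.
have [u uK u0] : exists2 u : 'rV_6, (u <= kermx Mphi^T)%MS & u != 0.
  by apply/rowV0Pn; rewrite kermx_eq0 /row_free mxrank_tr.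
have uM : u *m Mphi^T = 0 by apply/sub_kermxP.
have ann y : pair4 (alt4 u) (phi y) = 0 by rewrite pair4_phi uM mul0mx mxE.
have [pU|pU] := eqVneq (pf4 (alt4 u)) 0.
  by apply: (@phi_no_decomposable (alt4 u)) => //; [apply: altm_alt4|apply: alt4_neq0].
have g0 := triple_zero (altm_alt4 u) pU ann.
have [h /andP[frB fuB]] := @basis_completion _ 5 4 9 (col_mx x0 n) erefl free_n.
(* By now [phi] vanishes on [x0] and on the rows of [n], hence depends on the four rows of [h] only.
   Its annihilator in dimension 6 contains a plane, on which the quadratic form [pf4] has a
   non-trivial zero. *)
have [|Z [frZ ZM]] := @kernel_rows _ 6 4 2 (h *m Mphi)^T; first by [].
have annZ (v : 'rV_2) y : pair4 (alt4 (v *m Z)) (phi y) = 0.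
  rewrite pair4_phi; have /submxP[c ->] : (y <= col_mx (col_mx x0 n) h)%MS by apply: submx_full.
  rewrite -(@hsubmxK _ 1 5 4 c) mul_row_col -[lsubmx _ in X in X *m col_mx x0 n](@hsubmxK _ 1 1 4) mul_row_col.
  set c1 := lsubmx _; set c2 := rsubmx _; set c3 := rsubmx _.
  have xM : x0 *m Mphi = 0.
    rewrite -vec6_phi; have -> : phi x0 = 0 by rewrite kill_n mul0mx.
    by apply/rowP=> i; rewrite !mxE; case: i => [[|[|[|[|[|[|//]]]]]]] lt; rewrite /= /ent mxE.
  have nM (d : 'rV_4) : d *m n *m Mphi = 0.
    rewrite -vec6_phi; apply/rowP=> i; rewrite !mxE.
    by case: i => [[|[|[|[|[|[|//]]]]]]] lt; rewrite /= ent_phi !rowE g0.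
  have -> : v *m Z *m Mphi^T *m (c1 *m x0 + c2 *m n + c3 *m h)^T = v *m Z *m (h *m Mphi)^T *m c3^T.
    rewrite [(_ + _)^T]linearD /= [(_ + _)^T]linearD /= !trmx_mul !mulmxDr.
    have xM' : Mphi^T *m x0^T = 0 by rewrite -trmx_mul xM trmx0.
    have nM' : Mphi^T *m (n^T *m c2^T) = 0 by rewrite -!trmx_mul nM trmx0.
    rewrite -!mulmxA [Mphi^T *m (x0^T *m _)]mulmxA xM' mul0mx !mulmx0 add0r.
    by rewrite nM' !mulmx0 add0r.
  by rewrite -(mulmxA v) ZM mulmx0 mul0mx mxE.
have bad (v : 'rV_2) : v != 0 -> pf4 (alt4 (v *m Z)) = 0 -> False.
  move=> v0 pv; apply: (@phi_no_decomposable (alt4 (v *m Z))) => //; first exact: altm_alt4.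
  apply: alt4_neq0; apply: contraNneq v0 => vZ; apply/eqP/(row_free_inj frZ).
  by rewrite vZ mul0mx.
pose v1 : 'rV[K]_2 := delta_mx 0 0; pose v2 : 'rV[K]_2 := delta_mx 0 1.
have v20 : v2 != 0 by apply/eqP=> /rowP/(_ 1)/eqP; rewrite !mxE eqxx oner_eq0.
have [p2|p2] := eqVneq (pf4 (alt4 (v2 *m Z))) 0; first exact: bad v20 p2.
pose P := (pf4 (alt4 (v1 *m Z)))%:P + polar4 (alt4 (v1 *m Z)) (alt4 (v2 *m Z)) *: 'X + pf4 (alt4 (v2 *m Z)) *: 'X^2.
have sP : size P != 1%N.
  rewrite /P addrC size_polyDl ?size_scale ?size_polyXn //.
  apply: leq_ltn_trans (size_polyD _ _) _; rewrite gtn_max (leq_ltn_trans (size_polyC_leq1 _)) //.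
  by rewrite (leq_ltn_trans (size_scale_leq _ _)) // size_polyX.
have [t /eqP rt] := closed_rootP _ sP.
apply: (bad (v1 + t *: v2)).
  by apply/eqP=> /rowP/(_ 0)/eqP; rewrite !mxE /= mulr0 addr0 oner_eq0.
by rewrite mulmxDl -scalemxAl alt4D pf4_DZ -[RHS]rt /P !hE; ring.
Qed.

Variable c : K.
Hypotheses (c0 : c != 0) (F2E : forall y, cD C y x0 = c * pf4 (phi y))
  (Fx0 : F x0 = 0) (Dx0 : forall y, cD C x0 y = 0).

Lemma phiD y z : phi (y + z) = phi y + phi z.
Proof. by rewrite omD mulmxDr mulmxDl. Qed.

Lemma T_singular y z : cT C x0 y z = c * polar4 (phi y) (phi z).
Proof.
have P := pf4_DZ (phi y) (phi z) 1; rewrite scale1r in P.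
have := cDDl C y z x0; rewrite !F2E phiD P => E.
rewrite cT12 cT23; apply: (addrI (c * pf4 (phi y))); apply: (addIr (c * pf4 (phi z))).
by rewrite -E; ring.
Qed.

(** By surjectivity [phi y0] can be the Hodge dual of the bivector of a and b: its Pfaffian
    vanishes, and polarizing against it evaluates forms at (a, b). *)
Lemma direction_exists (a b : 'rV_4) : exists y0, cD C y0 x0 = 0 /\
  forall z, cT C x0 y0 z = c * g (a *m n) (b *m n) z.
Proof.
have [y0 yE] := phi_surj ((alt_entP _).1 (dual4_alt (a^T *m b - b^T *m a))).
exists y0; split=> [|z]; first by rewrite F2E yE pf4_dual pf4_wedge mulr0.
rewrite T_singular yE polar4_dual -mul_alt4; last exact: phi_altm.
by rewrite phi_formE a_rot.
Qed.

Lemma F2_neq0 : exists y, cD C y x0 != 0.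
Proof.
have [y yE] := phi_surj (altm_alt4 (\row_i nth 0 [:: 1; 0; 0; 0; 0; 1 : K] i)).
exists y; rewrite F2E mulf_neq0 // yE /pf4 !ent_alt4 //= !mxE !inordK //=.
by rewrite !mulr0 mulr1 subr0 addr0 oner_eq0.
Qed.

Definition gvec (a b : 'rV[K]_9) : 'rV[K]_9 := \row_i g a b (delta_mx 0 i).

(* [x0] is approached along a curve in the cubic on which the gradient tends to a multiple of [g (a *m n) (b *m n)]:
   a line in the direction [y0] if it lies in the cubic, and otherwise the residual points of lines through [x0]. *)
Lemma closure_singular (Phi : 'rV[K]_9 -> 'rV[K]_9 -> K) (d e : nat) :
  (forall X V : K -> 'rV[K]_9, (forall i, exists q : {poly K}, forall t, X t 0 i = q.[t]) ->
     (forall i, exists q : {poly K}, forall t, V t 0 i = q.[t]) ->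
     exists r : {poly K}, forall t, Phi (X t) (V t) = r.[t]) ->
  (forall s t x v, Phi (s *: x) (t *: v) = s ^+ d * t ^+ e * Phi x v) ->
  (forall x, F x = 0 -> Phi x (cgrad C x) = 0) ->
  forall a b : 'rV_4, Phi x0 (gvec (a *m n) (b *m n)) = 0.
Proof.
move=> polPhi homPhi zPhi a b; have [y0 [D0 TE]] := direction_exists a b.
pose trow y : 'rV[K]_9 := \row_i cT C x0 y (delta_mx 0 i).
have tE : trow y0 = c *: gvec (a *m n) (b *m n) by apply/rowP=> i; rewrite !mxE TE.
suff : Phi x0 (trow y0) = 0.
  rewrite tE => E; have := homPhi 1 c x0 (gvec (a *m n) (b *m n)).
  rewrite scale1r E expr1n mul1r => /esym/eqP.
  by rewrite mulf_eq0 expf_eq0 (negPf c0) andbF => /eqP.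
have gE s t y : cgrad C (s *: x0 + t *: y) = t *: (s *: trow y + t *: cgrad C y).
  by apply/rowP=> i; rewrite !mxE !cDDl !cDZl cTZ1 cTZ2 Dx0; ring.
have FE' s t y : F (s *: x0 + t *: y) = t ^+ 2 * (s * cD C y x0 + t * F y).
  by rewrite cFD !cFZ !cDZl !cDZr Fx0 Dx0; ring.
have polT i : polyf (fun y => trow y 0 i).
  apply: (polyf_ext (f := fun y => cD C (x0 + y) (delta_mx 0 i) - cD C y (delta_mx 0 i))) => [y|].
    by rewrite mxE cDDl Dx0 add0r addrK.
  apply: polyfB; last exact: polyf_cDl.
  by apply: (polyf_comp (polyf_cDl C _)) => j; apply: (polyf_ext (f := fun y => x0 0 j + y 0 j)) => [y|]; rewrite ?mxE //; apply: polyfD; [exact: polyf_const|exact: polyf_coord].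
have polG i : polyf (fun y => cgrad C y 0 i).
  by apply: (polyf_ext (f := fun y => cD C y (delta_mx 0 i))) => [y|]; [rewrite mxE | exact: polyf_cDl].
have [Fy0|Fy0] := eqVneq (F y0) 0.
  have [|i|r rE] := polPhi (fun s => x0 + s *: y0) (fun s => trow y0 + s *: cgrad C y0).
  - by move=> i; exists ((x0 0 i)%:P + y0 0 i *: 'X) => t; rewrite !mxE !hE mulrC.
  - by exists ((trow y0 0 i)%:P + cgrad C y0 0 i *: 'X) => t; rewrite [LHS]mxE [X in _ + X]mxE !hE [t * _]mulrC.
  have r0 : r = 0.
    apply: (@poly_mul_zero _ ('X ^+ e)) => [|s]; first by rewrite expf_neq0 ?polyX_eq0.
    rewrite -rE !hE -[s ^+ e]mul1r -(expr1n _ d) -homPhi scale1r.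
    have := gE 1 s y0; rewrite !scale1r => <-; apply: zPhi.
    by have := FE' 1 s y0; rewrite scale1r D0 Fy0 => ->; ring.
  by have := rE 0; rewrite r0 horner0 !scale0r !addr0.
have [y2 Dy2] := F2_neq0.
pose y t := y0 + t *: (y2 - y0).
have y1 : y 1 = y2 by rewrite /y scale1r addrC subrK.
have [f fE] := polyf_line y0 (y2 - y0) (polyf_cF C).
have [b' bE] := polyf_line y0 (y2 - y0) (polyf_cDl C x0).
have b0 : b' != 0 by apply: contraNneq Dy2 => b0; rewrite -y1 bE b0 horner0.
(* The residual point of the line through [x0] and [y t]. At t = 0 it becomes [F y0 *: x0], because
   [cD C y0 x0 = 0], and the second argument becomes [F y0 *: trow y0]. Moving towards [y2] keeps
   the coefficient of [y t] from vanishing identically. *)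
have [||r rE] := polPhi (fun t => F (y t) *: x0 + (- cD C (y t) x0) *: y t)
    (fun t => F (y t) *: trow (y t) + (- cD C (y t) x0) *: cgrad C (y t)).
- move=> i; apply: (@polyf_line _ _ (fun z => (F z *: x0 + (- cD C z x0) *: z) 0 i)).
  apply: (polyf_ext (f := fun z => F z * x0 0 i + (- cD C z x0) * z 0 i)) => [z|]; first by rewrite !mxE.
  apply: polyfD; apply: polyfM; [exact: polyf_cF|exact: polyf_const| |exact: polyf_coord].
  exact/polyfN/polyf_cDl.
- move=> i; apply: (@polyf_line _ _ (fun z => (F z *: trow z + (- cD C z x0) *: cgrad C z) 0 i)).
  apply: (polyf_ext (f := fun z => F z * trow z 0 i + (- cD C z x0) * cgrad C z 0 i)) => [z|].
    by rewrite [in RHS]mxE [X in _ = X + _]mxE [X in _ = _ + X]mxE.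
  apply: polyfD; apply: polyfM; [exact: polyf_cF|exact: polT| |exact: polG].
  exact/polyfN/polyf_cDl.
have r0 : r = 0.
  apply: (@poly_mul_zero _ ((- b') ^+ e)) => [|t]; first by rewrite expf_neq0 ?oppr_eq0.
  rewrite -rE horner_exp hornerN -bE -/(y t).
  set s := F (y t); set u := - cD C (y t) x0.
  have := gE s u (y t); set V := s *: trow _ + _ => gE'.
  rewrite -[_ ^+ e]mul1r -(expr1n _ d) -homPhi scale1r -gE'; apply: zPhi.
  by rewrite FE' /u /s; ring.
have := rE 0; rewrite r0 horner0 /y !scale0r !addr0 D0 oppr0 !scale0r !addr0 homPhi => /eqP.
by rewrite !mulf_eq0 !expf_eq0 (negPf Fy0) !andbF => /eqP.
Qed.

End Singular.

(** * Invariance of the hyperdiscriminant *)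

Definition ext3_mapr (A B : Type) (f : A -> B) n (w : ext3 A n) : ext3 B n := [ffun t => f (w t)].

Lemma ext3_form_rmorph (A B : comNzRingType) (f : {rmorphism A -> B}) n (w : ext3 A n) (X : 'M_(3, n)) :
  f (ext3_form w X) = ext3_form (ext3_mapr f w) (map_mx f X).
Proof.
rewrite rmorph_sum; apply: eq_bigr => t _; rewrite rmorphM ffunE -det_map_mx; congr (_ * \det _).
by apply/matrixP=> i j; rewrite !mxE.
Qed.

Lemma ext3_map_rmorph (A B : comNzRingType) (f : {rmorphism A -> B}) m n (M : 'M_(m, n)) (w : ext3 A m) :
  ext3_mapr f (ext3_map M w) = ext3_map (map_mx f M) (ext3_mapr f w).
Proof.
apply/ffunP=> t; rewrite !ffunE ext3_form_rmorph; congr (ext3_form _ _).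
by apply/matrixP=> i j; rewrite !mxE.
Qed.

Lemma ext3_map_diag (K : fieldType) n (d : 'rV[K]_n) (w : ext3 K n) t :
  ext3_map (diag_mx d) w t
  = d 0 (tnth (val t) i30) * d 0 (tnth (val t) i31) * d 0 (tnth (val t) i32) * w t.
Proof.
have E i : delta_mx 0 i *m (diag_mx d)^T = d 0 i *: (delta_mx 0 i : 'rV_n).
  by rewrite tr_diag_mx -rowE row_diag_mx.
by rewrite ext3_mapE ffunE pullE !E !aE tri_delta; ring.
Qed.

Lemma ext3_mapZ (K : fieldType) m n c (M : 'M[K]_(m, n)) (w : ext3 K m) :
  ext3_map (c *: M) w = ext3_mapr ( *%R (c ^+ 3)) (ext3_map M w).
Proof.
apply/ffunP=> t; rewrite !ext3_mapE !ffunE !pullE.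
by rewrite [(c *: M)^T]linearZ /= -!scalemxAr !aE; ring.
Qed.

Section Evaluation.
Variables (N : nat) (A : comNzRingType) (v : 'I_N -> A).
Definition zev : {rmorphism {mpoly int[N]} -> A} := mmap intr v.
Lemma zevE p : zev p = (map_mpoly intr p).@[v].
Proof.
rewrite [in RHS]/map_mpoly /mmap raddf_sum; apply: eq_bigr => m _ /=.
rewrite mevalM mevalC; congr (_ * _).
rewrite /mmap1 rmorph_prod; apply: eq_bigr => i _.
by rewrite rmorphXn /= mevalXU.
Qed.
Lemma zevX i : zev 'X_i = v i.
Proof. by rewrite /zev /= mmapX mmap1U. Qed.
End Evaluation.

Lemma zev_rmorph N (A B : comNzRingType) (h : {rmorphism A -> B}) v (p : {mpoly int[N]}) :
  h (zev v p) = zev (h \o v) p.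
Proof.
rewrite /zev /= /mmap rmorph_sum; apply: eq_bigr => m _.
rewrite rmorphM rmorph_int; congr (_ * _); rewrite /mmap1 rmorph_prod.
by apply: eq_bigr => i _; rewrite rmorphXn.
Qed.

Lemma zev_inj N (p : {mpoly int[N]}) : (forall v : 'I_N -> rat, zev v p = 0) -> p = 0.
Proof.
move=> p0; have : map_mpoly intr p = 0 :> {mpoly rat[N]}.
  by apply: mpoly_fun0 => [|v]; [exact: inf_dom_rat | rewrite -zevE].
move=> /mpolyP E; apply/mpolyP=> m; have := E m; rewrite mcoeff_map_mpoly !mcoeff0 /= => /eqP.
by rewrite intr_eq0 => /eqP.
Qed.

Section Invariant.
Variable f : {mpoly int[#|{: triple 8}|]}.
Definition f_eval (A : comNzRingType) (w : ext3 A 8) : A := (map_mpoly intr f).@[ext3_val w].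

Lemma f_evalE (A : comNzRingType) (w : ext3 A 8) : f_eval w = zev (ext3_val w) f.
Proof. by rewrite zevE. Qed.

Lemma f_eval_rmorph (A B : comNzRingType) (h : {rmorphism A -> B}) (w : ext3 A 8) :
  h (f_eval w) = f_eval (ext3_mapr h w).
Proof.
rewrite !f_evalE zev_rmorph /= /mmap; apply: eq_bigr => m _; congr (_ * _).
by apply: eq_bigr => i _; rewrite /= /ext3_val ffunE.
Qed.

Hypothesis hf : is_hyperdiscriminant f.

Lemma f_eval_homog (A : comNzRingType) (c : A) (w : ext3 A 8) :
  f_eval (ext3_mapr ( *%R c) w) = c ^+ 16 * f_eval w.
Proof.
have [hom _ _] := hf.
rewrite /f_eval -(meval_homog (d := 16)).
  by apply: meval_eq => i; rewrite /ext3_val ffunE.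
apply/dhomogP=> m; rewrite mcoeff_msupp mcoeff_map_mpoly => mf; apply: (dhomog_mf hom).
by rewrite mcoeff_msupp; apply: contraNneq mf => ->.
Qed.

(* The action of [g] corrected by the diagonal matrix (1 / det g, 1, ..., 1) so as to have determinant 1, multiplied by
   [det g] to clear the denominator. *)
Definition tilde (A : comNzRingType) (g : 'M[A]_8) (w : ext3 A 8) : ext3 A 8 :=
  [ffun t => if tnth (val t) i30 == ord0 then ext3_map g w t else \det g * ext3_map g w t].

Lemma tilde_rmorph (A B : comNzRingType) (h : {rmorphism A -> B}) (g : 'M[A]_8) (w : ext3 A 8) :
  ext3_mapr h (tilde g w) = tilde (map_mx h g) (ext3_mapr h w).
Proof.
apply/ffunP=> t; rewrite [LHS]ffunE [tilde g w t]ffunE [RHS]ffunE.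
have E := congr1 (fun z : ext3 B 8 => z t) (ext3_map_rmorph h g w); rewrite /= ffunE in E.
by case: ifP; rewrite ?rmorphM -E // det_map_mx.
Qed.

(** The factor [\det g] covers singular matrices, so the identity holds at all rational points and
    hence between polynomials, where it can be cancelled. *)
Lemma f_tilde_rat (g : 'M[rat]_8) (w : ext3 rat 8) :
  \det g * f_eval (tilde g w) = \det g * (\det g ^+ 16 * f_eval w).
Proof.
have [->|d0] := eqVneq (\det g) 0; first by rewrite !mul0r.
congr (_ * _); have [_ _ inv] := hf.
pose D : 'rV[rat]_8 := \row_i (if i == ord0 then (\det g)^-1 else 1).
have dD : \det (g *m diag_mx D) = 1.
  rewrite det_mulmx det_diag (bigD1 ord0) //= big1 ?mulr1 => [|i /negPf i0].
    by rewrite mxE eqxx mulfV.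
  by rewrite mxE i0.
rewrite -[f_eval w](inv _ w dD) -f_eval_homog -/(f_eval _); congr (f_eval _).
apply/ffunP=> t; rewrite [RHS]ffunE -ext3_map_comp ext3_map_diag !mxE ffunE.
have /andP[lt1 lt2] := triple_lt t.
have -> : (tnth (val t) i31 == ord0) = false by apply/negbTE; rewrite -lt0n; apply: leq_ltn_trans lt1.
have -> : (tnth (val t) i32 == ord0) = false by apply/negbTE; rewrite -lt0n; apply: leq_ltn_trans lt2.
by case: ifP => _; rewrite ?mulr1 ?mul1r // mulrA mulfV ?mul1r.
Qed.

(** The rational case yields an identity of integral polynomials for the generic matrix [Xg] and the
    generic trivector [Xw], which specializes to any commutative ring. *)
Lemma f_eval_SL (A : comNzRingType) (g : 'M[A]_8) (w : ext3 A 8) :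
  \det g = 1 -> f_eval (ext3_map g w) = f_eval w.
Proof.
move=> dg; pose I := ('I_8 * 'I_8 + triple 8)%type; pose N := #|{: I}|.
pose R := {mpoly int[N]}.
pose Xg : 'M[R]_8 := \matrix_(i, j) 'X_(enum_rank (inl (i, j) : I)).
pose Xw : ext3 R 8 := [ffun t => 'X_(enum_rank (inr t : I))].
have idR : f_eval (tilde Xg Xw) = \det Xg ^+ 16 * f_eval Xw.
  have dX0 : \det Xg != 0.
    pose v (k : 'I_N) : int := match enum_val k with inl (i, j) => (i == j)%:R | inr _ => 0 end.
    apply/eqP=> /(congr1 (zev v)); rewrite rmorph0 -det_map_mx.
    have -> : map_mx (zev v) Xg = 1%:M.
      by apply/matrixP=> i j; rewrite !mxE zevX /v enum_rankK.
    by rewrite det1 => /eqP; rewrite oner_eq0.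
  apply: (mulfI dX0); apply/eqP; rewrite -subr_eq0; apply/eqP; apply: zev_inj => v.
  have e1 := f_eval_rmorph (zev v) (tilde Xg Xw); have e2 := f_eval_rmorph (zev v) Xw.
  have e3 := det_map_mx (zev v) Xg; rewrite tilde_rmorph in e1.
  have e4 := f_tilde_rat (map_mx (zev v) Xg) (ext3_mapr (zev v) Xw).
  move: (f_eval (tilde Xg Xw)) (f_eval Xw) (\det Xg) (f_eval (tilde (map_mx (zev v) Xg) _)) (f_eval (ext3_mapr (zev v) Xw)) (\det (map_mx (zev v) Xg)) e1 e2 e3 e4.
  move=> a b d a' b' d' e1 e2 e3 e4; rewrite (rmorphB (zev v)) (rmorphM (zev v) d a) (rmorphM (zev v) d _).
  rewrite (rmorphM (zev v) (d ^+ 16)) (rmorphXn (zev v)).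
  by rewrite e1 e2 -e3 e4 subrr.
pose v (k : 'I_N) : A := match enum_val k with inl (i, j) => g i j | inr t => w t end.
have Eg : map_mx (zev v) Xg = g by apply/matrixP=> i j; rewrite !mxE zevX /v enum_rankK.
have Ew : ext3_mapr (zev v) Xw = w by apply/ffunP=> t; rewrite !ffunE zevX /v enum_rankK.
have e1 := f_eval_rmorph (zev v) (tilde Xg Xw); have e2 := f_eval_rmorph (zev v) Xw.
have e3 := det_map_mx (zev v) Xg; rewrite tilde_rmorph Eg Ew in e1; rewrite Ew in e2; rewrite Eg dg in e3.
have : f_eval (tilde g w) = f_eval w.
  move: (f_eval (tilde Xg Xw)) (f_eval Xw) (\det Xg) (f_eval (tilde g w)) (f_eval w) idR e1 e2 e3.
  move=> a b d a' b' /(congr1 (zev v)) + <- <- e3.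
  by rewrite (rmorphM (zev v)) (rmorphXn (zev v)) -e3 expr1n mul1r.
move=> <-; congr (f_eval _).
by apply/ffunP=> t; rewrite [RHS]ffunE dg mul1r if_same.
Qed.

(** Let c be an eighth root of the determinant. The action is cubic in the matrix and [f] has degree
    16, which gives c ^ 48 = (\det g) ^ 6. *)
Lemma f_eval_GL (K : closedFieldType) (g : 'M[K]_8) (w : ext3 K 8) :
  \det g != 0 -> f_eval (ext3_map g w) = \det g ^+ 6 * f_eval w.
Proof.
move=> d0; have sz : size ('X^8 - (\det g)%:P : {poly K}) != 1%N by rewrite size_XnsubC.
have /closed_rootP[c] := sz; rewrite /root !hE subr_eq0 => /eqP cE.
have c0 : c != 0 by apply: contraNneq d0 => c0; rewrite -cE c0 expr0n.
have gE : g = c *: (c^-1 *: g) by rewrite scalerA mulfV // scale1r.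
rewrite {1}gE ext3_mapZ f_eval_homog f_eval_SL; last by rewrite detZ exprVn cE mulVf.
by rewrite -cE -!exprM.
Qed.

Definition degenerate (K : fieldType) (h : alt3 K 8) := exists u1 u2 u3 : 'rV[K]_8,
  [/\ row_free (rows3 u1 u2 u3), kill h u1 u2, kill h u1 u3 & kill h u2 u3].

(* A one-parameter subgroup with weights 5 (three times) and -3 (five times) contracts degenerate forms to 0. *)
Lemma f_degenerate (K : closedFieldType) (w : ext3 K 8) : degenerate (tri w) -> f_eval w = 0.
Proof.
move=> [u1 [u2 [u3 [fr k12 k13 k23]]]].
have [B /andP[frB _]] := @basis_completion _ 3 5 8 _ erefl fr.
pose M : 'M_8 := col_mx (rows3 u1 u2 u3) B; have {}frB : row_free M := frB.
have dM : \det M^T != 0 by rewrite det_tr -unitfE -unitmxE -row_free_unit.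
suff : f_eval (ext3_map M^T w) = 0.
  by rewrite f_eval_GL // => /eqP; rewrite mulf_eq0 expf_eq0 (negPf dM) andbF => /eqP.
set w' := ext3_map _ w.
have w'0 (t : triple 8) : (tnth (val t) i31 < 3)%N -> w' t = 0.
  move=> lt1; have /andP[lt0 _] := triple_lt t; have lt2 := ltn_trans lt0 lt1.
  rewrite /w' ext3_mapE ffunE pullE trmxK -!rowE.
  have rE (i : 'I_8) (i3 : (i < 3)%N) : row i M = tnth [tuple u1; u2; u3] (Ordinal i3).
    have -> : row i M = row (lshift 5 (Ordinal i3)) M by congr (row _ M); apply: val_inj.
    by rewrite (@rowKu _ 3 5 8); apply/rowP=> j; rewrite !mxE.
  have kk (i j : 'I_8) : (i < j < 3)%N -> kill (tri w) (row i M) (row j M).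
    move=> /andP[ij j3]; rewrite (rE i (ltn_trans ij j3)) (rE j j3).
    by case: i j ij j3 => [[|[|[|i]]] ?] [[|[|[|j]]] ?] ij j3.
  have kt := kk (tnth (val t) i30) (tnth (val t) i31); rewrite lt0 in kt.
  by have /killP -> := kt lt1.
(* The exponents -5 + 3 + 3 = 1 and 3 + 3 + 3 = 9 by which [D] scales the coordinates with one or no
   index below 3; the other coordinates vanish. *)
pose k (t : triple 8) := if (tnth (val t) i30 < 3)%N then 1%N else 9.
pose W u : ext3 K 8 := [ffun t => u ^+ k t * w' t].
have [r rE] := meval_curve (map_mpoly intr f) (fun i => w' (enum_val i) *: 'X^(k (enum_val i))).
have {}rE u : f_eval (W u) = r.[u].
  by apply: rE => i; rewrite /ext3_val ffunE hornerZ hornerXn mulrC.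
have fW u : u != 0 -> f_eval (W u) = f_eval w'.
  move=> u0; pose D : 'rV[K]_8 := \row_i (if (i < 3)%N then u^-1 ^+ 5 else u ^+ 3).
  rewrite -[RHS](@f_eval_SL _ (diag_mx D)).
    congr (f_eval _); apply/ffunP=> t; rewrite ffunE ext3_map_diag !mxE.
    have [lt1|ge1] := ltnP (tnth (val t) i31) 3; first by rewrite w'0 // !mulr0.
    have /andP[_ lt2] := triple_lt t.
    have -> : (tnth (val t) i32 < 3)%N = false by apply/negbTE; rewrite -leqNgt (leq_trans ge1) // ltnW.
    congr (_ * _); rewrite /k; case: ifP => _; by field.
  rewrite det_diag !big_ord_recl big_ord0 !mxE /= /bump /=.
  by field.
have r0 : r - (f_eval w')%:P = 0.
  apply: (@poly_mul_zero _ 'X) => [|u]; first by rewrite polyX_eq0.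
  rewrite !hE -rE; have [->|u0] := eqVneq u 0; first by rewrite mul0r.
  by rewrite fW // subrr mulr0.
have : (r - (f_eval w')%:P).[0] = 0 by rewrite r0 horner0.
rewrite !hE -rE => /eqP; rewrite subr_eq0 => /eqP <-.
have -> : W 0 = ext3_mapr ( *%R 0) w'.
  by apply/ffunP=> t; rewrite !ffunE /k; case: ifP; rewrite expr0n.
by rewrite f_eval_homog expr0n mul0r.
Qed.

(** A polynomial vanishing at all points has zero coefficients in [K], so the characteristic would
    divide all coefficients of the primitive [f]. *)
Lemma f_eval_neq0 (K : closedFieldType) : exists w : ext3 K 8, f_eval w != 0.
Proof.
apply: NNPP => H.
have E : map_mpoly intr f = 0 :> {mpoly K[#|{: triple 8}|]}.
  apply: mpoly_fun0 => [|v]; first exact: inf_dom_closed.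
  apply/eqP/negPn/negP => fv; apply: H; exists [ffun t => v (enum_rank t)].
  rewrite /f_eval (meval_eq (v2 := v)) // => i.
  by rewrite /ext3_val ffunE enum_valK.
have {}E m : (f@_m)%:~R = 0 :> K.
  by have := congr1 (mcoeff m) E; rewrite mcoeff_map_mpoly mcoeff0.
have [_ prim _] := hf.
have absE m : (`|f@_m|%N)%:R = 0 :> K.
  have := E m; case: (f@_m) => n //=; rewrite NegzE mulrNz => /eqP; rewrite oppr_eq0 => /eqP //.
have [[p pK]|np] := classic (exists p, p \in [pchar K]).
  have pp := pcharf_prime pK; suff : p = 1%N by move=> p1; rewrite p1 in pp.
  apply: prim => m; by rewrite dvdzE /= (dvdn_pcharf pK) absE.
(* In characteristic 0 all coefficients of [f] are zero, so even 2 divides them. *)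
suff : 2%N = 1%N by [].
apply: prim => m; suff -> : f@_m = 0 by rewrite dvdz0.
apply/eqP; rewrite -absz_eq0; apply/negPn/negP => nz.
have := absE m; move: nz; rewrite -lt0n => /natf0_pchar nz /eqP /nz.
by move=> [p pK]; apply: np; exists p.
Qed.

End Invariant.

(** * Trivectors in dimension eight *)

Lemma isotropic_rank (F : fieldType) m n (P : 'M[F]_(m, n)) (A : 'M_n) : P *m A *m P^T = 0 ->
  (2 * \rank P + \rank A <= 2 * n)%N.
Proof.
move=> PAP; have := mulmx0_rank_max PAP; rewrite mxrank_tr; have := mxrank_mul_min P A.
move: (\rank _) (\rank P) (\rank A) => a b c.
by lia.
Qed.

Lemma submx_rank_ge (F : fieldType) m1 m2 n (A : 'M[F]_(m1, n)) (B : 'M_(m2, n)) :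
  (A <= B)%MS -> (\rank B <= \rank A)%N -> (B <= A)%MS.
Proof. by move=> AB le; rewrite -(mxrank_leqif_sup AB) eqn_leq le (mxrankS AB). Qed.

Lemma odd_kernel (F : fieldType) (B : 'M[F]_3) : altm B -> exists2 v : 'rV_3, v != 0 & v *m B = 0.
Proof.
move=> aB; have ev := altm_rank_even aB; have le := rank_leq_row B.
have : kermx B != 0 by rewrite kermx_eq0 /row_free; lia.
by move=> /rowV0Pn[v /sub_kermxP vB v0]; exists v.
Qed.

Section Rows.
Variables (F : fieldType) (n : nat) (h : alt3 F n).

Lemma rows3_threeform_zero (k : 'M_(3, n)) : h (row i30 k) (row i31 k) (row i32 k) = 0 ->
  forall x y z : 'rV_3, h (x *m k) (y *m k) (z *m k) = 0.
Proof.
move=> kz x y z.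
rewrite -pullE -[RHS](_ : pull h (0 : 'M_(3, n)) x y z = 0); last by rewrite pullE mulmx0 aE.
apply: alt3_ext => i1 i2 i3 ijk; rewrite !pullE !mulmx0 a01 -!rowE.
rewrite -[RHS]kz; case: i1 i2 i3 ijk => [[|[|[|//]]] ?] [[|[|[|//]]] ?] [[|[|[|//]]] ?] //= _.
by congr (h (row _ k) (row _ k) (row _ k)); apply: val_inj.
Qed.

Lemma kernel_threeform_zero t (k : 'M_(3, n)) : k *m om h t = 0 -> h (row i30 k) (row i31 k) (row i32 k) = 0 ->
  forall x y z : 'rV_4, h (x *m (col_mx t k : 'M_(4, n))) (y *m (col_mx t k : 'M_(4, n))) (z *m (col_mx t k : 'M_(4, n))) = 0.
Proof.
move=> kt0 /rows3_threeform_zero k3 x y z.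
have kt y1 y2 : h t (y1 *m k) y2 = 0 by move: y2; apply/killP; rewrite /kill -mulmxA kt0 mulmx0.
have K1E (v : 'rV_4) : exists r u, v *m (col_mx t k : 'M_(4, n)) = r *: t + u *m k.
  exists ((lsubmx (v : 'rV_(1 + 3))) 0 0), (rsubmx (v : 'rV_(1 + 3))).
  by rewrite -mul_scalar_mx -mx11_scalar -(@mul_row_col _ 1 1 3) hsubmxK.
have [r [u ->]] := K1E x; have [r' [u' ->]] := K1E y; have [r'' [u'' ->]] := K1E z.
rewrite !aE !kt (aC12 h (u *m k) t) (a_rot h (u *m k) (u' *m k) t) (a_rot h (u' *m k) t) !kt k3.
by ring.
Qed.

End Rows.

Section Tools.
Variable K : closedFieldType.

(** Four forms leave at least a plane of bivectors in dimension 6 that they annihilate, and this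
    plane meets the quadric [pf4 = 0] of decomposable bivectors. *)
Lemma isotropic_pair (B : 'I_4 -> 'M[K]_4) : (forall i, altm (B i)) ->
  exists a b : 'rV[K]_4, row_free (col_mx a b) /\ forall i, (a *m B i *m b^T) 0 0 = 0.
Proof.
move=> aB; pose M : 'M[K]_(6, 4) := (\matrix_i vec6 (B i))^T.
have [|Z [frZ ZM]] := @kernel_rows _ 6 4 2 M; first by [].
have annZ (v : 'rV_2) i : pair4 (alt4 (v *m Z)) (B i) = 0.
  have := congr1 (fun N => (v *m N) 0 i) ZM; rewrite mulmx0 mulmxA mxE [RHS]mxE => E.
  by rewrite pair4_alt4 mxE -[RHS]E; apply: eq_bigr => j _; rewrite !mxE.
suff [v [v0 pv]] : exists v : 'rV_2, v != 0 /\ pf4 (alt4 (v *m Z)) = 0.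
  have U0 : alt4 (v *m Z) != 0.
    apply: contraNneq v0 => E; apply/eqP/(row_free_inj frZ); rewrite mul0mx -[LHS]vec6_alt4 E.
    by apply/rowP=> i; rewrite !mxE; case: i => [[|[|[|[|[|[|//]]]]]]] lt; rewrite /= /ent mxE.
  have [a [b [frab abE]]] := decomposable4 (altm_alt4 _) U0 pv.
  by exists a, b; split=> // i; rewrite -abE.
pose v1 : 'rV[K]_2 := delta_mx 0 0; pose v2 : 'rV[K]_2 := delta_mx 0 1.
have v20 : v2 != 0 by apply/eqP=> /rowP/(_ 1)/eqP; rewrite !mxE eqxx oner_eq0.
have [p2|p2] := eqVneq (pf4 (alt4 (v2 *m Z))) 0; first by exists v2.
pose P := (pf4 (alt4 (v1 *m Z)))%:P + polar4 (alt4 (v1 *m Z)) (alt4 (v2 *m Z)) *: 'X + pf4 (alt4 (v2 *m Z)) *: 'X^2.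
have sP : size P != 1%N.
  rewrite /P addrC size_polyDl ?size_scale ?size_polyXn //.
  apply: leq_ltn_trans (size_polyD _ _) _; rewrite gtn_max (leq_ltn_trans (size_polyC_leq1 _)) //.
  by rewrite (leq_ltn_trans (size_scale_leq _ _)) // size_polyX.
have [t /eqP rt] := closed_rootP _ sP.
exists (v1 + t *: v2); split.
  by apply/eqP=> /rowP/(_ 0)/eqP; rewrite !mxE /= mulr0 addr0 oner_eq0.
by rewrite mulmxDl -scalemxAl alt4D pf4_DZ -[RHS]rt /P !hE; ring.
Qed.

Lemma pencil_singular n (A B : 'M[K]_n.+1) : \det B != 0 -> exists s, \det (A + s *: B) = 0.
Proof.
move=> dB; have uB : B \in unitmx by rewrite unitmxE unitfE.
pose M := - (A *m invmx B).
have : size (char_poly M) != 1%N by rewrite size_char_poly.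
move=> /closed_rootP[s]; rewrite -eigenvalue_root_char => /eigenvalueP[v vM v0].
exists s; apply/eqP/negPn/negP => d; have uA : A + s *: B \in unitmx by rewrite unitmxE unitfE.
case/eqP: v0; have : v *m (A + s *: B) = 0.
  have -> : A = - M *m B by rewrite /M opprK mulmxKV.
  by rewrite mulmxDr mulNmx mulmxN mulmxA vM -scalemxAr -scalemxAl addNr.
by move=> /(congr1 (mulmx^~ (invmx (A + s *: B)))); rewrite mul0mx mulmxK.
Qed.

Lemma pull_basis_zero n (g : alt3 K n) (c : 'M_(4, n)) :
  (forall i j k : 'I_4, (i < j < k)%N -> g (row i c) (row j c) (row k c) = 0) ->
  forall x y z : 'rV_4, g (x *m c) (y *m c) (z *m c) = 0.
Proof.
move=> c0 x y z; rewrite -pullE -[RHS](_ : pull g (0 : 'M_(4, n)) x y z = 0); last by rewrite pullE mulmx0 aE.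
by apply: alt3_ext => i j k ijk; rewrite !pullE !mulmx0 a01 -!rowE c0.
Qed.

Lemma ord4_triple (P : 'I_4 -> 'I_4 -> 'I_4 -> Prop) :
  let o i := inord i : 'I_4 in
  P (o 0) (o 1) (o 2) -> P (o 0) (o 1) (o 3) -> P (o 0) (o 2) (o 3) -> P (o 1) (o 2) (o 3) ->
  forall i j k : 'I_4, (i < j < k)%N -> P i j k.
Proof.
move=> o p012 p013 p023 p123 i j k; rewrite -(inord_val i) -(inord_val j) -(inord_val k).
by rewrite !inordK ?ltn_ord //; case: i j k => [[|[|[|[|//]]]] ?] [[|[|[|[|//]]]] ?] [[|[|[|[|//]]]] ?].
Qed.

(* Adding multiples of [t] to the rows of [c] changes the 3-form on them by a 1-form wedged
   with the symplectic form [c *m om g t *m c^T], and every 3-form in 4 variables has this shape. *)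
Lemma kill_threeform n (g : alt3 K n) (t : 'rV_n) (c : 'M_(4, n)) :
  \det (c *m om g t *m c^T) != 0 ->
  exists a : 'cV_4, forall x y z : 'rV_4, g (x *m (c + a *m t)) (y *m (c + a *m t)) (z *m (c + a *m t)) = 0.
Proof.
set W := c *m om g t *m c^T => dW.
have aW : altm W by apply/altm_cong/om_altm.
have pW : pf4 W != 0 by move: dW; rewrite det_pf4 ?expf_eq0 //; apply/alt_entP.
pose r i := row (inord i : 'I_4) c.
have WE i j : ent W i j = g t (r i) (r j) by rewrite /ent omP_mx.
pose z : 'cV[K]_4 := \col_i nth 0 [:: - g (r 1) (r 2) (r 3); g (r 0) (r 2) (r 3); - g (r 0) (r 1) (r 3); g (r 0) (r 1) (r 2)]%N i.
pose a : 'cV_4 := (- (pf4 W)^-1) *: (W *m z).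
have Da : dual4 W *m a = z.
  have WD : W *m ((- (pf4 W)^-1) *: dual4 W) = 1%:M.
    by rewrite -scalemxAr mul_dual4 ?scale_scalar_mx ?mulrNN ?mulVf //; apply/alt_entP.
  by rewrite /a -scalemxAr scalemxAl mulmxA; move/mulmx1C: WD => ->; rewrite mul1mx.
have aE' i : (i < 4)%N -> (dual4 W *m a) (inord i) 0 = nth 0 [:: - g (r 1) (r 2) (r 3); g (r 0) (r 2) (r 3); - g (r 0) (r 1) (r 3); g (r 0) (r 1) (r 2)]%N i.
  by move=> i4; rewrite Da mxE inordK.
have rE i : row i (c + a *m t) = row i c + a i 0 *: t.
  by rewrite [LHS]linearD /= row_mul [row i a]mx11_scalar mul_scalar_mx mxE.
exists a; apply: pull_basis_zero.
have := aE' 0%N isT; have := aE' 1%N isT; have := aE' 2 isT; have := aE' 3 isT.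
rewrite ![(_ *m a) _ _]mxE !sum4 -!/(ent (dual4 W) _ _) !ent_dual4 //= !WE.
move=> e3 e2 e1 e0.
have exp x1 x2 x3 (a1 a2 a3 : K) : g (x1 + a1 *: t) (x2 + a2 *: t) (x3 + a3 *: t) =
   g x1 x2 x3 + a1 * g t x2 x3 - a2 * g t x1 x3 + a3 * g t x1 x2.
  by rewrite !aE (aC12 g x1 t x3) (aC23 g x1 x2 t) (aC12 g x1 t x2) !aalt13; ring.
apply: ord4_triple; rewrite !rE exp -!/(r _).
- by rewrite -e3; ring.
- by rewrite -[g (r 0%N) (r 1%N) (r 3)]opprK -e2; ring.
- by rewrite -e1; ring.
by rewrite -[g (r 1%N) (r 2) (r 3)]opprK -e0; ring.
Qed.

Definition rows4 n (x y z u : 'rV[K]_n) : 'M[K]_(4, n) := \matrix_(i < 4) nth 0 [:: x; y; z; u] i.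
Lemma row_rows4 n (x y z u : 'rV[K]_n) i : (i < 4)%N -> row (inord i) (rows4 x y z u) = nth 0 [:: x; y; z; u] i.
Proof. by move=> i4; apply/rowP=> j; rewrite !mxE inordK. Qed.
Lemma mul_rows4 n (x y z u : 'rV[K]_n) (v : 'rV_4) : v *m rows4 x y z u =
  v 0 (inord 0) *: x + v 0 (inord 1) *: y + v 0 (inord 2) *: z + v 0 (inord 3) *: u.
Proof. by rewrite mulmx_sum_row (bigID xpredT) /= [X in _ + X]big_pred0 ?addr0 // big_mkcond /= !big_ord_recl big_ord0 addr0 !addrA; congr (v _ _ *: _ + v _ _ *: _ + v _ _ *: _ + v _ _ *: _); try (apply: val_inj; rewrite /= inordK //); apply/rowP=> j; rewrite !mxE. Qed.

(** If some [om k b] has rank 4, it is symplectic on a complement of [b], which [kill_threeform]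
    tilts until the 3-form vanishes on it. If all ranks are at most 2 and the form is non-zero, the
    kernel of a non-zero [om k b] is enlarged by one vector. *)
Lemma threeform5 (k : alt3 K 5) : exists W : 'M_(4, 5), row_free W /\
  forall x y z : 'rV_4, k (x *m W) (y *m W) (z *m W) = 0.
Proof.
have compl (b : 'rV[K]_5) : b != 0 -> exists c : 'M_(4, 5), row_free (col_mx b c) /\ row_full (col_mx b c).
  move=> b0; have [|c /andP[fr fu]] := @basis_completion _ 1 4 5 b erefl; last by exists c.
  by rewrite /row_free rank_rV b0.
have [[b rb]|nb] := classic (exists b, \rank (om k b) = 4%N).
  have b0 : b != 0 by apply: contra_eq_neq rb => ->; rewrite om0 mxrank0.
  have [c [fr fu]] := compl b b0.
  have rc : \rank (c *m om k b *m c^T) = 4%N by rewrite (rank_reduced (om_altm k b) fr fu) ?rb //; apply: killxx.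
  have [|a az] := @kill_threeform _ k b c; first by rewrite -unitfE -unitmxE -row_free_unit /row_free rc.
  exists (c + a *m b); split=> //; apply: inj_row_free => v; rewrite mulmxDr mulmxA addrC => E.
  by have [_ ->] := col_row_freeP fr E.
have rk2 b : (\rank (om k b) <= 2)%N.
  have ev := rank_om_even k b; have le := rank_leq_row (om k b).
  have ne : \rank (om k b) <> 4%N by move=> rb; apply: nb; exists b.
  by lia.
have [[b [r [s brs]]]|k0] := classic (exists b r s, k b r s != 0); last first.
  have [|c [fr _]] := compl (delta_mx 0 0); first by apply/eqP=> /rowP/(_ 0)/eqP; rewrite !mxE eqxx oner_eq0.
  exists c; split=> [|x y z]; last by apply/eqP/negPn/negP => H; apply: k0; exists (x *m c), (y *m c), (z *m c).
  apply: inj_row_free => v vc; have [|_ //] := @col_row_freeP _ 1 4 5 _ _ 0 v fr.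
  by rewrite mul0mx add0r.
have b0 : b != 0 by apply: contraNneq brs => ->; rewrite aE.
have [|m [frm mb]] := @kernel_extend _ _ k 2 b b0; first by have := rk2 b; lia.
pose p := row 0 m; pose q := row 1 m.
have kp : kill k b p by rewrite /kill -row_mul mb row0.
have kq : kill k b q by rewrite /kill -row_mul mb row0.
have kbp z : k b p z = 0 by move: z; apply/killP.
have kbq z : k b q z = 0 by move: z; apply/killP.
(* [om k r] has rank at most 2, so its Pfaffian on b, p, q, s vanishes; the only remaining term is
   k(r, b, s) k(r, p, q), with non-zero first factor. *)
have pqr : k p q r = 0.
  pose M := rows4 b p q s; pose A := M *m om k r *m M^T.
  have aA : altm A by apply/altm_cong/om_altm.
  have rA : (\rank A <= 2)%N.
    by apply: leq_trans (mxrankM_maxl _ _) _; apply: leq_trans (mxrankM_maxr _ _) (rk2 r).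
  have /eqP : \det A = 0.
    apply/eqP/negPn/negP => d; have : row_free A by rewrite row_free_unit unitmxE unitfE.
    by rewrite /row_free => /eqP rk; rewrite rk in rA.
  rewrite det_pf4; last exact/alt_entP.
  rewrite expf_eq0 /= /pf4.
  have AE i j : (i < 4)%N -> (j < 4)%N -> ent A i j = k r (nth 0 [:: b; p; q; s] i) (nth 0 [:: b; p; q; s] j).
    by move=> i4 j4; rewrite /ent omP_mx !row_rows4.
  rewrite !AE //= (a_rot k r b p) (a_rot k r b q) kbp kbq !mul0r subr0 add0r mulf_eq0.
  by rewrite (a_rot k r b s) (aC23 k b s r) oppr_eq0 (negPf brs) /= (a_rot k r p q) => /eqP.
exists (rows4 b p q r); split.
  apply: inj_row_free => v; rewrite mul_rows4 => E.
  have v3 : v 0 (inord 3) = 0.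
    apply: (mulIf brs); rewrite mul0r -[RHS](a02 k b s) -E !aE kbp kbq; ring.
  move: E; rewrite v3 scale0r addr0 => E.
  have [|e1 e2] := @col_row_freeP _ 1 2 5 b m (v 0 (inord 0))%:M (row_mx (v 0 (inord 1))%:M (v 0 (inord 2))%:M : 'rV_2) frm.
    rewrite -[RHS]E mul_scalar_mx -addrA; congr (_ + _).
    rewrite -[m](@vsubmxK _ 1 1 5) (@mul_row_col _ 1 1 1 5) !mul_scalar_mx.
    by congr (_ *: _ + _ *: _); apply/rowP=> j; rewrite !mxE; congr (m _ _); apply: val_inj.
  have v0 : v 0 (inord 0) = 0 by have := congr1 (fun M : 'M_1 => M 0 0) e1; rewrite !mxE eqxx mulr1n.
  move: e2; rewrite -(@row_mx0 _ 1 1 1) => /(@eq_row_mx _ 1 1 1)[e2 e3].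
  have v1 : v 0 (inord 1) = 0 by have := congr1 (fun M : 'M_1 => M 0 0) e2; rewrite !mxE eqxx mulr1n.
  have v2 : v 0 (inord 2) = 0 by have := congr1 (fun M : 'M_1 => M 0 0) e3; rewrite !mxE eqxx mulr1n.
  by apply/rowP; apply: ord4P; rewrite mxE.
apply: pull_basis_zero; apply: ord4_triple; rewrite !row_rows4 //=.
Qed.

(** The kernel of [om h t] contains [t] and five further vectors; [threeform5] finds there a 4-space
    [q] on which h vanishes. To kill each other, two vectors of [q] need only be isotropic for the
    contractions with a 3-dimensional complement, and [isotropic_pair] provides them. *)
Lemma rank2_degenerate (h : alt3 K 8) t : t != 0 -> (\rank (om h t) <= 2)%N -> degenerate h.
Proof.
move=> t0 rk; have [|b [frb bt]] := @kernel_extend _ _ h 5 t t0; first by lia.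
have [W [frW W0]] := threeform5 (pull h b).
pose q := W *m b; have qt : q *m om h t = 0 by rewrite -mulmxA bt mulmx0.
have frq : row_free (col_mx t q).
  apply: col_row_free => u v; rewrite mulmxA => /(col_row_freeP frb)[-> vW]; split=> //.
  by apply: (row_free_inj frW); rewrite vW mul0mx.
have [e /andP[_ fue]] := @basis_completion _ 5 3 8 (col_mx t q) erefl frq.
(* Three forms are to be killed; the fourth is padded with 0. *)
pose y (i : 'I_4) := nth 0 [:: row i30 e; row i31 e; row i32 e; 0] i.
have [|a [c [frac acE]]] := @isotropic_pair (fun i => q *m om h (y i) *m q^T).
  by move=> i; apply/altm_cong/om_altm.
have kq d : kill h t (d *m q) by rewrite /kill -mulmxA qt mulmx0.
exists t, (a *m q), (c *m q); split=> //; first exact: rows3_free_pair.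
apply/killP=> z; have /submxP[u ->] : (z <= col_mx (col_mx t q) e)%MS by apply: submx_full.
rewrite -(@hsubmxK _ 1 5 3 u) mul_row_col -[lsubmx _ in X in X *m col_mx t q](@hsubmxK _ 1 1 4) mul_row_col.
set u1 := lsubmx _; set u2 := rsubmx _; set u3 := rsubmx _.
have e0 i : h (a *m q) (c *m q) (y i) = 0.
  by have := acE i; rewrite mulmxA -(mulmxA _ q^T) -trmx_mul -(mulmxA _ _ (c *m q)^T) !mulmxA omE00 a_rot.
rewrite !aD3; have -> : h (a *m q) (c *m q) (u1 *m t) = 0.
  by rewrite [u1]mx11_scalar mul_scalar_mx aE -a_rot (killP h t _).1 ?mulr0 //; apply: kq.
have -> : h (a *m q) (c *m q) (u2 *m q) = 0 by have := W0 a c u2; rewrite pullE -!mulmxA.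
rewrite !add0r [u3 *m e]mulmx_sum_row a_sum3 big1 // => i _; rewrite aE.
case: i => [[|[|[|//]]]] lt.
- by rewrite (_ : row _ e = y (inord 0)) ?e0 ?mulr0 // /y inordK //; congr (row _ e); apply: val_inj.
- by rewrite (_ : row _ e = y (inord 1)) ?e0 ?mulr0 // /y inordK //; congr (row _ e); apply: val_inj.
- by rewrite (_ : row _ e = y (inord 2)) ?e0 ?mulr0 // /y inordK //; congr (row _ e); apply: val_inj.
Qed.

(** If [om h x] has rank 6, its kernel contains a second vector [x']. The contractions with x + s x'
    all vanish on [x] and [x'], hence live on a 6-dimensional quotient, and one of them is singular
    there. *)
Lemma rank_le4_exists (h : alt3 K 8) : exists t, t != 0 /\ (\rank (om h t) <= 4)%N.
Proof.
pose x : 'rV[K]_8 := delta_mx 0 0.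
have x0 : x != 0 by apply/eqP=> /rowP/(_ 0)/eqP; rewrite !mxE eqxx oner_eq0.
have [le|gt] := leqP (\rank (om h x)) 4; first by exists x.
have frx : row_free x by rewrite /row_free rank_rV x0.
have rk : \rank (om h x) = 6%N.
  have ev := rank_om_even h x; have := mulmx0_rank_max (killxx h x : x *m om h x = 0).
  by rewrite (eqP frx); lia.
have [|x' [fr' x'x]] := @kernel_extend _ _ h 1 x x0; first by rewrite rk.
have [e /andP[fr fu]] := @basis_completion _ 2 6 8 (col_mx x x') erefl fr'.
have N0 y : kill h x y -> kill h x' y -> col_mx x x' *m om h y = 0.
  by move=> k1 k2; rewrite (@mul_col_mx _ 1 1) (kill_sym k1) (kill_sym k2) col_mx0.
have kxx' : kill h x x' by [].
have red y : kill h x y -> kill h x' y -> \rank (e *m om h y *m e^T) = \rank (om h y).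
  by move=> k1 k2; apply: (rank_reduced (om_altm h y) fr fu); apply: N0.
have small y : kill h x y -> kill h x' y -> \det (e *m om h y *m e^T) = 0 -> (\rank (om h y) <= 4)%N.
  move=> k1 k2 d; have ev := rank_om_even h y; rewrite -red // in ev *.
  have le := rank_leq_row (e *m om h y *m e^T); have : \rank (e *m om h y *m e^T) <> 6%N.
    move=> r6; have : row_free (e *m om h y *m e^T) by rewrite /row_free r6.
    by rewrite row_free_unit unitmxE unitfE d eqxx.
  by lia.
have x'0 : x' != 0.
  apply: contraTneq fr' => ->; apply/negP => fr0; have [|_ /matrixP/(_ 0 0)/eqP] := @col_row_freeP _ 1 1 8 x 0 0 1%:M fr0.
    by rewrite mul0mx mulmx0 addr0.
  by rewrite !mxE eqxx oner_eq0.
have [d0|d0] := eqVneq (\det (e *m om h x' *m e^T)) 0.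
  by exists x'; split=> //; apply: small => //; apply: killxx.
have [s ds] := @pencil_singular 5 (e *m om h x *m e^T) _ d0.
exists (x + s *: x'); split.
  apply: contraTneq fr' => E; apply/negP => fr0.
  have [|/matrixP/(_ 0 0)/eqP] := @col_row_freeP _ 1 1 8 x x' 1%:M s%:M fr0.
    by rewrite mul1mx mul_scalar_mx.
  by rewrite !mxE eqxx oner_eq0.
have kD y z z' : kill h y z -> kill h y z' -> kill h y (z + s *: z').
  by move=> k1 k2; rewrite /kill; apply: kill_sym; apply/killP=> u; rewrite !aE (killP h z y).1 ?(killP h z' y).1 ?mulr0 ?addr0 //; apply: kill_sym.
apply: small.
- by apply: kD => //; apply: killxx.
- by apply: kD; [apply: kill_sym|apply: killxx].
by rewrite omD omZ mulmxDr mulmxDl -scalemxAr -scalemxAl.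
Qed.

(** * Normal form of a non-degenerate trivector *)

Section Normalization.
Variable h : alt3 K 8.
Hypothesis nd : ~ degenerate h.

Lemma rank_ge4 t : t != 0 -> (4 <= \rank (om h t))%N.
Proof.
move=> t0; have ev := rank_om_even h t; suff : ~ (\rank (om h t) <= 2)%N by lia.
by move=> r2; apply: nd; apply: rank2_degenerate t0 r2.
Qed.

(** If h vanishes on the kernel [K0] of a first [t0] of rank 4, a vector [t1] of [K0] is tuned so
    that a 6-space [P] containing [K0] is isotropic for [om h t1]; hence [t1] has rank 4 too and its
    kernel [K1] lies in [P]. If h also vanished on [K1], either [K0] and [K1] would share three
    dimensions and h be degenerate, or they would span [P], against h(t0, X0, X1) != 0. *)
Lemma rank4_kernel_threeform : exists (t : 'rV[K]_8) (k : 'M_(3, 8)),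
  [/\ row_free (col_mx t k), k *m om h t = 0, \rank (om h t) = 4%N &
     h (row i30 k) (row i31 k) (row i32 k) != 0].
Proof.
have [t0 [t00 rle]] := rank_le4_exists h.
have rk0 : \rank (om h t0) = 4%N by have := rank_ge4 t00; lia.
have [|b [frb bt]] := @kernel_extend _ _ h 3 t0 t00; first by rewrite rk0.
have [bz|bnz] := eqVneq (h (row i30 b) (row i31 b) (row i32 b)) 0; last by exists t0, b.
have b3 := rows3_threeform_zero bz.
have [c /andP[frc fuc]] := @basis_completion _ 4 4 8 (col_mx t0 b) erefl frb.
have N0 : col_mx t0 b *m om h t0 = 0 by rewrite (@mul_col_mx _ 1 3) bt (killxx h t0) col_mx0.
have rW := rank_reduced (om_altm h t0) frc fuc N0; set W := c *m om h t0 *m c^T in rW.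
have uW : W \in unitmx by rewrite -row_free_unit /row_free rW rk0.
(* Three linear conditions on four coefficients: h(X0, -, -) is to vanish on the span of [b]. *)
have [|c0 [frc0 c0Z]] := @kernel_rows K 4 3 1 (\matrix_(i, j) nth 0 [:: h (row i c) (row i30 b) (row i31 b);
    h (row i c) (row i30 b) (row i32 b); h (row i c) (row i31 b) (row i32 b)] j); first by [].
have c00 : c0 != 0 by apply: contraTneq frc0 => ->; rewrite /row_free mxrank0.
pose X0 := c0 *m c.
have X0b x y : h X0 (x *m b) (y *m b) = 0.
  have e (j : 'I_3) : h X0 (nth 0 [:: row i30 b; row i30 b; row i31 b] j) (nth 0 [:: row i31 b; row i32 b; row i32 b] j) = 0.
    have := congr1 (fun M : 'rV_3 => M 0 j) c0Z; rewrite mxE [RHS]mxE => <-.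
    rewrite /X0 [c0 *m c]mulmx_sum_row a_sum1; apply: eq_bigr => i _; rewrite mxE aZ1.
    by case: j => [[|[|[|//]]] lt].
  have bE (v : 'rV_3) : v *m b = v 0 i30 *: row i30 b + v 0 i31 *: row i31 b + v 0 i32 *: row i32 b.
    rewrite mulmx_sum_row !big_ord_recl big_ord0 addr0 addrA.
    by congr (v _ _ *: row _ b + v _ _ *: row _ b + v _ _ *: row _ b); apply: val_inj.
  have e0 := e i30; have e1 := e i31; have e2 := e i32; rewrite /= in e0 e1 e2.
  rewrite !bE !aE e0 e1 e2 (aC23 h X0 (row i31 b) (row i30 b)) (aC23 h X0 (row i32 b) (row i30 b)) (aC23 h X0 (row i32 b) (row i31 b)) e0 e1 e2.
  by ring.
have c0W : c0 *m W != 0.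
  by apply: contraNneq c00 => E; rewrite -[c0](mulmxK uW) E mul0mx.
have /rV0Pn[j c0Wj] := c0W.
pose X1 := row j c.
have tX : h t0 X0 X1 != 0.
  rewrite (_ : h t0 X0 X1 = (c0 *m W) 0 j) // -omE00 /W /X0 !mulmxA mxE [RHS]mxE.
  by apply: eq_bigr => i _; congr (_ * _); rewrite !mxE.
(* An alternating form in three variables has a kernel: h(Y, -, X1) vanishes on the span of [b]. *)
have [be be0 beM] := odd_kernel (altm_cong b (om_altm h X1)).
pose Y := be *m b.
have X1b x : h Y (x *m b) X1 = 0.
  by rewrite a_rot aC12 -aC23 -omE00 trmx_mul /Y !mulmxA; move: beM; rewrite !mulmxA => ->; rewrite mul0mx mxE.
(* The multiple of [t0] that removes the last obstruction h(t1, X0, X1) to isotropy. *)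
pose s := - h Y X0 X1 / h t0 X0 X1.
pose t1 := s *: t0 + Y.
have kb x : kill h t0 (x *m b) by rewrite /kill -mulmxA bt mulmx0.
have z1 x y : h t0 (x *m b) y = 0 by move: y; apply/killP.
have z2 x y : h t0 y (x *m b) = 0 by rewrite aC23 z1 oppr0.
have z3 x y : h (x *m b) t0 y = 0 by rewrite aC12 z1 oppr0.
have z4 x y : h (x *m b) y t0 = 0 by rewrite aC23 z3 oppr0.
have z5 x y : h (x *m b) (y *m b) X0 = 0 by rewrite -a_rot X0b.
have z6 x y : h (x *m b) X0 (y *m b) = 0 by rewrite aC23 z5 oppr0.
have z7 x : h Y X1 (x *m b) = 0 by rewrite aC23 X1b oppr0.
have t10 : t1 != 0.
  apply: contraNneq be0 => E; have [|_ ->] := @col_row_freeP _ 1 3 8 t0 b s%:M be frb; last by [].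
  by rewrite mul_scalar_mx.
have iso r1 (x1 : 'rV_3) u1 v1 r2 (x2 : 'rV_3) u2 v2 : h t1 (r1 *: t0 + x1 *m b + u1 *: X0 + v1 *: X1)
     (r2 *: t0 + x2 *m b + u2 *: X0 + v2 *: X1) = 0.
  rewrite /t1 !aE (aC23 h t0 X1 X0) !(z1, z2) /Y !(z3, z4, z5, z6, b3) -/Y !(z7, X1b) (aC23 h Y X1 X0) !aalt13 /s.
  by field.
pose P : 'M_(6, 8) := col_mx (col_mx t0 b) (col_mx X0 X1).
have PE (v : 'rV_6) : exists r x u w, v *m P = r *: t0 + x *m b + u *: X0 + w *: X1.
  exists ((lsubmx (lsubmx (v : 'rV_(1 + 3 + (1 + 1))))) 0 0), (rsubmx (lsubmx (v : 'rV_(1 + 3 + (1 + 1))))),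
    ((lsubmx (rsubmx (v : 'rV_(1 + 3 + (1 + 1))))) 0 0), ((rsubmx (rsubmx (v : 'rV_(1 + 3 + (1 + 1))))) 0 0).
  by rewrite -!mul_scalar_mx -!mx11_scalar -!addrA addrA -!mul_row_col !hsubmxK.
have PP : P *m om h t1 *m P^T = 0.
  apply/matrixP=> i i'; rewrite omP_mx mxE !rowE.
  by have [r [x [u [w ->]]]] := PE (delta_mx 0 i); have [r' [x' [u' [w' ->]]]] := PE (delta_mx 0 i').
have frX (u v : K) : u *: (c0 : 'rV_4) + v *: delta_mx 0 j = 0 -> u = 0 /\ v = 0.
  move=> E; have E' : u *: X0 + v *: X1 = 0.
    by rewrite /X0 /X1 rowE !scalemxAl -mulmxDl E mul0mx.
  split; apply: (mulIf tX); rewrite mul0r.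
    by rewrite -[RHS](a02 h t0 X1) -E' !aE mulr0 addr0.
  by rewrite -[RHS](a03 h t0 X0) -E' !aE mulr0 add0r.
have frP : row_free P.
  apply: (@col_row_free _ 4 2 8) => u v E.
  pose l : 'rV[K]_1 := @lsubmx _ 1 1 1 v; pose r : 'rV[K]_1 := @rsubmx _ 1 1 1 v.
  have vE : v = row_mx l r by rewrite /l /r (@hsubmxK _ 1 1 1).
  have [|u0 v0] := @col_row_freeP _ 4 4 8 (col_mx t0 b) c u (l *m c0 + r *m delta_mx 0 j : 'rV_4) frc.
    by rewrite -[RHS]E vE (@mul_row_col _ 1 1 1) mulmxDl -!mulmxA -rowE.
  split=> //; move: v0; rewrite vE [l]mx11_scalar [r]mx11_scalar !mul_scalar_mx => /frX[-> ->].
  by rewrite !raddf0 row_mx0.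
have rk1 : \rank (om h t1) = 4%N.
  have := isotropic_rank PP; have := rank_ge4 t10; rewrite (eqP frP).
  by move: (\rank _) => r; clear; lia.
have [|k [frk kt1]] := @kernel_extend _ _ h 3 t1 t10; first by rewrite rk1.
exists t1, k; split=> //; apply/eqP => kz.
pose K1 : 'M_(4, 8) := col_mx t1 k.
have K1t : K1 *m om h t1 = 0 by rewrite (@mul_col_mx _ 1 3) kt1 (killxx h t1) col_mx0.
have K1z := kernel_threeform_zero kt1 kz.
have rK1 : \rank K1 = 4%N by apply/eqP.
pose K0 : 'M_(4, 8) := col_mx t0 b.
have rK0 : \rank K0 = 4%N by apply/eqP.
have t1K0 : (t1 <= K0)%MS.
  by apply/submxP; exists (row_mx s%:M be); rewrite (@mul_row_col _ 1 1 3) mul_scalar_mx.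
have kill0 y : (y <= K0)%MS -> kill h t0 y.
  by case/submxP=> v ->; rewrite /kill -mulmxA N0 mulmx0.
have kill1 y : (y <= K1)%MS -> kill h t1 y.
  by case/submxP=> v ->; rewrite /kill -mulmxA K1t mulmx0.
have t1t0 : kill h t1 t0 by apply/kill_sym/kill0.
have K1P : (K1 <= P)%MS.
  have PK1 : col_mx P K1 *m om h t1 *m (col_mx P K1)^T = 0.
    rewrite mul_col_mx K1t tr_col_mx mul_mx_row mul_col_mx PP mul0mx mul_col_mx mul0mx.
    have -> : P *m om h t1 *m K1^T = 0.
      apply/trmx_inj; rewrite trmx0 !trmx_mul trmxK mulmxA.
      by rewrite (altm_tr (om_altm h t1)) mulmxN mulNmx K1t mul0mx oppr0.
    by rewrite !col_mx0 row_mx0.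
  have := isotropic_rank PK1; rewrite rk1 -addsmxE => le.
  apply: submx_trans (addsmxSr P K1) (submx_rank_ge (addsmxSl P K1) _).
  by rewrite (eqP frP); move: (\rank _) le => r; clear; lia.
have K0P : (K0 <= P)%MS.
  by apply/submxP; exists (row_mx 1%:M 0); rewrite (@mul_row_col _ 4 4 2) mul1mx mul0mx addr0.
have sumP : (K0 + K1 <= P)%MS by rewrite addsmx_sub K0P K1P.
have := mxrank_sum_cap K0 K1; rewrite rK0 rK1 => dim.
have [cap3|cap2] := leqP 3 (\rank (K0 :&: K1)%MS).
  have : ~~ (K0 :&: K1 <= col_mx t0 t1)%MS.
    apply/negP => /mxrankS le; have := leq_trans cap3 (leq_trans le (rank_leq_row _)).
    by [].
  case/row_subPn=> i; set xi := row i _ => xin.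
  have xi0 : (xi <= K0)%MS by rewrite (submx_trans (row_sub _ _)) ?capmxSl.
  have xi1 : (xi <= K1)%MS by rewrite (submx_trans (row_sub _ _)) ?capmxSr.
  apply: nd; exists t0, t1, xi; split; try by [apply: kill0|apply: kill1].
  apply: rows3_freeP => r r' r'' E.
  have t01 (u u' : K) : u *: t0 + u' *: t1 = 0 -> u = 0 /\ u' = 0.
    move=> E'; have u'0 : u' = 0.
      have [|_ e2] := @col_row_freeP _ 1 3 8 t0 b (u + u' * s)%:M (u' *: be) frb.
        by rewrite mul_scalar_mx -scalemxAl -[RHS]E' /t1 scalerDr scalerA scalerDl addrA.
      by move/eqP: e2; rewrite scaler_eq0 (negPf be0) orbF => /eqP.
    by split=> //; move/eqP: E'; rewrite u'0 scale0r addr0 scaler_eq0 (negPf t00) orbF => /eqP.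
  have r''0 : r'' = 0.
    apply/eqP/negPn/negP => r0; case/negP: xin; apply/submxP; exists (row_mx (- (r / r''))%:M (- (r' / r''))%:M).
    rewrite (@mul_row_col _ 1 1 1) !mul_scalar_mx; apply: (scalerI r0).
    rewrite scalerDr !scalerA !mulrN !(mulrC r'') !divfK //; apply/eqP.
    by rewrite -subr_eq0 -[X in _ == X]E !scaleNr opprD !opprK addrC.
  by move: E; rewrite r''0 scale0r addr0 => /t01[-> ->].
have Ple : (P <= K0 + K1)%MS.
  apply: submx_rank_ge sumP _; rewrite (eqP frP).
  by move: dim cap2; move: (\rank _) (\rank _) => r1 r2; clear; lia.
have XP u v : ((u *: X0 + v *: X1)%R <= P)%MS.
  apply/submxP; exists (@row_mx K 1 4 2 0 (@row_mx K 1 1 1 u%:M v%:M)); rewrite (@mul_row_col _ 1 4 2) mul0mx add0r (@mul_row_col _ 1 1 1).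
  by rewrite !mul_scalar_mx.
have X0P : (X0 <= K0 + K1)%MS by apply: submx_trans Ple; move: (XP 1 0); rewrite scale1r scale0r addr0.
have X1P : (X1 <= K0 + K1)%MS by apply: submx_trans Ple; move: (XP 0 1); rewrite scale1r scale0r add0r.
case/sub_addsmxP: X0P => -[u0 v0] /= X0E; case/sub_addsmxP: X1P => -[u1 v1] /= X1E.
case/eqP: tX; rewrite {}X0E {}X1E.
have k0 u z : h t0 (u *m K0) z = 0 by move: z; apply/killP/kill0/submxMl.
have t0K1 : (t0 <= K1)%MS.
  have sub : (K1 <= kermx (om h t1))%MS by apply/sub_kermxP.
  apply: submx_trans (submx_rank_ge sub _); first exact/sub_kermxP.
  by rewrite mxrank_ker rk1 rK1.
case/submxP: t0K1 => v t0E.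
rewrite aD2 k0 add0r aD3 (aC23 h _ _ (u1 *m K0)) k0 oppr0 add0r t0E.
exact: K1z.
Qed.

Lemma mul_rows_of3 n (v : 'rV[K]_3) (b : 'M_(3, n)) :
  v *m b = v 0 i30 *: row i30 b + v 0 i31 *: row i31 b + v 0 i32 *: row i32 b.
Proof.
rewrite mulmx_sum_row !big_ord_recl big_ord0 addr0 addrA.
by congr (v _ _ *: row _ b + v _ _ *: row _ b + v _ _ *: row _ b); apply: val_inj.
Qed.

(** [T] is the kernel of the [t] found before. The volume form on [k] allows a shift of [c] along
    [k] that clears the terms with two arguments in [T], and the symplectic form [om h t] on [c] a
    shift along [t] that clears the 3-form on [c]. *)
Lemma split_form : exists T c : 'M[K]_(4, 8),
  [/\ row_free (col_mx T c), forall x y z : 'rV_4, h (x *m T) (y *m T) (z *m c) = 0,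
      forall x y z : 'rV_4, h (x *m c) (y *m c) (z *m c) = 0,
      exists t : 'rV_4, (forall x y : 'rV_4, h (t *m T) (x *m T) (y *m T) = 0) /\
                        c *m om h (t *m T) *m c^T \in unitmx &
      exists x y z : 'rV_4, h (x *m T) (y *m T) (z *m T) != 0].
Proof.
have [t [k [frk kt0 rk kz]]] := rank4_kernel_threeform.
have [c /andP[frc fuc]] := @basis_completion _ 4 4 8 (col_mx t k) erefl frk.
have N0 : col_mx t k *m om h t = 0 by rewrite (@mul_col_mx _ 1 3) kt0 (killxx h t) col_mx0.
have rW := rank_reduced (om_altm h t) frc fuc N0.
have uW : c *m om h t *m c^T \in unitmx by rewrite -row_free_unit /row_free rW rk.
have tk0 : om h t *m k^T = 0.
  by apply/trmx_inj; rewrite trmx_mul trmxK (altm_tr (om_altm h t)) mulmxN kt0 oppr0 trmx0.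
set k0 := row i30 k in kz *; set k1 := row i31 k in kz *; set k2 := row i32 k in kz *.
(* Cramer's rule for the volume form h on the rows of [k]. *)
pose A : 'M[K]_(4, 3) := \matrix_(l, i) (nth 0 [:: h k1 k2 (row l c); h k2 k0 (row l c); h k0 k1 (row l c)] i / h k0 k1 k2).
pose c1 := c - A *m k.
have rc1 l : row l c1 = row l c - (h k1 k2 (row l c) / h k0 k1 k2) *: k0 - (h k2 k0 (row l c) / h k0 k1 k2) *: k1 - (h k0 k1 (row l c) / h k0 k1 k2) *: k2.
  by rewrite /c1 raddfB /= row_mul mul_rows_of3 !mxE /= !opprD !addrA.
have kc1 x y z : h (x *m k) (y *m k) (z *m c1) = 0.
  rewrite [z *m c1]mulmx_sum_row a_sum3 big1 // => l _; rewrite aZ3 rc1 !mul_rows_of3 -/k0 -/k1 -/k2.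
  move: (row l c) kz => cl kz0; clearbody k0 k1 k2; rewrite !aE !aalt13.
  have p1 : h k0 k2 k1 = - h k0 k1 k2 by rewrite aC23.
  have p2 : h k1 k0 k2 = - h k0 k1 k2 by rewrite aC12.
  have p3 : h k1 k2 k0 = h k0 k1 k2 by rewrite -a_rot.
  have p4 : h k2 k0 k1 = h k0 k1 k2 by rewrite a_rot.
  have p5 : h k2 k1 k0 = - h k0 k1 k2 by rewrite aC13.
  rewrite p1 p2 p3 p4 p5 (aC12 h k0 k2 cl) (aC12 h k1 k0 cl) (aC12 h k2 k1 cl).
  by field.
have W1 : c1 *m om h t *m c1^T = c *m om h t *m c^T.
  rewrite /c1 mulmxBl -(mulmxA A) kt0 mulmx0 subr0 linearB /= mulmxBr trmx_mul (mulmxA _ k^T) -(mulmxA c _ k^T) tk0.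
  by rewrite mulmx0 mul0mx subr0.
have [|a a0] := @kill_threeform _ h t c1; first by rewrite W1 -unitfE -unitmxE.
pose c2 := c1 + a *m t.
have tT : delta_mx 0 0 *m (col_mx t k : 'M_(4, 8)) = t.
  rewrite -rowE; apply/rowP=> j; rewrite mxE -(@col_mxEu _ 1 3 8 t k 0 j).
  by congr (col_mx _ _ _ _); apply: val_inj.
have kt y1 y2 : h t (y1 *m k) y2 = 0 by move: y2; apply/killP; rewrite /kill -mulmxA kt0 mulmx0.
have TE (v : 'rV_4) : exists r u, v *m (col_mx t k : 'M_(4, 8)) = r *: t + u *m k.
  exists ((lsubmx (v : 'rV_(1 + 3))) 0 0), (rsubmx (v : 'rV_(1 + 3))).
  by rewrite -mul_scalar_mx -mx11_scalar -(@mul_row_col _ 1 1 3) hsubmxK.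
exists (col_mx t k), c2; split=> //.
- apply: (@col_row_free _ 4 4 8) => u v E.
  have [|u0 v0] := @col_row_freeP _ 4 4 8 (col_mx t k) c (u + row_mx (v *m a) (- (v *m A))) v frc.
    rewrite -[RHS]E mulmxDl (@mul_row_col _ 1 1 3) mulNmx /c2 /c1 !mulmxDr mulmxN !mulmxA -!addrA.
    by congr (_ + _); rewrite addrA addrC; congr (_ + _); rewrite addrC.
  split=> //; rewrite v0 !mul0mx oppr0 in u0; rewrite -[RHS]u0 -[LHS]addr0; congr (_ + _).
  by rewrite (@row_mx0 _ 1 1 3).
- move=> x y z; have [r [u ->]] := TE x; have [r' [u' ->]] := TE y.
  rewrite /c2 mulmxDr mulmxA [z *m a]mx11_scalar mul_scalar_mx !aE !kt kc1 (aC12 h (u *m k) t) (a_rot h (u *m k) (u' *m k) t).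
  by rewrite !kt (aC12 h (u' *m k) t) !kt; ring.
- exists (delta_mx 0 0); rewrite tT; split=> [x y|].
    have [r [u ->]] := TE x; have [r' [u' ->]] := TE y.
    by rewrite !aE !kt; ring.
  rewrite /c2 mulmxDl -(mulmxA a) (killxx h t : t *m om h t = 0) mulmx0 addr0 linearD /= mulmxDr trmx_mul.
  have -> : c1 *m om h t *m (t^T *m a^T) = 0.
    rewrite (mulmxA _ t^T) -(mulmxA c1 _ t^T) -[om h t *m t^T]trmxK trmx_mul trmxK (altm_tr (om_altm h t)).
    by rewrite mulmxN (killxx h t : t *m om h t = 0) oppr0 trmx0 mulmx0 mul0mx.
  by rewrite addr0 W1.
have kin i : exists v : 'rV_4, v *m (col_mx t k : 'M_(4, 8)) = row i k.
  by exists (@row_mx K 1 1 3 0 (delta_mx 0 i)); rewrite (@mul_row_col _ 1 1 3) mul0mx add0r rowE.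
have [v0 e0] := kin i30; have [v1 e1] := kin i31; have [v2 e2] := kin i32.
by exists v0, v1, v2; rewrite e0 e1 e2.
Qed.

Definition mx2 (x : 'rV[K]_4) : 'M[K]_2 := \matrix_(i, j) x 0 (inord (2 * i + j)).
Definition vec2 (X : 'M[K]_2) : 'rV[K]_4 := \row_i X (inord (i %/ 2)) (inord (i %% 2)).

Lemma mx2K : cancel mx2 vec2.
Proof.
move=> x; apply/rowP; apply: ord4P; rewrite !mxE; congr (x _ _); by apply: val_inj; rewrite !inordK ?inordK.
Qed.
Lemma vec2K : cancel vec2 mx2.
Proof.
move=> X; apply/matrixP=> i j; rewrite !mxE; case: i => [[|[|//]] ?]; case: j => [[|[|//]] ?];
  by congr (X _ _); apply: val_inj; rewrite ?inordK //= ?inordK.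
Qed.

(** Both summands of K^2 + K^2 are isotropic and are paired by the 2 x 2 matrix of [x]. *)
Definition Om0 (x : 'rV[K]_4) : 'M[K]_4 := @block_mx K 2 2 2 2 0 (mx2 x) (- (mx2 x)^T) 0.

Lemma altm2 (A : 'M[K]_2) : altm A -> A 0 1 = 0 -> A = 0.
Proof.
move=> aA A01; have D i : A i i = 0 by apply: altm_diag.
have E i j : A i j = - A j i by rewrite -[in LHS](opprK A) -(altm_tr aA) !mxE.
apply/matrixP=> i j; rewrite [RHS]mxE; case: i => [[|[|//]] pi]; case: j => [[|[|//]] pj].
- by rewrite (_ : Ordinal pi = Ordinal pj) ?D //; apply: val_inj.
- by rewrite -[RHS]A01; congr (A _ _); apply: val_inj.
- by rewrite E -[RHS]oppr0 -A01; congr (- A _ _); apply: val_inj.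
- by rewrite (_ : Ordinal pi = Ordinal pj) ?D //; apply: val_inj.
Qed.

(** The four values are those of the form tr(X [Y, Z]) on 2 x 2 matrices, read by rows as in [mx2].
    The forms [Om x] share an isotropic plane [pp], and its pairing with a complement identifies [T]
    with the space of 2 x 2 matrices. *)
Lemma normal_form : exists T C : 'M[K]_(4, 8),
  let e i : 'rV_8 := delta_mx 0 (inord i) *m T in
  [/\ row_free (col_mx T C), forall x y z : 'rV_4, h (x *m T) (y *m T) (z *m C) = 0,
      forall x y z : 'rV_4, h (x *m C) (y *m C) (z *m C) = 0,
      forall x : 'rV_4, C *m om h (x *m T) *m C^T = Om0 x &
      [/\ h (e 0%N) (e 1%N) (e 2) = 1, h (e 0%N) (e 1%N) (e 3) = 0, h (e 0%N) (e 2) (e 3) = 0 & h (e 1%N) (e 2) (e 3) = -1]].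
Proof.
have [T [c [frTc TTc ccc [t [tTT utt]] [x0 [y0 [z0 TTT]]]]]] := split_form.
pose Om x := c *m om h (x *m T) *m c^T.
have OmD x y : Om (x + y) = Om x + Om y by rewrite /Om mulmxDl omD mulmxDr mulmxDl.
have OmZ a x : Om (a *: x) = a *: Om x by rewrite /Om -scalemxAl omZ -scalemxAr -scalemxAl.
have aOm x : altm (Om x) by apply/altm_cong/om_altm.
have OmE x y z : (y *m Om x *m z^T) 0 0 = h (x *m T) (y *m c) (z *m c).
  by rewrite -omE00 /Om trmx_mul !mulmxA.
have OmS x : Om x = \sum_i x 0 i *: Om (delta_mx 0 i).
  rewrite {1}[x]row_sum_delta; have Om0 : Om 0 = 0 by rewrite -[X in Om X](scale0r 0) OmZ scale0r.
  by rewrite (big_morph Om OmD Om0); apply: eq_bigr => i _; rewrite OmZ.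
have uO : Om t \in unitmx by [].
have OmDef x : c *m om h (x *m T) *m c^T = Om x by [].
clearbody Om; have [al [be [frab abO]]] := isotropic_pair (fun i => aOm (delta_mx 0 i)).
have ab0 x : al *m Om x *m be^T = 0.
  apply: mx11_eq; rewrite [RHS]mxE OmS mulmx_sumr mulmx_suml summxE big1 // => i _.
  by rewrite -scalemxAr -scalemxAl mxE abO mulr0.
have aa0 x (y : 'rV_4) : y *m Om x *m y^T = 0 by apply: aOm.
pose pp : 'M[K]_(2, 4) := col_mx al be.
have ppO x : pp *m Om x *m pp^T = 0.
  have ba0 : be *m Om x *m al^T = 0.
    by apply: trmx_inj; rewrite trmx0 !trmx_mul trmxK mulmxA (altm_tr (aOm x)) mulmxN mulNmx ab0 oppr0.
  by rewrite /pp (@tr_col_mx _ 1 1) (@mul_col_mx _ 1 1) (@mul_mx_row _ _ _ 1 1) !(@mul_col_mx _ 1 1) !aa0 ab0 ba0 !col_mx0 row_mx0.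
(* Otherwise [x *m T], [al *m c] and [be *m c] kill one another and h is degenerate. *)
have ppinj x : pp *m Om x = 0 -> x = 0.
  move=> ppx; apply/eqP/negPn/negP => x0'; apply: nd; exists (x *m T), (al *m c), (be *m c).
  have kx (p : 'rV_4) : p *m Om x = 0 -> kill h (x *m T) (p *m c).
    move=> px; apply/killP=> v; have /submxP[u ->] : (v <= col_mx T c)%MS.
      by apply: submx_full; rewrite /row_full (eqP frTc).
    rewrite -(@hsubmxK _ 1 4 4 u) mul_row_col aD3 aC23 TTc oppr0 add0r -OmE px mul0mx mxE //.
  have alx : al *m Om x = 0 /\ be *m Om x = 0.
    by move: ppx; rewrite /pp (@mul_col_mx _ 1 1) -(@col_mx0 _ 1 1) => /(@eq_col_mx _ 1 1)[].
  split; [|by apply/kx/alx.1|by apply/kx/alx.2|].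
    apply: rows3_free_pair frab; apply: (@col_row_free _ 1 4 8) => u v E.
    have [|ux v0] := col_row_freeP frTc (_ : u *m x *m T + v *m c = 0); first by rewrite -mulmxA.
    split=> //; move: ux; rewrite [u]mx11_scalar mul_scalar_mx => /eqP; rewrite scaler_eq0 (negPf x0') orbF.
    by move=> /eqP ->; rewrite raddf0.
  apply/killP=> v; have /submxP[u ->] : (v <= col_mx T c)%MS.
    by apply: submx_full; rewrite /row_full (eqP frTc).
  by rewrite -(@hsubmxK _ 1 4 4 u) mul_row_col aD3 ccc addr0 -a_rot -OmE ab0 mxE.
have [q0 /andP[frpq _]] := @basis_completion _ 2 2 4 pp erefl frab.
pose m := pp *m Om t *m q0^T.
have um : m \in unitmx.
  rewrite -row_free_unit; apply: inj_row_free => v vm.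
  have vO : v *m pp *m Om t = 0.
    have upq : col_mx pp q0 \in unitmx by rewrite -row_free_unit.
    apply: (can_inj (mulmxK (_ : (col_mx pp q0)^T \in unitmx))); first by rewrite unitmx_tr.
    rewrite mul0mx (@tr_col_mx _ 2 2) (@mul_mx_row _ _ _ 2 2) -!(mulmxA v) ppO -/m vm mulmx0 row_mx0 //.
  have : v *m pp = 0 by rewrite -[LHS](mulmxK uO) vO mul0mx.
  by move=> vp; apply: (row_free_inj frab); rewrite mul0mx.
(* Normalized so that [t] corresponds to the identity matrix. *)
pose p1 := invmx m *m pp.
have p1O x : p1 *m Om x *m p1^T = 0 by rewrite -(mulmx0 _ (invmx m)) -(mul0mx _ (invmx m)^T) -(ppO x) /p1 trmx_mul !mulmxA.
have p1t : p1 *m Om t *m q0^T = 1%:M by rewrite -(mulVmx um) /p1 /m !mulmxA.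
pose M : 'M[K]_4 := \matrix_i vec2 (p1 *m Om (delta_mx 0 i) *m q0^T).
have ME x : mx2 (x *m M) = p1 *m Om x *m q0^T.
  have mD (u v : 'rV_4) : mx2 (u + v) = mx2 u + mx2 v by apply/matrixP=> i j; rewrite !mxE.
  have m0 : mx2 0 = 0 by apply/matrixP=> i j; rewrite !mxE.
  have mZ a (u : 'rV_4) : mx2 (a *: u) = a *: mx2 u by apply/matrixP=> i j; rewrite !mxE.
  rewrite OmS mulmx_sumr mulmx_suml mulmx_sum_row (big_morph mx2 mD m0); apply: eq_bigr => i _.
  by rewrite mZ rowK vec2K -scalemxAr -scalemxAl.
have upq : col_mx pp q0 \in unitmx by rewrite -row_free_unit.
have uM : M \in unitmx.
  rewrite -row_free_unit; apply: inj_row_free => v vM; apply: ppinj.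
  have := ME v; rewrite vM => E0; have {}E0 : p1 *m Om v *m q0^T = 0.
    by rewrite -E0; apply/matrixP=> i j; rewrite !mxE.
  apply: (can_inj (mulmxK (_ : (col_mx pp q0)^T \in unitmx))); first by rewrite unitmx_tr.
  rewrite mul0mx (@tr_col_mx _ 2 2) (@mul_mx_row _ _ _ 2 2) ppO.
  have -> : pp *m Om v *m q0^T = m *m (p1 *m Om v *m q0^T) by rewrite /p1 !mulmxA mulmxV // mul1mx.
  by rewrite E0 mulmx0 row_mx0.
pose T1 := invmx M *m T.
pose Om1 x := Om (x *m invmx M); have Om1E x : Om1 x = Om (x *m invmx M) by [].
have aO1 x : altm (Om1 x) by apply: aOm.
have p1O1 x : p1 *m Om1 x *m p1^T = 0 by apply: p1O.
have Om1Def x : c *m om h (x *m T1) *m c^T = Om1 x by rewrite Om1E -OmDef mulmxA.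
have pq1 x : p1 *m Om1 x *m q0^T = mx2 x by rewrite Om1E -ME mulmxKV.
have Om1D x y : Om1 (x + y) = Om1 x + Om1 y by rewrite !Om1E mulmxDl OmD.
have Om1Z a x : Om1 (a *: x) = a *: Om1 x by rewrite !Om1E -scalemxAl OmZ.
clearbody Om1.
pose r0 := row 0 q0; pose r1 := row 1 q0.
pose s (x : 'rV_4) := (q0 *m Om1 x *m q0^T) 0 1.
(* The only entry [s x] of the alternating block on [q0] is linear in x; adding [G *m p1] to [q0]
   cancels it. *)
pose G : 'M[K]_2 := \matrix_(i, j) (if i == 0 then - s (delta_mx 0 (inord (2 * j + 1))) else s (delta_mx 0 (inord (2 * j)))).
have sD x y : s (x + y) = s x + s y by rewrite /s Om1D mulmxDr mulmxDl mxE.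
have sZ a x : s (a *: x) = a * s x by rewrite /s Om1Z -scalemxAr -scalemxAl mxE.
have s0 : s 0 = 0 by rewrite -[X in s X](scale0r 0) sZ mul0r.
pose q1 := q0 + G *m p1.
have pq x : p1 *m Om1 x *m q1^T = mx2 x.
  by rewrite /q1 linearD /= mulmxDr pq1 trmx_mul mulmxA p1O1 mul0mx addr0.
have qp x : q1 *m Om1 x *m p1^T = - (mx2 x)^T.
  by rewrite -pq !trmx_mul !trmxK mulmxA (altm_tr (aO1 _)) mulmxN mulNmx opprK.
have qq x : q1 *m Om1 x *m q1^T = 0.
  apply: altm2; first exact/altm_cong.
  have -> : q1 *m Om1 x *m q1^T = q0 *m Om1 x *m q0^T - (mx2 x)^T *m G^T + G *m mx2 x.
    have E : q0 *m Om1 x *m p1^T = - (mx2 x)^T.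
      by rewrite -pq1 !trmx_mul !trmxK mulmxA (altm_tr (aO1 _)) mulmxN mulNmx opprK.
    rewrite -mulNmx -E -pq {1}/q1 !mulmxDl !mulmxA; congr (_ + _).
    by rewrite /q1 linearD /= mulmxDr trmx_mul !mulmxA.
  have -> : (q0 *m Om1 x *m q0^T - (mx2 x)^T *m G^T + G *m mx2 x) 0 1 = s x - ((mx2 x)^T *m G^T) 0 1 + (G *m mx2 x) 0 1.
    by rewrite [LHS]mxE [X in X + _]mxE [X in _ + X + _]mxE.
  rewrite {1}[x]row_sum_delta (big_morph s sD s0); under eq_bigr do rewrite sZ.
  rewrite sum4 !mxE !big_ord_recl !big_ord0 !mxE /= !addr0.
  by ring.
pose E i : 'rV[K]_8 := delta_mx 0 (inord i) *m T1.
pose lam := h (E 0%N) (E 1%N) (E 2).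
have T1T x : x *m T1 = (x *m invmx M) *m T by rewrite mulmxA.
have TT1 x : x *m T = (x *m M) *m T1 by rewrite /T1 mulmxA mulmxK.
(* The identity matrix lies in the radical of the 3-form on [T], which leaves the single unknown
   value [lam]. *)
have tE : t *m T = E 0%N + E 3.
  rewrite TT1 /E -mulmxDl; congr (_ *m _).
  apply: (can_inj mx2K); rewrite ME p1t; apply/matrixP=> i j; rewrite !mxE.
  by case: i => [[|[|//]] ?]; case: j => [[|[|//]] ?]; rewrite /= -!val_eqE /= !inordK //= ?addr0 ?add0r.
have tk x y : h (E 0%N + E 3) (x *m T1) (y *m T1) = 0 by rewrite -tE !T1T tTT.
have f013 : h (E 0%N) (E 1%N) (E 3) = 0.
  by have := tk (delta_mx 0 (inord 0)) (delta_mx 0 (inord 1)); rewrite aD1 aalt12 add0r a_rot.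
have f023 : h (E 0%N) (E 2) (E 3) = 0.
  by have := tk (delta_mx 0 (inord 0)) (delta_mx 0 (inord 2)); rewrite aD1 aalt12 add0r a_rot.
have f123 : h (E 1%N) (E 2) (E 3) = - lam.
  have /eqP := tk (delta_mx 0 (inord 1)) (delta_mx 0 (inord 2)).
  by rewrite aD1 addrC (a_rot h (E 3)) addr_eq0 => /eqP.
have lam0 : lam != 0.
  apply: contraNneq TTT => l0; rewrite !TT1 pull_basis_zero //.
  by apply: ord4_triple; rewrite !rowE -!/(E _) // f123 l0 oppr0.
(* Scaling [T] by [mu] and [p1] by its inverse preserves the pairing and multiplies the 3-form on
   [T] by mu ^ 3. *)
have [mu muE] : exists mu, mu ^+ 3 * lam = 1.
  have : size (lam *: 'X^3 - 1 : {poly K}) != 1%N.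
    by rewrite size_polyDl size_scale ?size_polyXn // size_polyN size_poly1.
  move/closed_rootP=> [mu /eqP]; rewrite !hE => /eqP; rewrite subr_eq0 => /eqP e.
  by exists mu; rewrite mulrC -[RHS]e.
have mu0 : mu != 0 by apply: contra_eq_neq muE => ->; rewrite expr0n mul0r eq_sym oner_eq0.
pose cc : 'M[K]_4 := @col_mx _ 2 2 4 (mu^-1 *: p1) q1.
exists (mu *: T1), (cc *m c); split.
- apply: col_row_free => u v; rewrite -scalemxAr scalemxAl T1T mulmxA => /(col_row_freeP frTc)[u0 v0].
  have {}u0 : u = 0.
    apply: (scalerI mu0); rewrite scaler0 -[LHS](mulmxK (_ : invmx M \in unitmx)) ?unitmx_inv //.
    by rewrite u0 mul0mx.
  split=> //; move: v0; rewrite -(@hsubmxK _ 1 2 2 v) /cc (@mul_row_col _ 1 2 2).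
  move: (lsubmx _) (rsubmx _) => v1 v2; rewrite /q1 mulmxDr addrCA addrC /p1 -scalemxAr !mulmxA scalemxAl scalemxAl -mulmxDl.
  case/(col_row_freeP frpq) => e1 e2; move: e1; rewrite e2 !mul0mx addr0 => e1.
  suff -> : v1 = 0 by rewrite (@row_mx0 _ 1 2 2).
  move/(congr1 (mulmx^~ m)): e1; rewrite mulmxKV // mul0mx => /eqP.
  by rewrite scaler_eq0 invr_eq0 (negPf mu0) => /eqP.
- by move=> x y z; rewrite -!scalemxAr !T1T mulmxA !aE TTc !mulr0.
- by move=> x y z; rewrite !mulmxA ccc.
- move=> x; have -> : cc *m c *m om h (x *m (mu *: T1)) *m (cc *m c)^T = mu *: (cc *m Om1 x *m cc^T).
    by rewrite -scalemxAr omZ trmx_mul -Om1Def -scalemxAr -scalemxAl !mulmxA.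
  rewrite /cc (@tr_col_mx _ 2 2) (@mul_col_mx _ 2 2) (@mul_mx_row _ _ _ 2 2) !(@mul_col_mx _ 2 2).
  have b1 : (mu^-1 *: p1) *m Om1 x *m (mu^-1 *: p1)^T = 0.
    by rewrite [_^T]linearZ /= -scalemxAr -!scalemxAl p1O1 !scaler0.
  have b2 : (mu^-1 *: p1) *m Om1 x *m q1^T = mu^-1 *: mx2 x by rewrite -!scalemxAl pq.
  have b3 : q1 *m Om1 x *m (mu^-1 *: p1)^T = mu^-1 *: - (mx2 x)^T by rewrite [_^T]linearZ /= -scalemxAr qp.
  rewrite b1 b2 b3 qq (@scale_row_mx _ 4 2 2) !(@scale_col_mx _ 2 2 2) /Om0 (@block_mxEh _ 2 2 2 2) !scaler0.
  by rewrite !scalerA mulfV // !scale1r.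
by rewrite -!scalemxAr !aE -!/(E _) f013 f023 f123 -muE !mulr0 -!/lam; split=> //; ring.
Qed.

End Normalization.

Lemma single_orbit (h h' : alt3 K 8) : ~ degenerate h -> ~ degenerate h' ->
  exists2 N : 'M[K]_8, N \in unitmx & forall x y z, h' x y z = h (x *m N) (y *m N) (z *m N).
Proof.
move=> nd nd'; have [T [C [fr TTC CCC CO [v1 v2 v3 v4]]]] := normal_form nd.
have [T' [C' [fr' TTC' CCC' CO' [v1' v2' v3' v4']]]] := normal_form nd'.
have uB : (col_mx T C : 'M_8) \in unitmx by rewrite -row_free_unit.
have uB' : (col_mx T' C' : 'M_8) \in unitmx by rewrite -row_free_unit.
have expand (g : alt3 K 8) (S D : 'M_(4, 8)) (a a' b b' d d' : 'rV_4) :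
    (forall x y z : 'rV_4, g (x *m S) (y *m S) (z *m D) = 0) ->
    (forall x y z : 'rV_4, g (x *m D) (y *m D) (z *m D) = 0) ->
  g (a *m S + a' *m D) (b *m S + b' *m D) (d *m S + d' *m D) =
  g (a *m S) (b *m S) (d *m S) + g (a *m S) (b' *m D) (d' *m D)
    - g (b *m S) (a' *m D) (d' *m D) + g (d *m S) (a' *m D) (b' *m D).
  move=> SSD DDD; rewrite !aE SSD DDD (aC23 g (a *m S) (b' *m D) (d *m S)) SSD (a_rot g (a' *m D) (b *m S) (d *m S)) SSD.
  rewrite (aC12 g (a' *m D) (b *m S)) (a_rot g (a' *m D) (b' *m D) (d *m S)) (a_rot g (b' *m D) (d *m S)).
  by ring.
pose N := invmx (col_mx T' C') *m (col_mx T C : 'M_8).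
exists N; first by rewrite unitmx_mul unitmx_inv uB'.
move=> x y z; rewrite /N !mulmxA.
have xE (v : 'rV_8) : v = (v *m invmx (col_mx T' C')) *m (col_mx T' C' : 'M_8) by rewrite mulmxKV.
rewrite {1}(xE x) {1}(xE y) {1}(xE z).
move: (x *m _) (y *m _) (z *m _) => a b d.
rewrite -(@hsubmxK _ 1 4 4 a) -(@hsubmxK _ 1 4 4 b) -(@hsubmxK _ 1 4 4 d) !(@mul_row_col _ 1 4 4) !expand //.
have E1 (p q r : 'rV_4) : h' (p *m T') (q *m C') (r *m C') = h (p *m T) (q *m C) (r *m C).
  have E (g : alt3 K 8) (S D : 'M_(4, 8)) : g (p *m S) (q *m D) (r *m D) = (q *m (D *m om g (p *m S) *m D^T) *m r^T) 0 0.
    by rewrite -omE00 trmx_mul !mulmxA.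
  by rewrite !E CO CO'.
have E0 (p q r : 'rV_4) : h' (p *m T') (q *m T') (r *m T') = h (p *m T) (q *m T) (r *m T).
  rewrite -!pullE; apply: alt3_ext; apply: ord4_triple; rewrite !pullE.
  - by rewrite v1 v1'.
  - by rewrite v2 v2'.
  - by rewrite v3 v3'.
  by rewrite v4 v4'.
by rewrite E0 !E1.
Qed.

Lemma f_nondegenerate (f : {mpoly int[#|{: triple 8}|]}) (w : ext3 K 8) : is_hyperdiscriminant f ->
  ~ degenerate (tri w) -> f_eval f w != 0.
Proof.
move=> hf nd; have [w' w'0] := f_eval_neq0 hf K.
have nd' : ~ degenerate (tri w') by move/(f_degenerate hf)/eqP; apply/negP.
have [N uN NE] := single_orbit nd nd'.
suff E : w' = ext3_map N^T w.
  by apply: contraNneq w'0 => w0; rewrite E f_eval_GL ?w0 ?mulr0 // det_tr -unitfE -unitmxE.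
rewrite -[LHS]ext3_of_tri -[RHS]ext3_of_tri; apply: ext3_of_eq => x y z.
by rewrite tri_ext3_map trmxK.
Qed.

End Tools.

(** * The sextic equation of D *)

(* [v] is the tangent hyperplane at [x] if [om g x] has rank 6, and a limit of tangent hyperplanes if it has rank 4. *)
Definition incident (K : fieldType) (g : alt3 K 9) (x v : 'rV[K]_9) := exists a b : 'rV[K]_9,
  [/\ row_free (rows3 x a b), kill g x a, kill g x b &
      exists2 c, c != 0 & forall y, g a b y = c * (v *m y^T) 0 0].

Section DLocus.
Variables (K : closedFieldType) (f : {mpoly int[#|{: triple 8}|]}).
Hypothesis hf : is_hyperdiscriminant f.
Variables (w : ext3 K 9).
Local Notation g := (tri w).
Hypothesis S1 : forall x a b : 'rV[K]_9, row_free (rows3 x a b) -> kill g x a -> kill g x b -> ~ kill g a b.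

Definition Dpt (v : 'rV[K]_9) := exists x, incident g x v.

Lemma rows3_free0 n (x a b : 'rV[K]_n) : row_free (rows3 x a b) ->
  forall r s t, r *: x + s *: a + t *: b = 0 -> [/\ r = 0, s = 0 & t = 0].
Proof.
move=> fr r s t E; pose v : 'rV[K]_3 := \row_i nth 0 [:: r; s; t] i.
have v0 : v = 0 by apply: (row_free_inj fr); rewrite mul0mx mul_rows3 !mxE.
have H (i : 'I_3) : v 0 i = 0 by rewrite v0 mxE.
by have := H i30; have := H i31; have := H i32; rewrite !mxE.
Qed.

Lemma perp_functional n (v u : 'rV[K]_n) : v != 0 ->
  (forall y : 'rV_n, (v *m y^T) 0 0 = 0 -> (u *m y^T) 0 0 = 0) -> exists c, u = c *: v.
Proof.
move=> v0 H; suff /sub_rVP[c ->] : (u <= v)%MS by exists c.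
rewrite submxE; apply/eqP; apply/matrixP=> i j; rewrite ord1 [RHS]mxE.
pose y := (col j (cokermx v))^T; have := H y; rewrite trmxK => E.
have -> : (u *m cokermx v) 0 j = (u *m col j (cokermx v)) 0 0 by rewrite !mxE; apply: eq_bigr => l _; rewrite !mxE.
by apply: E; rewrite colE mulmxA mulmx_coker mul0mx mxE.
Qed.

(** The rows of [M^T] span the hyperplane orthogonal to [v]. A degenerate triple of the projected
    trivector consists of three vectors of this hyperplane whose pairwise contractions with [g] are
    multiples of [v]. *)
Lemma D_eval (v : 'rV[K]_9) (M : 'M[K]_(9, 8)) : v != 0 -> \rank M = 8%N -> v *m M = 0 ->
  f_eval f (ext3_map M w) = 0 <-> Dpt v.
Proof.
move=> v0 rM vM.
have frM : row_free M^T by rewrite /row_free mxrank_tr rM.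
have kM : (M^T :=: kermx v^T)%MS.
  have sub : (M^T <= kermx v^T)%MS by apply/sub_kermxP; rewrite -trmx_mul vM trmx0.
  apply/eqmxP; rewrite sub /=; apply: submx_rank_ge sub _.
  by rewrite mxrank_ker !mxrank_tr rank_rV v0 rM.
have perp y : (v *m y^T) 0 0 = 0 -> exists z : 'rV_8, y = z *m M^T.
  move=> vy; apply/submxP; rewrite kM; apply/sub_kermxP; apply: trmx_inj.
  by rewrite trmx_mul trmxK trmx0; apply: mx11_eq; rewrite vy mxE.
have perpM (z : 'rV_8) : (v *m (z *m M^T)^T) 0 0 = 0.
  by rewrite trmx_mul trmxK mulmxA vM mul0mx mxE.
have -> : f_eval f (ext3_map M w) = 0 <-> degenerate (tri (ext3_map M w)).
  split; last exact: f_degenerate.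
  by move=> f0; apply: NNPP => nd; have := f_nondegenerate hf nd; rewrite f0 eqxx.
split=> [[u1 [u2 [u3 [fru k12 k13 k23]]]]|[x [a [b [fr xa xb [c c0 ab]]]]]]; last first.
  have xab y : g a b y = 0 -> (v *m y^T) 0 0 = 0.
    by rewrite ab => /eqP; rewrite mulf_eq0 (negPf c0) => /eqP.
  have [x' x'E] : exists z : 'rV_8, x = z *m M^T.
    by apply/perp/xab; rewrite -a_rot (killP g x a).1.
  have [a' a'E] : exists z : 'rV_8, a = z *m M^T by apply/perp/xab; rewrite aalt13.
  have [b' b'E] : exists z : 'rV_8, b = z *m M^T by apply/perp/xab; rewrite aalt23.
  exists x', a', b'; split.
  - apply: rows3_freeP => r s t E; apply: (rows3_free0 fr).
    by rewrite x'E a'E b'E !scalemxAl -!mulmxDl E mul0mx.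
  - by apply/killP=> z; rewrite tri_ext3_map -x'E -a'E (killP g x a).1.
  - by apply/killP=> z; rewrite tri_ext3_map -x'E -b'E (killP g x b).1.
  by apply/killP=> z; rewrite tri_ext3_map -a'E -b'E ab perpM mulr0.
pose x := u1 *m M^T; pose a := u2 *m M^T; pose b := u3 *m M^T.
have fr : row_free (rows3 x a b).
  apply: rows3_freeP => r s t; rewrite /x /a /b !scalemxAl -!mulmxDl => E; apply: (rows3_free0 fru).
  by apply: (row_free_inj frM); rewrite mul0mx.
have cE p q (kpq : kill (tri (ext3_map M w)) p q) :
    exists c, forall y, g (p *m M^T) (q *m M^T) y = c * (v *m y^T) 0 0.
  pose u : 'rV_9 := \row_i g (p *m M^T) (q *m M^T) (delta_mx 0 i).
  have uE y : g (p *m M^T) (q *m M^T) y = (u *m y^T) 0 0.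
    rewrite {1}(row_sum_delta y) a_sum3 mxE; apply: eq_bigr => i _.
    by rewrite aZ3 !mxE mulrC.
  have [y /perp[z ->]|c uv] := @perp_functional _ v u v0.
    by rewrite -uE -tri_ext3_map (killP (tri (ext3_map M w)) p q).1.
  by exists c => y; rewrite uE uv -scalemxAl mxE.
have [c1 e1] := cE _ _ k12; have [c2 e2] := cE _ _ k13; have [c3 e3] := cE _ _ k23.
rewrite -/x -/a -/b in e1 e2 e3; move: fr e1 e2 e3; move: x a b => x a b fr e1 e2 e3.
have dpt p q r (c : K) : row_free (rows3 p q r) -> kill g p q -> kill g p r ->
    (forall y, g q r y = c * (v *m y^T) 0 0) -> Dpt v.
  move=> fr' pq pr E; exists p, q, r; split=> //; exists c => //.
  by apply: contra_notN (S1 fr' pq pr) => /eqP c0; apply/killP => z; rewrite E c0 mul0r.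
(* With [c1], [c2], [c3] the multiples of [v] coming from (x, a), (x, b), (a, b), this vector is
   killed by [x], [a] and [b]. If some coefficient is non-zero, [x'] with the corresponding pair
   witnesses incidence; all three cannot vanish by [S1]. *)
pose x' := c3 *: x - c2 *: a + c1 *: b.
have e1' y : g a x y = - (c1 * (v *m y^T) 0 0) by rewrite aC12 e1.
have e2' y : g b x y = - (c2 * (v *m y^T) 0 0) by rewrite aC12 e2.
have e3' y : g b a y = - (c3 * (v *m y^T) 0 0) by rewrite aC12 e3.
have kx : kill g x' x by apply/killP=> y; rewrite /x' !aE e1' e2'; ring.
have ka : kill g x' a by apply/killP=> y; rewrite /x' !aE e1 e3'; ring.
have kb : kill g x' b by apply/killP=> y; rewrite /x' !aE e2 e3; ring.
have [c30|c30] := eqVneq c3 0; last first.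
  apply: (dpt x' a b c3) => //; apply: rows3_freeP => r s t E.
  have [|r0 s0 t0] := rows3_free0 fr (r := r * c3) (s := s - r * c2) (t := t + r * c1).
    by rewrite -[RHS]E /x' !scalerDr !scalerDl !scalerN !scalerA !scaleNr; apply/rowP=> i; rewrite !mxE; ring.
  have {}r0 : r = 0 by apply/eqP; move/eqP: r0; rewrite mulf_eq0 (negPf c30) orbF.
  by move: s0 t0; rewrite r0 !mul0r subr0 addr0.
have [c20|c20] := eqVneq c2 0; last first.
  apply: (dpt x' x b c2) => //; apply: rows3_freeP => r s t E.
  have [|r0 s0 t0] := rows3_free0 fr (r := s) (s := - (r * c2)) (t := t + r * c1).
    by rewrite -[RHS]E /x' c30 !scalerDr !scalerDl !scalerN !scalerA !scaleNr; apply/rowP=> i; rewrite !mxE; ring.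
  have {}s0 : r = 0 by apply/eqP; move/eqP: s0; rewrite oppr_eq0 mulf_eq0 (negPf c20) orbF.
  by move: t0; rewrite s0 !mul0r addr0.
have [c10|c10] := eqVneq c1 0; last first.
  apply: (dpt x' x a c1) => //; apply: rows3_freeP => r s t E.
  have [|r0 s0 t0] := rows3_free0 fr (r := s) (s := t) (t := r * c1).
    by rewrite -[RHS]E /x' c30 c20; apply/rowP=> i; rewrite !mxE; ring.
  by split=> //; apply/eqP; move/eqP: t0; rewrite mulf_eq0 (negPf c10) orbF.
by apply: (dpt x a b c3) => //; apply/killP => y; rewrite ?e1 ?e2 ?c10 ?c20 mul0r.
Qed.

Definition M0 (R : comNzRingType) (v : 'rV[R]_9) : 'M[R]_(9, 8) :=
  @col_mx _ 1 8 8 (- @rsubmx _ 1 1 8 v) (v 0 0)%:M.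
Definition T_ (R : comNzRingType) i : 'M[R]_9 := perm_mx (perm.tperm ord0 i).
(* A matrix of the projection along [v] that is linear in [v], of rank 8 where [v 0 i != 0]. *)
Definition chart (R : comNzRingType) i (v : 'rV[R]_9) := T_ R i *m M0 (v *m T_ R i).

Lemma T_T (R : comNzRingType) i : T_ R i *m T_ R i = 1%:M.
Proof. by rewrite /T_ -perm_mxM perm.tperm2 perm_mx1. Qed.

Lemma T_0 (R : comNzRingType) i (v : 'rV[R]_9) : (v *m T_ R i) 0 0 = v 0 i.
Proof. by rewrite /T_ -perm.tpermV -col_permE mxE perm.tpermL. Qed.

Lemma chart_rmorph (A B : comNzRingType) (h : {rmorphism A -> B}) i (v : 'rV[A]_9) :
  map_mx h (chart i v) = chart i (map_mx h v).
Proof.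
have M0E (u : 'rV_9) : map_mx h (M0 u) = M0 (map_mx h u).
  by rewrite /M0 (@map_col_mx _ _ h 1 8 8) map_mxN map_scalar_mx map_rsubmx mxE.
by rewrite /chart /T_ map_mxM map_perm_mx M0E map_mxM map_perm_mx.
Qed.

Lemma chartZ (R : comNzRingType) i t (v : 'rV[R]_9) : chart i (t *: v) = t *: chart i v.
Proof.
rewrite /chart -scalemxAl [in RHS]scalemxAr; congr (T_ R i *m _).
by rewrite /M0 (@scale_col_mx _ 1 8 8) scale_scalar_mx mxE [@rsubmx _ 1 1 8 (t *: _)]linearZ /= scalerN.
Qed.

Lemma mul_chart (R : comNzRingType) i (v : 'rV[R]_9) : v *m chart i v = 0.
Proof.
rewrite /chart mulmxA; set u := v *m _; rewrite /M0 -{1}(@hsubmxK _ 1 1 8 u) (@mul_row_col _ 1 1 8).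
rewrite [@lsubmx _ 1 1 8 u]mx11_scalar mul_scalar_mx mul_mx_scalar scalerN mxE.
by have -> : @lshift 1 8 0 = 0; [apply: val_inj|rewrite addNr].
Qed.

Lemma det_M0 (v : 'rV[K]_9) (y : 'cV[K]_9) : v 0 0 != 0 ->
  \det (@row_mx _ 9 1 8 y (M0 v)) = v 0 0 ^+ 7 * (v *m y) 0 0.
Proof.
move=> v0; pose y1 := @usubmx _ 1 8 1 y; pose y2 := @dsubmx _ 1 8 1 y; pose v' := @rsubmx _ 1 1 8 v.
have -> : @row_mx _ 9 1 8 y (M0 v) = @block_mx _ 1 8 1 8 y1 (- v') y2 (v 0 0)%:M.
  by rewrite (@block_mxEh _ 1 8 1 8) vsubmxK.
have : \det (@block_mx _ 1 8 1 8 y1 (- v') y2 (v 0 0)%:M *m @block_mx _ 1 8 1 8 1%:M 0 (- ((v 0 0)^-1 *: y2)) 1%:M)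
   = v 0 0 ^+ 7 * (v *m y) 0 0.
  rewrite (@mulmx_block _ 1 8 1 8 1 8) !mulmx1 !mulmx0 !add0r mulNmx mulmxN opprK -scalemxAr.
  rewrite mulmxN mul_scalar_mx scalerA mulfV // scale1r subrr.
  rewrite (@det_ublock _ 1 8) det_mx11 det_scalar mxE [in X in _ + X]mxE.
  have -> : v *m y = @lsubmx _ 1 1 8 v *m y1 + v' *m y2 by rewrite -(@mul_row_col _ 1 1 8) hsubmxK vsubmxK.
  rewrite [in RHS]mxE [@lsubmx _ 1 1 8 v]mx11_scalar mul_scalar_mx [in RHS]mxE.
  have -> : @lsubmx _ 1 1 8 v 0 0 = v 0 0 by rewrite mxE; congr (v _ _); apply: val_inj.
  by rewrite exprS; field.
by rewrite det_mulmx (@det_lblock _ 1 8) !det1 !mulr1.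
Qed.

Lemma det_chart i (v : 'rV[K]_9) (y : 'cV[K]_9) : v 0 i != 0 ->
  \det (@row_mx _ 9 1 8 y (chart i v)) ^+ 2 = v 0 i ^+ 14 * (v *m y) 0 0 ^+ 2.
Proof.
move=> vi; have -> : @row_mx _ 9 1 8 y (chart i v) = T_ K i *m @row_mx _ 9 1 8 (T_ K i *m y) (M0 (v *m T_ K i)).
  by rewrite (@mul_mx_row _ _ _ 1 8) mulmxA T_T mul1mx.
rewrite det_mulmx exprMn [\det (T_ _ _) ^+ 2]expr2 -det_mulmx T_T det1 mul1r.
by rewrite det_M0 T_0 // mulmxA -(mulmxA v) T_T mulmx1 exprMn -exprM.
Qed.

Lemma rank_chart i (v : 'rV[K]_9) : v 0 i != 0 -> \rank (chart i v) = 8%N.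
Proof.
move=> vi; have := det_chart (delta_mx i 0) vi; rewrite -colE mxE => E.
have fu : row_free (@row_mx _ 9 1 8 (delta_mx i 0) (chart i v)).
  by rewrite row_free_unit unitmxE unitfE -sqrf_eq0 E mulf_neq0 // expf_neq0.
apply/eqP; rewrite eqn_leq rank_leq_col /=.
have := mxrank_tr (@row_mx _ 9 1 8 (delta_mx i 0) (chart i v)); rewrite (eqP fu) (@tr_row_mx _ 9 1 8) -addsmxE => E'.
have := mxrank_adds_leqif (delta_mx i 0 : 'cV[K]_9)^T (chart i v)^T => -[le _].
move: le; rewrite E' mxrank_tr; have := rank_leq_row (delta_mx i 0 : 'cV[K]_9)^T.
by rewrite !mxrank_tr; move: (\rank _) (\rank _); clear; lia.
Qed.

(** Two charts differ by a matrix [D] with (\det D) ^ 2 = (v_j / v_i) ^ 14, and the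
    hyperdiscriminant scales by (\det D) ^ 6; hence the exponent 3 * 14 = 42. *)
Lemma chart_eval i j (v : 'rV[K]_9) : v 0 i != 0 -> v 0 j != 0 ->
  f_eval f (ext3_map (chart j v) w) * v 0 i ^+ 42 = f_eval f (ext3_map (chart i v) w) * v 0 j ^+ 42.
Proof.
move=> vi vj; have v0 : v != 0 by apply: contraNneq vi => ->; rewrite mxE.
have sub l : v 0 l != 0 -> ((chart l v)^T :=: kermx v^T)%MS.
  move=> vl; have s : ((chart l v)^T <= kermx v^T)%MS by apply/sub_kermxP; rewrite -trmx_mul mul_chart trmx0.
  apply/eqmxP; rewrite s /=; apply: submx_rank_ge s _.
  by rewrite mxrank_ker !mxrank_tr rank_rV v0 rank_chart.
have /submxP[D DE] : ((chart j v)^T <= (chart i v)^T)%MS by rewrite !sub.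
have NE : chart j v = chart i v *m D^T by rewrite -[LHS]trmxK DE trmx_mul trmxK.
have dD : \det D ^+ 2 * v 0 i ^+ 14 = v 0 j ^+ 14.
  have E : @row_mx _ 9 1 8 (delta_mx i 0) (chart j v) =
     @row_mx _ 9 1 8 (delta_mx i 0) (chart i v) *m @block_mx _ 1 8 1 8 1%:M 0 0 D^T.
    by rewrite (@mul_row_block _ 9 1 8 1 8) !mulmx0 mulmx1 addr0 add0r NE.
  have := congr1 (fun A => \det A ^+ 2) E; rewrite det_mulmx exprMn !det_chart // (@det_ublock _ 1 8) det1 mul1r det_tr.
  rewrite -colE mxE => E2; apply: (mulIf (_ : v 0 i ^+ 2 != 0)); first by rewrite expf_neq0.
  by rewrite E2; ring.
have d0 : \det D != 0.
  by apply: contra_eq_neq dD => ->; rewrite expr0n mul0r eq_sym expf_neq0.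
rewrite NE -ext3_map_comp f_eval_GL ?det_tr //.
have -> : v 0 j ^+ 42 = (\det D ^+ 2 * v 0 i ^+ 14) ^+ 3 by rewrite dD -exprM.
by ring.
Qed.

Lemma D_locusE v : D_locus f w v <-> v != 0 /\ Dpt v.
Proof.
split=> [[v0 [M [rM vM fM]]]|[v0 Dv]]; first by split=> //; apply/(D_eval v0 rM vM).
split=> //; have /rV0Pn[i vi] := v0; exists (chart i v).
split; [exact: rank_chart|exact: mul_chart|].
by apply/(D_eval v0 (rank_chart vi) (mul_chart i v)).
Qed.

(** A chart is linear in [v], the action is cubic and f has degree 16: this gives degree 48, from
    which the comparison of charts splits off the factor X_i ^ 42. The quotient is the same for all
    charts. *)
Lemma D_equation (k : fieldType) (iota : {rmorphism k -> K}) (w0 : ext3 k 9) : w = ext3_base_change iota w0 ->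
  exists r : {mpoly k[9]}, r \is 6.-homog /\
    forall v : 'rV[K]_9, v != 0 -> (map_mpoly iota r).@[v 0] = 0 <-> Dpt v.
Proof.
move=> wE; pose X : 'rV[{mpoly k[9]}]_9 := \row_i 'X_i.
have [N N42] : exists N, N = 42%N by exists 42%N.
have [H [HE cE]] : exists H : 'I_9 -> 'rV[K]_9 -> K, (forall i v, f_eval f (ext3_map (chart i v) w) = H i v) /\
    forall i j (v : 'rV[K]_9), v 0 i != 0 -> v 0 j != 0 -> H j v * v 0 i ^+ N = H i v * v 0 j ^+ N.
  by exists (fun i v => f_eval f (ext3_map (chart i v) w)); split; [move=> i v; reflexivity|move=> i j v vi vj; rewrite N42; exact: chart_eval].
have [G GE] : exists G : 'I_9 -> {mpoly k[9]}, forall v i, ev iota v (G i) = H i v.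
  exists (fun i => f_eval f (ext3_map (chart i X) (ext3_mapr (@mpolyC 9 k) w0))) => v i.
  have EX : map_mx (ev iota v) X = v by apply/rowP=> j; rewrite !mxE /= map_mpolyXm mevalXU.
  have Ew : ext3_mapr (ev iota v) (ext3_mapr (@mpolyC 9 k) w0) = w.
    by apply/ffunP=> t; rewrite wE !ffunE /= map_mpolyC mevalC.
  by rewrite f_eval_rmorph -HE; rewrite ext3_map_rmorph; rewrite chart_rmorph EX Ew.
have evX v j : ev iota v 'X_j = v 0 j by rewrite /= map_mpolyXm mevalXU.
have X0 j : 'X_j != 0 :> {mpoly k[9]} by rewrite -msupp_eq0 msuppX.
have Gij i j : G j * 'X_i ^+ N = G i * 'X_j ^+ N.
  apply: (mulIf (X0 i)); apply: (mulIf (X0 j)); apply: (@ev_inj _ _ iota) => v.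
  move: (ev iota v) (GE v) (evX v) => e Ge eX.
  have eM p a b n : e (p * a ^+ n * a * b) = e p * e a ^+ n * e a * e b by rewrite !rmorphM rmorphXn.
  have eM' p a b n : e (p * a ^+ n * b * a) = e p * e a ^+ n * e b * e a by rewrite !rmorphM rmorphXn.
  apply: (etrans (eM _ _ _ _)); apply/esym; apply: (etrans (eM' _ _ _ _)); apply/esym.
  rewrite (eX i) (eX j) (Ge i) (Ge j).
  have [->|vi] := eqVneq (v 0 i) 0; first by rewrite !(mulr0, mul0r).
  have [->|vj] := eqVneq (v 0 j) 0; first by rewrite !(mulr0, mul0r).
  by rewrite (cE i j).
have [r rE] : exists r, G 0 = r * 'X_[U_(0%R : 'I_9) *+ N].
  apply: (mpoly_div_monomial (m1 := (U_(1%R : 'I_9) *+ N)%MM) (q := G 1)).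
    by move=> i; rewrite !mulmnE !mnm1E; case: (1%R =P i) => [<-|]; [right|left].
  by rewrite -!mpolyXn Gij.
rewrite -mpolyXn in rE; have GrE i : G i = r * 'X_i ^+ N.
  by apply: (mulIf (_ : 'X_0 ^+ N != 0)); rewrite ?expf_neq0 // Gij rE mulrAC.
exists r; split.
  have h48 : map_mpoly iota (G 0) \is 48.-homog.
    apply: homog_meval => [|t v]; first exact: inf_dom_closed.
    pose x := \row_i v i.
    have e1 : (fun i => t * v i) =1 (t *: x) 0 by move=> i; rewrite !mxE.
    have e2 : v =1 x 0 by move=> i; rewrite mxE.
    rewrite (meval_eq _ e1) (meval_eq _ e2); rewrite -[LHS]/(ev iota (t *: x) (G 0)) -[X in _ * X]/(ev iota x (G 0)) !GE -!HE.
    have -> : chart 0 (t *: x) = t *: chart 0 x.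
      exact: chartZ.
    by rewrite ext3_mapZ f_eval_homog // -exprM.
  apply/dhomogP=> m mF.
  have : (m + U_(0%R : 'I_9) *+ N)%MM \in msupp (map_mpoly iota (G 0)).
    by rewrite mcoeff_msupp mcoeff_map_mpoly fmorph_eq0 rE mpolyXn addmC mcoeffMX -mcoeff_msupp.
  by move=> /(dhomog_mf h48) /=; rewrite mdegD mdegMn mdeg1 N42; lia.
move=> v v0; have /rV0Pn[i vi] := v0; rewrite -(D_eval v0 (rank_chart vi) (mul_chart i v)) HE -GE GrE.
have eM p a n : ev iota v (p * a ^+ n) = ev iota v p * ev iota v a ^+ n by rewrite rmorphM rmorphXn.
rewrite eM evX /=.
split=> [->|/eqP]; first by rewrite mul0r.
by rewrite mulf_eq0 expf_eq0 (negPf vi) andbF orbF => /eqP.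
Qed.

End DLocus.

(** * Algebraic relations between partial derivatives *)

(** The number of forms of degree e in nine variables grows like e ^ 8, the number of forms of
    degree 2 e modulo a cubic only like e ^ 7. *)
Lemma bin_growth : exists2 e, (3 <= 2 * e)%N &
  ('C(2 * e + 8, 8) < 'C(e + 8, 8) + 'C(2 * e - 3 + 8, 8))%N.
Proof.
(* The two large binomials differ by three terms, each at most 128 C(e + 7, 7), while C(e + 8, 8) is
   (e + 8) / 8 times C(e + 7, 7). Any e with e + 8 > 8 * 384 = 3072 will do. *)
have [e le] : exists e, (3080 <= e)%N by exists 3080.
exists e; first by lia.
have fE n : (n + 7) ^_ 7 = ((n + 7) * (n + 6) * (n + 5) * (n + 4) * (n + 3) * (n + 2) * (n + 1))%N.
  by rewrite !addnS !addn0 !ffactnS ffactn0 /= !mulnA muln1.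
have mono m n p q : (m <= n)%N -> (p <= q)%N -> (m * p <= n * q)%N by apply: leq_mul.
have c7 : ('C(2 * e + 7, 7) <= 128 * 'C(e + 7, 7))%N.
  rewrite -(leq_pmul2r (fact_gt0 7)) -mulnA !bin_ffact !fE.
  have -> : (128 * ((e + 7) * (e + 6) * (e + 5) * (e + 4) * (e + 3) * (e + 2) * (e + 1)) =
    (2 * (e + 7)) * (2 * (e + 6)) * (2 * (e + 5)) * (2 * (e + 4)) * (2 * (e + 3)) * (2 * (e + 2)) * (2 * (e + 1)))%N by ring.
  by do 6 (apply: leq_mul; last by lia); lia.
have c8 : (8 * 'C(e + 8, 8) = (e + 8) * 'C(e + 7, 7))%N.
  by rewrite -mul_bin_diag addnS.
pose m := (2 * e - 3)%N; have mE : (2 * e = m + 3)%N by rewrite /m; lia.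
have -> : (2 * e - 3)%N = m by [].
have E8 : 'C(2 * e + 8, 8) = ('C(m + 8, 8) + 'C(m + 8, 7) + 'C(m + 9, 7) + 'C(m + 10, 7))%N.
  by rewrite mE (_ : m + 3 + 8 = (m + 8).+3)%N ?binS ?addnS //; lia.
have le1 : ('C(m + 8, 7) <= 'C(2 * e + 7, 7))%N by apply: leq_bin2l; lia.
have le2 : ('C(m + 9, 7) <= 'C(2 * e + 7, 7))%N by apply: leq_bin2l; lia.
have le3 : ('C(m + 10, 7) <= 'C(2 * e + 7, 7))%N by apply: leq_bin2l; lia.
have c0 : (0 < 'C(e + 7, 7))%N by rewrite bin_gt0; lia.
rewrite E8; move: c7 c8 le1 le2 le3 c0.
move: 'C(m + 8, 8) 'C(m + 8, 7) 'C(m + 9, 7) 'C(m + 10, 7) 'C(2 * e + 7, 7) 'C(e + 7, 7) 'C(e + 8, 8).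
move=> a b1 b2 b3 c d f c7 c8 le1 le2 le3 c0.
have : (3088 * d <= (e + 8) * d)%N by apply: mono; lia.
by rewrite -c8; clear -c7 le1 le2 le3 c0; lia.
Qed.

Section Relation.
Variable K : closedFieldType.
Implicit Types (F P q : {mpoly K[9]}).

Lemma dhomog_comp (lq : 9.-tuple {mpoly K[9]}) P d e : (forall i, tnth lq i \is d.-homog) ->
  P \is e.-homog -> (P \mPo lq) \is (d * e).-homog.
Proof.
move=> hq hP; apply: homog_meval => [|t v]; first exact: inf_dom_closed.
rewrite !comp_mpoly_meval.
have -> : (P.@[fun i => (tnth lq i).@[fun j => t * v j]]) = P.@[fun i => t ^+ d * (tnth lq i).@[v]].
  by apply: meval_eq => i; rewrite (meval_homog _ _ (hq i)).
by rewrite (meval_homog _ _ hP) exprM.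
Qed.

Lemma mderiv_homog n d (p : {mpoly K[n]}) i : p \is d.+1.-homog -> p^`M(i) \is d.-homog.
Proof.
move/dhomogP=> hp; apply/dhomogP=> m; rewrite mcoeff_msupp mcoeff_deriv => nz.
have : (m + U_(i))%MM \in msupp p by rewrite mcoeff_msupp; apply: contraNneq nz => ->; rewrite mul0rn.
by move/hp; rewrite /= mdegD mdeg1 addn1 => -[].
Qed.

Section Maps.
Variables (lq : 9.-tuple {mpoly K[9]}) (F : {mpoly K[9]}) (c d e e' : nat).
Hypotheses (hq : forall i, tnth lq i \is d.-homog) (hF : F \is c.-homog) (eE : (e' + c = d * e)%N).

Definition hcomp (p : dhomog 9 K e) : dhomog 9 K (d * e) :=
  DHomog (dhomog_comp hq (dhomog_is_dhomog p)).
Lemma hcomp_linear : linear hcomp.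
Proof. by move=> a p q; apply/val_inj; rewrite /= linearP. Qed.
HB.instance Definition _ := GRing.isLinear.Build K (dhomog 9 K e) (dhomog 9 K (d * e)) _ hcomp hcomp_linear.

Lemma hmul_subproof (q : dhomog 9 K e') : val q * F \is (d * e).-homog.
Proof. by rewrite -eE; apply: dhomogM => //; apply: dhomog_is_dhomog. Qed.
Definition hmul (q : dhomog 9 K e') : dhomog 9 K (d * e) := DHomog (hmul_subproof q).
Lemma hmul_linear : linear hmul.
Proof. by move=> a p q; apply/val_inj; rewrite /= mulrDl scalerAl. Qed.
HB.instance Definition _ := GRing.isLinear.Build K (dhomog 9 K e') (dhomog 9 K (d * e)) _ hmul hmul_linear.

(* The maps [p |-> p \mPo lq] and [q |-> q * F] cannot be jointly injective for dimension reasons. *)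
Lemma homog_relation : F != 0 -> ('C(d * e + 8, 8) < 'C(e + 8, 8) + 'C(e' + 8, 8))%N ->
  exists P q, [/\ P \is e.-homog, P != 0 & P \mPo lq = q * F].
Proof.
move=> F0 lt; pose f := linfun hcomp; pose h := linfun hmul.
have dimE n : \dim {: dhomog 9 K n} = 'C(n + 8, 8).
  by rewrite dimvf /dim /= -bin_sub ?leq_addr // addKn.
have [ker0|kerN] := eqVneq (lker f) 0%VS; last first.
  have [p pk p0] : exists2 p, p \in lker f & p != 0.
    by exists (vpick (lker f)); rewrite ?memv_pick // vpick0.
  exists (val p), 0; split; [exact: dhomog_is_dhomog| |].
    by apply: contra p0 => /eqP E; apply/eqP/val_inj.
  by move: pk; rewrite memv_ker lfunE /= => /eqP/(congr1 val); rewrite mul0r.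
have hk0 : lker h = 0%VS.
  apply/eqP; rewrite -subv0; apply/subvP=> q; rewrite memv_ker lfunE /= memv0 => /eqP/(congr1 val)/= /eqP.
  by rewrite mulf_eq0 (negPf F0) orbF => /eqP E; apply/eqP/val_inj.
have df : \dim (limg f) = 'C(e + 8, 8) by have := limg_ker_dim f {:_}; rewrite ker0 capv0 dimv0 add0n dimE.
have dh : \dim (limg h) = 'C(e' + 8, 8) by have := limg_ker_dim h {:_}; rewrite hk0 capv0 dimv0 add0n dimE.
have := dimv_sum_cap (limg f) (limg h); rewrite df dh => dS.
have : (\dim (limg f + limg h) <= 'C(d * e + 8, 8))%N by rewrite -dimE dimvS ?subvf.
move=> le; have : (limg f :&: limg h)%VS != 0%VS.
  by rewrite -dimv_eq0; move: lt dS le; clear; lia.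
rewrite -vpick0 => nz; have := memv_pick (limg f :&: limg h)%VS; move: nz.
move: (vpick _) => z z0 /memv_capP[/memv_imgP[p _ zp] /memv_imgP[q _ zq]].
exists (val p), (val q); split; first exact: dhomog_is_dhomog.
  by apply: contraNneq z0 => E; rewrite zp lfunE; apply/eqP/val_inj; rewrite /= [mpoly_of_dhomog p]E linear0.
by move: zp; rewrite zq !lfunE /= => /(congr1 val).
Qed.

End Maps.

Lemma gradient_relation F : F != 0 -> F \is 3.-homog ->
  exists e P q, [/\ P \is e.-homog, P != 0 & P \mPo [tuple F^`M(i) | i < 9] = q * F].
Proof.
move=> F0 hF; have [e e3 lt] := bin_growth.
have hq i : tnth [tuple F^`M(i) | i < 9] i \is 2.-homog by rewrite tnth_mktuple mderiv_homog.
have [P [q [H1 H2 H3]]] := homog_relation hq hF (subnK e3) F0 lt.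
by exists e, P, q.
Qed.

End Relation.

(** * The dual of Y *)

Section Duality.
Variables (K : closedFieldType) (g : alt3 K 9) (C : tri3 K 9).
Local Notation F := (cF C).
Hypothesis FE : forall (x : 'rV[K]_9) (M : 'M_(8, 9)),
  F x ^+ 2 * \det (col_mx x M : 'M_9) ^+ 2 = \det (M *m om g x *m M^T).
Hypothesis S1 : forall x a b : 'rV_9,
  row_free (rows3 x a b) -> kill g x a -> kill g x b -> kill g a b -> False.
Hypothesis S2 : forall x : 'rV_9, x != 0 -> (2 < \rank (om g x))%N.
Hypothesis S3 : forall (R : 'M_(4, 9)) (H : 'M_(8, 9)),
  row_free R -> row_free H -> (R <= H)%MS ->
  (forall r s y : 'rV_9, (r <= R)%MS -> (s <= R)%MS -> (y <= H)%MS -> g r s y = 0) -> False.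

Lemma rank46 x : x != 0 -> F x = 0 -> \rank (om g x) = 4%N \/ \rank (om g x) = 6%N.
Proof.
move=> x0 /eqP; rewrite (F_rank FE x0) => le; have := S2 x0; have := rank_om_even g x.
move: (\rank _) le; clear => r; move: r => [|[|[|[|[|[|[|r]]]]]]] //= *; by [left|right].
Qed.

Lemma incidentE x v : incident g x v -> x != 0 /\ F x = 0.
Proof.
move=> [a [b [fr xa xb _]]].
have x0 : x != 0.
  apply/eqP => x0; have [] := rows3_free0 fr (r := 1) (s := 0) (t := 0); last by move/eqP; rewrite oner_eq0.
  by rewrite x0 !scale0r scaler0 !addr0.
split=> //; apply/eqP; rewrite (F_rank FE x0).
have := mulmx0_rank_max (_ : rows3 x a b *m om g x = 0); rewrite (eqP fr) => H.
suff : rows3 x a b *m om g x = 0 by move/H; move: (\rank _); clear; lia.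
apply/row_matrixP=> i; rewrite row_mul row0.
have -> : row i (rows3 x a b) = tnth [tuple x; a; b] i by apply/rowP=> j; rewrite !mxE.
by case: i => [[|[|[|//]]] lt]; rewrite (tnth_nth 0) /=; [exact: killxx|exact: xa|exact: xb].
Qed.

(** Just the regularity that a limit along a polynomial curve requires of a bihomogeneous
    condition. *)
Definition polynomial_on_curves (Phi : 'rV[K]_9 -> 'rV[K]_9 -> K) := forall X V : K -> 'rV[K]_9,
  (forall i, exists q : {poly K}, forall t, X t 0 i = q.[t]) ->
  (forall i, exists q : {poly K}, forall t, V t 0 i = q.[t]) ->
  exists r : {poly K}, forall t, Phi (X t) (V t) = r.[t].

(** At rank 6, [v] is a multiple of the gradient. At rank 4, [a] and [b] may be replaced by
    combinations of the rows of [n], since [x] kills the kernel, and [closure_singular] applies. *)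
Lemma incident_closure (Phi : 'rV[K]_9 -> 'rV[K]_9 -> K) (d e : nat) : polynomial_on_curves Phi ->
  (forall s t x v, Phi (s *: x) (t *: v) = s ^+ d * t ^+ e * Phi x v) ->
  (forall x, F x = 0 -> Phi x (cgrad C x) = 0) ->
  forall x v, incident g x v -> Phi x v = 0.
Proof.
move=> polPhi homPhi zPhi x v inc; have [x0 Fx] := incidentE inc.
have [a [b [fr xa xb [c c0 abE]]]] := inc.
have scal u t : u = t *: v -> t != 0 -> Phi x u = 0 -> Phi x v = 0.
  move=> -> t0; have := homPhi 1 t x v; rewrite scale1r => ->.
  by move/eqP; rewrite expr1n mul1r mulf_eq0 expf_eq0 (negPf t0) andbF => /eqP.
have [rk|rk] := rank46 x0 Fx.
  have [|n [frn nx]] := @kernel_extend _ _ g 4 x x0; first by rewrite rk.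
  have [D0 [c' [c'0 D1]]] := grad_rank4 FE rk frn nx.
  have kerE y : kill g x y -> exists r (u : 'rV_4), y = r *: x + u *m n.
    move=> kxy; have sub : (col_mx x n <= kermx (om g x))%MS.
      by apply/sub_kermxP; rewrite mul_col_mx nx (killxx g x : x *m om g x = 0) col_mx0.
    have : (y <= col_mx x n)%MS.
      apply: submx_trans (_ : (kermx (om g x) <= _)%MS); first exact/sub_kermxP.
      by rewrite -(mxrank_leqif_sup sub) (eqP frn) mxrank_ker rk.
    case/submxP=> u ->; exists (@lsubmx _ 1 1 4 u 0 0), (@rsubmx _ 1 1 4 u).
    by rewrite -mul_scalar_mx -mx11_scalar -mul_row_col hsubmxK.
  have [r [u aE']] := kerE _ xa; have [s [t bE]] := kerE _ xb.
  apply: (scal (gvec g (u *m n) (t *m n)) c _ c0).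
    apply/rowP=> i; rewrite !mxE.
    have kx y : kill g x y -> forall z, g x y z = 0 by move/killP.
    have kun : kill g x (u *m n) by rewrite /kill -mulmxA nx mulmx0.
    have ktn : kill g x (t *m n) by rewrite /kill -mulmxA nx mulmx0.
    transitivity (g a b (delta_mx 0 i)).
      by rewrite aE' bE !aE (kx _ ktn) (aC12 g (u *m n) x) (kx _ kun); ring.
    by rewrite abE trmx_delta -colE mxE.
  exact: (closure_singular S1 frn nx c'0 D1 Fx D0 polPhi homPhi zPhi).
pose n : 'M_(2, 9) := col_mx a b.
have nx : n *m om g x = 0 by rewrite (@mul_col_mx _ 1 1) xa xb col_mx0.
have rn : row 0 n = a /\ row 1 n = b.
  split; apply/rowP=> j; rewrite mxE; [rewrite -(@col_mxEu _ 1 1 9 a b 0 j)|rewrite -(@col_mxEd _ 1 1 9 a b 0 j)];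
  by congr (col_mx _ _ _ _); apply: val_inj.
have frn : row_free (col_mx x n).
  apply: (@col_row_free _ 1 2 9) => u w E.
  have [|e1 e2 e3] := rows3_free0 fr (r := u 0 0) (s := @lsubmx _ 1 1 1 w 0 0) (t := @rsubmx _ 1 1 1 w 0 0).
    rewrite -!mul_scalar_mx -!mx11_scalar -addrA -(@mul_row_col _ 1 1 1) hsubmxK -[RHS]E //.
  have -> : w = row_mx (@lsubmx _ 1 1 1 w) (@rsubmx _ 1 1 1 w) by rewrite (@hsubmxK _ 1 1 1).
  by rewrite [u]mx11_scalar [@lsubmx _ 1 1 1 w]mx11_scalar [@rsubmx _ 1 1 1 w]mx11_scalar e1 e2 e3 !raddf0 (@row_mx0 _ 1 1 1).
have [c' [c'0 D1]] := grad_rank6 FE rk frn nx.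
apply: (scal (cgrad C x) (c' * c)); [|by rewrite mulf_neq0|exact: zPhi].
by apply/rowP=> i; rewrite !mxE D1 rn.1 rn.2 abE mulrA trmx_delta -colE mxE.
Qed.

Lemma incident_grad x : x != 0 -> F x = 0 -> cgrad C x != 0 -> incident g x (cgrad C x).
Proof.
move=> x0 Fx gx; have [rk|rk] := rank46 x0 Fx.
  have [|n [frn nx]] := @kernel_extend _ _ g 4 x x0; first by rewrite rk.
  have [D0 _] := grad_rank4 FE rk frn nx.
  by case/eqP: gx; apply/rowP=> i; rewrite !mxE D0.
have [|n [frn nx]] := @kernel_extend _ _ g 2 x x0; first by rewrite rk.
have [c [c0 D1]] := grad_rank6 FE rk frn nx.
exists (row 0 n), (row 1 n); split; [exact: rows3_free| | |].
- by rewrite /kill -row_mul nx row0.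
- by rewrite /kill -row_mul nx row0.
by exists c^-1; rewrite ?invr_eq0 // => y; rewrite cgradE D1 mulKf.
Qed.

Lemma incident_exists x : x != 0 -> F x = 0 -> exists2 v, v != 0 & incident g x v.
Proof.
move=> x0 Fx.
have [n [frn nx]] : exists n : 'M_(2, 9), row_free (col_mx x n) /\ n *m om g x = 0.
  by apply: kernel_extend => //; have [->|->] := rank46 x0 Fx.
have kn i : kill g x (row i n) by rewrite /kill -row_mul nx row0.
have fr := rows3_free frn.
pose v : 'rV[K]_9 := \row_i g (row 0 n) (row 1 n) (delta_mx 0 i).
have vE y : g (row 0 n) (row 1 n) y = (v *m y^T) 0 0.
  rewrite {1}(row_sum_delta y) a_sum3 mxE; apply: eq_bigr => i _.
  by rewrite aZ3 !mxE mulrC.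
exists v; last by exists (row 0 n), (row 1 n); split=> //; exists 1; rewrite ?oner_eq0 // => y; rewrite mul1r.
apply/eqP => v0; apply: (S1 fr) => //; apply/killP => y; rewrite vE v0 mul0mx mxE //.
Qed.

Lemma no_hyper (H : 'M[K]_(8, 9)) : row_free H -> exists y, (y <= H)%MS /\ F y != 0.
Proof. exact: (no_hyperplane FE S1 S3). Qed.

Lemma Y_point : exists x, x != 0 /\ F x = 0.
Proof.
have [e [H [Fe fr fu]]] := good_frame no_hyper.
have [t Ft] := slice_root H Fe (delta_mx 0 0).
by exists (delta_mx 0 0 *m H + t *: e); split=> //; apply: slice_neq0; rewrite ?fr //; apply/eqP => /rowP/(_ 0)/eqP; rewrite !mxE !eqxx oner_eq0.
Qed.

Lemma coord_curves (i : 'I_9) : polynomial_on_curves (fun _ v => v 0 i).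
Proof. by move=> X V _ pV. Qed.

(** If the gradient vanished on all of Y, [incident_closure] for the coordinate functions would make
    every incident [v] zero. *)
Lemma smooth_exists : exists x i, [/\ x != 0, F x = 0 & cgrad C x 0 i != 0].
Proof.
have [x [x0 Fx]] := Y_point; have [v v0 inc] := incident_exists x0 Fx.
apply: NNPP => H; case/eqP: v0; apply/rowP=> i; rewrite [RHS]mxE.
apply: (incident_closure (d := 0) (e := 1) (coord_curves i) _ _ inc) => [s t x' v'|x' Fx'].
  by rewrite mxE mul1r.
apply/eqP/negPn/negP => nz; apply: H; exists x', i; split=> //.
by apply: contraNneq nz => ->; rewrite mxE -(scale0r 0) cDZl expr0n mul0r.
Qed.

Lemma mpoly_curves (p : {mpoly K[9]}) : polynomial_on_curves (fun _ v => p.@[v 0]).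
Proof. by move=> X V _ pV; have [r rE] := polyf_curve (polyf_mp p) pV; exists r. Qed.

Variable Fp : {mpoly K[9]}.
Hypotheses (hFp : Fp \is 3.-homog) (FpE : forall x : 'rV_9, Fp.@[x 0] = F x).

Lemma Fp_deriv i (x : 'rV_9) : Fp^`M(i).@[x 0] = cgrad C x 0 i.
Proof. by rewrite -(gradient_cgrad FpE) mxE. Qed.

Definition lgrad := [tuple Fp^`M(i) | i < 9].

Lemma comp_lgrad p (x : 'rV_9) : (p \mPo lgrad).@[x 0] = p.@[cgrad C x 0].
Proof. by rewrite comp_mpoly_meval; apply: meval_eq => i; rewrite tnth_mktuple Fp_deriv. Qed.

Lemma meval_scale p d (t : K) (v : 'rV[K]_9) : p \is d.-homog -> p.@[(t *: v) 0] = t ^+ d * p.@[v 0].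
Proof. by move=> hp; rewrite -(meval_homog _ _ hp); apply: meval_eq => i; rewrite mxE. Qed.

Lemma incident_mpoly p d : p \is d.-homog -> (forall x, F x = 0 -> p.@[cgrad C x 0] = 0) ->
  forall x v, incident g x v -> p.@[v 0] = 0.
Proof.
move=> hp p0 x v; apply: (incident_closure (Phi := fun _ v => p.@[v 0]) (d := 0) (e := d)) => //.
- exact: mpoly_curves.
- by move=> s t x' v'; rewrite mul1r (meval_scale _ _ hp).
Qed.

Lemma dual_relation : exists d p, [/\ p \is d.-homog, p != 0 & forall x v, incident g x v -> p.@[v 0] = 0].
Proof.
have Fp0 : Fp != 0.
  have [e [H [Fe _ _]]] := good_frame no_hyper.
  by apply: contraNneq Fe => E; rewrite -FpE E meval0.
have [d [p [q [hp p0 E]]]] := gradient_relation Fp0 hFp; exists d, p; split=> //.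
by apply: (incident_mpoly hp) => x Fx; rewrite -comp_lgrad E mevalM FpE Fx mulr0.
Qed.

Lemma non_incident : exists2 v, v != 0 & forall x, ~ incident g x v.
Proof.
have [d [p [_ p0 pv]]] := dual_relation.
have [|v] := mpoly_nz (@inf_dom_closed K) (_ : p * 'X_0 != 0).
  by rewrite mulf_neq0 // -msize_poly_eq0 msizeX.
rewrite mevalM mevalXU mulf_eq0 negb_or => /andP[nz v0].
exists (\row_i v i); first by apply: contraNneq v0 => /rowP/(_ 0); rewrite !mxE => ->.
move=> x /pv; rewrite (meval_eq (v2 := v)) => [|i]; last by rewrite mxE.
by move/eqP; apply/negP.
Qed.

Definition Ycone (x : 'rV[K]_9) := x != 0 /\ F x = 0.

Lemma ideal_Y p : vanishes_on Ycone p -> exists q : {mpoly K[9]}, p = q * Fp.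
Proof.
move=> pY; have [|q [[q' qE] E]] := cubic_divides no_hyper (polyf_mp p); first by move=> x x0 Fx; apply: pY.
exists q'; apply: mpoly_fun_eq => [|v]; first exact: inf_dom_closed.
have e : v =1 (\row_i v i) 0 by move=> i; rewrite mxE.
by rewrite !(meval_eq _ e) mevalM E qE FpE.
Qed.

Lemma tangent_YP x h : tangent_hyperplane_at Ycone x h <->
  [/\ x != 0, F x = 0, cgrad C x != 0 & exists2 c, c != 0 & h = c *: cgrad C x].
Proof.
have grad p : vanishes_on Ycone p -> F x = 0 -> exists c, gradient p x = c *: cgrad C x.
  move=> /ideal_Y[q ->] Fx; exists q.@[x 0].
  by rewrite gradientM FpE Fx scale0r add0r (gradient_cgrad FpE).
have FpY : vanishes_on Ycone Fp by move=> y [_ Fy]; rewrite FpE.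
split=> [[[x0 Fx] h0 H]|[x0 Fx gx [c c0 ->]]].
  have [|d [p [hp pY gp]]] := (H h).2; first by exists 1; rewrite scale1r.
  have [c cE] := grad p pY Fx; rewrite gp in cE.
  have c0 : c != 0 by apply: contraNneq h0 => c0; rewrite cE c0 scale0r.
  split=> //; last by exists c.
  by apply: contraNneq h0 => g0; rewrite cE g0 scaler0.
split; [by []|by rewrite scaler_eq0 negb_or c0|move=> u; split].
  by move=> [d [p [hp pY <-]]]; have [e ->] := grad p pY Fx; exists (e / c); rewrite scalerA divfK.
move=> [e ->]; exists 3, ((e * c) *: Fp); split.
- by rewrite rpredZ.
- by move=> y [_ Fy]; rewrite mevalZ FpE Fy mulr0.
by rewrite gradientZ (gradient_cgrad FpE) scalerA.
Qed.

Lemma incidentZ x v c : c != 0 -> incident g x v -> incident g x (c *: v).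
Proof.
move=> c0 [a [b [fr xa xb [d d0 E]]]]; exists a, b; split=> //; exists (d / c).
  by rewrite mulf_neq0 ?invr_eq0.
by move=> y; rewrite E -scalemxAl [X in _ = _ * X]mxE mulrA divfK.
Qed.

Lemma dual_Y (r : {mpoly K[9]}) d : r \is d.-homog ->
  (forall v : 'rV_9, v != 0 -> r.@[v 0] = 0 <-> exists x, incident g x v) ->
  forall v, proj_dual Ycone v <-> v != 0 /\ exists x, incident g x v.
Proof.
move=> hr rE v; split=> [[v0 H]|[v0 [x inc]]].
  split=> //; apply/(rE v v0); apply: (H d r hr) => h [x /tangent_YP[x0 Fx gx [c c0 ->]]].
  have inc := incidentZ c0 (incident_grad x0 Fx gx).
  by apply/rE; [rewrite scaler_eq0 negb_or c0|exists x].
split=> // e p hp pT; apply: (incident_mpoly hp _ inc) => y Fy.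
have [gy|gy] := eqVneq (cgrad C y) 0; last first.
  apply: pT; exists y; apply/tangent_YP; split=> //; last by exists 1; rewrite ?oner_eq0 ?scale1r.
  by apply: contraNneq gy => ->; apply/eqP/rowP=> i; rewrite !mxE -(scale0r 0) cDZl expr0n mul0r.
(* At a singular y the value in question is p(0). It vanishes because p, even if constant, vanishes
   at the gradient of a smooth point. *)
have [x' [i [x'0 Fx' gx']]] := smooth_exists.
have gx'0 : cgrad C x' != 0 by apply: contraNneq gx' => ->; rewrite mxE.
have : p.@[cgrad C x' 0] = 0.
  by apply: pT; exists x'; apply/tangent_YP; split=> //; exists 1; rewrite ?oner_eq0 ?scale1r.
rewrite gy -(scale0r (cgrad C x')) (meval_scale _ _ hp) => ->; exact: mulr0.
Qed.

End Duality.

(** * The dual of D *)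

Section Roots.
Variables (K : closedFieldType) (n : nat).

(* The coefficients of such a [p] are supported on exponents divisible by the characteristic, and have roots in [K]. *)
Lemma frobenius_root (p : {mpoly K[n]}) d : p \is d.+1.-homog -> p != 0 -> (forall i, p^`M(i) = 0) ->
  exists e (q : {mpoly K[n]}), [/\ (e < d.+1)%N, q \is e.-homog, q != 0 & forall v, p.@[v] = 0 -> q.@[v] = 0].
Proof.
move=> hp p0 dp.
have van m i : m \in msupp p -> (m i)%:R = 0 :> K.
  move=> mp; case mi: (m i) => [//|l]; apply/eqP.
  have := congr1 (mcoeff (m - U_(i))%MM) (dp i); rewrite mcoeff_deriv mcoeff0.
  rewrite submK ?lep1mP ?mi // mnmBE mi mnm1E eqxx subn1 /= => /eqP; rewrite -[p@_m *+ _]mulr_natr.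
  by rewrite mulf_eq0 mcoeff_eq0 mp.
have [i mi] : exists i, (0 < mlead p i)%N.
  apply: NNPP => H; move/dhomogP: (hp) => /(_ _ (mlead_supp p0)); rewrite /= mdegE big1 // => i _.
  by apply/eqP; rewrite -leqn0 leqNgt; apply/negP => lt; apply: H; exists i.
have [c cK] := natf0_pchar mi (introT eqP (van _ i (mlead_supp p0))).
have cp := pcharf_prime cK; have c1 := prime_gt1 cp; have c0 := ltnW c1.
have dvd m i' : m \in msupp p -> (c %| m i')%N by move=> mp; rewrite (dvdn_pcharf cK) van.
have ex (a : K) : exists b, b ^+ c == a.
  have : size ('X^c - a%:P) != 1%N by rewrite size_XnsubC // eqSS -lt0n.
  by move=> /closed_rootP[b]; rewrite rootE !hE subr_eq0 => E; exists b.
pose rt a := xchoose (ex a); have rtE a : rt a ^+ c = a by apply/eqP/(xchooseP (ex a)).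
pose mq (m : 'X_{1..n}) : 'X_{1..n} := [multinom (m j %/ c)%N | j < n].
pose q : {mpoly K[n]} := \sum_(m <- msupp p) rt p@_m *: 'X_[mq m].
have qE v : q.@[v] ^+ c = p.@[v].
  rewrite -(pFrobenius_autE cK) /q (raddf_sum (meval v)) rmorph_sum [in RHS](mpolyE p) (raddf_sum (meval v)).
  rewrite [LHS]big_seq [RHS]big_seq; apply: eq_bigr => m mp.
  rewrite /= pFrobenius_autE !mevalZ exprMn rtE !mevalX -prodrXl; congr (_ * _); apply: eq_bigr => j _.
  by rewrite mnmE -exprM divnK // dvd.
exists (d.+1 %/ c)%N, q; split.
- exact: ltn_Pdiv.
- rewrite /q big_seq; apply: rpred_sum => m mp; apply: rpredZ; rewrite dhomogX /=; apply/eqP.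
  have <- : mdeg m = d.+1 by move/dhomogP: hp; apply.
  have -> : mdeg m = (mdeg (mq m) * c)%N.
    by rewrite !mdegE big_distrl; apply: eq_bigr => j _; rewrite mnmE /= divnK // dvd.
  by rewrite mulnK.
- have [v pv] := mpoly_nz (@inf_dom_closed K) p0; apply: contraNneq pv => q0.
  by rewrite -qE q0 meval0 expr0n eqn0Ngt c0.
by move=> v pv; apply/eqP; have /eqP := qE v; rewrite pv expf_eq0 c0.
Qed.

End Roots.

Section Biduality.
Variables (K : closedFieldType) (g : alt3 K 9) (C : tri3 K 9).
Local Notation F := (cF C).
Hypothesis FE : forall (x : 'rV[K]_9) (M : 'M_(8, 9)),
  F x ^+ 2 * \det (col_mx x M : 'M_9) ^+ 2 = \det (M *m om g x *m M^T).
Hypothesis S1 : forall x a b : 'rV_9,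
  row_free (rows3 x a b) -> kill g x a -> kill g x b -> kill g a b -> False.
Hypothesis S2 : forall x : 'rV_9, x != 0 -> (2 < \rank (om g x))%N.
Hypothesis S3 : forall (R : 'M_(4, 9)) (H : 'M_(8, 9)),
  row_free R -> row_free H -> (R <= H)%MS ->
  (forall r s y : 'rV_9, (r <= R)%MS -> (s <= R)%MS -> (y <= H)%MS -> g r s y = 0) -> False.
Variable Fp : {mpoly K[9]}.
Hypotheses (hFp : Fp \is 3.-homog) (FpE : forall x : 'rV_9, Fp.@[x 0] = F x).
Hypothesis two : (2%:R : K) != 0.
Hypothesis Hess : exists2 x, F x = 0 & \det (hessian C x) != 0.

Local Notation incident_mpoly := (incident_mpoly FE S1 S2).
Local Notation no_hyper := (no_hyper FE S1 S3).
Local Notation Ycone := (Ycone C).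

Definition Dcone (v : 'rV[K]_9) := v != 0 /\ exists x, incident g x v.

Lemma incident_neq0 x v : incident g x v -> v != 0.
Proof.
move=> [a [b [fr xa xb [c c0 E]]]]; apply/eqP => v0; apply: (S1 fr) => //; apply/killP => y.
by rewrite E v0 mul0mx mxE mulr0.
Qed.

Lemma incident_ex : exists x v, incident g x v.
Proof.
have [x [x0 Fx]] := Y_point FE S1 S3; have [v _ inc] := incident_exists FE S1 S2 x0 Fx.
by exists x, v.
Qed.

Lemma vanishes_DconeP (p : {mpoly K[9]}) : vanishes_on Dcone p <-> forall x v, incident g x v -> p.@[v 0] = 0.
Proof.
split=> [H x v inc|H v [v0 [x inc]]]; last exact: H inc.
by apply: H; split; [exact: incident_neq0 inc|exists x].
Qed.

(** If all partial derivatives of p vanish on D, a non-zero one of them, or else the Frobenius root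
    of p, is an equation of smaller degree. *)
Lemma minimal_equation : exists d (p : {mpoly K[9]}), [/\ p \is d.-homog, vanishes_on Dcone p &
  exists x j, F x = 0 /\ p^`M(j).@[cgrad C x 0] != 0].
Proof.
have [d [p [hp p0 pv]]] := dual_relation FE S1 S2 S3 hFp FpE.
elim/ltn_ind: d p hp p0 pv => -[|d] IH p hp p0 pv.
  have [x [v inc]] := incident_ex; have [u pu] := mpoly_nz (@inf_dom_closed K) p0.
  have := meval_homog 0 u hp; have := meval_homog 0 (v 0) hp.
  rewrite !expr0 !mul1r (pv _ _ inc) (meval_eq (v2 := fun=> 0)) => [E|i]; last by rewrite mul0r.
  rewrite (meval_eq (v2 := fun=> 0)) => [E'|i]; last by rewrite mul0r.
  by case/eqP: pu; rewrite -E' E.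
have [H|H] := classic (exists x j, F x = 0 /\ p^`M(j).@[cgrad C x 0] != 0).
  by exists d.+1, p; split=> //; apply/vanishes_DconeP.
have dv j : forall x v, incident g x v -> p^`M(j).@[v 0] = 0.
  apply: (incident_mpoly (mderiv_homog j hp)) => x Fx; apply/eqP/negPn/negP => nz.
  by apply: H; exists x, j.
have [[j pj]|nj] := classic (exists j, p^`M(j) != 0).
  by apply: (IH d _ p^`M(j)) => //; [apply: mderiv_homog|apply: dv].
have [|e [q [ed hq q0 qv]]] := frobenius_root hp p0.
  by move=> j; apply/eqP/negPn/negP => nz; apply: nj; exists j.
by apply: (IH e ed q) => // x v inc; apply/qv/pv; exact: inc.
Qed.

Lemma gradient_deriv i x : gradient (Fp^`M(i)) x = \row_j cT C x (delta_mx 0 i) (delta_mx 0 j).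
Proof.
apply/rowP=> j; have [r rE] := meval_line Fp^`M(i) x (delta_mx 0 j).
have -> : gradient Fp^`M(i) x 0 j = (gradient Fp^`M(i) x *m (delta_mx 0 j : 'rV_9)^T) 0 0.
  by rewrite trmx_delta -colE [RHS]mxE.
rewrite [RHS]mxE; apply: (poly_lin_eq (p := r) (q := (cD C (delta_mx 0 j) (delta_mx 0 i))%:P)) => t.
have := rE t; rewrite !(Fp_deriv FpE) !mxE !cDDl cDZl => E.
apply: (addrI (cD C x (delta_mx 0 i))); rewrite !addrA -E hE cTZ2 (cT23 C x).
by ring.
Qed.

Lemma gradient_comp_lgrad p x : gradient (p \mPo lgrad Fp) x = gradient p (cgrad C x) *m hessian C x.
Proof.
rewrite gradient_comp; congr (gradient p _ *m _).
  by apply/rowP=> i; rewrite mxE tnth_mktuple (Fp_deriv FpE).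
apply/matrixP=> i j; rewrite !mxE tnth_mktuple.
by have := gradient_deriv i x => /rowP/(_ j); rewrite !mxE.
Qed.

Lemma hessian_self x : x *m hessian C x = 2%:R *: cgrad C x.
Proof.
apply/rowP=> j; have := hessianE C x x (delta_mx 0 j).
by rewrite trmx_delta -colE [LHS]mxE => ->; rewrite cTxx !mxE.
Qed.

Lemma polyf_cgrad i : polyf (fun x => cgrad C x 0 i).
Proof. by apply: (polyf_ext (f := fun y => cD C y (delta_mx 0 i))) => [y|]; [rewrite mxE | exact: polyf_cDl]. Qed.

Lemma polyf_hessian i j : polyf (fun x => hessian C x i j).
Proof.
apply: (polyf_ext (f := fun x => cD C (x + delta_mx 0 i) (delta_mx 0 j) - cD C x (delta_mx 0 j) - cD C (delta_mx 0 i) (delta_mx 0 j))) => [x|].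
  by rewrite mxE cDDl; ring.
apply: polyfB; last exact: polyf_const.
apply: polyfB; last exact: polyf_cDl.
apply: (polyf_comp (polyf_cDl C _)) => l; apply: (polyf_ext (f := fun y => y 0 l + (delta_mx 0 i : 'rV_9) 0 l)) => [y|]; first by rewrite !mxE.
by apply: polyfD; [exact: polyf_coord|exact: polyf_const].
Qed.

Lemma polyf_comp_cgrad (p : {mpoly K[9]}) : polyf (fun x => p.@[cgrad C x 0]).
Proof. exact: (polyf_comp (polyf_mp p) polyf_cgrad). Qed.

(* The derivative of [p(grad F) = q F] along the cubic shows that the Hessian, generically invertible there, kills
   2 grad p(grad F(x)) - q x. *)
Lemma gradient_D p d : p \is d.-homog -> vanishes_on Dcone p ->
  forall x v, incident g x v -> forall i j, x 0 i * p^`M(j).@[v 0] = x 0 j * p^`M(i).@[v 0].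
Proof.
move=> hp /vanishes_DconeP pv x v inc i j.
have pY : vanishes_on Ycone (p \mPo lgrad Fp).
  move=> y [y0 Fy]; rewrite (comp_lgrad FpE).
  have [gy|gy] := eqVneq (cgrad C y) 0; last exact: pv (incident_grad FE S2 y0 Fy gy).
  by rewrite gy -(scale0r v) (meval_scale _ _ hp) (pv _ _ inc) mulr0.
have [q qE] := ideal_Y FE S1 S3 FpE pY.
have key y : F y = 0 -> (2%:R *: gradient p (cgrad C y) - q.@[y 0] *: y) *m hessian C y = 0.
  move=> Fy; rewrite mulmxBl -!scalemxAl hessian_self -gradient_comp_lgrad qE gradientM FpE Fy.
  by rewrite scale0r add0r (gradient_cgrad FpE) !scalerA mulrC subrr.
have : forall y, F y = 0 -> y 0 i * p^`M(j).@[cgrad C y 0] - y 0 j * p^`M(i).@[cgrad C y 0] = 0.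
  have [||y _ Fy|//|H] := cubic_prime no_hyper (p := fun y => y 0 i * p^`M(j).@[cgrad C y 0] - y 0 j * p^`M(i).@[cgrad C y 0])
    (q := fun y => \det (hessian C y)).
  - by apply: polyfB; apply: polyfM; [exact: polyf_coord|exact: polyf_comp_cgrad|exact: polyf_coord|exact: polyf_comp_cgrad].
  - by apply: polyf_det => l m; apply: polyf_hessian.
  - have [->|dy] := eqVneq (\det (hessian C y)) 0; first by rewrite mulr0.
    have uy : hessian C y \in unitmx by rewrite unitmxE unitfE.
    have := congr1 (mulmx^~ (invmx (hessian C y))) (key y Fy); rewrite mulmxK // mul0mx => /eqP; rewrite subr_eq0 => /eqP E.
    have E' l : 2%:R * p^`M(l).@[cgrad C y 0] = q.@[y 0] * y 0 l.
      by have := congr1 (fun M : 'rV_9 => M 0 l) E; rewrite !mxE.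
    suff -> : y 0 i * p^`M(j).@[cgrad C y 0] - y 0 j * p^`M(i).@[cgrad C y 0] = 0 by rewrite mul0r.
    apply: (mulfI two); rewrite mulr0 mulrBr mulrCA E' (mulrCA 2%:R (y 0 j)) E'; ring.
  by have [y Fy /eqP[]] := Hess; apply: H.
move=> zY; apply/eqP; rewrite -subr_eq0; apply/eqP.
(* The condition extended below has degree d - 1 in [v], so constants are treated apart. *)
case: d hp => [|d] hp.
  have dp l : p^`M(l) = 0.
    apply/mpolyP=> m; rewrite mcoeff_deriv mcoeff0 (dhomog_nemf_coeff hp) ?mul0rn //=.
    by rewrite mdegD mdeg1 addn1.
  by rewrite !dp !meval0 !mulr0 subrr.
apply: (incident_closure FE S1 S2 (Phi := fun x v => x 0 i * p^`M(j).@[v 0] - x 0 j * p^`M(i).@[v 0]) (d := 1) (e := d)) => //.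
- move=> X V pX pV; have [r1 r1E] := mpoly_curves p^`M(j) pX pV; have [r2 r2E] := mpoly_curves p^`M(i) pX pV.
  have [xi xiE] := pX i; have [xj xjE] := pX j; exists (xi * r1 - xj * r2) => t.
  by rewrite !hE xiE xjE r1E r2E.
move=> s t x' v'; rewrite !(meval_scale _ _ (mderiv_homog _ hp)) !mxE expr1; ring.
Qed.

Lemma gradient_D_prop p d x v : p \is d.-homog -> vanishes_on Dcone p -> incident g x v ->
  exists c, gradient p v = c *: x.
Proof.
move=> hp pv inc; have [/rV0Pn[i xi] _] := incidentE FE inc.
exists (p^`M(i).@[v 0] / x 0 i); apply/rowP=> j; rewrite !mxE.
by apply: (mulfI xi); rewrite (gradient_D hp pv inc i j) mulrCA mulrA divfK // mulrC.
Qed.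

(** Where a partial derivative of the equation [p0] does not vanish at grad F(y), the gradient of
    [p0] there is a non-zero multiple of y, so y is a tangent hyperplane of D. Primality of F
    disposes of the points where this fails. *)
Lemma bidual x : Ycone x <-> proj_dual Dcone x.
Proof.
split=> [[x0 Fx]|[x0 H]]; last first.
  split=> //; rewrite -FpE; apply: (H 3) => // h [v [[v0 [y inc]] h0 Hh]].
  have [|d [p [hp pv <-]]] := (Hh h).2; first by exists 1; rewrite scale1r.
  have [c ->] := gradient_D_prop hp pv inc.
  by rewrite (meval_scale _ _ hFp) FpE (incidentE FE inc).2 mulr0.
split=> // d p hp pT.
have [e [p0 [hp0 p0v [y [j [Fy nz]]]]]] := minimal_equation.
have [z [i [z0 Fz gz]]] := smooth_exists FE S1 S2 S3.
have main y' : y' != 0 -> F y' = 0 -> p.@[y' 0] * p0^`M(j).@[cgrad C y' 0] * cgrad C y' 0 i = 0.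
  move=> y'0 Fy'; have [->|gi] := eqVneq (cgrad C y' 0 i) 0; first by rewrite mulr0.
  have [->|pj] := eqVneq p0^`M(j).@[cgrad C y' 0] 0; first by rewrite mulr0 mul0r.
  have g0 : cgrad C y' != 0 by apply: contraNneq gi => ->; rewrite mxE.
  have inc := incident_grad FE S2 y'0 Fy' g0.
  have [c cE] := gradient_D_prop hp0 p0v inc.
  have c0 : c != 0.
    by apply: contraNneq pj => c0; have := congr1 (fun M : 'rV_9 => M 0 j) cE; rewrite c0 scale0r !mxE => ->.
  suff : p.@[(c *: y') 0] = 0.
    by rewrite (meval_scale _ _ hp) => /eqP; rewrite mulf_eq0 expf_eq0 (negPf c0) andbF => /eqP ->; rewrite !mul0r.
  apply: pT; exists (cgrad C y'); split.
  - by split=> //; exists y'.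
  - by rewrite scaler_eq0 negb_or c0.
  move=> u; split=> [[d' [q [hq qv <-]]]|[s ->]].
    by have [s ->] := gradient_D_prop hq qv inc; exists (s / c); rewrite scalerA divfK.
  exists e, (s *: p0); split; [by rewrite rpredZ| |by rewrite gradientZ cE].
  by move=> v' Dv'; rewrite mevalZ p0v // mulr0.
have [||H|H] := cubic_prime no_hyper _ _ main.
- by apply: polyfM; [exact: polyf_mp|exact: polyf_comp_cgrad].
- exact: polyf_cgrad.
- have [|||H'|H'] := cubic_prime no_hyper (p := fun y => p.@[y 0]) (q := fun y => p0^`M(j).@[cgrad C y 0]).
  + exact: polyf_mp.
  + exact: polyf_comp_cgrad.
  + by move=> y' _; apply: H.
  + exact: H'.
  by case/eqP: nz; apply: H'.
by case/eqP: gz; apply: H.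
Qed.

End Biduality.

(** * The Hessian of the cubic when all ranks are at least six *)

Section Blocks.
Variable F : fieldType.

Lemma det_line n (A B : 'M[F]_n) : exists q : {poly F}, forall t, q.[t] = \det (A + t *: B).
Proof.
exists (\det (map_mx polyC A + 'X *: map_mx polyC B)) => t.
rewrite -[LHS]/(horner_eval t _) -det_map_mx; congr (\det _).
by apply/matrixP=> i j; rewrite !mxE /= /horner_eval !hE.
Qed.

Lemma det_zero_block d e (B : 'M[F]_(d, e)) (C : 'M_(e, d)) (D : 'M_e) : D \in unitmx ->
  \det (block_mx 0 B C D) = \det (- (B *m invmx D *m C)) * \det D.
Proof.
move=> uD; have : \det (block_mx 0 B C D *m block_mx 1%:M 0 (- (invmx D *m C)) 1%:M) = \det (- (B *m invmx D *m C)) * \det D.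
  rewrite mulmx_block !mulmx1 !mulmx0 !add0r !mulmxN !mulmxA mulmxV // mul1mx subrr.
  by rewrite det_ublock.
by rewrite det_mulmx det_lblock !det1 !mulr1.
Qed.

Lemma det_scale_block d e (B : 'M[F]_(d, e)) (C : 'M_(e, d)) (D : 'M_e) t :
  \det (block_mx 0 (t *: B) (t *: C) D) = t ^+ (d + d) * \det (block_mx 0 B C D).
Proof.
have -> : block_mx 0 (t *: B) (t *: C) D =
    block_mx t%:M 0 0 1%:M *m block_mx 0 B C D *m block_mx t%:M 0 0 1%:M.
  by rewrite !mulmx_block !(mulmx1, mul1mx, mulmx0, mul0mx, addr0, add0r, mul_scalar_mx, mul_mx_scalar, scaler0).
by rewrite !det_mulmx !det_ublock !det1 !det_scalar !mulr1 exprD; ring.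
Qed.

Lemma altm_inv n (A : 'M[F]_n) : altm A -> A \in unitmx -> altm (invmx A).
Proof.
move=> aA uA; have iT : (invmx A)^T = - invmx A.
  by rewrite trmx_inv (altm_tr aA) -scaleN1r invmxZ ?scalerN1 ?invrN1 ?scaleN1r // -scaleN1r unitmxZ // unitrN unitr1.
have -> : invmx A = invmx A *m ((-1) *: A) *m (invmx A)^T.
  by rewrite iT -scalemxAr mulVmx // mulmxN scaleN1r mulNmx mul1mx opprK.
exact/altm_cong/altmZ.
Qed.

Lemma altm2_det (A : 'M[F]_2) : altm A -> \det A = A 0 1 ^+ 2.
Proof.
move=> aA; have A10 : A 1 0 = - A 0 1 by have := altm_tr aA => /matrixP/(_ 0 1); rewrite !mxE.
by rewrite det2 !(altm_diag _ aA) A10; ring.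
Qed.

End Blocks.

Section SecondOrder.
Variables (K : closedFieldType) (g : alt3 K 9) (C : tri3 K 9).
Local Notation F := (cF C).
Hypothesis FE : forall (x : 'rV[K]_9) (M : 'M_(8, 9)),
  F x ^+ 2 * \det (col_mx x M : 'M_9) ^+ 2 = \det (M *m om g x *m M^T).
Variables (x : 'rV[K]_9) (n : 'M[K]_(2, 9)) (W : 'M[K]_(6, 9)) (H : 'M[K]_(8, 9)).
Hypotheses (free_nW : row_free (col_mx (col_mx x n) W)) (nx : n *m om g x = 0).
Local Notation Omega := (W *m om g x *m W^T).
Hypotheses (uO : Omega \in unitmx) (Fx : F x = 0).
Hypotheses (DH : forall u, cD C x (u *m H) = 0) (nH : forall u : 'rV_8, n *m om g (u *m H) *m n^T = 0).
Local Notation B y := (n *m om g y *m W^T).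
Local Notation beta y := ((B y *m invmx Omega *m (B y)^T) 0 1).

(** For a tangent direction y both sides of [FE] have order at least 4 along x + t y. The
    coefficient of t ^ 4 of the determinant is that of [Omega] times that of a Schur complement, an
    alternating 2 x 2 matrix with entry [beta]. *)
Lemma second_order_sqr u : cD C (u *m H) x ^+ 2 * \det (col_mx x (col_mx n W) : 'M_9) ^+ 2
  = \det Omega * beta (u *m H) ^+ 2.
Proof.
set y := u *m H; have yx : cD C x y = 0 by apply: DH.
have aO : altm Omega by apply/altm_cong/om_altm.
have By : (B y)^T = - (W *m om g y *m n^T).
  by rewrite !trmx_mul trmxK mulmxA (altm_tr (om_altm g y)) mulmxN mulNmx.
have [q qE] := det_line (@block_mx _ 2 6 2 6 0 (B y) (W *m om g y *m n^T) Omega)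
  (@block_mx _ 2 6 2 6 0 0 0 (W *m om g y *m W^T)).
have [D DE] := polyf_line x y (polyf_det_col (col_mx n W)).
have xn : om g x *m n^T = 0.
  by rewrite -[om g x]trmxK -trmx_mul (altm_tr (om_altm g x)) mulmxN nx oppr0 trmx0.
have key t : t ^+ 4 * ((cD C y x + t * F y) ^+ 2 * D.[t] ^+ 2) = t ^+ 4 * q.[t].
  have -> : t ^+ 4 * ((cD C y x + t * F y) ^+ 2 * D.[t] ^+ 2) = F (x + t *: y) ^+ 2 * D.[t] ^+ 2.
    by rewrite cF_line Fx yx; ring.
  rewrite -DE FE qE (@scale_block_mx _ 2 6 2 6) !scaler0 (@add_block_mx _ 2 6 2 6) !addr0.
  rewrite -[t ^+ 4]/(t ^+ (2 + 2)) -det_scale_block; congr (\det _).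
  rewrite omD omZ (@tr_col_mx _ 2 6) (@mul_col_mx _ 2 6) (@mul_col_row _ 2 6 9 2 6).
  rewrite !mulmxDr !mulmxDl nx !mul0mx !add0r -[W *m om g x *m n^T]mulmxA xn mulmx0 add0r.
  by rewrite -!scalemxAr -!scalemxAl nH scaler0.
have := congr1 (horner^~ 0) (@poly_cancelX K 4 (((cD C y x)%:P + 'X * (F y)%:P) ^+ 2 * D ^+ 2) q _).
rewrite !hE mul0r addr0 -DE scale0r addr0 qE scale0r addr0 => ->; last by move=> t; rewrite !hE key.
have E : - (B y *m invmx Omega *m (W *m om g y *m n^T)) = B y *m invmx Omega *m (B y)^T by rewrite By mulmxN.
have -> := @det_zero_block K 2 6 (B y) (W *m om g y *m n^T) Omega uO.
rewrite E altm2_det; first by rewrite mulrC.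
exact/altm_cong/altm_inv.
Qed.

Lemma second_order : exists2 c, c != 0 & forall u, cD C (u *m H) x = c * beta (u *m H).
Proof.
set D0 := \det (col_mx x (col_mx n W) : 'M_9).
have D00 : D0 != 0 by apply: det_unit9; apply: (@col_mxA_free _ 1 2 6).
have [| |u|c [cE cH]] := @sqr_polyf K 8 (fun u => cD C (u *m H) x) (fun u => beta (u *m H)) (\det Omega / D0 ^+ 2).
- by apply: (polyf_lin (f := fun y => cD C y x)); apply: polyf_cDl.
- apply: (polyf_lin (f := fun y => beta y)).
  have pB i j : polyf (fun y => B y i j).
    apply: (polyf_ext (f := fun y => g y (row i n) (row j W))) => [y|]; first by rewrite omP_mx.
    by apply: polyf_aform => l; [exact: polyf_coord|exact: polyf_const|exact: polyf_const].
  apply: (polyf_ext (f := fun y => \sum_l (\sum_j B y 0 j * invmx Omega j l) * B y 1 l)) => [y|].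
    by rewrite [RHS]mxE; apply: eq_bigr => l _; rewrite [X in _ = X * _]mxE [X in _ = _ * X]mxE.
  apply: polyf_sum => l _; apply: polyfM => //; apply: polyf_sum => j _; apply: polyfM => //; exact: polyf_const.
- apply: (mulIf (_ : D0 ^+ 2 != 0)); first by rewrite expf_neq0.
  by rewrite second_order_sqr mulrAC divfK // expf_neq0.
exists c => //; apply: contraTneq uO => c0; rewrite unitmxE unitfE negbK.
move: cE; rewrite c0 expr0n => /esym/eqP; rewrite mulf_eq0 invr_eq0 expf_eq0 (negPf D00) andbF orbF //.
Qed.

End SecondOrder.

Section Subspaces.
Variable F : fieldType.

Lemma kernel_rows_rank m n d (M : 'M[F]_(m, n)) : (d + \rank M <= m)%N ->
  exists Z : 'M_(d, m), row_free Z /\ Z *m M = 0.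
Proof.
move=> le; have [Z [frZ ZM]] := @kernel_rows F m (\rank M) d (col_base M) le.
by exists Z; split=> //; rewrite -(mulmx_base M) mulmxA ZM mul0mx.
Qed.

Lemma complement_rows m1 m2 n d (A : 'M[F]_(m1, n)) (B : 'M_(m2, n)) : (\rank A + d <= \rank B)%N ->
  exists Z : 'M_(d, n), (Z <= B)%MS /\ forall v : 'rV_d, (v *m Z <= A)%MS -> v = 0.
Proof.
move=> le; pose D := (B :\: A)%MS.
have dD : (d <= \rank D)%N.
  have := mxrank_cap_compl B A; have := mxrankS (capmxSr B A).
  rewrite -/D; move: le; move: (\rank A) (\rank B) (\rank D) (\rank _); clear; lia.
pose Z := pid_mx d *m row_base D : 'M_(d, n).
have frZ : row_free Z.
  rewrite /row_free /Z mxrankMfree ?row_base_free // rank_pid_mx //.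
have ZD : (Z <= D)%MS by rewrite (submx_trans (submxMl _ _)) // eq_row_base.
exists Z; split; first exact: submx_trans ZD (diffmxSl _ _).
move=> v vA; apply: (row_free_inj frZ); rewrite mul0mx; apply/eqP.
rewrite -submx0 -(capmx_diff B A) sub_capmx vA andbT.
exact: submx_trans (submxMl _ _) ZD.
Qed.

Lemma rank_col_row m n (A : 'M[F]_(m, n)) (h : 'rV_n) : ~~ (h <= A)%MS -> (\rank A < \rank (col_mx A h))%N.
Proof.
move=> hA; rewrite -addsmxE ltnNge; apply: contra hA => le.
exact: submx_trans (addsmxSr A h) (submx_rank_ge (addsmxSl A h) le).
Qed.

Lemma row_rows3 n (x a b : 'rV[F]_n) : [/\ row i30 (rows3 x a b) = x, row i31 (rows3 x a b) = a & row i32 (rows3 x a b) = b].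
Proof. by split; apply/rowP=> j; rewrite !mxE. Qed.

Lemma ord3P (P : 'I_3 -> Prop) : P i30 -> P i31 -> P i32 -> forall i, P i.
Proof.
by move=> p0 p1 p2 [[|[|[|//]]] lt]; [move: p0|move: p1|move: p2]; congr P; apply: val_inj.
Qed.

End Subspaces.

Section Regular.
Variables (K : closedFieldType) (g : alt3 K 9) (C : tri3 K 9).
Local Notation F := (cF C).
Hypothesis FE : forall (x : 'rV[K]_9) (M : 'M_(8, 9)),
  F x ^+ 2 * \det (col_mx x M : 'M_9) ^+ 2 = \det (M *m om g x *m M^T).
Hypothesis S1 : forall x a b : 'rV_9,
  row_free (rows3 x a b) -> kill g x a -> kill g x b -> kill g a b -> False.
Hypothesis two : (2%:R : K) != 0.
Hypothesis noS : forall u : 'rV_9, u != 0 -> (6 <= \rank (om g u))%N.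

(* The situation at a kernel vector [k] of the Hessian at [x], where the rows of [U] are [x, a, b] and [fU] is the
   first-order deformation of [U] along [k]. *)
Section Deformation.
Variables (H : 'M[K]_(8, 9)) (U fU : 'M[K]_(3, 9)).
Hypotheses (rH : \rank H = 8%N) (frU : row_free U) (UH : (U <= H)%MS) (fUH : (fU <= H)%MS).
Hypothesis UU : forall (s s' : 'rV_3) h, (h <= H)%MS -> g (s *m U) (s' *m U) h = 0.
Hypothesis sym : forall (s s' : 'rV_3) h, (h <= H)%MS -> g h (s *m U) (s' *m fU) = g h (s' *m U) (s *m fU).
Local Notation R := (col_mx U fU).

(** This trilinear expression in l, s, s' is symmetric in the last two and skew in the outer two
    arguments; together these make it equal to its opposite. *)
Lemma deform_tau (l s s' : 'rV_3) : g (l *m fU) (s *m U) (s' *m fU) = 0.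
Proof.
have inH (r : 'rV_3) : (r *m fU <= H)%MS by apply: submx_trans (submxMl _ _) fUH.
pose t (l s s' : 'rV_3) := g (l *m fU) (s *m U) (s' *m fU); rewrite -/(t l s s').
have A p q r : t p q r = t p r q by apply: sym.
have B p q r : t p q r = - t r q p by apply: aC13.
have E : t l s s' = - t l s s'.
  by rewrite [LHS]B (A s' s l) (B s' l s) opprK (A s l s') (B s s' l) (A l s' s).
have : 2%:R * t l s s' = 0 by rewrite mulr_natl mulr2n {1}E addNr.
by move/eqP; rewrite mulf_eq0 (negPf two) => /eqP.
Qed.

Lemma deform_isotropic (u : 'rV_3) r r' : (r <= R)%MS -> (r' <= R)%MS -> g (u *m U) r r' = 0.
Proof.
have inH (v : 'rV_3) : (v *m fU <= H)%MS by apply: submx_trans (submxMl _ _) fUH.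
have inH' (v : 'rV_3) : (v *m U <= H)%MS by apply: submx_trans (submxMl _ _) UH.
case/submxP=> v ->; case/submxP=> v' ->; rewrite -(@hsubmxK _ 1 3 3 v) -(@hsubmxK _ 1 3 3 v') !mul_row_col.
rewrite !aE !UU // (aC23 g _ (_ *m fU) (_ *m U)) UU // (aC12 g _ (_ *m fU)) deform_tau.
by rewrite !oppr0 !addr0.
Qed.

Lemma uU_neq0 (u : 'rV_3) : u != 0 -> u *m U != 0.
Proof. by move=> u0; apply: contraNneq u0 => E; apply/eqP/(row_free_inj frU); rewrite mul0mx. Qed.

(** The 3 x 3 matrices [S h], for h in a plane complementary to [R] in [H], form a pencil with a
    singular member. It yields an h and a point u U for which the 7-dimensional span of [R] and h is
    isotropic, so this point has rank at most 4, against [noS]. *)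
Lemma deform_rank6 : \rank R <> 6%N.
Proof.
move=> rR; have [|Z [ZH Zv]] := @complement_rows _ 6 8 9 2 R H; first by rewrite rR rH.
pose S h := U *m om g h *m fU^T.
have SE h (s s' : 'rV_3) : (s *m S h *m s'^T) 0 0 = g h (s *m U) (s' *m fU).
  by rewrite -omE00 /S trmx_mul !mulmxA.
have SD h h' t : S (h + t *: h') = S h + t *: S h'.
  by rewrite /S omD omZ mulmxDr mulmxDl -scalemxAr -scalemxAl.
have [v v0 dv] : exists2 v : 'rV_2, v != 0 & \det (S (v *m Z)) = 0.
  pose e0 : 'rV[K]_2 := delta_mx 0 0; pose e1 : 'rV[K]_2 := delta_mx 0 1.
  have [d1|d1] := eqVneq (\det (S (e1 *m Z))) 0.
    by exists e1 => //; apply/eqP=> /rowP/(_ 1)/eqP; rewrite !mxE eqxx oner_eq0.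
  have [s ds] := pencil_singular (S (e0 *m Z)) d1.
  exists (e0 + s *: e1); first by apply/eqP=> /rowP/(_ 0)/eqP; rewrite !mxE /= mulr0 addr0 oner_eq0.
  by rewrite mulmxDl -scalemxAl SD.
have /eqP/det0P[u u0 uS] := dv; set h := v *m Z in uS.
have hH : (h <= H)%MS by apply: submx_trans (submxMl _ _) ZH.
have hR : ~~ (h <= R)%MS by apply: contra v0 => /Zv ->.
have iso : col_mx R h *m om g (u *m U) *m (col_mx R h)^T = 0.
  apply/matrixP=> i j; rewrite omP_mx [RHS]mxE.
  have rowE' i' : (row i' (col_mx R h) <= R)%MS \/ row i' (col_mx R h) = h.
    case: (@split_ordP 6 1 i') => l ->; [left|right]; first by rewrite (@rowKu _ 6 1) row_sub.
    by rewrite (@rowKd _ 6 1) ord1; apply/rowP=> l'; rewrite mxE.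
  have gh r : (r <= R)%MS -> g (u *m U) r h = 0.
    case/submxP=> w ->; rewrite -(@hsubmxK _ 1 3 3 w) mul_row_col !aE UU // add0r.
    by rewrite a_rot a_rot -SE uS mul0mx mxE.
  have [Ri|->] := rowE' i; have [Rj|->] := rowE' j.
  - exact: deform_isotropic.
  - exact: gh.
  - by rewrite aC23 gh // oppr0.
  by rewrite aalt23.
have := isotropic_rank iso; have := rank_col_row hR; have := noS (uU_neq0 u0); rewrite rR.
by move: (\rank _) (\rank _); clear; lia.
Qed.

Lemma perp_rank (w : 'rV_9) m (Q : 'M_(m, 9)) : w != 0 ->
  (forall q h, (q <= Q)%MS -> (h <= H)%MS -> g w q h = 0) -> (\rank Q <= 4)%N.
Proof.
move=> w0 QH; have : Q *m (om g w *m H^T) = 0.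
  by rewrite mulmxA; apply/matrixP=> i j; rewrite omP_mx [RHS]mxE QH ?row_sub.
move/mulmx0_rank_max; have := mxrank_mul_min (om g w) H^T; rewrite mxrank_tr rH.
by have := noS w0; move: (\rank _) (\rank _) (\rank _); clear; lia.
Qed.

Lemma deform_radical (u : 'rV_3) : (u *m fU <= U)%MS ->
  forall r h, (r <= R)%MS -> (h <= H)%MS -> g (u *m U) r h = 0.
Proof.
move=> /submxP[s sE] r h /submxP[w ->] hH; rewrite -(@hsubmxK _ 1 3 3 w) mul_row_col !aE UU // add0r.
by rewrite -a_rot sym // sE a_rot UU.
Qed.

(** A linear relation between [U] and [fU] gives u != 0 with u fU in [U]; then u U contracts all of
    [R] x [H] to zero, and [perp_rank] bounds [R]. *)
Lemma deform_le : (\rank R <= 4)%N.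
Proof.
have le6 : (\rank R <= 6)%N := rank_leq_row R.
have lt6 : (\rank R < 6)%N by rewrite ltn_neqAle le6 andbT; apply/eqP/deform_rank6.
have [|Z [frZ ZR]] := @kernel_rows_rank _ 6 9 1 R; first by rewrite add1n.
pose s := @lsubmx _ 1 3 3 Z; pose u := @rsubmx _ 1 3 3 Z.
have suE : s *m U + u *m fU = 0 by rewrite -mul_row_col hsubmxK.
have u0 : u != 0.
  apply: contraTneq frZ => u0; have s0 : s = 0.
    by apply: (row_free_inj frU); rewrite mul0mx -[RHS]suE u0 mul0mx addr0.
  by rewrite -(@hsubmxK _ 1 3 3 Z) -/s -/u u0 s0 (@row_mx0 _ 1 3 3) /row_free mxrank0.
apply: (perp_rank (uU_neq0 u0)); apply: deform_radical.
by apply/submxP; exists (- s); rewrite mulNmx; apply/eqP; rewrite -addr_eq0 addrC suE.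
Qed.

(** Now there is a plane of such u, and a pencil of alternating forms on a 4-dimensional complement
    of [R] in [H]. A singular member enlarges [R] by one dimension, beyond the bound of
    [perp_rank]. *)
Lemma deform_rank4 : \rank R <> 4%N.
Proof.
move=> rR; have [|Z [frZ ZR]] := @kernel_rows_rank _ 6 9 2 R; first by rewrite rR.
pose s := @lsubmx _ 2 3 3 Z; pose u := @rsubmx _ 2 3 3 Z.
have suE : s *m U + u *m fU = 0 by rewrite -mul_row_col hsubmxK.
have fru : row_free u.
  apply: inj_row_free => v vu; apply: (row_free_inj frZ); rewrite mul0mx -(@hsubmxK _ 2 3 3 Z) (@mul_mx_row _ _ _ 3 3) -/s -/u vu.
  have -> : v *m s = 0; last by rewrite row_mx0.
  apply: (row_free_inj frU); rewrite mul0mx -mulmxA -[RHS](mulmx0 _ v) -suE mulmxDr !mulmxA vu mul0mx addr0 //.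
have inU (v : 'rV_2) : (v *m u *m fU <= U)%MS.
  apply/submxP; exists (- (v *m s)); rewrite mulNmx -!mulmxA; apply/eqP.
  by rewrite -addr_eq0 addrC -mulmxDr suE mulmx0.
have [|Y [YH Yv]] := @complement_rows _ 6 8 9 4 R H; first by rewrite rR rH.
have RH : (R <= H)%MS by rewrite col_mx_sub UH.
have HRY : (H <= R + Y)%MS.
  apply: submx_rank_ge; first by rewrite addsmx_sub RH.
  have := mxrank_sum_cap R Y; have -> : (R :&: Y)%MS = 0.
    apply/eqP; rewrite -submx0; apply/row_subP=> i; have := row_sub i (R :&: Y)%MS; rewrite sub_capmx => /andP[iR /submxP[w wE]].
    by move: iR; rewrite wE => /Yv ->; rewrite mul0mx sub0mx.
  have -> : \rank Y = 4%N by apply/eqP; apply: inj_row_free => w wY; apply: Yv; rewrite wY sub0mx.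
  by rewrite mxrank0 addn0 rR rH => ->.
pose A (v : 'rV_2) := Y *m om g (v *m u *m U) *m Y^T.
have AD v v' t : A (v + t *: v') = A v + t *: A v'.
  by rewrite /A !mulmxDl -!scalemxAl omD omZ mulmxDr mulmxDl -scalemxAr -scalemxAl.
have [v v0 dv] : exists2 v : 'rV_2, v != 0 & \det (A v) = 0.
  pose e0 : 'rV[K]_2 := delta_mx 0 0; pose e1 : 'rV[K]_2 := delta_mx 0 1.
  have [d1|d1] := eqVneq (\det (A e1)) 0.
    by exists e1 => //; apply/eqP=> /rowP/(_ 1)/eqP; rewrite !mxE eqxx oner_eq0.
  have [t dt] := pencil_singular (A e0) d1.
  exists (e0 + t *: e1); first by apply/eqP=> /rowP/(_ 0)/eqP; rewrite !mxE /= mulr0 addr0 oner_eq0.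
  by rewrite AD.
have vu0 : v *m u != 0.
  by apply: contraNneq v0 => E; apply/eqP/(row_free_inj fru); rewrite mul0mx.
have /eqP/det0P[z z0 zA] := dv; pose h := z *m Y.
have hR : ~~ (h <= R)%MS by apply: contra z0 => /Yv ->.
have : (\rank (col_mx R h) <= 4)%N.
  apply: (perp_rank (uU_neq0 vu0)) => q h' /submxP[c ->]; rewrite -(@hsubmxK _ 1 6 1 c) mul_row_col => h'H.
  have rad := deform_radical (inU v).
  rewrite aD2 rad ?submxMl // add0r [rsubmx c]mx11_scalar mul_scalar_mx aZ2.
  have /sub_addsmxP[[c1 c2] /= ->] := submx_trans h'H HRY.
  rewrite aD3 aC23 rad ?submxMl //; last by apply: submx_trans (submxMl _ _) YH.
  by rewrite oppr0 add0r -omE00 /h trmx_mul !mulmxA -2!(mulmxA z) -/(A v) zA mul0mx [X in _ * X]mxE mulr0.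
by move=> le; have := rank_col_row hR; rewrite rR => lt; have := leq_trans lt le.
Qed.

Lemma deform_trivial : (fU <= U)%MS.
Proof.
have UR : (U <= R)%MS by rewrite -addsmxE addsmxSl.
have : (R <= U)%MS.
  apply: submx_rank_ge UR _; rewrite (eqP frU); have := deform_le; have := deform_rank4.
  by move: (\rank _); clear; lia.
by rewrite col_mx_sub => /andP[].
Qed.

End Deformation.

(** A kernel vector [k] of the Hessian is a direction in which the tangent hyperplane is stationary
    to first order. It is completed to a deformation of the isotropic space spanned by x, a, b,
    which [deform_trivial] shows to be trivial. *)
Lemma hess_regular (x : 'rV[K]_9) : x != 0 -> F x = 0 -> \det (hessian C x) != 0.
Proof.
move=> x0 Fx; apply/negP => /det0P[k k0 kx].
have rk : \rank (om g x) = 6%N.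
  have := noS x0; have /eqP/[!F_rank FE x0] := Fx.
  by move: (\rank _); clear; lia.
have [|n [frn nx]] := @kernel_extend _ _ g 2 x x0; first by rewrite rk.
have [c0 [c00 D1]] := grad_rank6 FE rk frn nx.
pose a := row 0 n; pose b := row 1 n; rewrite -/a -/b in D1.
have fr3 : row_free (rows3 x a b) := rows3_free frn.
have xa : kill g x a by rewrite /kill -row_mul nx row0.
have xb : kill g x b by rewrite /kill -row_mul nx row0.
have kT z : cT C x k z = 0 by move: z; apply/hessian_kerP.
have abk : g a b k = 0.
  apply: (mulfI c00); rewrite mulr0 -D1; apply: (mulfI two); rewrite mulr0.
  by rewrite -[2%:R * _](cTxx C x k) cT23 kT.
have [W /andP[frW fuW]] := @basis_completion _ 3 6 9 (col_mx x n) erefl frn.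
have N0 : col_mx x n *m om g x = 0 by rewrite (@mul_col_mx _ 1 2) (killxx g x : x *m om g x = 0) nx col_mx0.
have uO : W *m om g x *m W^T \in unitmx.
  by rewrite -row_free_unit /row_free (rank_reduced (om_altm g x) frW fuW N0) rk.
pose v : 'rV[K]_9 := \row_i g a b (delta_mx 0 i).
have vE y : g a b y = (v *m y^T) 0 0.
  rewrite {1}(row_sum_delta y) a_sum3 mxE; apply: eq_bigr => i _.
  by rewrite aZ3 !mxE mulrC.
have [|H [frH Hv]] := @kernel_rows K 9 1 8 v^T; first by [].
have rH : \rank H = 8%N by apply/eqP.
have abH (u : 'rV_8) : g a b (u *m H) = 0.
  by rewrite vE -[v]trmxK -trmx_mul -mulmxA Hv mulmx0 trmx0 mxE.
have abH' y : (y <= H)%MS -> g a b y = 0 by case/submxP=> u ->.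
have v0 : v != 0.
  by apply/eqP => v0; apply: (S1 fr3) => //; apply/killP => y; rewrite vE v0 mul0mx mxE.
have HP y : g a b y = 0 -> (y <= H)%MS.
  rewrite vE => vy; have sub : (H <= kermx v^T)%MS by apply/sub_kermxP.
  apply: submx_trans (submx_rank_ge sub _).
    apply/sub_kermxP; apply: trmx_inj; rewrite trmx_mul trmxK trmx0.
    by apply: mx11_eq; rewrite vy mxE.
  by rewrite mxrank_ker mxrank_tr rank_rV v0 rH.
have /submxP[uk kE] : (k <= H)%MS := HP k abk.
have DH u : cD C x (u *m H) = 0 by rewrite D1 abH mulr0.
have nH (u : 'rV_8) : n *m om g (u *m H) *m n^T = 0.
  apply: altm2; first exact/altm_cong/om_altm.
  by rewrite omP_mx -/a -/b a_rot abH.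
have [c cn0 cE'] := second_order FE frW nx uO Fx DH nH.
pose B y := n *m om g y *m W^T; pose Oi := invmx (W *m om g x *m W^T).
(* Its rows [a'], [b'] are the velocities of a and b as x moves along k: [first] is the derivative
   of the relations that x kills a and b, [third] that of the vanishing of g(a, b, -) on [H]. *)
pose A' := - (B k *m Oi *m W).
have aO : altm (W *m om g x *m W^T) by apply/altm_cong/om_altm.
have OiT : Oi^T = - Oi by apply/altm_tr/altm_inv.
have BT y : (B y)^T = - (W *m om g y *m n^T).
  by rewrite !trmx_mul trmxK mulmxA (altm_tr (om_altm g y)) mulmxN mulNmx.
have bil z z' : (B z *m Oi *m (B z')^T) = - (B z *m Oi *m W *m om g z' *m n^T).
  by rewrite BT mulmxN !mulmxA.
have bil2 z : B z *m Oi *m (B k)^T = n *m om g z *m A'^T.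
  have -> : A'^T = W^T *m (Oi *m (B k)^T).
    by rewrite /A' linearN /= (trmx_mul (B k *m Oi) W) (trmx_mul (B k) Oi) OiT mulNmx mulmxN opprK.
  by rewrite !mulmxA.
pose a' := row 0 A'; pose b' := row 1 A'.
(* Polarizing [second_order] at [k], where T(k, -, x) = 0. *)
have third z : (z <= H)%MS -> g a' b z + g a b' z = 0.
  case/submxP=> uz ->.
  have BD u u' : B (u + u') = B u + B u' by rewrite /B omD mulmxDr mulmxDl.
  have := cE' (uk + uz); rewrite mulmxDl -kE cDDl cE' kE cE' -kE.
  have -> : cT C k (uz *m H) x = 0 by rewrite cT23 cT12 kT.
  have betaE z' : (n *m om g z' *m W^T *m invmx (W *m om g x *m W^T) *m (n *m om g z' *m W^T)^T) 0 1 = (B z' *m Oi *m (B z')^T) 0 1 by [].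
  rewrite !betaE; clear betaE; move: (uz *m H) => {}z.
  have -> : B (k + z) *m Oi *m (B (k + z))^T = B k *m Oi *m (B k)^T + B k *m Oi *m (B z)^T + n *m om g z *m A'^T + B z *m Oi *m (B z)^T.
    have -> : (B (k + z))^T = (B k)^T + (B z)^T by rewrite BD; apply/matrixP=> i j; rewrite !mxE.
    rewrite BD -bil2 !mulmxDr !mulmxDl; move: (_ *m _) (_ *m _) (_ *m _) (_ *m _) => M1 M2 M3 M4.
    by apply/matrixP=> i j; rewrite !mxE; ring.
  have -> : B k *m Oi *m (B z)^T = A' *m om g z *m n^T by rewrite bil /A' !mulNmx.
  rewrite addr0 => E.
  have {}E : (A' *m om g z *m n^T) 0 1 + (n *m om g z *m A'^T) 0 1 = 0.
    apply: (mulfI cn0); rewrite mulr0; move: E; move: (B k *m Oi *m (B k)^T) (B z *m Oi *m (B z)^T) (A' *m _ *m _) (n *m _ *m _) => M1 M2 M3 M4.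
    have -> : (M1 + M3 + M4 + M2) 0 1 = M1 0 1 + M3 0 1 + M4 0 1 + M2 0 1 by rewrite !mxE.
    move=> E; have -> : c * (M3 0 1 + M4 0 1) = c * (M1 0 1 + M3 0 1 + M4 0 1 + M2 0 1) - (c * M1 0 1 + c * M2 0 1) by ring.
    by rewrite -E subrr.
  move: E; rewrite !omP_mx -/a -/b -/a' -/b' => E.
  by rewrite -(a_rot g z a' b) -(a_rot g z a b').
have first : A' *m om g x + n *m om g k = 0.
  have xx : om g x *m x^T = 0.
    by rewrite -[om g x]trmxK -trmx_mul (altm_tr (om_altm g x)) mulmxN (killxx g x : x *m om g x = 0) oppr0 trmx0.
  have xn : om g x *m n^T = 0.
    by rewrite -[om g x]trmxK -trmx_mul (altm_tr (om_altm g x)) mulmxN nx oppr0 trmx0.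
  have uM : (col_mx (col_mx x n) W : 'M_9)^T \in unitmx by rewrite unitmx_tr -row_free_unit.
  apply: (can_inj (mulmxK uM)); rewrite mul0mx (@tr_col_mx _ 3 6) (@tr_col_mx _ 1 2) (@mul_mx_row _ _ _ 3 6) (@mul_mx_row _ _ _ 1 2).
  rewrite !mulmxDl -!(mulmxA A') xx xn !mulmx0 !add0r.
  have -> : n *m om g k *m x^T = 0.
    apply/matrixP=> i j; rewrite omP_mx [RHS]mxE; have -> : row j x = x by apply/rowP=> l; rewrite mxE ord1.
    have /killP K1 : kill g x (row i n) by rewrite /kill -row_mul nx row0.
    by rewrite -a_rot aC23 K1 oppr0.
  have -> : n *m om g k *m n^T = 0 by rewrite kE nH.
  have -> : A' *m (om g x *m W^T) + n *m om g k *m W^T = 0.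
    by rewrite /A' mulNmx -!mulmxA (mulmxA W) /Oi mulVmx // mulmx1 addNr.
  by rewrite (@row_mx0 _ 2 1 2) (@row_mx0 _ 2 3 6).
have first' i z : g x (row i A') z + g k (row i n) z = 0.
  have : row i (A' *m om g x + n *m om g k) *m z^T = 0 by rewrite first row0 mul0mx.
  by move/matrixP/(_ 0 0); rewrite raddfD /= !row_mul mulmxDl mxE !omE00 mxE.
have fa z : g x a' z = - g k a z by apply/eqP; rewrite -addr_eq0 first'.
have fb z : g x b' z = - g k b z by apply/eqP; rewrite -addr_eq0 first'.
pose U := rows3 x a b; pose fU := rows3 k a' b'.
have aH : (a <= H)%MS by apply: HP; rewrite aalt13.
have bH : (b <= H)%MS by apply: HP; rewrite aalt23.
have xH : (x <= H)%MS by apply: HP; rewrite -a_rot (killP g x a).1.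
have a'H : (a' <= H)%MS.
  apply: HP; have := third a aH; rewrite (aalt13 g a b') addr0 => E.
  by rewrite -(a_rot g a' a b) aC23 E oppr0.
have b'H : (b' <= H)%MS.
  by apply: HP; have := third b bH; rewrite aalt23 add0r aC23 => /eqP; rewrite oppr_eq0 => /eqP.
have kH : (k <= H)%MS by apply: HP.
have r3H (p q r : 'rV_9) : (p <= H)%MS -> (q <= H)%MS -> (r <= H)%MS -> (rows3 p q r <= H)%MS.
  move=> pH qH rH'; have [e0 e1 e2] := row_rows3 p q r.
  by apply/row_subP; apply: ord3P; rewrite ?e0 ?e1 ?e2.
have [rU0 rU1 rU2] := row_rows3 x a b; have [rf0 rf1 rf2] := row_rows3 k a' b'.
have xay y : g x a y = 0 by move: y; apply/killP.
have xby y : g x b y = 0 by move: y; apply/killP.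
have UUh s s' h : (h <= H)%MS -> g (s *m U) (s' *m U) h = 0.
  move=> hH; rewrite !mul_rows3 !aE !(aC12 g a x) !(aC12 g b x) !(aC12 g b a) !xay !xby !abH' //; ring.
have symh s s' h : (h <= H)%MS -> g h (s *m U) (s' *m fU) = g h (s' *m U) (s *m fU).
  move=> hH; rewrite !mul_rows3 !aE.
  have q1 : g h x a' = g h a k by rewrite a_rot fa aC12 opprK -a_rot.
  have q2 : g h x b' = g h b k by rewrite a_rot fb aC12 opprK -a_rot.
  have q3 : g h a b' = g h b a'.
    have := third h hH; rewrite (a_rot g h a b') => /eqP; rewrite addr_eq0 => /eqP.
    by rewrite (a_rot g h b a') (aC12 g b a') => ->; rewrite opprK.
  by rewrite q1 q2 q3; ring.
have fUU := deform_trivial (U := U) rH fr3 (r3H _ _ _ xH aH bH) (r3H _ _ _ kH a'H b'H) UUh symh.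
have UN : (U <= col_mx x n)%MS.
  have xN : (x <= col_mx x n)%MS by rewrite -addsmxE addsmxSl.
  have nN i : (row i n <= col_mx x n)%MS by rewrite (submx_trans (row_sub i n)) // -addsmxE addsmxSr.
  by apply/row_subP; apply: ord3P; rewrite ?rU0 ?rU1 ?rU2 // nN.
have rowf i : (row i fU <= col_mx x n)%MS by rewrite (submx_trans (row_sub i _)) // (submx_trans fUU).
have A'0 i : row i A' = 0.
  have : (row i A' <= col_mx x n)%MS.
    case: i => [[|[|//]] lt].
      by have := rowf i31; rewrite rf1 (_ : Ordinal lt = 0) //; apply: val_inj.
    by have := rowf i32; rewrite rf2 (_ : Ordinal lt = 1) //; apply: val_inj.
  case/submxP=> u uE.
  have [|_ y0] := @col_row_freeP _ 3 6 9 (col_mx x n) W u (row i (B k *m Oi)) frW.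
    by rewrite -uE /A' raddfN /= row_mul addNr.
  by rewrite /A' raddfN /= row_mul y0 mul0mx oppr0.
(* With [A' = 0] the vector k kills a and b; being in the span of x, a, b it is a multiple of x, and
   the kernel condition then makes the gradient at x vanish. *)
have gkn i z : g k (row i n) z = 0 by have := first' i z; rewrite A'0 a02 add0r.
have [z abz] : exists z, g a b z != 0.
  apply: NNPP => H0; apply: (S1 fr3) => //; apply/killP => z.
  by apply/eqP/negPn/negP => nz; apply: H0; exists z.
have /submxP[u uE] : (k <= U)%MS by rewrite -rf0 (submx_trans (row_sub i30 fU)).
rewrite mul_rows3 in uE.
have u2 : u 0 i32 = 0.
  have := gkn 0 z; rewrite -/a uE !aE (aC12 g b a) xay => /eqP.
  by rewrite !(mulr0, add0r, addr0, mulrN) oppr_eq0 mulf_eq0 (negPf abz) orbF => /eqP.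
have u1 : u 0 i31 = 0.
  have := gkn 1 z; rewrite -/b uE !aE xby => /eqP.
  by rewrite !(mulr0, add0r, addr0) mulf_eq0 (negPf abz) orbF => /eqP.
move: uE; rewrite u1 u2 !scale0r !addr0 => kx'.
have u00 : u 0 i30 != 0 by apply: contraNneq k0 => E; rewrite kx' E scale0r.
case/eqP: abz; apply: (mulfI c00); rewrite mulr0 -D1; apply: (mulfI two); rewrite mulr0.
apply: (mulfI u00); rewrite mulr0 -[2%:R * _](cTxx C x z) -cTZ2 -kx' kT //.
Qed.

End Regular.

(** * The Hessian of the cubic at points killed by a singular point *)

Section Linear.
Variable F : fieldType.

Lemma two_rows_threeform n (g : alt3 F n) (Z : 'M_(2, n)) (a b c : 'rV_2) : g (a *m Z) (b *m Z) (c *m Z) = 0.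
Proof.
rewrite -pullE -[RHS](_ : pull g (0 : 'M_(2, n)) a b c = 0); last by rewrite pullE mulmx0 a01.
by apply: alt3_ext => i j k ijk; have := ltn_ord k; lia.
Qed.

(** A 3-form in four variables is the contraction of a volume form with a vector, which lies in its
    radical; [u] is this vector, unless the 3-form is zero. *)
Lemma four_rows_kernel n (g : alt3 F n) (Z : 'M_(4, n)) :
  exists2 u : 'rV_4, u != 0 & forall a b : 'rV_4, g (u *m Z) (a *m Z) (b *m Z) = 0.
Proof.
pose h := pull g Z.
suff [u u0 uh] : exists2 u : 'rV_4, u != 0 & forall a b : 'rV_4, h u a b = 0.
  by exists u => // a b; rewrite -pullE.
pose r i : 'rV[F]_4 := delta_mx 0 (inord i : 'I_4).
pose u := h (r 1) (r 2) (r 3) *: r 0 - h (r 0) (r 2) (r 3) *: r 1 + h (r 0) (r 1) (r 3) *: r 2 - h (r 0) (r 1) (r 2) *: r 3.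
have [u0|u0] := eqVneq u 0; last first.
  exists u => // a b; rewrite -omE00; suff -> : om h u = 0 by rewrite mulmx0 mul0mx mxE.
  apply/matrixP; apply: ord4P; apply: ord4P; rewrite [LHS]mxE [RHS]mxE -?/(r _) /u;
  rewrite !aE ?(aalt13 h);
  rewrite ?(aC23 h _ (r 1) (r 0)) ?(aC23 h _ (r 2) (r 0)) ?(aC23 h _ (r 3) (r 0)) ?(aC23 h _ (r 2) (r 1)) ?(aC23 h _ (r 3) (r 1)) ?(aC23 h _ (r 3) (r 2));
  rewrite ?(aC12 h (r 1) (r 0)) ?(aC12 h (r 2) (r 0)) ?(aC12 h (r 3) (r 0)) ?(aC12 h (r 2) (r 1)) ?(aC12 h (r 3) (r 1)) ?(aC12 h (r 3) (r 2));
  rewrite ?(aC23 h _ (r 1) (r 0)) ?(aC23 h _ (r 2) (r 0)) ?(aC23 h _ (r 3) (r 0)) ?(aC23 h _ (r 2) (r 1)) ?(aC23 h _ (r 3) (r 1)) ?(aC23 h _ (r 3) (r 2)) ?(aalt12, aalt23); ring.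
have U i : u 0 i = 0 by rewrite u0 mxE.
have e0 := U (inord 0); have e1 := U (inord 1); have e2 := U (inord 2); have e3 := U (inord 3).
rewrite !mxE -!val_eqE /= !inordK //= !(mulr1n, mulr0n, mulr1, mulr0, addr0, add0r, subr0, sub0r) in e0 e1 e2 e3.
rewrite ?(sub0r, add0r, oppr0) in e0 e1 e2 e3; move/eqP: e1; rewrite oppr_eq0 => /eqP e1; move/eqP: e3; rewrite oppr_eq0 => /eqP e3.
exists (r 0).
  by apply/eqP=> /rowP/(_ (inord 0))/eqP; rewrite !mxE !eqxx oner_eq0.
move=> a b; rewrite -[RHS](_ : pull g (0 : 'M_(4, n)) (r 0) a b = 0); last by rewrite pullE !mulmx0 a01.
apply: alt3_ext => i j k ijk; rewrite [RHS]pullE !mulmx0 a01 -/h.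
rewrite -(inord_val i) -(inord_val j) -(inord_val k) -!/(r _).
by case: i j k ijk => [[|[|[|[|//]]]] ?] [[|[|[|[|//]]]] ?] [[|[|[|[|//]]]] ?].
Qed.

Lemma rank_pencil_ge m n d (A B : 'M[F]_(m, n)) : (d <= \rank A)%N ->
  exists2 q : {poly F}, q != 0 & forall t, q.[t] != 0 -> (d <= \rank (A + t *: B)%R)%N.
Proof.
move=> dA; pose r := \rank A.
have [R [L RAL]] : exists R : 'M_(r, m), exists L : 'M_(n, r), R *m A *m L = 1%:M.
  exists (pid_mx r *m invmx (col_ebase A)), (invmx (row_ebase A) *m pid_mx r).
  rewrite -[X in _ *m X *m _]mulmx_ebase !mulmxA mulmxKV ?col_ebase_unit //.
  rewrite mulmxK ?row_ebase_unit // !pid_mx_id ?rank_leq_row ?rank_leq_col //.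
  by rewrite pid_mx_1.
have [q qE] := det_line (R *m A *m L) (R *m B *m L).
exists q.
  by apply/eqP => q0; have := qE 0; rewrite q0 horner0 scale0r addr0 RAL det1 => /eqP; rewrite eq_sym oner_eq0.
move=> t; rewrite qE; have -> : R *m A *m L + t *: (R *m B *m L) = R *m (A + t *: B) *m L.
  by rewrite mulmxDr mulmxDl -scalemxAr -scalemxAl.
move=> dn; apply: leq_trans dA _.
have rk : \rank (R *m (A + t *: B)%R *m L)%R = r by apply/eqP; rewrite -/(row_free _) row_free_unit unitmxE unitfE.
by rewrite -/r -rk; apply: leq_trans (mxrankM_maxl _ _) (mxrankM_maxr _ _).
Qed.

(** Vectors with independent images have the same factor, by additivity; rank 2 provides an
    independent image for comparison with any other. *)
Lemma proportional_rows m n (P Q : 'M[F]_(m, n)) : (2 <= \rank P)%N ->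
  (forall v : 'rV_m, v *m P != 0 -> exists a, v *m Q = a *: (v *m P)) -> exists a, Q = a *: P.
Proof.
move=> rP H.
have rowi (M : 'M[F]_(m, n)) : (0 < \rank M)%N -> exists i, row i M != 0.
  move=> M0; apply: NNPP => N; have M00 : M = 0.
    by apply/row_matrixP => i; rewrite row0; apply/eqP/negPn/negP => ni; apply: N; exists i.
  by rewrite M00 mxrank0 in M0.
have [i1 P1] := rowi P (ltnW rP).
pose v1 : 'rV[F]_m := delta_mx 0 i1; have v1P : v1 *m P != 0 by rewrite -rowE.
have [v2 v2P] : exists v2 : 'rV_m, ~~ (v2 *m P <= v1 *m P)%MS.
  apply: NNPP => N; have : (P <= v1 *m P)%MS.
    by apply/row_subP => i; apply/negPn/negP; rewrite rowE => ni; apply: N; exists (delta_mx 0 i).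
  by move/mxrankS; have := rank_leq_row (v1 *m P); move: rP; lia.
have [k0 k0E] := H v1 v1P.
have indep (v : 'rV_m) : ~~ (v *m P <= v1 *m P)%MS -> v *m Q = k0 *: (v *m P).
  move=> nv; have [|a aE] := H v; first by apply: contraNneq nv => ->; rewrite sub0mx.
  have [|b] := H (v + v1).
    apply: contraNneq nv => E; have -> : v *m P = (-1) *: (v1 *m P).
      by apply/eqP; rewrite scaleN1r -subr_eq0 opprK -mulmxDl E.
    exact: scalemx_sub.
  rewrite !mulmxDl aE k0E scalerDr => E.
  have {}E : (a - b) *: (v *m P) = (b - k0) *: (v1 *m P).
    rewrite !scalerBl; apply/eqP; rewrite subr_eq addrAC eq_sym subr_eq eq_sym; apply/eqP.
    by rewrite E addrC.
  have [ab|ab] := eqVneq (a - b) 0.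
    move/eqP: E; rewrite ab scale0r eq_sym scaler_eq0 (negPf v1P) orbF subr_eq0 => /eqP <-.
    by move/eqP: ab; rewrite subr_eq0 => /eqP ->.
  case/negP: nv; have -> : v *m P = (a - b)^-1 *: ((b - k0) *: (v1 *m P)) by rewrite -E scalerA mulVf ?scale1r.
  by rewrite !scalemx_sub.
exists k0; apply/row_matrixP => i; rewrite linearZ /= !rowE; set v := delta_mx 0 i.
have [vP|/indep //] := boolP (v *m P <= v1 *m P)%MS.
have nv : ~~ ((v + v2) *m P <= v1 *m P)%MS.
  apply: contra v2P => s; have -> : v2 *m P = (v + v2) *m P - v *m P by rewrite mulmxDl addrC addKr.
  by rewrite addmx_sub // eqmx_opp.
have := indep _ nv; rewrite !mulmxDl (indep v2 v2P) scalerDr => /addIr //.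
Qed.

End Linear.

(** * The kernel of the quadratic term at a singular point *)

Section SingularKernel.
Variables (K : closedFieldType) (g : alt3 K 9) (C : tri3 K 9).
Local Notation F := (cF C).
Hypothesis S1 : forall x a b : 'rV_9,
  row_free (rows3 x a b) -> kill g x a -> kill g x b -> kill g a b -> False.
Variables (x0 : 'rV[K]_9) (n : 'M[K]_(4, 9)).
Hypotheses (free_n : row_free (col_mx x0 n)) (kill_n : n *m om g x0 = 0).
Local Notation phi y := (n *m om g y *m n^T).

Lemma phi_kernel : exists Z : 'M_(3, 9), row_free Z /\ forall y : 'rV_9, (y <= Z)%MS <-> phi y = 0.
Proof.
pose M : 'M[K]_(9, 6) := \matrix_i vec6 (phi (delta_mx 0 i)).
have ME y : vec6 (phi y) = y *m M := vec6_phi g n y.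
have M0 y : phi y = 0 <-> y *m M = 0.
  rewrite -ME; have v0 : vec6 (0 : 'M[K]_4) = 0.
    by apply/rowP=> i; rewrite !mxE; case: i => [[|[|[|[|[|[|//]]]]]]] lt; rewrite /= /ent mxE.
  split=> [->//|E]; rewrite -(alt4_vec6 (phi_altm g n y)) E -v0 alt4_vec6 //.
  by move=> u; rewrite mulmx0 mul0mx.
have rM : (6 <= \rank M)%N.
  rewrite -[X in (X <= _)%N](mxrank1 K 6); apply: mxrankS; apply/row_subP => i.
  have [y yE] := phi_surj S1 free_n kill_n (altm_alt4 (row i (1%:M : 'M[K]_6))).
  by rewrite -[row i _]vec6_alt4 -yE ME submxMl.
have [|Z [frZ ZM]] := @kernel_rows K 9 6 3 M; first by [].
have sub : (Z <= kermx M)%MS by apply/sub_kermxP.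
have rk : (\rank (kermx M) <= \rank Z)%N.
  by rewrite mxrank_ker (eqP (frZ : \rank Z == 3)); move: (\rank M) rM; lia.
have ge := submx_rank_ge sub rk.
exists Z; split=> // y; rewrite M0; split=> [yZ|/sub_kermxP yM]; last exact: submx_trans yM ge.
by apply/sub_kermxP; exact: submx_trans yZ sub.
Qed.

Variable c : K.
Hypotheses (c0 : c != 0) (F2E : forall y, cD C y x0 = c * pf4 (phi y)).

(** T(x0, -, -) is the polar form of [pf4] pulled back along the surjection [phi], and this polar
    form is non-degenerate. *)
Lemma T_kernel y : (forall w, cT C x0 y w = 0) <-> phi y = 0.
Proof.
split=> [H|E w]; last first.
  by rewrite (T_singular F2E) E /polar4 /ent !mxE; ring.
suff v0 : vec6 (phi y) = 0.
  rewrite -(alt4_vec6 (phi_altm g n y)) v0.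
  by apply/matrixP; apply: ord4P; apply: ord4P; rewrite -[LHS]/(ent (alt4 0) _ _) ent_alt4 //= !mxE ?oppr0.
apply: trmx_inj; rewrite trmx0; apply/colP=> i; rewrite [RHS]mxE.
have -> : (vec6 (phi y))^T i 0 = ((delta_mx 0 i : 'rV_6) *m (vec6 (phi y))^T) 0 0 by rewrite -rowE [RHS]mxE.
rewrite -pair4_alt4 -polar4_dual.
have [w wE] := phi_surj S1 free_n kill_n ((alt_entP _).1 (dual4_alt (alt4 (delta_mx 0 i : 'rV_6)))).
rewrite -wE; apply: (mulfI c0); rewrite mulr0 -(T_singular F2E) cT23; exact: H.
Qed.

End SingularKernel.

Section SingularPoint.
Variables (K : closedFieldType) (g : alt3 K 9) (C : tri3 K 9).
Local Notation F := (cF C).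
Hypothesis FE : forall (x : 'rV[K]_9) (M : 'M_(8, 9)),
  F x ^+ 2 * \det (col_mx x M : 'M_9) ^+ 2 = \det (M *m om g x *m M^T).
Hypothesis S1 : forall x a b : 'rV_9,
  row_free (rows3 x a b) -> kill g x a -> kill g x b -> kill g a b -> False.
Hypothesis S2 : forall x : 'rV_9, x != 0 -> (2 < \rank (om g x))%N.
Hypothesis two : (2%:R : K) != 0.

Lemma kill_sub (x y : 'rV_9) : (y <= kermx (om g x))%MS <-> kill g x y.
Proof. by split=> /sub_kermxP. Qed.

Lemma singular_rank (z : 'rV_9) : z != 0 -> F z = 0 -> (forall y, cD C z y = 0) -> \rank (om g z) = 4%N.
Proof.
move=> z0 Fz Dz; have [//|r6] := rank46 FE S2 z0 Fz.
have [|m [frm mz]] := @kernel_extend _ 9 g 2 z z0; first by rewrite r6.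
have [c [c0 cE]] := grad_rank6 FE r6 frm mz.
case: (S1 (rows3_free frm)); try by rewrite /kill -row_mul mz row0.
by apply/killP => y; apply: (mulfI c0); rewrite mulr0 -cE.
Qed.

Lemma kernel_frame (z : 'rV_9) (m : 'M_(4, 9)) : \rank (om g z) = 4%N -> row_free (col_mx z m) -> m *m om g z = 0 ->
  forall y : 'rV_9, (y <= (col_mx z m : 'M_(5, 9)))%MS <-> kill g z y.
Proof.
move=> rk fr mz y.
have z0 : z *m om g z = 0 := killxx g z.
have sub : ((col_mx z m : 'M_(5, 9)) <= kermx (om g z))%MS.
  by apply/sub_kermxP; rewrite (@mul_col_mx _ 1 4) z0 mz col_mx0.
have le : (\rank (kermx (om g z)) <= \rank (col_mx z m : 'M_(5, 9)))%N.
  by rewrite mxrank_ker rk (eqP (fr : \rank (col_mx z m : 'M_(5, 9)) == 5%N)).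
have ge := submx_rank_ge sub le.
split=> [yN|/kill_sub yk]; last exact: submx_trans yk ge.
by apply/kill_sub; exact: submx_trans yN sub.
Qed.

Lemma singular_frame (z : 'rV_9) : z != 0 -> F z = 0 -> (forall y, cD C z y = 0) ->
  exists m c, [/\ row_free (col_mx z m), m *m om g z = 0, c != 0 &
    forall y, cD C y z = c * pf4 (m *m om g y *m m^T)].
Proof.
move=> z0 Fz Dz; have rk := singular_rank z0 Fz Dz.
have [|m [frm mz]] := @kernel_extend _ 9 g 4 z z0; first by rewrite rk.
by have [_ [c [c0 cE]]] := grad_rank4 FE rk frm mz; exists m, c.
Qed.

Variables (x0 : 'rV[K]_9) (n : 'M[K]_(4, 9)).
Hypotheses (rk0 : \rank (om g x0) = 4%N) (free_n : row_free (col_mx x0 n)) (kill_n : n *m om g x0 = 0).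
Local Notation N := (col_mx x0 n : 'M[K]_(5, 9)).
Local Notation phi y := (n *m om g y *m n^T).

Lemma x0_neq0 : x0 != 0.
Proof. by apply/eqP => E; move: rk0; rewrite E om0 mxrank0. Qed.

Lemma x0N : (x0 <= N)%MS.
Proof. by rewrite -(@addsmxE _ 1 4) addsmxSl. Qed.

Lemma nN (i : 'I_4) : (row i n <= N)%MS.
Proof. by rewrite -(@addsmxE _ 1 4) (submx_trans (row_sub i n)) ?addsmxSr. Qed.

Lemma N_kill (y : 'rV_9) : (y <= N)%MS <-> kill g x0 y.
Proof. exact: kernel_frame. Qed.

(** If y is not a multiple of [x0], then [om g y] kills the independent vectors y and [x0], so its
    even rank is at most 6. *)
Lemma F_on_kernel (y : 'rV_9) : (y <= N)%MS -> F y = 0.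
Proof.
move=> /N_kill xy; have [->|y0] := eqVneq y 0; first by rewrite -(scale0r 0) cFZ expr0n mul0r.
have [/sub_rVP[a aE]|nxy] := boolP (y <= x0)%MS.
  rewrite aE cFZ; apply/eqP; rewrite mulf_eq0; apply/orP; right.
  by rewrite (F_rank FE x0_neq0) rk0.
apply/eqP; rewrite (F_rank FE y0).
have sub : (col_mx y x0 <= kermx (om g y))%MS.
  apply/sub_kermxP; rewrite mul_col_mx (killxx g y : y *m om g y = 0).
  by rewrite (kill_sym xy : x0 *m om g y = 0) col_mx0.
have fr : (2 <= \rank (col_mx y x0))%N.
  have h : ~~ (y <= x0)%MS by [].
  have := rank_col_row h; rewrite rank_rV x0_neq0 -!addsmxE addsmxC //.
have := mxrankS sub; have := rank_om_even g y; rewrite mxrank_ker; move: fr (rank_leq_row (om g y)).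
move: (\rank (om g y)) (\rank _) => p q; clear; lia.
Qed.

Lemma D_on_kernel (y z : 'rV_9) : (y <= N)%MS -> (z <= N)%MS -> cD C y z = 0.
Proof.
move=> yN zN; have L t : t * cD C y z + t ^+ 2 * cD C z y = 0.
  have := cF_line C y z t; rewrite !F_on_kernel ?addmx_sub ?scalemx_sub //.
  by rewrite mulr0 addr0 add0r => <-.
apply: (mulfI two); rewrite mulr0.
have -> : 2%:R * cD C y z = (1 * cD C y z + 1 ^+ 2 * cD C z y) - ((-1) * cD C y z + (-1) ^+ 2 * cD C z y) by ring.
by rewrite !L subrr.
Qed.

Lemma T_on_kernel (y z w : 'rV_9) : (y <= N)%MS -> (z <= N)%MS -> (w <= N)%MS -> cT C y z w = 0.
Proof.
move=> yN zN wN; have := cDDl C y z w; rewrite !D_on_kernel ?addmx_sub //.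
by rewrite add0r addr0 => <-.
Qed.

(* If the 3-dimensional kernel of [T(z,-,-)] lay in [N], it would contain the kernel of the 3-form that [g] induces on
   [N_z], and [x0] would be incompatible with it. *)
Lemma singular_kernel d (z : 'rV_9) (P : 'M_(d, 9)) : (z <= N)%MS -> z != 0 -> (forall y, cD C z y = 0) ->
  (P <= N)%MS -> P *m hessian C z = 0 -> (\rank P <= 2)%N.
Proof.
move=> zN z0 Dz PN PT; rewrite leqNgt; apply/negP => rP.
have Fz := F_on_kernel zN; have rkz := singular_rank z0 Fz Dz.
have [m [c [frm mz c0 cE]]] := singular_frame z0 Fz Dz.
have [Z [frZ ZP]] := phi_kernel S1 frm mz.
have Nz := kernel_frame rkz frm mz.
have rZ : \rank Z = 3%N by apply/eqP.
have ZN : (Z <= N)%MS.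
  apply: submx_trans PN; apply: submx_rank_ge; last by rewrite rZ.
  apply/row_subP => i; apply/ZP/(T_kernel S1 frm mz c0 cE) => w; move: w; apply/hessian_kerP.
  by rewrite -row_mul PT row0.
have zZ : (z <= Z)%MS by apply/ZP; rewrite mz mul0mx.
have xz : kill g x0 z by apply/N_kill.
have mk (i : 'I_4) : kill g z (row i m) by rewrite /kill -row_mul mz row0.
have [/sub_rVP[a aE]|zx0] := boolP (z <= x0)%MS.
  have a0 : a != 0 by apply: contraNneq z0 => E; rewrite aE E scale0r.
  have zx y : kill g z y <-> kill g x0 y.
    rewrite /kill aE omZ -scalemxAr; split=> [/eqP|->]; last by rewrite scaler0.
    by rewrite scaler_eq0 (negPf a0) => /eqP.
  have mN : (m <= N)%MS by apply/row_subP => i; apply/N_kill/zx.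
  have ZNz y : (y <= Z)%MS -> forall p q : 'rV_9, (p <= N)%MS -> (q <= N)%MS -> g y p q = 0.
    move=> yZ p q /N_kill/zx/Nz/submxP[u ->] /N_kill/zx/Nz/submxP[v ->].
    rewrite -[u](@hsubmxK _ 1 1 4) -[v](@hsubmxK _ 1 1 4) !(@mul_row_col _ 1 1 4).
    set u1 := @lsubmx _ 1 1 4 u; set v1 := @lsubmx _ 1 1 4 v; rewrite (mx11_scalar u1) (mx11_scalar v1) !mul_scalar_mx.
    have yz q' : g y z q' = 0.
      rewrite aC12; have /Nz/killP : (y <= (col_mx z m : 'M_(5, 9)))%MS.
        by apply/Nz/zx/N_kill; exact: submx_trans yZ ZN.
      by move=> H; rewrite H oppr0.
    have yz' q' : g y q' z = 0 by rewrite aC23 yz oppr0.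
    rewrite aD2 !aD3 !aZ2 !aZ3 yz yz yz' !(mulr0, add0r).
    by rewrite -phi_formE ((ZP y).1 yZ) mulmx0 mul0mx mxE.
  (* Here z is a multiple of [x0], and g restricted to N comes from N / Z, of dimension 2, hence
     vanishes. Then all of N would lie in the 3-dimensional [Z]. *)
  have [|Z' [Z'N Z'P]] := @complement_rows _ 3 5 9 2 Z N.
    by rewrite rZ (eqP (free_n : \rank N == 5%N)).
  have frZZ : row_free (col_mx Z Z').
    apply: col_row_free => u v E; have v0 : v = 0.
      apply: Z'P; have -> : v *m Z' = (- u) *m Z by apply/eqP; rewrite mulNmx -addr_eq0 addrC E.
      exact: submxMl.
    by move: E; rewrite v0 mul0mx addr0 => uZ; split=> //; apply: (row_free_inj frZ); rewrite mul0mx.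
  have NZZ : (N <= (col_mx Z Z' : 'M_(5, 9)))%MS.
    apply: submx_rank_ge; first by rewrite -(@addsmxE _ 3 2) addsmx_sub ZN.
    by rewrite (eqP (free_n : \rank N == 5%N)) (eqP (frZZ : \rank (col_mx Z Z' : 'M_(5, 9)) == 5%N)).
  have ZZN : ((col_mx Z Z' : 'M_(5, 9)) <= N)%MS by rewrite -(@addsmxE _ 3 2) addsmx_sub ZN.
  have NZ : (N <= Z)%MS.
    apply/row_subP => i; apply/ZP; apply/matrixP => j k; rewrite omP_mx [RHS]mxE.
    have dec y : (y <= N)%MS -> exists2 p : 'rV_9, (p <= Z)%MS & exists w : 'rV_2, y = p + w *m Z'.
      move=> yN; have /submxP[u ->] : (y <= (col_mx Z Z' : 'M_(5, 9)))%MS := submx_trans yN NZZ.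
      rewrite -[u](@hsubmxK _ 1 3 2) (@mul_row_col _ 1 3 2).
      by exists (@lsubmx _ 1 3 2 u *m Z); [exact: submxMl|exists (@rsubmx _ 1 3 2 u)].
    have wN (w : 'rV_2) : (w *m Z' <= N)%MS by apply: submx_trans (submxMl _ _) Z'N.
    have mjN j' : (row j' m <= N)%MS by apply: submx_trans (row_sub _ _) mN.
    have [p1 p1Z [w1 e1]] := dec _ (row_sub i N).
    have [p2 p2Z [w2 e2]] := dec _ (mjN j); have [p3 p3Z [w3 e3]] := dec _ (mjN k).
    rewrite e1 aD1 (ZNz p1) ?mjN // add0r e2 aD2 aC12 (ZNz p2) ?mjN ?wN // oppr0 add0r.
    rewrite e3 aD3 aC13 (ZNz p3) ?wN // oppr0 add0r two_rows_threeform //.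
  by have := mxrankS NZ; rewrite rZ (eqP (free_n : \rank N == 5%N)).
(* The radical vector [k] of the 3-form on [m] lies in [Z], hence in N, so [x0], z and k kill one
   another; they are independent unless [x0] is in [Z]. *)
have [u u0 uP] := four_rows_kernel g m; pose k := u *m m.
have kZ : (k <= Z)%MS by apply/ZP/matrixP => i j; rewrite omP_mx [RHS]mxE !rowE uP.
have xk : kill g x0 k by apply/N_kill; exact: submx_trans kZ ZN.
have zk : kill g z k by rewrite /kill -mulmxA mz mulmx0.
have [xZ|xZ] := boolP (x0 <= Z)%MS; last first.
  apply: (@S1 x0 z k) => //; apply: rows3_freeP => r s t E.
  have [r0|r0] := eqVneq r 0.
    have [|s0 t0] := @col_row_freeP _ 1 4 9 z m s%:M (t *: u) frm.
      by rewrite mul_scalar_mx -scalemxAl -[RHS]E r0 scale0r add0r.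
    split=> //; first by move/matrixP/(_ 0 0): s0; rewrite !mxE mulr1n.
    by move/eqP: t0; rewrite scaler_eq0 (negPf u0) orbF => /eqP.
  case/negP: xZ; have -> : x0 = r^-1 *: (- (s *: z + t *: k)).
    have -> : - (s *: z + t *: k) = r *: x0 by apply/eqP; rewrite eqr_oppLR -subr_eq0 opprK addrC addrA E.
    by rewrite scalerA mulVf // scale1r.
  by rewrite scalemx_sub // eqmx_opp addmx_sub // scalemx_sub.
(* If [x0] is in [Z], the sum of N and N_z is isotropic for [om g x0]. By [S1] they meet in
   dimension at most 2, so the sum has dimension at least 8, whereas rank 4 allows only 7. *)
pose Q := (N + (col_mx z m : 'M_(5, 9)))%MS.
have Q0 : Q *m om g x0 *m Q^T = 0.
  have sub (p q : 'rV_9) : (p <= Q)%MS -> (q <= Q)%MS -> g x0 p q = 0.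
    have NK y : (y <= N)%MS -> forall q', g x0 y q' = 0 by move=> /N_kill/killP.
    have NK' y q' : (y <= N)%MS -> g x0 q' y = 0 by move=> yN; rewrite aC23 NK ?oppr0.
    case/sub_addsmxP=> [[p1 p2] ->] /sub_addsmxP[[q1 q2] ->] /=.
    rewrite aD2 !aD3 (NK (p1 *m N)) ?submxMl // (NK (p1 *m N)) ?submxMl // (NK' (q1 *m N)) ?submxMl //.
    rewrite !add0r -[p2](@hsubmxK _ 1 1 4) -[q2](@hsubmxK _ 1 1 4) !(@mul_row_col _ 1 1 4) !aE.
    have zz (v : 'rV_1) : (v *m z <= N)%MS by apply: submx_trans (submxMl _ _) zN.
    do 2! (rewrite NK //); rewrite NK' // !add0r.
    by rewrite -phi_formE ((ZP x0).1 xZ) mulmx0 mul0mx mxE.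
  by apply/matrixP => i j; rewrite omP_mx [RHS]mxE sub ?row_sub.
have := isotropic_rank Q0; rewrite rk0.
have := mxrank_sum_cap N (col_mx z m : 'M_(5, 9)); rewrite -/Q.
rewrite (eqP (free_n : \rank N == 5%N)) (eqP (frm : \rank (col_mx z m : 'M_(5, 9)) == 5%N)).
suff : (\rank (N :&: (col_mx z m : 'M_(5, 9)))%MS <= 2)%N.
  by move: (\rank _) (\rank Q) => p q; clear; lia.
have sub : (N :&: (col_mx z m : 'M_(5, 9)) <= col_mx x0 z)%MS.
  apply/rV_subP => v; rewrite sub_capmx => /andP[/N_kill xv /Nz zv].
  apply: NNPP => nv; apply: (@S1 x0 z v) => //; apply: rows3_freeP => r s t E.
  have [t0|t0] := eqVneq t 0.
    move: E; rewrite t0 scale0r addr0 => E; have [s0|s0] := eqVneq s 0.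
      by move/eqP: E; rewrite s0 scale0r addr0 scaler_eq0 (negPf x0_neq0) orbF => /eqP.
    case/negP: zx0; have -> : z = s^-1 *: ((- r) *: x0).
      have -> : (- r) *: x0 = s *: z by apply/eqP; rewrite scaleNr eqr_oppLR -addr_eq0 E.
      by rewrite scalerA mulVf // scale1r.
    by rewrite !scalemx_sub.
  case: nv; have -> : v = t^-1 *: (- (r *: x0 + s *: z)).
    have -> : - (r *: x0 + s *: z) = t *: v by apply/eqP; rewrite eqr_oppLR -addr_eq0 E.
    by rewrite scalerA mulVf // scale1r.
  by rewrite scalemx_sub // eqmx_opp -addsmxE addmx_sub // scalemx_sub ?addsmxSl ?addsmxSr.
exact: leq_trans (mxrankS sub) (rank_leq_row _).
Qed.

End SingularPoint.

(** * Generic rank of the Hessian along the kernel of a singular point *)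

Section GenericRank.
Variables (K : closedFieldType) (g : alt3 K 9) (C : tri3 K 9).
Local Notation F := (cF C).
Hypothesis FE : forall (x : 'rV[K]_9) (M : 'M_(8, 9)),
  F x ^+ 2 * \det (col_mx x M : 'M_9) ^+ 2 = \det (M *m om g x *m M^T).
Hypothesis S1 : forall x a b : 'rV_9,
  row_free (rows3 x a b) -> kill g x a -> kill g x b -> kill g a b -> False.
Hypothesis S2 : forall x : 'rV_9, x != 0 -> (2 < \rank (om g x))%N.
Hypothesis two : (2%:R : K) != 0.
Variables (x0 : 'rV[K]_9) (n : 'M[K]_(4, 9)).
Hypotheses (rk0 : \rank (om g x0) = 4%N) (free_n : row_free (col_mx x0 n)) (kill_n : n *m om g x0 = 0).
Local Notation N := (col_mx x0 n : 'M[K]_(5, 9)).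
Local Notation phi y := (n *m om g y *m n^T).
Local Notation N_kill := (N_kill rk0 free_n kill_n).
Local Notation T_on_kernel := (T_on_kernel FE two rk0 free_n kill_n).
Local Notation singular_kernel := (singular_kernel FE S1 S2 rk0 free_n kill_n).
Local Notation x0N := (x0N x0 n).
Local Notation x0_neq0 := (x0_neq0 rk0).

Lemma hessian_line x y t : hessian C (x + t *: y) = hessian C x + t *: hessian C y.
Proof. by apply/matrixP => i j; rewrite !mxE cTD1 cTZ1. Qed.

Lemma kill_last (x y : 'rV_9) : kill g x y -> (forall z, g z x y = 0) /\ (forall z, g z y x = 0).
Proof.
move=> xy; split=> z; first by rewrite a_rot (killP g x y).1.
by rewrite a_rot (killP g y x).1 //; apply: kill_sym.
Qed.

Lemma N_om : N *m om g x0 = 0.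
Proof. by rewrite (@mul_col_mx _ 1 4) (killxx g x0 : x0 *m om g x0 = 0) kill_n col_mx0. Qed.

Lemma not_free_span (x y v : 'rV[K]_9) : x != 0 -> ~~ (y <= x)%MS -> ~ row_free (rows3 x y v) -> (v <= col_mx x y)%MS.
Proof.
move=> nx nyx nf; apply: NNPP => nv; apply: nf; apply: rows3_freeP => r s t E.
have [t0|t0] := eqVneq t 0.
  move: E; rewrite t0 scale0r addr0 => E; have [s0|s0] := eqVneq s 0.
    by move/eqP: E; rewrite s0 scale0r addr0 scaler_eq0 (negPf nx) orbF => /eqP.
  case/negP: nyx; have -> : y = s^-1 *: ((- r) *: x).
    have -> : (- r) *: x = s *: y by apply/eqP; rewrite scaleNr eqr_oppLR -addr_eq0 E.
    by rewrite scalerA mulVf // scale1r.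
  by rewrite !scalemx_sub.
case: nv; have -> : v = t^-1 *: (- (r *: x + s *: y)).
  have -> : - (r *: x + s *: y) = t *: v by apply/eqP; rewrite eqr_oppLR -addr_eq0 E.
  by rewrite scalerA mulVf // scale1r.
by rewrite scalemx_sub // eqmx_opp -addsmxE addmx_sub // scalemx_sub ?addsmxSl ?addsmxSr.
Qed.

Lemma common_kernel (x y : 'rV[K]_9) d (P : 'M_(d, 9)) : x != 0 -> ~~ (y <= x)%MS -> kill g x y ->
  P *m om g x = 0 -> P *m om g y = 0 -> (\rank P <= 2)%N.
Proof.
move=> nx nyx xy Px Py; apply: leq_trans (rank_leq_row (col_mx x y)); apply/mxrankS/row_subP => i.
apply: not_free_span => // fr; apply: (S1 fr) => //; by rewrite /kill -row_mul ?Px ?Py row0.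
Qed.

Lemma phi_on_kernel (y p q : 'rV_9) : phi y = 0 -> (p <= N)%MS -> (q <= N)%MS -> g y p q = 0.
Proof.
move=> y0 /submxP[u ->] /submxP[v ->].
have xn (w : 'rV_4) : kill g x0 (w *m n) by rewrite /kill -mulmxA kill_n mulmx0.
rewrite -[u](@hsubmxK _ 1 1 4) -[v](@hsubmxK _ 1 1 4) !(@mul_row_col _ 1 1 4).
set u1 := @lsubmx _ 1 1 4 u; set v1 := @lsubmx _ 1 1 4 v; rewrite (mx11_scalar u1) (mx11_scalar v1) !mul_scalar_mx.
have [P5 P6] := kill_last (xn (@rsubmx _ 1 1 4 v)); have [Q5 Q6] := kill_last (xn (@rsubmx _ 1 1 4 u)).
rewrite aD2 !aD3 !aZ2 !aZ3 -(phi_formE g n y) y0 mulmx0 mul0mx mxE aalt23 P5 Q6.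
by rewrite [X in _ + (_ + X)]mxE; ring.
Qed.

Variable c : K.
Hypotheses (c0 : c != 0) (F2E : forall y, cD C y x0 = c * pf4 (phi y)).
Hypothesis D0 : forall y, cD C x0 y = 0.
Local Notation T_kernel := (T_kernel S1 free_n kill_n c0 F2E).

Lemma T_x0_rank : (3 <= \rank (N *m hessian C x0))%N.
Proof.
pose P := kermx (N *m hessian C x0) *m N.
have PT : P *m hessian C x0 = 0 by rewrite -mulmxA mulmx_ker.
have := singular_kernel x0N x0_neq0 D0 (submxMl _ _) PT.
rewrite mxrankMfree // mxrank_ker; move: (\rank _) => d; clear; lia.
Qed.

Lemma phi_hessian y : phi y = 0 -> y *m hessian C x0 = 0.
Proof. by move=> /T_kernel H; apply/hessian_kerP. Qed.

(** The kernel of [phi] has dimension 3 and is killed by the Hessian at [x0]; inside N this would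
    contradict [singular_kernel]. *)
Lemma kernel_outside : exists r : 'rV_9, phi r = 0 /\ ~~ (r <= N)%MS.
Proof.
have [Z [frZ ZP]] := phi_kernel S1 free_n kill_n.
have [i ri] : exists i, ~~ (row i Z <= N)%MS.
  apply: NNPP => H; have ZN : (Z <= N)%MS.
    by apply/row_subP => i; apply: NNPP => /negP ni; apply: H; exists i.
  have := singular_kernel x0N x0_neq0 D0 ZN; rewrite (eqP (frZ : \rank Z == 3%N)) => H'.
  have : (3 <= 2)%N by apply: H'; apply/row_matrixP => i; rewrite row_mul row0 phi_hessian //; apply/ZP/row_sub.
  by [].
by exists (row i Z); split=> //; apply/ZP/row_sub.
Qed.

(** The vector is the radical of the 3-form that [g] induces on the rows of [n]. *)
Lemma kernel_inside : exists m : 'rV_9, [/\ phi m = 0, (m <= N)%MS & ~~ (m <= x0)%MS].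
Proof.
have [u u0 uP] := four_rows_kernel g n; exists (u *m n); split.
- by apply/matrixP => i j; rewrite omP_mx [RHS]mxE !rowE uP.
- by rewrite -(@addsmxE _ 1 4) (submx_trans (submxMl _ _)) ?addsmxSr.
apply/negP => /sub_rVP[a E].
have [|_ E'] := @col_row_freeP _ 1 4 9 x0 n (- a)%:M u free_n.
  by rewrite mul_scalar_mx scaleNr E addNr.
by rewrite E' eqxx in u0.
Qed.

(** The row [q] of the Hessian at y is outside the row space of N at [x0], which annihilates r while
    q does not. It belongs to the row space of N at x0 + t y for t != 0, because (x0 - t y) times
    that Hessian is - t ^ 2 q; a general t then has rank at least 4. *)
Lemma rank_from_square (r y : 'rV_9) : phi r = 0 -> (y <= N)%MS -> cT C y y r != 0 ->
  exists2 x : 'rV_9, (x <= N)%MS & (4 <= \rank (N *m hessian C x)%R)%N.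
Proof.
move=> pr yN yyr; pose q := y *m hessian C y.
have nq : ~~ (q <= N *m hessian C x0)%MS.
  apply/negP => /submxP[u uE]; case/negP: yyr; rewrite -hessianE -/q uE mulmxA hessianE cT23.
  by rewrite (hessian_kerP C x0 r).1 ?phi_hessian.
have r4 : (4 <= \rank (col_mx (N *m hessian C x0) q))%N by apply: leq_ltn_trans T_x0_rank (rank_col_row nq).
have [p p0 pP] := rank_pencil_ge (col_mx (N *m hessian C y) 0) r4.
have [t [pt]] := poly_nz2 p0 (negbT (polyX_eq0 K)); rewrite hornerX => t0.
exists (x0 + t *: y); first by rewrite addmx_sub ?scalemx_sub // x0N.
apply: leq_trans (pP t pt) _; apply: mxrankS.
rewrite scale_col_mx scaler0 add_col_mx addr0 hessian_line scalemxAr -mulmxDr.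
set X := (hessian C x0 + _); rewrite -addsmxE addsmx_sub submx_refl /=.
have -> : q = (- t ^- 2) *: ((x0 - t *: y) *m X).
  have xx : x0 *m hessian C x0 = 0 by rewrite phi_hessian // kill_n mul0mx.
  have xy : x0 *m hessian C y = y *m hessian C x0.
    by apply/rowP => j; have := cT12 C y x0 (delta_mx 0 j); rewrite -!hessianE !trmx_delta -!colE !mxE.
  rewrite /X mulmxBl !mulmxDr xx -!scalemxAr -!scalemxAl xy -/q add0r scalerBr.
  rewrite !scalerDr.
  by rewrite opprD addrA subrr add0r !scalerA -scaleNr -[LHS]scale1r; congr (_ *: _); field.
apply: scalemx_sub; apply: submxMr; rewrite addmx_sub ?x0N // eqmx_opp scalemx_sub //.
Qed.

(* Here [r - l m] turns out to be singular for some [l], with a kernel that meets [N] in dimension 4; then some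
   combination of [x0] and [r - l m] is singular with vanishing quadratic term. *)
Section Degenerate.
Variables (r m : 'rV[K]_9).
Hypotheses (pr : phi r = 0) (rN : ~~ (r <= N)%MS).
Hypotheses (pm : phi m = 0) (mN : (m <= N)%MS) (mx : ~~ (m <= x0)%MS).
Hypothesis Tr : forall y z : 'rV_9, (y <= N)%MS -> (z <= N)%MS -> cT C y z r = 0.
Local Notation o := (x0 *m om g r).

Lemma oE y : (o *m y^T) 0 0 = g r x0 y.
Proof. exact: omE00. Qed.

Lemma o_neq0 : o != 0.
Proof. by apply: contra rN => /eqP E; apply/N_kill/kill_sym. Qed.

Lemma Dr y : (y <= N)%MS -> cD C y r = 0.
Proof. by move=> yN; apply: (mulfI two); rewrite mulr0 -[2%:R * _](cTxx C y r) Tr. Qed.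

Lemma xm : kill g x0 m.
Proof. exact/N_kill. Qed.

Lemma rank_N_m : (3 <= \rank (N *m om g m))%N.
Proof.
pose P := kermx (N *m om g m) *m N.
have Pm : P *m om g m = 0 by rewrite -mulmxA mulmx_ker.
have Px : P *m om g x0 = 0.
  by rewrite /P -mulmxA N_om mulmx0.
have := common_kernel x0_neq0 mx xm Px Pm.
rewrite mxrankMfree // mxrank_ker; move: (\rank _) => d; clear; lia.
Qed.

Lemma annihilator_span d (D : 'M_(d, 9)) (p q : 'rV[K]_9) : (7 <= \rank D)%N -> ~~ (p <= o)%MS ->
  (forall i, (p *m (row i D)^T) 0 0 = 0 /\ (q *m (row i D)^T) 0 0 = 0 /\ (o *m (row i D)^T) 0 0 = 0) ->
  (q <= col_mx o p)%MS.
Proof.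
move=> rD po H.
have ker0 (v : 'rV_9) : (forall i, (v *m (row i D)^T) 0 0 = 0) -> v *m D^T = 0.
  by move=> E; apply/rowP=> i; rewrite [RHS]mxE -(E i) tr_row !mxE; apply: eq_bigr => k _; rewrite !mxE.
have sub : (col_mx o p <= kermx D^T)%MS.
  by apply/sub_kermxP; rewrite mul_col_mx !ker0 ?col_mx0 // => i; have [? [? ?]] := H i.
have rk := rank_col_row po; rewrite rank_rV o_neq0 in rk.
apply: submx_trans (submx_rank_ge sub _); first by apply/sub_kermxP/ker0 => i; have [? [? ?]] := H i.
by rewrite mxrank_ker mxrank_tr; apply: leq_trans rk; move: (\rank D) rD; clear; lia.
Qed.

(** The functionals p, q and o vanish on N. If they vanish on a space of dimension at least 7, q is
    a combination of o and p, which are independent. *)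
Lemma slope_span (y : 'rV_9) : (y <= N)%MS -> ~~ (y *m om g m <= o)%MS ->
  (y *m om g r <= col_mx o (y *m om g m))%MS.
Proof.
move=> yN py; set p := y *m om g m in py *; set q := y *m om g r.
have pE z : (p *m z^T) 0 0 = g m y z := omE00 g m y z.
have qE z : (q *m z^T) 0 0 = g r y z := omE00 g r y z.
have p0 : p != 0 by apply: contraNneq py => ->; rewrite sub0mx.
have y0 : y != 0 by apply: contraNneq p0 => E; rewrite /p E mul0mx.
have ynx : ~~ (y <= x0)%MS.
  by apply: contra p0 => /sub_rVP[a aE]; rewrite /p aE -scalemxAl (kill_sym xm : x0 *m om g m = 0) scaler0.
have pN z : (z <= N)%MS -> g m y z = 0 by move=> zN; apply: phi_on_kernel.
have qN z : (z <= N)%MS -> g r y z = 0 by move=> zN; apply: phi_on_kernel.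
have oN z : (z <= N)%MS -> g r x0 z = 0 by move=> zN; apply: phi_on_kernel => //; exact: x0N.
have kerN d (P : 'M_(d, 9)) : (P <= N)%MS -> P *m om g x0 = 0.
  by move=> PN; apply/row_matrixP => i; rewrite row_mul row0; apply/N_kill/(submx_trans (row_sub i P)).
have [r4|r6] := rank46 FE S2 y0 (F_on_kernel FE rk0 free_n kill_n yN).
  (* At rank 4, p and q also vanish on the kernel [L], which meets N in dimension at most 2. The sum
     has dimension at least 8, so q is even a multiple of p. *)
  pose L := kermx (om g y); pose D := (N + L)%MS.
  have rD : (8 <= \rank D)%N.
    have c2 : (\rank (N :&: L) <= 2)%N.
      apply: (common_kernel x0_neq0 ynx); first exact/N_kill.
        by apply: kerN; exact: capmxSl.
      by apply/sub_kermxP; exact: capmxSr.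
    have := mxrank_sum_cap N L; rewrite -/D mxrank_ker r4 (eqP (free_n : \rank N == 5%N)).
    by move: (\rank D) (\rank (N :&: L)%MS) c2; clear; lia.
  have H (w : 'rV[K]_9) : (forall z : 'rV_9, (z <= N)%MS -> (w *m z^T) 0 0 = 0) -> (forall z, kill g y z -> (w *m z^T) 0 0 = 0) ->
      (w <= kermx D^T)%MS.
    move=> H1 H2; apply/sub_kermxP/rowP => i; rewrite [RHS]mxE.
    have /sub_addsmxP[[u v] /= E] := row_sub i D.
    have -> : (w *m D^T) 0 i = (w *m (row i D)^T) 0 0 by rewrite tr_row !mxE; apply: eq_bigr => k _; rewrite !mxE.
    rewrite E; have -> : (u *m N + v *m L)^T = (u *m N)^T + (v *m L)^T by apply/matrixP => a b; rewrite !mxE.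
    rewrite mulmxDr mxE H1 ?submxMl // H2 ?addr0 //.
    by rewrite /kill -mulmxA mulmx_ker mulmx0.
  have pD : (p <= kermx D^T)%MS.
    by apply: H => z zz; rewrite pE; [exact: pN|rewrite a_rot (killP g y z).1].
  have qD : (q <= kermx D^T)%MS.
    by apply: H => z zz; rewrite qE; [exact: qN|rewrite a_rot (killP g y z).1].
  have qp : (q <= p)%MS.
    apply: submx_trans qD (submx_rank_ge pD _).
    by rewrite rank_rV p0 mxrank_ker mxrank_tr; move: (\rank D) rD; clear; lia.
  by rewrite -addsmxE (submx_trans qp) ?addsmxSr.
have [a [ya nya]] : exists a : 'rV_9, kill g y a /\ ~~ (a <= col_mx x0 y)%MS.
  apply: NNPP => H; have : (kermx (om g y) <= col_mx x0 y)%MS.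
    apply/row_subP => i; apply: NNPP => /negP ni; apply: H; exists (row i (kermx (om g y))).
    by split=> //; rewrite /kill -row_mul mulmx_ker row0.
  by move/mxrankS; rewrite mxrank_ker r6 => le; have := leq_trans le (rank_leq_row _).
have [a5 a6] := kill_last ya.
have fr3 : row_free (rows3 x0 y a) by apply: NNPP => /(not_free_span x0_neq0 ynx); apply/negP.
have aN : ~~ (a <= N)%MS.
  by apply/negP => aN; apply: (S1 fr3) => //; apply/N_kill.
have frya : row_free (col_mx y (col_mx x0 a)).
  apply: (@col_row_free _ 1 2 9) => u v; rewrite -[v](@hsubmxK _ 1 1 1) (@mul_row_col _ 1 1 1).
  set v1 := @lsubmx _ 1 1 1 v; set v2 := @rsubmx _ 1 1 1 v; rewrite (mx11_scalar u) (mx11_scalar v1) (mx11_scalar v2) !mul_scalar_mx.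
  move: (u 0 0) (v1 0 0) (v2 0 0) => b1 a1 c1 E; pose w : 'rV[K]_3 := \row_i nth 0 [:: a1; b1; c1] i.
  have w0 : w = 0.
    apply: (row_free_inj fr3); rewrite mul0mx mul_rows3 !mxE /=.
    by rewrite -[RHS]E [RHS]addrCA addrA.
  have W i : w 0 i = 0 by rewrite w0 mxE.
  have := W i30; have := W i31; have := W i32; rewrite !mxE /= => -> -> ->.
  by rewrite !raddf0 (@row_mx0 _ 1 1 1).
have kya : col_mx x0 a *m om g y = 0.
  by rewrite mul_col_mx (ya : a *m om g y = 0) (kill_sym ((N_kill y).1 yN) : x0 *m om g y = 0) col_mx0.
have [e [e0 eE]] := grad_rank6 FE r6 frya kya.
have row0E : row 0 (col_mx x0 a) = x0 by apply/rowP => j; rewrite !mxE; case: splitP => i //= _; rewrite ?ord1.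
have row1E : row 1 (col_mx x0 a) = a.
  by apply/rowP => j; rewrite !mxE; case: splitP => i Hi; [case: i Hi => [[]]|rewrite ord1].
(* g(x0, a, -) is the gradient at y up to a factor, and r is tangent there by [Dr]. *)
have oa : g r x0 a = 0.
  by rewrite a_rot; apply: (mulfI e0); have := eE r; rewrite row0E row1E (Dr yN) mulr0.
have [rNa|rNa] := boolP (r <= col_mx N a)%MS; last first.
  apply: (@annihilator_span _ (col_mx (col_mx N a) r)) => //.
    by apply: leq_ltn_trans (rank_col_row rNa); apply: leq_ltn_trans (rank_col_row aN); rewrite (eqP (free_n : \rank N == 5%N)).
  move=> i; rewrite pE qE oE; set v := row i _.
  have : (v <= col_mx (col_mx N a) r)%MS by apply: row_sub.
  rewrite -addsmxE => /sub_addsmxP[[u w] /= ->].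
  have : (u *m col_mx N a <= col_mx N a)%MS by apply: submxMl.
  rewrite -addsmxE => /sub_addsmxP[[u1 w1] /= ->].
  rewrite (mx11_scalar w) (mx11_scalar w1) !mul_scalar_mx !aD3 !aZ3 oa !a5.
  have -> : g m y r = 0 by rewrite -(a_rot g r m y) phi_on_kernel.
  by rewrite !aalt13 pN ?qN ?oN ?submxMl // !(mulr0, addr0).
move: rNa; rewrite -addsmxE => /sub_addsmxP[[u w] /= rE]; set s := u *m N in rE.
have sN : (s <= N)%MS by apply: submxMl.
have qs : q = y *m om g s.
  by rewrite /q rE (mx11_scalar w) mul_scalar_mx omD omZ mulmxDr -scalemxAr (kill_sym ya : y *m om g a = 0) scaler0 addr0.
have ymfr : row_free (rows3 x0 y m).
  apply: NNPP => /(not_free_span x0_neq0 ynx); rewrite -addsmxE => /sub_addsmxP[[u' v'] /= mE].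
  case/eqP: p0; rewrite /p mE (mx11_scalar u') (mx11_scalar v') !mul_scalar_mx omD !omZ mulmxDr -!scalemxAr.
  by rewrite ((N_kill y).1 yN : y *m om g x0 = 0) (killxx g y : y *m om g y = 0) !scaler0 addr0.
have rowsN : (rows3 x0 y m <= N)%MS.
  by have [e1 e2 e3] := row_rows3 x0 y m; apply/row_subP; apply: ord3P; rewrite ?e1 ?e2 ?e3 // x0N.
have [|sfr] := boolP (s <= rows3 x0 y m)%MS.
  case/submxP=> v; rewrite mul_rows3 => sE.
  have -> : q = v 0 i32 *: p.
    rewrite qs sE !omD !omZ !mulmxDr -!scalemxAr ((N_kill y).1 yN : y *m om g x0 = 0) (killxx g y : y *m om g y = 0).
    by rewrite !scaler0 !add0r.
  by rewrite scalemx_sub // -addsmxE addsmxSr.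
have Q4 := rank_col_row sfr; rewrite (eqP (ymfr : \rank (rows3 x0 y m) == 3%N)) in Q4.
have QN : (col_mx (rows3 x0 y m) s <= N)%MS by rewrite -addsmxE addsmx_sub rowsN sN.
(* Four independent vectors of N lie in the radical of this alternating form on five variables, so
   it vanishes and [phi y = 0]. Then x0, y, m are killed by the Hessian at [x0], against
   [singular_kernel]. *)
pose B := N *m om g y *m N^T.
have /submxP[Y YE] := QN.
have YB : Y *m B = 0.
  rewrite /B !mulmxA -YE (@mul_col_mx _ 3 1) (@mul_col_mx _ 3 1); apply/eqP; rewrite col_mx_eq0.
  apply/andP; split; apply/eqP; last first.
    apply/rowP => j; rewrite omP_mx [RHS]mxE; have -> : row 0 s = s by apply/rowP => l; rewrite mxE.
    rewrite aC12; apply/eqP; rewrite oppr_eq0; apply/eqP.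
    have <- : g r y (row j N) = g s y (row j N).
      by rewrite -qE qs omE00.
    by rewrite qN // row_sub.
  apply/matrixP => i j; rewrite omP_mx [RHS]mxE; have jN : (row j N <= N)%MS by apply: row_sub.
  have [e1 e2 e3] := row_rows3 x0 y m; move: i; apply: ord3P; rewrite ?e1 ?e2 ?e3 ?aalt12 //.
    by apply: (killP g y x0).1; apply/kill_sym/N_kill.
  by rewrite aC12 pN // oppr0.
have rB : \rank B = 0%N.
  have sub : (Y <= kermx B)%MS by apply/sub_kermxP.
  have := mxrankS sub; rewrite mxrank_ker.
  have rY : (4 <= \rank Y)%N by apply: leq_trans Q4 _; rewrite YE; exact: mxrankM_maxl.
  have aB : altm B by apply/altm_cong/om_altm.
  have := altm_rank_even aB; have := rank_leq_row B; move: rY; move: (\rank B) (\rank Y); clear; lia.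
have B0 : B = 0 by apply/eqP; rewrite -mxrank_eq0 rB.
have py0 : phi y = 0.
  apply/matrixP => i j; rewrite omP_mx [RHS]mxE.
  have /submxP[u1 u1E] : (row i n <= N)%MS := nN x0 n i.
  have /submxP[u2 u2E] : (row j n <= N)%MS := nN x0 n j.
  by rewrite u1E u2E -omE00 trmx_mul mulmxA -(mulmxA u1) -(mulmxA u1) -/B B0 mulmx0 mul0mx mxE.
have : (\rank (rows3 x0 y m) <= 2)%N.
  apply: (singular_kernel x0N x0_neq0 D0 rowsN); apply/row_matrixP => i; rewrite row_mul row0.
  have [e1 e2 e3] := row_rows3 x0 y m; move: i; apply: ord3P; rewrite ?e1 ?e2 ?e3 phi_hessian //.
  by rewrite kill_n mul0mx.
by rewrite (eqP (ymfr : \rank (rows3 x0 y m) == 3%N)).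
Qed.

Lemma degenerate_absurd : False.
Proof.
have [|H [frH Ho]] := @kernel_rows K 9 1 8 o^T; first by [].
have Ho' : o *m H^T = 0 by apply: trmx_inj; rewrite trmx_mul trmxK Ho trmx0.
have osub : (o <= kermx H^T)%MS by apply/sub_kermxP.
have rkH : \rank (kermx H^T) = 1%N by rewrite mxrank_ker mxrank_tr (eqP (frH : \rank H == 8%N)).
have kerH : (kermx H^T <= o)%MS by apply: (submx_rank_ge osub); rewrite rkH rank_rV o_neq0.
have perp d (w : 'M[K]_(d, 9)) : w *m H^T = 0 -> (w <= o)%MS by move=> /sub_kermxP wH; exact: submx_trans wH kerH.
have rP : (2 <= \rank (N *m om g m *m H^T))%N.
  have := mxrank_mul_ker (N *m om g m) H^T; have := mxrankS (capmxSr (N *m om g m) (kermx H^T)).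
  rewrite rkH; have := rank_N_m; move: (\rank _) (\rank _) (\rank _) => p q s; clear; lia.
have [v|k kE] := @proportional_rows _ _ _ _ (N *m om g r *m H^T) rP.
  rewrite !mulmxA => vP.
  have : (v *m N *m om g r <= col_mx o (v *m N *m om g m))%MS.
    apply: slope_span; first exact: submxMl.
    by apply: contra vP => /submxP[D ->]; rewrite -mulmxA Ho' mulmx0.
  rewrite -addsmxE => /sub_addsmxP[[a b] /= ->].
  exists (b 0 0); rewrite mulmxDl -(mulmxA a) Ho' mulmx0 add0r {1}(mx11_scalar b) mul_scalar_mx.
  by rewrite -scalemxAl.
(* On N the contraction with [r'] takes values in the multiples of [o] only, so it kills a 4-space
   [n'] of N. *)
pose r' := r - k *: m.
have r'N : ~~ (r' <= N)%MS.
  apply: contra rN => r'N; have -> : r = r' + k *: m by rewrite subrK.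
  by rewrite addmx_sub // scalemx_sub.
have r'0 : r' != 0 by apply: contraNneq r'N => ->; rewrite sub0mx.
have omr' : om g r' = om g r - k *: om g m by rewrite /r' omD -scaleNr omZ scaleNr.
have /submxP[s sE] : (N *m om g r' <= o)%MS.
  by apply: perp; rewrite omr' mulmxBr mulmxBl -scalemxAr -scalemxAl kE subrr.
have [|Z [frZ Zs]] := @kernel_rows K 5 1 4 s; first by [].
pose n' := Z *m N.
have n'N : (n' <= N)%MS by apply: submxMl.
have n'r : n' *m om g r' = 0 by rewrite -mulmxA sE mulmxA Zs mul0mx.
have frn' : row_free n' by rewrite /row_free mxrankMfree.
have n'x : n' *m om g x0 = 0 by apply/row_matrixP => i; rewrite row_mul row0; apply/N_kill/(submx_trans (row_sub i n')).
have frx : row_free (col_mx x0 n').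
  apply: (@col_row_free _ 1 4 9) => u v E.
  have := congr1 (fun w => w *m om g r') E; rewrite mulmxDl -(mulmxA u) -(mulmxA v) n'r mulmx0 addr0 mul0mx omr' mulmxBr -scalemxAr.
  rewrite (kill_sym xm : x0 *m om g m = 0) scaler0 subr0 (mx11_scalar u) mul_scalar_mx => /eqP.
  rewrite scaler_eq0 (negPf o_neq0) orbF => /eqP u0.
  have uu : u = 0 by apply/matrixP => i j; rewrite !ord1 u0 mxE.
  move: E; rewrite uu mul0mx add0r => vn.
  by split; [rewrite ?mxE ?raddf0|apply: (row_free_inj frn'); rewrite mul0mx].
have frr : row_free (col_mx r' n').
  apply: (@col_row_free _ 1 4 9) => u v E; have [u0|u0] := eqVneq (u 0 0) 0.
    have uu : u = 0 by apply/matrixP => i j; rewrite !ord1 u0 mxE.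
    move: E; rewrite uu mul0mx add0r => vn.
    by split; [rewrite ?mxE ?raddf0|apply: (row_free_inj frn'); rewrite mul0mx].
  case/negP: r'N; have -> : r' = (u 0 0)^-1 *: ((- v) *m n').
    have -> : (- v) *m n' = u 0 0 *: r' by apply/eqP; rewrite mulNmx eqr_oppLR -addr_eq0 addrC -mul_scalar_mx -mx11_scalar E.
    by rewrite scalerA mulVf // scale1r.
  by rewrite scalemx_sub // (submx_trans (submxMl _ _)).
have rkr : \rank (om g r') = 4%N.
  have sub : ((col_mx r' n' : 'M_(5, 9)) <= kermx (om g r'))%MS.
    by apply/sub_kermxP; rewrite (@mul_col_mx _ 1 4) (killxx g r' : r' *m om g r' = 0) n'r col_mx0.
  have := mxrankS sub; rewrite (eqP (frr : \rank (col_mx r' n' : 'M_(5, 9)) == 5%N)) mxrank_ker.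
  have := S2 r'0; have := rank_om_even g r'; move: (\rank _) => d; clear; lia.
have [Dr' [c1 [c10 c1E]]] := grad_rank4 FE rkr frr n'r.
have [_ [c2 [c20 c2E]]] := grad_rank4 FE rk0 frx n'x.
(* The quadratic terms at [r'] and [x0] are multiples of the same Pfaffian on [n'] and cancel in
   this combination. *)
pose y := c2 *: r' - c1 *: x0.
have y0 : y != 0.
  apply: contra r'N => /eqP E; have -> : r' = (c2^-1 * c1) *: x0.
    by apply: (scalerI c20); rewrite scalerA mulrA mulfV // mul1r; apply/eqP; rewrite -subr_eq0 -/y E.
  by rewrite scalemx_sub // x0N.
have Dy z : cD C z y = 0.
  by rewrite /y cDDr -scaleNr !cDZr c1E c2E; ring.
have Ty z w : cT C z w y = 0.
  by have := cDDl C z w y; rewrite !Dy add0r addr0 => <-.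
have Fr' : F r' = 0 by apply/eqP; rewrite (F_rank FE r'0) rkr.
have Fy : F y = 0.
  rewrite /y -scaleNr cFD !cFZ !cDZl !cDZr Fr' (F_on_kernel FE rk0 free_n kill_n x0N) Dr' D0.
  by rewrite !mulr0 !addr0.
have Dy' z : cD C y z = 0.
  by apply: (mulfI two); rewrite mulr0 -[2%:R * _](cTxx C y z) cT23 Ty.
have [n2 [c3 [fr3 kn3 c30 c3E]]] := singular_frame FE S1 S2 y0 Fy Dy'.
by have [z] := F2_neq0 S1 fr3 kn3 c30 c3E; rewrite Dy eqxx.
Qed.

End Degenerate.

Lemma generic_rank : exists2 x : 'rV_9, (x <= N)%MS & (4 <= \rank (N *m hessian C x)%R)%N.
Proof.
have [r [pr rN]] := kernel_outside; have [m [pm mN mx]] := kernel_inside.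
apply: NNPP => H; have sq y : (y <= N)%MS -> cT C y y r = 0.
  by move=> yN; apply/eqP/negPn/negP => nz; apply: H; exact: rank_from_square nz.
apply: (degenerate_absurd pr rN pm mN mx) => y z yN zN.
have := sq (y + z) (addmx_sub yN zN); rewrite !cTD1 !cTD2 !sq // (cT12 C z y) add0r addr0 => E.
by apply: (mulfI two); rewrite mulr0 -E; ring.
Qed.

End GenericRank.

(** * Kernel vectors from maximal minors *)

Section CofactorKernel.
Variables (R : comNzRingType) (n : nat).

Definition cofactor_row (A : 'M[R]_(n.+1, n)) : 'rV[R]_n.+1 := \row_i cofactor (row_mx (0 : 'cV_n.+1) A : 'M_n.+1) i 0.

(** Laplace expansion along the first column; a column of [A] as [c] gives determinant 0, hence the
    kernel property. *)
Lemma cofactor_row_det (A : 'M[R]_(n.+1, n)) (c : 'cV_n.+1) :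
  (cofactor_row A *m c) 0 0 = \det (row_mx c A : 'M_n.+1).
Proof.
rewrite (expand_det_col _ 0) mxE; apply: eq_bigr => i _; rewrite mxE mulrC; congr (_ * _).
  by rewrite mxE; case: splitP => j // _; rewrite ord1.
rewrite /cofactor; congr (_ * \det _); apply/matrixP => p q; rewrite !mxE.
case E: (split _) => [j|//]; have := congr1 unsplit E; rewrite splitK => /(congr1 val) /=.
by rewrite ord1.
Qed.

Lemma cofactor_row_ker (A : 'M[R]_(n.+1, n)) : cofactor_row A *m A = 0.
Proof.
apply/rowP => j; rewrite [RHS]mxE; have := cofactor_row_det A (col j A).
rewrite colE mulmxA -colE mxE => ->; rewrite -det_tr.
apply: (determinant_alternate (i1 := 0) (i2 := rshift 1 j)) => // i.
have E1 : row_mx (A *m delta_mx j (0 : 'I_1)) A i (rshift 1 j) = A i j := row_mxEr _ _ _ _.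
have E2 : row_mx (A *m delta_mx j (0 : 'I_1)) A i 0 = A i j.
  by rewrite mxE; case: splitP => k // _; rewrite ord1 -colE mxE.
by rewrite [LHS]mxE [RHS]mxE; exact: etrans E2 (esym E1).
Qed.

End CofactorKernel.

Section PolyKernel.
Variables (K : closedFieldType).

Lemma cofactor_row_map (R S : comNzRingType) (f : {rmorphism R -> S}) n (A : 'M[R]_(n.+1, n)) i :
  cofactor_row (map_mx f A) 0 i = f (cofactor_row A 0 i).
Proof.
rewrite [LHS]mxE [in RHS]mxE -cofactor_map_mx; congr (cofactor _ _ _).
by apply/matrixP => a b; rewrite !mxE; case: split => c; rewrite !mxE ?rmorph0.
Qed.

Lemma cofactor_row_neq0 n (A : 'M[K]_(n.+1, n)) : (cofactor_row A != 0) = (\rank A == n).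
Proof.
apply/idP/idP => [H|/eqP rA].
  have [i Hi] : exists i, cofactor_row A 0 i != 0.
    by apply/existsP; apply: contraNT H => /existsPn H; apply/eqP/rowP => i; rewrite [RHS]mxE; apply/eqP; have := H i; rewrite negbK.
  have := cofactor_row_det A (delta_mx i 0); rewrite -colE mxE => E.
  have : (row_mx (delta_mx i 0 : 'cV_n.+1) A : 'M_n.+1) \in unitmx by rewrite unitmxE unitfE -E.
  rewrite -unitmx_tr -row_free_unit (@tr_row_mx _ n.+1 1 n) => fr.
  rewrite eqn_leq rank_leq_col /= -mxrank_tr.
  have := mxrank_adds_leqif (delta_mx i 0 : 'M[K]_(n.+1, 1))^T A^T => -[le _].
  have := rank_leq_row (delta_mx i 0 : 'M[K]_(n.+1, 1))^T.
  move: fr le; rewrite addsmxE /row_free => /eqP ->; move: (\rank _) (\rank _); clear; lia.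
have [v vA] : exists v : 'rV_n.+1, ~~ (v <= A^T)%MS.
  apply: NNPP => H; have : (1%:M <= A^T)%MS.
    by apply/row_subP => i; apply: NNPP => /negP ni; apply: H; exists (row i 1%:M).
  by move/mxrankS; rewrite mxrank1 mxrank_tr rA ltnn.
have rk := rank_col_row vA; rewrite mxrank_tr rA in rk.
have : \det (row_mx v^T A : 'M_n.+1) != 0.
  rewrite -det_tr (@tr_row_mx _ n.+1 1 n) trmxK -unitfE -unitmxE -row_free_unit /row_free eqn_leq rank_leq_row /=.
  by rewrite -(@addsmxE _ 1 n n.+1 v A^T) addsmxC addsmxE.
by rewrite -cofactor_row_det; apply: contraNneq => ->; rewrite mul0mx mxE.
Qed.

Lemma coef1M (p q : {poly K}) : (p * q)`_1 = p`_0 * q`_1 + p`_1 * q`_0.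
Proof. by rewrite coefM !big_ord_recl big_ord0 addr0. Qed.

Lemma poly_eq_closed (p q : {poly K}) : (forall t, p.[t] = q.[t]) -> p = q.
Proof.
move=> E; apply/eqP; rewrite -subr_eq0; apply/eqP; apply: poly_zero_on_closed => t.
by rewrite hornerD hornerN E subrr.
Qed.

End PolyKernel.

(** * Cubics with singular Hessian at all their points *)

Section TangentHessian.
Variables (K : closedFieldType) (g : alt3 K 9) (C : tri3 K 9).
Local Notation F := (cF C).
Hypothesis FE : forall (x : 'rV[K]_9) (M : 'M_(8, 9)),
  F x ^+ 2 * \det (col_mx x M : 'M_9) ^+ 2 = \det (M *m om g x *m M^T).
Hypothesis S1 : forall x a b : 'rV_9,
  row_free (rows3 x a b) -> kill g x a -> kill g x b -> kill g a b -> False.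
Hypothesis S2 : forall x : 'rV_9, x != 0 -> (2 < \rank (om g x))%N.
Hypothesis S3 : forall (R : 'M_(4, 9)) (H : 'M_(8, 9)),
  row_free R -> row_free H -> (R <= H)%MS ->
  (forall r s y : 'rV_9, (r <= R)%MS -> (s <= R)%MS -> (y <= H)%MS -> g r s y = 0) -> False.
Hypothesis two : (2%:R : K) != 0.
Hypothesis flat : forall x, F x = 0 -> \det (hessian C x) = 0.
Local Notation no_hyper := (no_hyper FE S1 S3).

Lemma hessian_sym x : (hessian C x)^T = hessian C x.
Proof. by apply/matrixP => i j; rewrite !mxE cT23. Qed.

Lemma hessian_swap x y : x *m hessian C y = y *m hessian C x.
Proof.
apply/rowP => j; have := cT12 C y x (delta_mx 0 j).
by rewrite -!hessianE !trmx_delta -!colE !mxE.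
Qed.

(* At a point of corank one the derivative of [det hessian] along [w] is a nonzero multiple of [T(k,k,w)]; since [F] divides
   [det hessian], it is also a multiple of [cD y w]. *)
Lemma hessian_tangent (y k : 'rV_9) : F y = 0 -> k *m hessian C y = 0 -> (\rank (kermx (hessian C y)) <= 1)%N ->
  exists l, k *m hessian C k = l *: (y *m hessian C y).
Proof.
move=> Fy ky rk; have [k0|k0] := eqVneq k 0; first by exists 0; rewrite k0 mul0mx scale0r.
have r8 : (8 <= \rank (hessian C y))%N by move: rk; rewrite mxrank_ker; move: (\rank _); clear; lia.
have frk : row_free k by rewrite /row_free rank_rV k0.
have [W /andP[frW _]] := @basis_completion _ 1 8 9 k erefl frk.
pose M : 'M[K]_9 := col_mx k W.
have uM : M \in unitmx by rewrite -row_free_unit.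
have ky' : hessian C y *m k^T = 0 by rewrite -[hessian C y]trmxK -trmx_mul hessian_sym ky trmx0.
have MM (A : 'M[K]_9) : M *m A *m M^T = block_mx (k *m A *m k^T) (k *m A *m W^T) (W *m A *m k^T) (W *m A *m W^T).
  by rewrite /M (@mul_col_mx _ 1 8) (@tr_col_mx _ 1 8) (@mul_col_row _ 1 8 9 1 8).
have dW : \det (W *m hessian C y *m W^T) != 0.
  rewrite -unitfE -unitmxE -row_free_unit /row_free eqn_leq rank_leq_row /=; apply: leq_trans r8 _.
  have -> : \rank (hessian C y) = \rank (M *m hessian C y *m M^T).
    by rewrite mxrankMfree ?row_free_unit ?unitmx_tr // -(mxrank_tr (M *m _)) trmx_mul mxrankMfree ?row_free_unit ?unitmx_tr // mxrank_tr.
  rewrite MM ky !mul0mx -(mulmxA W (hessian C y) k^T) ky' mulmx0 (@rank_diag_block_mx _ 1 1 8 8) mxrank0 //.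
have key w : cD C y w = 0 -> cT C k k w = 0.
  move=> yw.
  (* In the basis k, W the determinant of the Hessian along y + t w is t q(t) up to a non-zero
     factor, and q(0) is a non-zero multiple of T(k, k, w). For tangent w the cubic, which divides
     this determinant, has order at least 2 at t = 0, so q(0) = 0. *)
  have [q q0 qE] := det_pencil (k *m hessian C w *m k^T) (k *m hessian C w *m W^T) (W *m hessian C w *m k^T)
    (W *m hessian C y *m W^T) (W *m hessian C w *m W^T).
  have pd : polyf (fun x => \det (hessian C x)).
    by apply: polyf_det => i j; apply: polyf_hessian.
  have [h [ph hFE]] := cubic_divides no_hyper pd (fun x _ => @flat x).
  have [p pE] := polyf_line y w ph.
  have E : 'X * q = (\det M * \det M) *: (p * 'X^2 * ((cD C w y)%:P + (F w) *: 'X)).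
    apply: poly_eq_closed => t; rewrite hornerM hornerX -[X in X * q.[t]](expr1 t) -qE.
    have -> : block_mx (t *: (k *m hessian C w *m k^T)) (t *: (k *m hessian C w *m W^T)) (t *: (W *m hessian C w *m k^T))
      (W *m hessian C y *m W^T + t *: (W *m hessian C w *m W^T)) = M *m hessian C (y + t *: w) *m M^T.
      rewrite hessian_line MM !mulmxDr !mulmxDl -!scalemxAr -!scalemxAl ky !mul0mx !add0r.
      by rewrite -(mulmxA W (hessian C y) k^T) ky' mulmx0 add0r.
    rewrite !det_mulmx det_tr hFE pE cF_line Fy yw !hE; ring.
  have q00 : q.[0] = 0.
    move: E; rewrite (_ : _ *: _ = 'X * ((\det M * \det M) *: (p * 'X * ((cD C w y)%:P + F w *: 'X)))); last first.
      by rewrite -scalerAr expr2; congr (_ *: _); ring.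
    by move/(mulfI (negbT (polyX_eq0 K))) => ->; rewrite !hE !(mulr0, mul0r).
  move/eqP: q0; rewrite q00 eq_sym mulf_eq0 (negPf dW) orbF det_mx11 hessianE => /eqP.
  by rewrite cT12 cT23.
have [yy|yy] := eqVneq (y *m hessian C y) 0.
  exists 0; rewrite scale0r; apply/hessian_kerP => w; apply: key.
  by apply: (mulfI two); rewrite mulr0 -[2%:R * _](cTxx C y w); move: w; apply/hessian_kerP.
apply: perp_functional yy _ => w; rewrite !hessianE => yw; apply: key.
by apply: (mulfI two); rewrite mulr0 -[2%:R * _](cTxx C y w).
Qed.

Variables (x0 : 'rV[K]_9) (n : 'M[K]_(4, 9)).
Hypotheses (rk0 : \rank (om g x0) = 4%N) (free_n : row_free (col_mx x0 n)) (kill_n : n *m om g x0 = 0).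
Local Notation N := (col_mx x0 n : 'M[K]_(5, 9)).
Local Notation T_on_kernel := (T_on_kernel FE two rk0 free_n kill_n).
Local Notation singular_kernel := (singular_kernel FE S1 S2 rk0 free_n kill_n).
Variable h : 'M[K]_(4, 9).
Hypothesis free_h : row_free (col_mx N h).

Definition mixed y : 'M[K]_(5, 4) := N *m hessian C y *m h^T.
(* The signed maximal minors of the mixed block: a kernel vector of the Hessian depending polynomially on [y]. *)
Definition kvec y : 'rV[K]_9 := cofactor_row (mixed y) *m N.

Lemma kvecN y : (kvec y <= N)%MS.
Proof. exact: submxMl. Qed.

Lemma hessian_N (y v : 'rV_9) : (y <= N)%MS -> (v <= N)%MS -> v *m hessian C y *m N^T = 0.
Proof.
move=> yN vN; apply/rowP => j; rewrite [RHS]mxE.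
have -> : (v *m hessian C y *m N^T) 0 j = (v *m hessian C y *m (row j N)^T) 0 0.
  by rewrite tr_row [LHS]mxE [RHS]mxE; apply: eq_bigr => i _; rewrite !mxE.
by rewrite hessianE T_on_kernel // row_sub.
Qed.

Lemma hessian_mixed (y : 'rV_9) (u : 'rV_5) : (y <= N)%MS -> u *m mixed y = 0 -> u *m N *m hessian C y = 0.
Proof.
move=> yN uy; have uM : (col_mx N h : 'M_9)^T \in unitmx by rewrite unitmx_tr -row_free_unit.
apply: (can_inj (mulmxK uM)); rewrite mul0mx (@tr_col_mx _ 5 4) (@mul_mx_row _ _ _ 5 4).
rewrite hessian_N ?submxMl // -(mulmxA u) -(mulmxA u) -/(mixed y) uy.
by rewrite (@row_mx0 _ 1 5 4).
Qed.

Lemma kvec_ker y : (y <= N)%MS -> kvec y *m hessian C y = 0.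
Proof. by move=> yN; apply: hessian_mixed => //; apply: cofactor_row_ker. Qed.

Lemma mixed_rank y : (y <= N)%MS -> \rank (mixed y) = \rank (N *m hessian C y).
Proof.
move=> yN; apply/eqP; rewrite eqn_leq mxrankM_maxl /=.
have : (kermx (mixed y) <= kermx (N *m hessian C y))%MS.
  apply/rV_subP => u /sub_kermxP uy; apply/sub_kermxP; rewrite mulmxA; exact: hessian_mixed.
move/mxrankS; rewrite !mxrank_ker; have := rank_leq_row (mixed y); have := rank_leq_row (N *m hessian C y).
by move: (\rank _) (\rank (mixed y)); clear; lia.
Qed.

Lemma kvec_neq0 y : (y <= N)%MS -> (kvec y != 0) = (\rank (N *m hessian C y) == 4%N).
Proof.
move=> yN; rewrite -mixed_rank // -cofactor_row_neq0; congr negb; apply/eqP/eqP => [E|E]; last by rewrite /kvec E mul0mx.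
by apply: (row_free_inj free_n); rewrite mul0mx.
Qed.

Lemma kvec_tangent (y : 'rV_9) : (y <= N)%MS -> exists l, kvec y *m hessian C (kvec y) = l *: (y *m hessian C y).
Proof.
move=> yN; have [k0|k0] := eqVneq (kvec y) 0; first by exists 0; rewrite k0 mul0mx scale0r.
have r4 : \rank (N *m hessian C y) = 4%N by apply/eqP; rewrite -kvec_neq0.
apply: hessian_tangent; [exact: (F_on_kernel FE rk0 free_n kill_n yN)|exact: kvec_ker|].
have NN : N *m hessian C y *m N^T = 0.
  apply/row_matrixP => i; rewrite row_mul row0 row_mul; exact: hessian_N (row_sub i N).
(* N is isotropic for the Hessian and its image has rank 4, so N is the full orthogonal of N and
   contains the kernel of the Hessian. *)
have subN : (kermx (hessian C y) <= N)%MS.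
  have Z : (N <= kermx (N *m hessian C y)^T)%MS.
    by apply/sub_kermxP; rewrite trmx_mul hessian_sym mulmxA; exact: NN.
  have ge := submx_rank_ge Z.
  apply: submx_trans (ge _); last by rewrite mxrank_ker mxrank_tr r4 (eqP (free_n : \rank N == 5%N)).
  by apply/sub_kermxP; rewrite trmx_mul hessian_sym mulmxA mulmx_ker mul0mx.
have /submxP[U UE] := subN.
have : (U <= kermx (N *m hessian C y))%MS by apply/sub_kermxP; rewrite mulmxA -UE mulmx_ker.
move/mxrankS; rewrite mxrank_ker r4 => le; rewrite UE; exact: leq_trans (mxrankM_maxl _ _) le.
Qed.

Lemma T_sum (a b : 'rV[K]_5) w : cT C (a *m N) (b *m N) w = \sum_i \sum_j a 0 i * b 0 j * cT C (row i N) (row j N) w.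
Proof.
have s2 x y I (r : seq I) P (f : I -> 'rV[K]_9) : cT C x (\sum_(i <- r | P i) f i) y = \sum_(i <- r | P i) cT C x (f i) y.
  by rewrite cT23 cT_sum3; apply: eq_bigr => i _; rewrite cT23.
have s1 x y I (r : seq I) P (f : I -> 'rV[K]_9) : cT C (\sum_(i <- r | P i) f i) x y = \sum_(i <- r | P i) cT C (f i) x y.
  by rewrite cT12 s2; apply: eq_bigr => i _; rewrite cT12.
rewrite !mulmx_sum_row s1; apply: eq_bigr => i _; rewrite s2; apply: eq_bigr => j _.
by rewrite cTZ1 cTZ2 mulrA.
Qed.

(** [k1] is the derivative of [kvec] at x along y. The first identity differentiates [kvec_ker], and
    the coefficients of p of degree 0 and 1 give the value and derivative of T(kvec, kvec, w). *)
Lemma kvec_curve (x y : 'rV_9) : exists2 k1 : 'rV_9, (k1 <= N)%MS &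
  ((x <= N)%MS -> (y <= N)%MS -> kvec x *m hessian C y + k1 *m hessian C x = 0) /\
  forall w, exists p : {poly K}, [/\ forall t, p.[t] = cT C (kvec (x + t *: y)) (kvec (x + t *: y)) w,
    p`_0 = cT C (kvec x) (kvec x) w & p`_1 = 2%:R * cT C (kvec x) k1 w].
Proof.
pose M := map_mx polyC (mixed x) + 'X *: map_mx polyC (mixed y).
have mixedE t : mixed (x + t *: y) = map_mx (horner_eval t) M.
  rewrite /mixed hessian_line mulmxDr mulmxDl -scalemxAr -scalemxAl -!/(mixed _).
  by apply/matrixP => i j; rewrite !mxE /= /horner_eval !hE.
pose q := cofactor_row M.
have qE t i : cofactor_row (mixed (x + t *: y)) 0 i = (q 0 i).[t] by rewrite mixedE cofactor_row_map.
have q0E : cofactor_row (mixed x) = \row_i (q 0 i)`_0.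
  by apply/rowP => i; rewrite [RHS]mxE -horner_coef0 -qE scale0r addr0.
pose u1 : 'rV[K]_5 := \row_i (q 0 i)`_1; exists (u1 *m N); first exact: submxMl.
split=> [xN yN|w].
  have uN : (kvec x *m hessian C y + u1 *m N *m hessian C x) *m h^T = 0.
    suff E : cofactor_row (mixed x) *m mixed y + u1 *m mixed x = 0 by rewrite mulmxDl /kvec -[RHS]E /mixed !mulmxA.
    apply/rowP => j; have := cofactor_row_ker M => /matrixP/(_ 0 j); rewrite !mxE => E.
    have := congr1 (fun p : {poly K} => p`_1) E; rewrite coef0 coef_sum => E0; rewrite -[RHS]E0.
    rewrite -big_split; apply: eq_bigr => i _ /=.
    have ME : M i j = (mixed x i j)%:P + 'X * (mixed y i j)%:P.
      by rewrite mxE [X in X + _]mxE [X in _ + X]mxE [X in 'X * X]mxE.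
    have u0E : cofactor_row (mixed x) 0 i = (q 0 i)`_0 by rewrite q0E mxE.
    have u1E : u1 0 i = (q 0 i)`_1 by rewrite mxE.
    by rewrite -/q ME u0E u1E coef1M !coefD !coefXM !coefC /= addr0 add0r.
  have NN : (kvec x *m hessian C y + u1 *m N *m hessian C x) *m N^T = 0.
    by rewrite mulmxDl !hessian_N ?kvecN ?submxMl ?addr0.
  have uM : (col_mx N h : 'M_9)^T \in unitmx by rewrite unitmx_tr -row_free_unit.
  apply: (can_inj (mulmxK uM)); rewrite mul0mx (@tr_col_mx _ 5 4) (@mul_mx_row _ _ _ 5 4) uN NN.
  by rewrite (@row_mx0 _ 1 5 4).
exists (\sum_i \sum_j q 0 i * q 0 j * (cT C (row i N) (row j N) w)%:P); split=> [t||].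
- rewrite T_sum horner_sum; apply: eq_bigr => i _; rewrite horner_sum; apply: eq_bigr => j _.
  by rewrite !qE !hE.
- rewrite /kvec q0E T_sum coef_sum; apply: eq_bigr => i _; rewrite coef_sum; apply: eq_bigr => j _.
  by rewrite coefMC coef0M !mxE.
have -> : 2%:R * cT C (kvec x) (u1 *m N) w = cT C (kvec x) (u1 *m N) w + cT C (u1 *m N) (kvec x) w.
  by rewrite [X in _ + X]cT12; ring.
rewrite /kvec q0E !T_sum coef_sum -big_split; apply: eq_bigr => i _; rewrite /= coef_sum -big_split; apply: eq_bigr => j _.
by rewrite coefMC coef1M /= mulrDl !mxE.
Qed.

Definition singular_space (z : 'rV[K]_9) := kermx (N *m hessian C z) *m N.

Lemma singular_spaceP (z v : 'rV_9) : (v <= N)%MS -> v *m hessian C z = 0 -> (v <= singular_space z)%MS.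
Proof.
case/submxP=> u -> uz; apply: submxMr; apply/sub_kermxP; by rewrite mulmxA.
Qed.

Lemma singular_space_rank (z : 'rV_9) : (z <= N)%MS -> z != 0 -> z *m hessian C z = 0 -> (\rank (singular_space z) <= 2)%N.
Proof.
move=> zN z0 zz; apply: (singular_kernel zN z0) => [y||]; [|exact: submxMl|by rewrite -mulmxA mulmx_ker].
by apply: (mulfI two); rewrite mulr0 -[2%:R * _](cTxx C z y); move: y; apply/hessian_kerP.
Qed.

Lemma hessianD x y : hessian C (x + y) = hessian C x + hessian C y.
Proof. by have := hessian_line C x y 1; rewrite !scale1r. Qed.
Lemma hessianZ a x : hessian C (a *: x) = a *: hessian C x.
Proof. by apply/matrixP => i j; rewrite !mxE cTZ1. Qed.

(* Otherwise every [kvec x] is singular, and differentiating along [N] bounds the rank of its Hessian on [N]. *)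
Lemma kvec_isotropic : (forall y, (y <= N)%MS -> kvec y *m hessian C (kvec y) = 0) ->
  forall x, (x <= N)%MS -> kvec x != 0 -> False.
Proof.
move=> iso x xN k0; pose k := kvec x; have kN := kvecN x.
have rL := singular_space_rank kN k0 (iso x xN).
have sub : (N *m hessian C k <= singular_space k *m hessian C x)%MS.
  apply/row_subP => i; rewrite row_mul; have yN : (row i N <= N)%MS by apply: row_sub.
  have [k1 k1N [E1 E2]] := kvec_curve x (row i N).
  have -> : row i N *m hessian C k = - (k1 *m hessian C x).
    have -> : row i N *m hessian C k = kvec x *m hessian C (row i N) := hessian_swap _ _.
    by apply/eqP; rewrite -addr_eq0 E1.
  rewrite eqmx_opp submxMr // singular_spaceP //; apply/hessian_kerP => w.
  have [p [pE _ p1]] := E2 w; apply: (mulfI two); rewrite mulr0 -p1.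
  suff -> : p = 0 by rewrite coef0.
  apply: poly_zero_on_closed => t; rewrite pE.
  by move: w {p pE p1}; apply/hessian_kerP/iso; rewrite addmx_sub // scalemx_sub.
(* The Hessian of k has rank at least 5 - 2 on N, but its image there comes from a space of
   dimension at most 2. *)
have := mxrankS sub; rewrite leqNgt; case/negP.
apply: leq_ltn_trans (mxrankM_maxl _ _) _; apply: (leq_ltn_trans rL).
move: rL; rewrite /singular_space mxrankMfree // mxrank_ker; move: (\rank _); clear; lia.
Qed.

(* With [e ^+ 2 = - l] both [k + e *: x] and [k - e *: x] are singular, and [N] is the sum of their singular spaces. *)
Lemma kvec_anisotropic (x : 'rV_9) : (x <= N)%MS -> kvec x *m hessian C (kvec x) != 0 -> False.
Proof.
move=> xN kk; have [l lE] := kvec_tangent xN; set k := kvec x in kk lE.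
have kN : (k <= N)%MS := kvecN x; have kx : k *m hessian C x = 0 := kvec_ker xN.
have l0 : l != 0 by apply: contraNneq kk => E; rewrite lE E scale0r.
have xx : x *m hessian C x != 0 by apply: contraNneq kk => E; rewrite lE E scaler0.
have xk : x *m hessian C k = 0 by rewrite hessian_swap.
have [e eE] : exists e, e ^+ 2 = - l.
  have : size ('X^2 - (- l)%:P) != 1%N by rewrite size_XnsubC.
  by move=> /closed_rootP[e]; rewrite rootE !hE subr_eq0 => /eqP; exists e.
have e0 : e != 0 by apply: contraNneq l0 => E; rewrite -[l]opprK -eE E expr0n oppr0.
have [w0 xw0] : exists w, cT C x x w != 0.
  apply: NNPP => H; case/negP: xx; apply/eqP/hessian_kerP => w; apply/eqP/negPn/negP => nz; apply: H; by exists w.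
have iso e' : e' ^+ 2 = - l -> (k + e' *: x) *m hessian C (k + e' *: x) = 0.
  move=> eE'; rewrite hessianD hessianZ mulmxDl !mulmxDr -!scalemxAr -!scalemxAl kx xk lE !scaler0 addr0 add0r !scalerA.
  by rewrite -scalerDl -expr2 eE' subrr scale0r.
have zN e' : ((k + e' *: x)%R <= N)%MS by rewrite addmx_sub // scalemx_sub.
have zmem e' : e' ^+ 2 = - l -> ((k + e' *: x)%R <= singular_space (k + e' *: x)%R)%MS.
  by move=> eE'; apply: singular_spaceP => //; exact: iso.
have bound e' : e' ^+ 2 = - l -> (\rank (singular_space (k + e' *: x)%R) <= 2)%N.
  move=> eE'; have e0' : e' != 0 by apply: contraNneq l0 => E; rewrite -[l]opprK -eE' E expr0n oppr0.
  apply: singular_space_rank; [exact: zN| |exact: iso].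
  apply: contraNneq xx => E; have : (k + e' *: x) *m hessian C x = 0 by rewrite E mul0mx.
  by rewrite mulmxDl kx add0r -scalemxAl => /eqP; rewrite scaler_eq0 (negPf e0').
(* The vector is the derivative along y of the singular point k + e' x, where e' ^ 2 = - l and l has
   derivative 2 mu, so that e' has derivative - mu / e'. Differentiating z H(z) = 0 gives 2 z' H(z)
   = 0. *)
have mem e' (y k1 : 'rV_9) mu : e' ^+ 2 = - l -> (y <= N)%MS -> (k1 <= N)%MS ->
    k *m hessian C y + k1 *m hessian C x = 0 -> k *m hessian C k1 = l *: (x *m hessian C y) + mu *: (x *m hessian C x) ->
    ((k1 + (e' *: y - (mu / e') *: x))%R <= singular_space (k + e' *: x)%R)%MS.
  move=> eE' yN k1N E1 E2; have e0' : e' != 0 by apply: contraNneq l0 => E; rewrite -[l]opprK -eE' E expr0n oppr0.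
  apply: singular_spaceP; first by rewrite !addmx_sub ?eqmx_opp ?scalemx_sub.
  rewrite hessianD hessianZ mulmxDr -scalemxAr !mulmxDl !mulNmx -!scalemxAl xk !scaler0 oppr0 addr0.
  rewrite (hessian_swap k1 k) E2 (hessian_swap y k) (hessian_swap y x).
  have -> : k1 *m hessian C x = - (k *m hessian C y) by apply/eqP; rewrite -addr_eq0 addrC E1.
  move: (k *m hessian C y) (x *m hessian C y) (x *m hessian C x) => A B D.
  apply/rowP => j; rewrite !mxE; have -> : l = - e' ^+ 2 by rewrite eE' opprK.
  by field.
have eN : (- e) ^+ 2 = - l by rewrite sqrrN.
pose S := (singular_space (k + e *: x)%R + singular_space (k + (- e) *: x)%R)%MS.
have inl v : (v <= singular_space (k + e *: x)%R)%MS -> (v <= S)%MS by move=> vL; rewrite (submx_trans vL) ?addsmxSl.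
have inr v : (v <= singular_space (k + (- e) *: x)%R)%MS -> (v <= S)%MS by move=> vL; rewrite (submx_trans vL) ?addsmxSr.
have xS : (x <= S)%MS.
  have -> : x = (2%:R * e)^-1 *: ((k + e *: x) - (k + (- e) *: x)).
    by apply/rowP => j; rewrite !mxE; field; rewrite e0 two.
  apply: scalemx_sub; apply: addmx_sub; first exact/inl/zmem.
  by rewrite eqmx_opp; exact/inr/zmem.
have NL : (N <= S)%MS.
  apply/row_subP => i; set y := row i N; have yN : (y <= N)%MS by apply: row_sub.
  have [k1 k1N [E1 E2]] := kvec_curve x y; have {}E1 := E1 xN yN.
  (* Half the derivative of the factor l in T(k, k, -) = l T(x, x, -), solved for at the test vector
     [w0]. Cross-multiplying the values at w and [w0] avoids any regularity of l. *)
  pose mu := (cT C k k1 w0 - l * cT C x y w0) / cT C x x w0.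
  have kk1 : k *m hessian C k1 = l *: (x *m hessian C y) + mu *: (x *m hessian C x).
    apply/eqP; rewrite -subr_eq0; apply/eqP/rowP => j; rewrite [RHS]mxE.
    have TE a b : (a *m hessian C b) 0 j = cT C b a (delta_mx 0 j) by rewrite -hessianE trmx_delta -colE [RHS]mxE.
    have DE (A B D : 'rV[K]_9) : (A - (l *: B + mu *: D)) 0 j = A 0 j - (l * B 0 j + mu * D 0 j) by rewrite !mxE.
    rewrite DE !TE (cT12 C k1) (cT12 C y); set w := delta_mx 0 j.
    have [p [pE p0 p1]] := E2 w; have [p' [pE' p0' p1']] := E2 w0.
    pose G v := (cT C x x v)%:P + (2%:R * cT C x y v) *: 'X + (cT C y y v) *: 'X^2.
    have GE v t : (G v).[t] = cT C (x + t *: y) (x + t *: y) v.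
      by rewrite /G !hE !cTD1 !cTD2 !cTZ1 !cTZ2 (cT12 C y x); ring.
    have G0 v : (G v)`_0 = cT C x x v by rewrite -horner_coef0 GE scale0r addr0.
    have G1 v : (G v)`_1 = 2%:R * cT C x y v.
      by rewrite /G !coefD !coefZ coefC coefX coefXn /= mulr1 mulr0 addr0 add0r.
    have : p * G w0 = p' * G w.
      apply: poly_eq_closed => t; rewrite !hornerM pE pE' !GE.
      have xtN : ((x + t *: y)%R <= N)%MS by rewrite addmx_sub // scalemx_sub.
      have [lt ltE] := kvec_tangent xtN; move: (x + t *: y) ltE {xtN} => z zE.
      have zT v : cT C (kvec z) (kvec z) v = lt * cT C z z v.
        by rewrite -!hessianE zE -scalemxAl mxE.
      by rewrite !zT; ring.
    move/(congr1 (fun p : {poly K} => p`_1)); rewrite !coef1M !G0 !G1 p0 p0' p1 p1' -/k.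
    have kT v : cT C k k v = l * cT C x x v by rewrite -!hessianE lE -scalemxAl mxE.
    rewrite !kT => E; apply: (mulfI two); rewrite mulr0; apply: (mulfI xw0); rewrite mulr0 /mu.
    move: (cT C k k1 w) (cT C k k1 w0) (cT C x y w) (cT C x y w0) (cT C x x w) (cT C x x w0) xw0 E => a a' b b' d d' d0 E.
    have -> : d' * (2%:R * (a - (l * b + (a' - l * b') / d' * d))) = (l * d * (2%:R * b') + 2%:R * a * d') - (l * d' * (2%:R * b) + 2%:R * a' * d) by field.
    by rewrite E subrr.
  have m1 := mem e y k1 mu eE yN k1N E1 kk1; have m2 := mem (- e) y k1 mu eN yN k1N E1 kk1.
  have -> : y = (2%:R * e)^-1 *: ((k1 + (e *: y - (mu / e) *: x)) - (k1 + ((- e) *: y - (mu / (- e)) *: x)) + (2%:R * mu / e) *: x).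
    by apply/rowP => j; rewrite !mxE; field; rewrite e0 two oppr_eq0 e0.
  apply: scalemx_sub; apply: addmx_sub; last exact: scalemx_sub.
  by apply: addmx_sub; [exact: inl|rewrite eqmx_opp; exact: inr].
have := mxrankS NL; rewrite (eqP (free_n : \rank N == 5%N)).
have := mxrank_adds_leqif (singular_space (k + e *: x)%R) (singular_space (k + (- e) *: x)%R) => -[le _].
have := bound e eE; have := bound (- e) eN; move: le; rewrite -/S.
move: (\rank _) (\rank _) (\rank S); clear; lia.
Qed.

End TangentHessian.

(** * The duality theorem *)

Section Hessian.
Variables (K : closedFieldType) (g : alt3 K 9) (C : tri3 K 9).
Local Notation F := (cF C).
Hypothesis FE : forall (x : 'rV[K]_9) (M : 'M_(8, 9)),
  F x ^+ 2 * \det (col_mx x M : 'M_9) ^+ 2 = \det (M *m om g x *m M^T).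
Hypothesis S1 : forall x a b : 'rV_9,
  row_free (rows3 x a b) -> kill g x a -> kill g x b -> kill g a b -> False.
Hypothesis S2 : forall x : 'rV_9, x != 0 -> (2 < \rank (om g x))%N.
Hypothesis S3 : forall (R : 'M_(4, 9)) (H : 'M_(8, 9)),
  row_free R -> row_free H -> (R <= H)%MS ->
  (forall r s y : 'rV_9, (r <= R)%MS -> (s <= R)%MS -> (y <= H)%MS -> g r s y = 0) -> False.
Hypothesis two : (2%:R : K) != 0.

Lemma hessian_nonzero : exists2 x, F x = 0 & \det (hessian C x) != 0.
Proof.
have [[x0 x00 r4]|noS] := classic (exists2 x0 : 'rV_9, x0 != 0 & \rank (om g x0) = 4%N); last first.
  have [x [nx Fx]] := Y_point FE S1 S3; exists x => //; apply: (hess_regular FE S1 two) => // u u0.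
  have u4 : \rank (om g u) <> 4%N by move=> E; apply: noS; exists u.
  by have := S2 u0; have := rank_om_even g u; move: (\rank _) u4; clear; lia.
apply: NNPP => H.
have flat x : F x = 0 -> \det (hessian C x) = 0.
  by move=> Fx; apply/eqP/negPn/negP => nz; apply: H; exists x.
have [|n [frn nx]] := @kernel_extend _ 9 g 4 x0 x00; first by rewrite r4.
have [D0 [c [c0 cE]]] := grad_rank4 FE r4 frn nx.
have [x xN xr] := generic_rank FE S1 S2 two r4 frn nx c0 cE D0.
have [h /andP[frh _]] := @basis_completion _ 5 4 9 (col_mx x0 n) erefl frn.
have xr4 : \rank ((col_mx x0 n : 'M_(5, 9)) *m hessian C x) = 4%N.
  apply/eqP; rewrite eqn_leq xr andbT -(mixed_rank FE two r4 frn nx frh xN).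
  exact: rank_leq_col.
have xk : kvec C x0 n h x != 0 by rewrite (kvec_neq0 FE two r4 frn nx frh xN) xr4.
apply: (kvec_isotropic FE S1 S2 two r4 frn nx frh _ xN xk) => y yN.
apply/eqP/negPn/negP => nz; exact: (kvec_anisotropic FE S1 S2 S3 two flat r4 frn nx frh yN nz).
Qed.

End Hessian.

Section Congruence.
Variables (K : fieldType) (n : nat) (X X' : 'rV[K]_n -> Prop).
Hypothesis XX' : forall x, X x <-> X' x.

Lemma vanishes_on_iff p : vanishes_on X p <-> vanishes_on X' p.
Proof. by split=> H x /XX'; exact: H. Qed.

Lemma tangent_hyperplane_iff x h : tangent_hyperplane_at X x h <-> tangent_hyperplane_at X' x h.
Proof.
split=> [[/XX' Xx h0 H]|[/XX' Xx h0 H]]; split=> // u; rewrite -H.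
  by split=> -[d [p [hp /vanishes_on_iff vp gp]]]; exists d, p.
by split=> -[d [p [hp /vanishes_on_iff vp gp]]]; exists d, p.
Qed.

Lemma proj_dual_iff v : proj_dual X v <-> proj_dual X' v.
Proof.
split=> -[v0 H]; split=> // d p hp vp; apply: (H d) => // h [x T]; apply: vp; exists x.
  exact/tangent_hyperplane_iff.
exact/tangent_hyperplane_iff.
Qed.

End Congruence.

Lemma map_mpoly_homog (k K : fieldType) (f : {rmorphism k -> K}) (n d : nat) (p : {mpoly k[n]}) :
  p \is d.-homog -> map_mpoly f p \is d.-homog.
Proof.
move=> /dhomogP hp; apply/dhomogP => m; rewrite mcoeff_msupp mcoeff_map_mpoly fmorph_eq0 => nz.
by apply: hp; rewrite mcoeff_msupp.
Qed.

Theorem proposition5p2 (k : fieldType) (V : vectType k)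
    (dimV : \dim {: V} = 9%N) (gamma : trivector V)
    (e : 9.-tuple V) (e_basis : basis_of {: V} e)
    (K : closedFieldType) (iota : {rmorphism k -> K})
    (K_algebraic : forall z : K, algebraicOver iota z)
    (f16 : {mpoly int[#|{: triple 8}|]})
    (f16_hyperdisc : is_hyperdiscriminant f16) :
  let w : ext3 K 9 := ext3_base_change iota (tri_coords e gamma) in
  stable w ->
  [/\ is_hypersurface iota (Y_locus w),
      is_hypersurface iota (D_locus f16 w),
      forall v : 'rV[K]_9, D_locus f16 w v <-> proj_dual (Y_locus w) v &
      2%N \notin [pchar k] ->
        forall x : 'rV[K]_9, Y_locus w x <-> proj_dual (D_locus f16 w) x].
Proof.
move=> w st; pose g := tri w.
have S1 := stable_no_triple st; have S2 := stable_rank_gt2 st; have S3 := stable_no_flag st.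
have [F0 [hF0 F0E]] := cubic_exists iota (tri_coords e gamma).
pose F := map_mpoly iota F0.
have hF : F \is 3.-homog := map_mpoly_homog iota hF0.
have [C CE] := homog_tri3 hF.
have FE (x : 'rV[K]_9) (M : 'M_(8, 9)) : cF C x ^+ 2 * \det (col_mx x M : 'M_9) ^+ 2 = \det (M *m om g x *m M^T).
  by rewrite -CE F0E.
have YE x : Y_locus w x <-> Ycone C x.
  rewrite /Y_locus contractionE; split=> -[x0 H]; split=> //; first by apply/eqP; rewrite (F_rank FE x0).
  by rewrite -(F_rank FE x0) H.
have [r [hr rE]] := D_equation f16_hyperdisc S1 (w := w) (w0 := tri_coords e gamma) erefl.
have DE := D_locusE f16_hyperdisc S1.
have hR : map_mpoly iota r \is 6.-homog := map_mpoly_homog iota hr.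
split.
- exists 3%N, F0; split=> //.
    have [x] := F_neq0 FE S1; apply: contraNneq => F00; by rewrite -CE /F F00 rmorph0 meval0.
  by move=> x; rewrite YE /Ycone -CE.
- exists 6%N, r; split=> //.
    have [v v0 nv] := non_incident FE S1 S2 S3 hF CE.
    by apply/eqP => r0; have [H _] := rE v v0; have [|x /nv] := H; rewrite ?r0 ?rmorph0 ?meval0.
  by move=> v; rewrite DE; split=> -[v0 H]; split=> //; apply/(rE v v0).
- by move=> v; rewrite DE (proj_dual_iff YE) (dual_Y FE S1 S2 S3 hF CE hR rE).
move=> k2 x; have two : (2%:R : K) != 0.
  by rewrite -(rmorph_nat iota) fmorph_eq0; move: k2; rewrite inE.
by rewrite YE (proj_dual_iff DE) (bidual FE S1 S2 S3 hF CE two (hessian_nonzero FE S1 S2 S3 two)).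
Qed.
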